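(* Let $(M_N)_{N\ge1}$ be probability measures, $M_N$ on $\mathbb Y(N)$, whose Jack generating functions $F_N$ satisfy Assumption A and Assumption L (with constants $\mathfrak c_k$). Then the random measures $\mu[\lambda]$ (with $\lambda\sim M_N$) satisfy the law of large numbers, and for every $k\ge1$ $$\lim_{N\to\infty}\mathbb E\int_{\mathbb R}x^k\,d\mu[\lambda](x)=[w^{-1}]\,\frac{1}{k+1}\left(\frac{w+1}{\theta}U_\mu(w+1)+\frac1w\right)^{k+1}\sum_{a\ge0}(-w)^a,$$ where $U_\mu(z)=\sum_{k\ge1}\frac{\mathfrak c_k}{(k-1)!}(z-1)^{k-1}$ is a formal power series in $z-1$ and $[w^{-1}]$ denotes the coefficient of $w^{-1}$ in the formal Laurent series in $w$.
   Context: Fix $\theta>0$. Young diagrams $\lambda=(\lambda_1\ge\lambda_2\ge\dots\ge0)$, $\ell(\lambda)$ = number of nonzero parts, $|\lambda|=\sum\lambda_i$, $\mathbb Y(N)$ = diagrams with $\ell(\lambda)\le N$, $\mathbb Y=\bigcup_N\mathbb Y(N)$. Symmetric functions are identified with $\mathbb R[p_1,p_2,\dots]$, $p_n=\sum_ix_i^n$, $p_\lambda=\prod p_{\lambda_i}$. $J_\lambda(\mathbf p;\theta)$ is the Jack symmetric function (orthogonal for $\langle p_\lambda,p_\mu\rangle=\delta_{\lambda\mu}z_\lambda\theta^{-\ell(\lambda)}$, triangular in the monomial basis w.r.t. dominance order, leading term $x_1^{\lambda_1}\cdots x_{\ell}^{\lambda_\ell}$). ''$\mathbf p=1^N$'' means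 $p_n=N$ for all $n$ (i.e. $x_1=\dots=x_N=1$, other $x_i=0$). Jack generating function of a probability measure $M_N$ on $\mathbb Y(N)$: $F_N(\mathbf p;\theta)=\sum_{\lambda\in\mathbb Y(N)}M_N(\lambda)J_\lambda(\mathbf p;\theta)/J_\lambda(1^N;\theta)=\sum_{\lambda\in\mathbb Y}a_{M_N}(\lambda)p_\lambda$. Assumption A: there is $\varepsilon>0$ such that for all $N$, $\sum_\lambda|a_{M_N}(\lambda)|N^{\ell(\lambda)}|x|^{|\lambda|}$ converges for complex $|x|<1+\varepsilon$. Assumption L: (1) for every $k\ge1$, $\lim_{N}\frac1N\sum_{i\ge1}k!\binom ik\frac{\partial\ln F_N}{\partial p_i}\big|_{\mathbf p=1^N}=\mathfrak c_k$ exists; (2) for every $r\ge2$ and $k_1,\dots,k_r\ge1$, $\lim_N\frac1N\sum_{i_1,\dots,i_r\ge1}\prod_{j}\binom{i_j}{k_j}\frac{\partial^r\ln F_N}{\partial p_{i_1}\cdots\partial p_{i_r}}\big|_{\mathbf p=1^N}=0$. Empirical measure: for $\lambda\in\mathbb Y(N)$ put $y_i=\frac{\lambda_i}{\theta N}-\frac{i-1}{N}$, $i=1,\dots,N$, and $\mu[\lambda]=\frac1N\sum_{i=1}^N\delta_{y_i}$. Law of large numbers: there are numbers $\mathfrak p_1,\mathfrak p_2,\dots$ such that for all $r\ge1$, $k_1,\dots,k_r\ge1$, $\lim_N\mathbb E\prod_{i=1}^r\int x^{k_i}d\mu[\lambda]=\prod_i\mathfrak p_{k_i}$. *)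

(* Defs.v *)
From Stdlib Require Import Reals Lra List Arith ClassicalEpsilon.
Import ListNotations.
Open Scope R_scope.

Definition sumR (l : list R) : R := fold_right Rplus 0 l.
Definition prodR (l : list R) : R := fold_right Rmult 1 l.
Definition sum_over {A : Type} (l : list A) (f : A -> R) : R := sumR (map f l).

(* Limit of a real sequence (a chosen limit if it converges; unspecified
   otherwise).  Only used for series that converge under Assumption A. *)
Definition lim (u : nat -> R) : R :=
  epsilon (inhabits 0) (fun l => Un_cv u l).

(* A Young diagram is a weakly decreasing list of positive integers
   [lambda_1; lambda_2; ...].  [partitions n] enumerates all diagrams with
   |lambda| = n (parts_aux fuel m n: diagrams of n with parts <= m). *)
Fixpoint parts_aux (fuel m n : nat) : list (list nat) :=
  match fuel with
  | O => if Nat.eqb n 0 then [[]] else []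
  | S f => if Nat.eqb n 0 then [[]]
           else flat_map (fun k => map (cons k) (parts_aux f k (n - k)))
                         (seq 1 (Nat.min m n))
  end.
Definition partitions (n : nat) : list (list nat) := parts_aux n n n.

Definition YN (N n : nat) : list (list nat) :=
  filter (fun l => Nat.leb (length l) N) (partitions n).

Definition mult (i : nat) (l : list nat) : nat := count_occ Nat.eq_dec l i.

Definition zee (mu : list nat) : R :=
  prodR (map (fun i => INR (i ^ mult i mu * fact (mult i mu))) (seq 1 (list_sum mu))).

(* coefficient of x_1^{nu_1} ... x_l^{nu_l} in p_mu (infinitely many x's) *)
Definition decr (j m : nat) (nu : list nat) : list nat :=
  firstn j nu ++ (nth j nu 0%nat - m)%nat :: skipn (S j) nu.
Fixpoint Lc (mu nu : list nat) : R :=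
  match mu with
  | [] => if forallb (Nat.eqb 0) nu then 1 else 0
  | m :: mu' => sumR (map (fun j => if Nat.leb m (nth j nu 0%nat)
                                    then Lc mu' (decr j m nu) else 0)
                          (seq 0 (length nu)))
  end.

Definition dominates (lam nu : list nat) : Prop :=
  forall k, (list_sum (firstn k nu) <= list_sum (firstn k lam))%nat.

(* jc lam mu = coefficient of p_mu in J_lam; mcoef = coefficient of m_nu *)
Definition mcoef (jc : list nat -> list nat -> R) (lam nu : list nat) : R :=
  sum_over (partitions (list_sum lam)) (fun mu => jc lam mu * Lc mu nu).

(* <f,g> with <p_la,p_mu> = delta z_la theta^{-l(la)}, in degree n *)
Definition pinner (theta : R) (f g : list nat -> R) (n : nat) : R :=
  sum_over (partitions n) (fun mu => f mu * g mu * zee mu * / theta ^ length mu).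

(* jc is the family of Jack symmetric functions J_lambda(p; theta),
   given through their p-expansions J_lam = sum_mu jc lam mu p_mu. *)
Definition IsJack (theta : R) (jc : list nat -> list nat -> R) : Prop :=
  forall n lam, In lam (partitions n) ->
    mcoef jc lam lam = 1 /\
    (forall nu, In nu (partitions n) -> mcoef jc lam nu <> 0 -> dominates lam nu) /\
    (forall nu, In nu (partitions n) -> nu <> lam ->
        pinner theta (jc lam) (jc nu) n = 0).

(* J_lam(1^N) *)
Definition Jval (jc : list nat -> list nat -> R) (N : nat) (lam : list nat) : R :=
  sum_over (partitions (list_sum lam)) (fun mu => jc lam mu * INR N ^ length mu).

Definition IsProbYN (M : nat -> list nat -> R) (N : nat) : Prop :=
  (forall lam, 0 <= M N lam) /\
  (forall lam, M N lam <> 0 ->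
      In lam (partitions (list_sum lam)) /\ (length lam <= N)%nat) /\
  Un_cv (fun K => sum_f_R0 (fun n => sum_over (YN N n) (M N)) K) 1.

(* a_{M_N}(mu): coefficient of p_mu in F_N *)
Definition acoef (jc : list nat -> list nat -> R) (M : nat -> list nat -> R)
    (N : nat) (mu : list nat) : R :=
  sum_over (YN N (list_sum mu)) (fun lam => M N lam * jc lam mu / Jval jc N lam).

Definition AssumpA (jc : list nat -> list nat -> R) (M : nat -> list nat -> R) : Prop :=
  exists eps, 0 < eps /\
   forall N, (1 <= N)%nat -> forall x : R, Rabs x < 1 + eps ->
     exists S, Un_cv (fun K => sum_f_R0 (fun n =>
        sum_over (partitions n) (fun lam =>
          Rabs (acoef jc M N lam) * INR N ^ length lam * Rabs x ^ n)) K) S.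

Fixpoint falling (m r : nat) : nat :=
  match r with O => 1%nat | S r' => (m * falling (m - 1) r')%nat end.

(* d^r p_lam / dp_{i_1} ... dp_{i_r} at p = 1^N, times N^{r} / N^{l(lam)} *)
Definition dmono (lam is : list nat) : R :=
  prodR (map (fun j => INR (falling (mult j lam) (count_occ Nat.eq_dec is j)))
             (nodup Nat.eq_dec is)).

(* d^r F_N / dp_{i_1} ... dp_{i_r} at p = 1^N (termwise) ; dF [] = F_N(1^N) *)
Definition dF jc M N (is : list nat) : R :=
  lim (fun K => sum_f_R0 (fun n => sum_over (partitions n) (fun lam =>
        acoef jc M N lam * dmono lam is * INR N ^ length lam / INR N ^ length is)) K).

Definition ins_block (x k : nat) (P : list (list nat)) : list (list nat) :=
  firstn k P ++ (x :: nth k P []) :: skipn (S k) P.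
Fixpoint setparts (l : list nat) : list (list (list nat)) :=
  match l with
  | [] => [[]]
  | x :: xs => flat_map (fun P => ([x] :: P) :: map (fun k => ins_block x k P)
                                                   (seq 0 (length P)))
                        (setparts xs)
  end.

(* d^r ln F_N / dp_{i_1} ... dp_{i_r} at p = 1^N (chain rule / Faa di Bruno) *)
Definition dlnF jc M N (is : list nat) : R :=
  sum_over (setparts (seq 0 (length is))) (fun P =>
    (-1) ^ (length P - 1) * INR (fact (length P - 1)) *
    prodR (map (fun B => dF jc M N (map (fun b => nth b is 0%nat) B)) P) /
    (dF jc M N []) ^ length P).

Definition binomR (i k : nat) : R := if Nat.leb k i then C i k else 0.

Fixpoint boxsum (r K : nat) (f : list nat -> R) : R :=
  match r with
  | O => f []
  | S r' => sum_over (seq 1 K) (fun i => boxsum r' K (fun l => f (i :: l)))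
  end.

Definition AssumpL jc M (c : nat -> R) : Prop :=
  (forall k, (1 <= k)%nat ->
     Un_cv (fun N => / INR N *
        lim (fun K => sum_over (seq 1 K) (fun i =>
              INR (fact k) * binomR i k * dlnF jc M N [i]))) (c k)) /\
  (forall ks : list nat, (2 <= length ks)%nat -> Forall (fun k => 1 <= k)%nat ks ->
     Un_cv (fun N => / INR N *
        lim (fun K => boxsum (length ks) K (fun is =>
              prodR (map (fun p => binomR (fst p) (snd p)) (combine is ks)) *
              dlnF jc M N is))) 0).

(* int x^k dmu[lam],  y_{i+1} = lam_{i+1}/(theta N) - i/N, i = 0..N-1 *)
Definition moment (theta : R) (N : nat) (lam : list nat) (k : nat) : R :=
  / INR N * sum_f_R0 (fun i =>
     (INR (nth i lam 0%nat) / (theta * INR N) - INR i / INR N) ^ k) (N - 1).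

Definition HasExpect (M : nat -> list nat -> R) (N : nat) (f : list nat -> R) (e : R) : Prop :=
  (exists B, forall K, sum_f_R0 (fun n => sum_over (YN N n)
                         (fun lam => M N lam * Rabs (f lam))) K <= B) /\
  Un_cv (fun K => sum_f_R0 (fun n => sum_over (YN N n)
                         (fun lam => M N lam * f lam)) K) e.

Definition LimExpect (M : nat -> list nat -> R) (f : nat -> list nat -> R) (l : R) : Prop :=
  exists e : nat -> R,
    (exists N0, forall N, (N0 <= N)%nat -> HasExpect M N (f N) (e N)) /\ Un_cv e l.

(* (s, f) represents w^{-s} * sum_n f n w^n *)
Definition ps_mul (f g : nat -> R) (n : nat) : R :=
  sum_f_R0 (fun j => f j * g (n - j)%nat) n.
Definition ps_shift (d : nat) (f : nat -> R) (n : nat) : R :=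
  if Nat.ltb n d then 0 else f (n - d)%nat.
Definition ls_add (x y : nat * (nat -> R)) : nat * (nat -> R) :=
  let (s, f) := x in let (t, g) := y in
  (Nat.max s t, fun n => ps_shift (Nat.max s t - s) f n + ps_shift (Nat.max s t - t) g n).
Definition ls_mul (x y : nat * (nat -> R)) : nat * (nat -> R) :=
  let (s, f) := x in let (t, g) := y in (s + t, ps_mul f g)%nat.
Definition ps_one (n : nat) : R := if Nat.eqb n 0 then 1 else 0.
Fixpoint ls_pow (x : nat * (nat -> R)) (m : nat) : nat * (nat -> R) :=
  match m with O => (0%nat, ps_one) | S m' => ls_mul x (ls_pow x m') end.
Definition ls_scale (a : R) (x : nat * (nat -> R)) : nat * (nat -> R) :=
  let (s, f) := x in (s, fun n => a * f n).
Definition ls_coef_m1 (x : nat * (nat -> R)) : R :=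
  let (s, f) := x in match s with O => 0 | S s' => f s' end.

(* U_mu(w+1) = sum_{k>=1} c_k/(k-1)! w^{k-1} *)
Definition Uw (c : nat -> R) (j : nat) : R := c (S j) / INR (fact j).
Definition w_plus_1 (n : nat) : R := if Nat.leb n 1 then 1 else 0.

Definition lln_formula (theta : R) (c : nat -> R) (k : nat) : R :=
  ls_coef_m1 (ls_scale (/ INR (S k))
    (ls_mul (ls_pow (ls_add (0%nat, fun n => / theta * ps_mul w_plus_1 (Uw c) n)
                            (1%nat, ps_one)) (S k))
            (0%nat, fun a => (-1) ^ a))).

(* Main.v *)
(* In the variables p, with w an auxiliary letter recording one marked part,
   L = (1 - theta) w d/dw + (creation) + theta (annihilation) is self-adjoint,
   so the operators D_K = tau L^(K-1) iota (Nazarov-Sklyanin) are self-adjoint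
   for the Jack inner product. In the variables x they are triangular for the
   dominance order, whence every J_lambda is a joint eigenfunction. The
   eigenvalues h_K, rescaled by N (theta N)^K, generate
     1 - z h(z) = (1 + z) prod_i (1 - y_i z) / (1 - (y_i - 1/N) z),
   so the moments of mu[lambda] are polynomials in them, up to O(1/N).

   J_lambda(1^N) does not vanish for l(lambda) <= N: if the last box of the last
   row of mu is removed to get lambda, a suitable product of factors L - d maps
   iota J_mu to an eigenvector of L, whose w-component is a nonzero multiple of
   J_lambda, and J_mu(1^N) is a nonzero multiple of J_lambda(1^N).

   Hence E prod h_(K_j) is the value at p = 1^N of prod D_(K_j) F_N. The operators
   act on the Taylor data sum_i prod binom(i_j, s_j) d^r F_N / dp_(i_1)...dp_(i_r);
   Assumption L says that the cumulants of these data are o(N) beyond order one,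
   so the data, and with them the E prod h_(K_j), factorize to leading order. The
   limit of h_K is the constant term of a K-fold iterate, and Lagrange inversion
   turns it into the coefficient of w^(-1). *)
Require Import Defs.
From Stdlib Require Import Reals List Arith.
From Stdlib Require Import Lra Lia Permutation FunctionalExtensionality ClassicalEpsilon.
Import ListNotations.
Open Scope R_scope.

(** Two comparisons take the place of explicit formulas for Jack functions. Dominance is only a
    partial order, so triangularity alone does not give eigenfunctions; but if [J_k] occurs in
    [D J_lambda] then [k] lies below [lambda], and self-adjointness puts [lambda] below [k] as well.
    For the value at [1^N], the quadratic operator [D_2] identifies the [w]-component obtained from
    [J_mu]: its eigenvalue is strictly increasing for dominance, and an operator commuting with [L]
    carries the eigenvalue equation to that component. The weights [binom(i, k)] of Assumption L are
    those for which the operators act on Taylor data by finite formulas: the sums over a part cut in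
    two close by Vandermonde and hockey-stick identities. A power of [N] is gained when a power sum
    takes its value [N] or when a derivative adds an index to the data; all other terms are of lower
    order, whence the normalization of [h_K]. Assumption A is applied at a radius beyond 1: the
    exponential margin absorbs every polynomial factor, so sums over indices, sums over degrees and
    expectations may be exchanged. *)

(** * Finite sums over lists *)

Lemma sum_over_nil {A} (f : A -> R) : sum_over [] f = 0.
Proof. reflexivity. Qed.

Lemma sum_over_cons {A} x (l : list A) f : sum_over (x :: l) f = f x + sum_over l f.
Proof. reflexivity. Qed.

Lemma sum_over_app {A} (l1 l2 : list A) f :
  sum_over (l1 ++ l2) f = sum_over l1 f + sum_over l2 f.
Proof.
  induction l1 as [|x l1 IH]; cbn [app].
  - rewrite sum_over_nil; ring.
  - rewrite !sum_over_cons, IH; ring.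
Qed.

Lemma sum_over_ext {A} (l : list A) f g :
  (forall x, In x l -> f x = g x) -> sum_over l f = sum_over l g.
Proof.
  induction l as [|x l IH]; intros H; [reflexivity|].
  rewrite !sum_over_cons, IH, H; auto with datatypes.
Qed.

Lemma sum_over_0 {A} (l : list A) f :
  (forall x, In x l -> f x = 0) -> sum_over l f = 0.
Proof.
  induction l as [|x l IH]; intros H; [reflexivity|].
  rewrite sum_over_cons, IH, H; auto with datatypes; ring.
Qed.

Lemma sum_over_plus {A} (l : list A) f g :
  sum_over l (fun x => f x + g x) = sum_over l f + sum_over l g.
Proof.
  induction l as [|x l IH]; rewrite ?sum_over_nil, ?sum_over_cons, ?IH; ring.
Qed.

Lemma sum_over_scal {A} (l : list A) c f :
  sum_over l (fun x => c * f x) = c * sum_over l f.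
Proof.
  induction l as [|x l IH]; rewrite ?sum_over_nil, ?sum_over_cons, ?IH; ring.
Qed.

Lemma sum_over_scal_r {A} (l : list A) c f :
  sum_over l (fun x => f x * c) = sum_over l f * c.
Proof.
  induction l as [|x l IH]; rewrite ?sum_over_nil, ?sum_over_cons, ?IH; ring.
Qed.

Lemma sum_over_minus {A} (l : list A) f g :
  sum_over l (fun x => f x - g x) = sum_over l f - sum_over l g.
Proof.
  induction l as [|x l IH]; rewrite ?sum_over_nil, ?sum_over_cons, ?IH; ring.
Qed.

Lemma sum_over_swap {A B} (l : list A) (m : list B) f :
  sum_over l (fun x => sum_over m (fun y => f x y)) =
  sum_over m (fun y => sum_over l (fun x => f x y)).
Proof.
  induction l as [|x l IH].
  - rewrite sum_over_nil; symmetry; apply sum_over_0; reflexivity.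
  - rewrite sum_over_cons, IH, <- sum_over_plus; reflexivity.
Qed.

Lemma sum_over_perm {A} (l l' : list A) f :
  Permutation l l' -> sum_over l f = sum_over l' f.
Proof.
  induction 1; rewrite ?sum_over_cons; lra.
Qed.

Lemma sum_over_map {A B} (g : A -> B) l f :
  sum_over (map g l) f = sum_over l (fun x => f (g x)).
Proof. unfold sum_over; rewrite map_map; reflexivity. Qed.

Lemma sum_over_flat_map {A B} (g : A -> list B) l f :
  sum_over (flat_map g l) f = sum_over l (fun x => sum_over (g x) f).
Proof.
  induction l as [|x l IH]; [reflexivity|].
  cbn [flat_map]; rewrite sum_over_app, sum_over_cons, IH; reflexivity.
Qed.

Lemma sum_over_filter {A} (p : A -> bool) l f :
  sum_over (filter p l) f = sum_over l (fun x => if p x then f x else 0).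
Proof.
  induction l as [|x l IH]; [reflexivity|].
  cbn [filter]; rewrite sum_over_cons, <- IH.
  destruct (p x); rewrite ?sum_over_cons; ring.
Qed.

Lemma sum_over_le {A} (l : list A) f g :
  (forall x, In x l -> f x <= g x) -> sum_over l f <= sum_over l g.
Proof.
  induction l as [|x l IH]; intros H; [right; reflexivity|].
  rewrite !sum_over_cons; apply Rplus_le_compat; auto with datatypes.
Qed.

Lemma sum_over_nonneg {A} (l : list A) f :
  (forall x, In x l -> 0 <= f x) -> 0 <= sum_over l f.
Proof.
  intros H; rewrite <- (sum_over_0 l (fun _ => 0)) by reflexivity.
  apply sum_over_le, H.
Qed.

Lemma sum_over_Rabs {A} (l : list A) f :
  Rabs (sum_over l f) <= sum_over l (fun x => Rabs (f x)).
Proof.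
  induction l as [|x l IH].
  - rewrite !sum_over_nil, Rabs_R0; lra.
  - rewrite !sum_over_cons; pose proof (Rabs_triang (f x) (sum_over l f)); lra.
Qed.

Lemma sum_over_zero_term {A} (l : list A) f :
  (forall x, In x l -> 0 <= f x) -> sum_over l f = 0 -> forall x, In x l -> f x = 0.
Proof.
  induction l as [|y l IH]; intros H0 H x Hx; [destruct Hx|].
  rewrite sum_over_cons in H.
  assert (0 <= f y) by auto with datatypes.
  assert (0 <= sum_over l f) by (apply sum_over_nonneg; auto with datatypes).
  destruct Hx as [<-|Hx]; [lra|].
  apply IH; auto with datatypes; lra.
Qed.

Lemma sum_over_single {A : Type} (dec : forall x y : A, {x = y} + {x <> y}) l (f : A -> R) x0 :
  NoDup l -> In x0 l -> (forall x, In x l -> x <> x0 -> f x = 0) ->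
  sum_over l f = f x0.
Proof.
  induction l as [|y l IH]; intros Hn Hi H; [destruct Hi|].
  inversion Hn; subst.
  rewrite sum_over_cons. destruct (dec y x0) as [->|Hne].
  - rewrite (sum_over_0 l); [ring|].
    intros x Hx; apply H; auto with datatypes; congruence.
  - destruct Hi as [->|Hi]; [congruence|].
    rewrite (H y), IH; auto with datatypes. ring.
Qed.

Lemma sum_over_seq_S a n f :
  sum_over (seq a (S n)) f = sum_over (seq a n) f + f (a + n)%nat.
Proof.
  rewrite seq_S, sum_over_app, sum_over_cons, sum_over_nil; ring.
Qed.

Lemma sum_over_seq_shift a b n f :
  sum_over (seq (a + b) n) f = sum_over (seq a n) (fun i => f (i + b)%nat).
Proof.
  revert a; induction n as [|n IH]; intros a; [reflexivity|].
  cbn [seq]; rewrite !sum_over_cons; rewrite <- IH; reflexivity.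
Qed.

Lemma sum_over_seq_rev n f :
  sum_over (seq 0 (S n)) f = sum_over (seq 0 (S n)) (fun i => f (n - i)%nat).
Proof.
  rewrite <- (sum_over_map (fun i => (n - i)%nat)).
  apply sum_over_perm, NoDup_Permutation.
  - apply seq_NoDup.
  - apply FinFun.Injective_map_NoDup_in; [|apply seq_NoDup].
    intros x y Hx Hy; apply in_seq in Hx, Hy; lia.
  - intros x; rewrite in_map_iff; split.
    + intros Hx; apply in_seq in Hx; exists (n - x)%nat; rewrite in_seq; lia.
    + intros (y & <- & Hy); apply in_seq in Hy; apply in_seq; lia.
Qed.

(* [rsum F l] is the sum of [F x l'] over the positions of [l], where [x] is the
   entry at that position and [l'] is [l] without it. *)
Fixpoint rsum (F : nat -> list nat -> R) (l : list nat) : R :=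
  match l with
  | [] => 0
  | x :: t => F x t + rsum (fun y t' => F y (x :: t')) t
  end.

(* A function [f] of power sums is encoded by its derivatives at [p = 0]: [f l] is
   its derivative with respect to [p_x], [x] in [l]. Differentiation by [p_a] is
   [fun l => f (a :: l)]; multiplication by [p_a] removes one [a] from [l], so
   [rsum G] stands for [sum_a p_a G_a]. *)
Definition Symf (f : list nat -> R) : Prop :=
  forall l l', Permutation l l' -> f l = f l'.

Lemma rsum_ext F G l :
  (forall x t, Permutation l (x :: t) -> F x t = G x t) -> rsum F l = rsum G l.
Proof.
  revert F G; induction l as [|a l IH]; intros F G H; cbn [rsum]; [reflexivity|].
  rewrite H by reflexivity; f_equal; apply IH; intros x t Hp; apply H.
  rewrite Hp; apply perm_swap.
Qed.

Lemma rsum_plus F G l :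
  rsum (fun x t => F x t + G x t) l = rsum F l + rsum G l.
Proof.
  revert F G; induction l as [|a l IH]; intros F G; cbn [rsum]; [ring|].
  rewrite IH; ring.
Qed.

Lemma rsum_scal c F l : rsum (fun x t => c * F x t) l = c * rsum F l.
Proof.
  revert F; induction l as [|a l IH]; intros F; cbn [rsum]; [ring|].
  rewrite IH; ring.
Qed.

Lemma rsum_scal_r c F l : rsum (fun x t => F x t * c) l = rsum F l * c.
Proof.
  revert F; induction l as [|a l IH]; intros F; cbn [rsum]; [ring|].
  rewrite IH; ring.
Qed.

Lemma rsum_minus F G l :
  rsum (fun x t => F x t - G x t) l = rsum F l - rsum G l.
Proof.
  revert F G; induction l as [|a l IH]; intros F G; cbn [rsum]; [ring|].
  rewrite IH; ring.
Qed.

Lemma rsum_0 F l : (forall x t, Permutation l (x :: t) -> F x t = 0) -> rsum F l = 0.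
Proof.
  revert F; induction l as [|a l IH]; intros F H; cbn [rsum]; [reflexivity|].
  rewrite H, IH by (reflexivity || (intros x t Hp; apply H; rewrite Hp; apply perm_swap)).
  ring.
Qed.

Lemma rsum_sum_over {A} (m : list A) F l :
  rsum (fun x t => sum_over m (fun y => F y x t)) l =
  sum_over m (fun y => rsum (F y) l).
Proof.
  revert F; induction l as [|a l IH]; intros F; cbn [rsum].
  - symmetry; apply sum_over_0; reflexivity.
  - rewrite IH, <- sum_over_plus; reflexivity.
Qed.

(** Both sides run over the ordered pairs of distinct positions of [l]. The list that remains keeps
    its order whichever entry is removed first, so the exchange matches the terms one by one. *)
Lemma rsum_swap2 F l :
  rsum (fun x l1 => rsum (fun y l2 => F x y l2) l1) l =
  rsum (fun x l1 => rsum (fun y l2 => F y x l2) l1) l.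
Proof.
  revert F; induction l as [|a l IH]; intros F; cbn [rsum]; [reflexivity|].
  rewrite !rsum_plus.
  rewrite (IH (fun x y t => F x y (a :: t))).
  change (rsum (F a) l) with (rsum (fun y l2 => F a y l2) l); ring.
Qed.

Lemma rsum_perm F l l' :
  (forall x, Symf (F x)) -> Permutation l l' -> rsum F l = rsum F l'.
Proof.
  intros HF Hp; revert F HF; induction Hp; intros F HF; cbn [rsum].
  - reflexivity.
  - rewrite (HF x l l') by assumption; f_equal; apply IHHp.
    intros y u v Huv; apply HF; constructor; assumption.
  - rewrite <- !Rplus_assoc, (Rplus_comm (F y (x :: l))); f_equal.
    apply rsum_ext; intros; apply HF, perm_swap.
  - rewrite IHHp1, IHHp2; auto.
Qed.

Lemma rsum_le F G l :
  (forall x t, Permutation l (x :: t) -> F x t <= G x t) -> rsum F l <= rsum G l.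
Proof.
  revert F G; induction l as [|a l IH]; intros F G H; cbn [rsum]; [lra|].
  apply Rplus_le_compat; [apply H; reflexivity|].
  apply IH; intros x t Hp; apply H; rewrite Hp; apply perm_swap.
Qed.

Lemma rsum_fst g l : rsum (fun x _ => g x) l = sum_over l g.
Proof.
  induction l as [|a l IH]; cbn [rsum]; [reflexivity|].
  rewrite IH; reflexivity.
Qed.

(** * Young diagrams as multisets *)

Definition posl (l : list nat) : Prop := Forall (fun x => 1 <= x)%nat l.

Fixpoint desc (l : list nat) : Prop :=
  match l with
  | [] => True
  | x :: t => (forall y, In y t -> y <= x)%nat /\ desc t
  end.

Fixpoint ins (a : nat) (l : list nat) : list nat :=
  match l with
  | [] => [a]
  | x :: t => if Nat.leb x a then a :: x :: t else x :: ins a t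
  end.

(** Canonical representative of a multiset. The family [jc] is constrained on weakly decreasing
    lists only, so symmetric functions of arbitrary lists are built through sorting. *)
Fixpoint isort (l : list nat) : list nat :=
  match l with [] => [] | x :: t => ins x (isort t) end.

Lemma ins_perm a l : Permutation (ins a l) (a :: l).
Proof.
  induction l as [|x t IH]; cbn; [reflexivity|].
  destruct (Nat.leb x a); [reflexivity|].
  rewrite IH; apply perm_swap.
Qed.

Lemma ins_desc a l : desc l -> desc (ins a l).
Proof.
  induction l as [|x t IH]; cbn; [intros _; split; auto; intros y []|].
  intros [H1 H2]; destruct (Nat.leb_spec x a).
  - cbn; repeat split; auto; intros y [<-|Hy]; auto.
    apply H1 in Hy; lia.
  - split; auto; intros y Hy.
    apply (Permutation_in _ (ins_perm a t)) in Hy; destruct Hy as [<-|Hy]; auto; lia.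
Qed.

Lemma isort_perm l : Permutation (isort l) l.
Proof.
  induction l as [|x t IH]; cbn; [reflexivity|].
  rewrite ins_perm, IH; reflexivity.
Qed.

Lemma isort_desc l : desc (isort l).
Proof. induction l as [|x t IH]; cbn; auto; apply ins_desc, IH. Qed.

Lemma desc_perm_eq l l' : desc l -> desc l' -> Permutation l l' -> l = l'.
Proof.
  revert l'; induction l as [|x t IH]; intros l' H H' Hp.
  - apply Permutation_nil in Hp; auto.
  - destruct l' as [|y t']; [symmetry in Hp; apply Permutation_nil in Hp; discriminate|].
    destruct H as [H1 H2], H' as [H1' H2'].
    assert (x = y).
    { assert (In x (y :: t')) as Hx by (eapply Permutation_in; [exact Hp|left; auto]).
      assert (In y (x :: t)) as Hy
        by (eapply Permutation_in; [symmetry; exact Hp|left; auto]).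
      destruct Hx as [->|Hx]; auto; destruct Hy as [->|Hy]; auto.
      apply H1 in Hy; apply H1' in Hx; lia. }
    subst y; f_equal; apply IH; auto.
    eapply Permutation_cons_inv; eassumption.
Qed.

Lemma isort_id l : desc l -> isort l = l.
Proof. intros H; apply desc_perm_eq; auto using isort_desc, isort_perm. Qed.

Lemma isort_eq l l' : Permutation l l' -> isort l = isort l'.
Proof.
  intros H; apply desc_perm_eq; auto using isort_desc.
  rewrite !isort_perm; exact H.
Qed.

Lemma list_sum_in l x : In x l -> (x <= list_sum l)%nat.
Proof.
  induction l as [|y l IH]; intros []; simpl; [lia|]. apply IH in H; lia.
Qed.

Lemma posl_sum0 l : posl l -> list_sum l = 0%nat -> l = [].
Proof.
  destruct 1; simpl; auto; lia.
Qed.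

Lemma posl_length_sum l : posl l -> (length l <= list_sum l)%nat.
Proof. induction 1; simpl; lia. Qed.

(** The condition [n <= fuel] persists because every recursive call removes a part of size at least
    1, so the fuel outlasts [n]. *)
Lemma parts_aux_spec fuel m n l : (n <= fuel)%nat ->
  In l (parts_aux fuel m n) <->
  desc l /\ posl l /\ list_sum l = n /\ (forall x, In x l -> x <= m)%nat.
Proof.
  revert m n l; induction fuel as [|f IH]; intros m n l Hn.
  - assert (n = 0)%nat by lia; subst; simpl; split.
    + intros [<-|[]]; simpl; repeat split; auto; [constructor|intros x []].
    + intros (_ & Hp & Hs & _); left; symmetry; apply posl_sum0; auto.
  - simpl parts_aux. destruct (Nat.eqb_spec n 0) as [->|Hn0].
    + simpl; split.
      * intros [<-|[]]; simpl; repeat split; auto; [constructor|intros x []].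
      * intros (_ & Hp & Hs & _); left; symmetry; apply posl_sum0; auto.
    + rewrite in_flat_map; split.
      * intros (k & Hk & Hl); apply in_map_iff in Hl; destruct Hl as (t & <- & Ht).
        apply in_seq in Hk; apply IH in Ht; [|lia].
        destruct Ht as (H1 & H2 & H3 & H4).
        repeat split; auto; [constructor; auto; lia|simpl; lia|].
        intros x [<-|Hx]; [|apply H4 in Hx]; lia.
      * intros (H1 & H2 & H3 & H4); destruct l as [|k t]; [simpl in H3; lia|].
        destruct H1 as [H1 H1']; inversion H2; subst.
        exists k; split.
        { apply in_seq. specialize (H4 k (or_introl eq_refl)); simpl in *; lia. }
        apply in_map, IH; [simpl in *; lia|].
        repeat split; auto; simpl; lia.
Qed.

Lemma partitions_spec n l :
  In l (partitions n) <-> desc l /\ posl l /\ list_sum l = n.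
Proof.
  unfold partitions; rewrite parts_aux_spec by lia; split; [tauto|].
  intros (H1 & H2 & H3); repeat split; auto.
  intros x Hx; rewrite <- H3; apply list_sum_in, Hx.
Qed.

Lemma NoDup_app_disj {A} (l1 l2 : list A) :
  NoDup l1 -> NoDup l2 -> (forall x, In x l1 -> ~ In x l2) -> NoDup (l1 ++ l2).
Proof.
  induction 1 as [|x l1 Hx Hn IH]; intros H2 Hd; simpl; auto.
  constructor; [|apply IH; auto with datatypes].
  rewrite in_app_iff; intros [H|H]; auto; apply (Hd x); auto with datatypes.
Qed.

Lemma NoDup_flat_map {A B} (g : A -> list B) l :
  NoDup l -> (forall x, NoDup (g x)) ->
  (forall x y b, In b (g x) -> In b (g y) -> x = y) -> NoDup (flat_map g l).
Proof.
  induction 1 as [|x l Hx Hn IH]; intros Hg Hd; simpl; [constructor|].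
  apply NoDup_app_disj; auto.
  intros b Hb Hb'; apply in_flat_map in Hb'; destruct Hb' as (y & Hy & Hb').
  rewrite (Hd _ _ _ Hb Hb') in Hx; auto.
Qed.

Lemma NoDup_parts_aux fuel m n : NoDup (parts_aux fuel m n).
Proof.
  revert m n; induction fuel as [|f IH]; intros m n; simpl.
  - destruct (Nat.eqb n 0); repeat constructor; auto.
  - destruct (Nat.eqb n 0); [repeat constructor; auto|].
    apply NoDup_flat_map; [apply seq_NoDup| |].
    + intros x; apply FinFun.Injective_map_NoDup; auto; intros u v; congruence.
    + intros x y b Hx Hy; apply in_map_iff in Hx, Hy.
      destruct Hx as (? & <- & _), Hy as (? & H & _); congruence.
Qed.

Lemma NoDup_partitions n : NoDup (partitions n).
Proof. apply NoDup_parts_aux. Qed.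

Lemma isort_partitions l : posl l -> In (isort l) (partitions (list_sum l)).
Proof.
  intros H; apply partitions_spec; repeat split; [apply isort_desc| |].
  - eapply Permutation_Forall; [symmetry; apply isort_perm|exact H].
  - apply Permutation_list_sum, isort_perm.
Qed.

(** * Symmetry factors and the pairing of coefficients *)

(** Product of the factorials of the multiplicities: successive copies of the same value contribute
    its multiplicity, then one less, down to 1. *)
Fixpoint mfact (l : list nat) : R :=
  match l with
  | [] => 1
  | x :: t => INR (count_occ Nat.eq_dec (x :: t) x) * mfact t
  end.

Lemma count_occ_perm (l l' : list nat) x :
  Permutation l l' -> count_occ Nat.eq_dec l x = count_occ Nat.eq_dec l' x.
Proof. intros H; apply Permutation_count_occ; exact H. Qed.

Lemma mfact_Symf : Symf mfact.
Proof.
  intros l l' Hp; induction Hp.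
  - reflexivity.
  - cbn [mfact]; rewrite IHHp, (count_occ_perm (x :: l) (x :: l')); auto.
  - cbn [mfact count_occ].
    destruct (Nat.eq_dec y y), (Nat.eq_dec x x), (Nat.eq_dec y x), (Nat.eq_dec x y);
      try congruence; ring.
  - congruence.
Qed.

Lemma mfact_pos l : 0 < mfact l.
Proof.
  induction l as [|x t IH]; cbn [mfact]; [lra|].
  apply Rmult_lt_0_compat; auto.
  cbn [count_occ]; destruct (Nat.eq_dec x x); [|congruence].
  apply lt_0_INR; lia.
Qed.

Lemma mfact_neq0 l : mfact l <> 0.
Proof. pose proof (mfact_pos l); lra. Qed.

Fixpoint rem1 (a : nat) (l : list nat) : list nat :=
  match l with
  | [] => []
  | x :: t => if Nat.eq_dec x a then t else x :: rem1 a t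
  end.

Lemma rem1_perm a l : In a l -> Permutation l (a :: rem1 a l).
Proof.
  induction l as [|x t IH]; intros H; [destruct H|].
  cbn; destruct (Nat.eq_dec x a) as [->|Hne]; [reflexivity|].
  destruct H as [->|H]; [congruence|].
  rewrite IH at 1 by assumption; apply perm_swap.
Qed.

Lemma rem1_incl a l x : In x (rem1 a l) -> In x l.
Proof.
  induction l as [|y t IH]; cbn; auto.
  destruct (Nat.eq_dec y a); cbn; tauto.
Qed.

Lemma rem1_desc a l : desc l -> desc (rem1 a l).
Proof.
  induction l as [|y t IH]; cbn; auto; intros [H1 H2].
  destruct (Nat.eq_dec y a); auto; split; auto.
  intros x Hx; apply H1; eapply rem1_incl; eassumption.
Qed.

(** Removing any copy of [a] leaves the multiset [rem1 a l], so equal entries give equal terms.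
    Values of [S] that do not occur in [l] have count 0, so any duplicate-free list covering the
    entries will do. *)
Lemma rsum_count H l S : (forall a, Symf (H a)) -> NoDup S -> incl l S ->
  rsum H l = sum_over S (fun a => INR (count_occ Nat.eq_dec l a) * H a (rem1 a l)).
Proof.
  intros HP HS; revert H HP; induction l as [|x t IH]; intros H HP Hi.
  - cbn; symmetry; apply sum_over_0; intros; ring.
  - cbn [rsum]; rewrite IH; [|intros a u v Huv; apply HP; constructor; exact Huv|
                              eapply incl_cons_inv; exact Hi].
    assert (In x S) as HxS by (apply Hi; left; auto).
    assert (H x t = sum_over S (fun a => if Nat.eq_dec a x then H x t else 0)) as ->.
    { rewrite (sum_over_single Nat.eq_dec S _ x); auto.
      - destruct (Nat.eq_dec x x); congruence.
      - intros y _ Hy; destruct (Nat.eq_dec y x); congruence. }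
    rewrite <- sum_over_plus; apply sum_over_ext; intros a Ha.
    cbn [count_occ rem1]; destruct (Nat.eq_dec x a) as [->|Hne].
    + destruct (Nat.eq_dec a a) as [_|]; [|congruence].
      rewrite S_INR.
      destruct (in_dec Nat.eq_dec a t) as [Hin|Hnin].
      * rewrite (HP a (a :: rem1 a t) t) by (symmetry; apply rem1_perm; auto). ring.
      * apply (count_occ_not_In Nat.eq_dec) in Hnin; rewrite Hnin; cbn; ring.
    + destruct (Nat.eq_dec a x) as [->|_]; [congruence|]. ring.
Qed.

(* [f mu / mfact mu] is the coefficient of [p_mu] in [f]. *)
Definition pr (n : nat) (h : list nat -> R) : R :=
  sum_over (partitions n) (fun mu => h mu / mfact mu).

(** The inverse map is the sorted insertion [ins a]. *)
Lemma partitions_rem1 n a : (1 <= a)%nat -> (a <= n)%nat ->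
  Permutation (map (rem1 a) (filter (fun l => if in_dec Nat.eq_dec a l then true else false)
                                    (partitions n)))
              (partitions (n - a)).
Proof.
  intros Ha Han; apply NoDup_Permutation; [|apply NoDup_partitions|].
  - apply FinFun.Injective_map_NoDup_in; [|apply NoDup_filter, NoDup_partitions].
    intros u v Hu Hv Huv; apply filter_In in Hu, Hv.
    destruct Hu as [Hu Hua], Hv as [Hv Hva].
    apply partitions_spec in Hu, Hv.
    destruct (in_dec Nat.eq_dec a u) as [Iu|]; [|discriminate].
    destruct (in_dec Nat.eq_dec a v) as [Iv|]; [|discriminate].
    apply desc_perm_eq; try tauto.
    rewrite (rem1_perm a u), (rem1_perm a v), Huv; auto.
  - intros x; rewrite in_map_iff; split.
    + intros (l & <- & Hl); apply filter_In in Hl; destruct Hl as [Hl Hla].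
      destruct (in_dec Nat.eq_dec a l) as [Il|]; [|discriminate].
      apply partitions_spec in Hl; destruct Hl as (H1 & H2 & H3).
      pose proof (rem1_perm a l Il) as Hp.
      apply partitions_spec; repeat split.
      * apply rem1_desc, H1.
      * apply (Permutation_Forall Hp) in H2; inversion H2; auto.
      * apply Permutation_list_sum in Hp; simpl in Hp; lia.
    + intros Hx; apply partitions_spec in Hx; destruct Hx as (H1 & H2 & H3).
      exists (ins a x).
      assert (In a (ins a x)) as Ia
        by (eapply Permutation_in; [symmetry; apply ins_perm|left; auto]).
      split.
      * apply desc_perm_eq; auto using rem1_desc, ins_desc.
        apply (Permutation_cons_inv (a := a)).
        rewrite <- rem1_perm by auto; apply ins_perm.
      * apply filter_In; split; [|destruct (in_dec Nat.eq_dec a (ins a x)); tauto].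
        apply partitions_spec; repeat split; auto using ins_desc.
        -- eapply Permutation_Forall; [symmetry; apply ins_perm|constructor; auto].
        -- rewrite (Permutation_list_sum (ins_perm a x)); simpl; lia.
Qed.

(* Removing one part [a] from a diagram divides its symmetry factor by the
   multiplicity of [a]. *)
Lemma pr_rsum n H : (forall a, Symf (H a)) ->
  pr n (rsum H) = sum_over (seq 1 n) (fun a => pr (n - a) (H a)).
Proof.
  intros HP; unfold pr.
  transitivity (sum_over (partitions n) (fun mu => sum_over (seq 1 n) (fun a =>
     if in_dec Nat.eq_dec a mu then H a (rem1 a mu) / mfact (rem1 a mu) else 0))).
  { apply sum_over_ext; intros mu Hmu; apply partitions_spec in Hmu.
    destruct Hmu as (H1 & H2 & H3).
    rewrite (rsum_count H mu (seq 1 n)); auto using seq_NoDup.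
    2:{ intros x Hx; apply in_seq.
        pose proof (list_sum_in mu x Hx).
        unfold posl in H2; rewrite Forall_forall in H2; apply H2 in Hx; lia. }
    unfold Rdiv; rewrite <- sum_over_scal_r; apply sum_over_ext; intros a Ha.
    destruct (in_dec Nat.eq_dec a mu) as [Hi|Hi].
    - pose proof (rem1_perm a mu Hi) as Hp.
      rewrite (mfact_Symf _ _ Hp); cbn [mfact].
      rewrite <- (count_occ_perm _ _ a Hp).
      assert (INR (count_occ Nat.eq_dec mu a) <> 0).
      { apply not_0_INR; apply (count_occ_In Nat.eq_dec) in Hi; lia. }
      pose proof (mfact_neq0 (rem1 a mu)); field; auto.
    - apply (count_occ_not_In Nat.eq_dec) in Hi; rewrite Hi; cbn; ring. }
  rewrite sum_over_swap; apply sum_over_ext; intros a Ha; apply in_seq in Ha.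
  rewrite <- (sum_over_perm _ _ _ (partitions_rem1 n a ltac:(lia) ltac:(lia))).
  rewrite sum_over_map, sum_over_filter; apply sum_over_ext; intros mu _.
  destruct (in_dec Nat.eq_dec a mu); reflexivity.
Qed.

Lemma pr_ext n f g : (forall l, In l (partitions n) -> f l = g l) -> pr n f = pr n g.
Proof. intros H; apply sum_over_ext; intros l Hl; rewrite H; auto. Qed.

Lemma pr_plus n f g : pr n (fun l => f l + g l) = pr n f + pr n g.
Proof.
  unfold pr; rewrite <- sum_over_plus; apply sum_over_ext; intros; field; apply mfact_neq0.
Qed.

Lemma pr_minus n f g : pr n (fun l => f l - g l) = pr n f - pr n g.
Proof.
  unfold pr; rewrite <- sum_over_minus; apply sum_over_ext; intros; field; apply mfact_neq0.
Qed.

Lemma pr_scal n c f : pr n (fun l => c * f l) = c * pr n f.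
Proof.
  unfold pr; rewrite <- sum_over_scal; apply sum_over_ext; intros; field; apply mfact_neq0.
Qed.

Lemma pr_0 n f : (forall l, In l (partitions n) -> f l = 0) -> pr n f = 0.
Proof. intros H; apply sum_over_0; intros l Hl; rewrite H; auto; unfold Rdiv; ring. Qed.

Lemma pr_sum_over {A} n (m : list A) F :
  pr n (fun l => sum_over m (fun y => F y l)) = sum_over m (fun y => pr n (F y)).
Proof.
  unfold pr; rewrite sum_over_swap; apply sum_over_ext; intros l _.
  unfold Rdiv; rewrite sum_over_scal_r; reflexivity.
Qed.

(** In the pairing [pr], multiplication by [p_a] (inside [rsum]) is adjoint to differentiation by
    [p_a]. The self-adjointness of the operators, the coefficients in [x] and the values at [1^N]
    are all computed from this identity, with different [W]. *)
Lemma pr_adj n G W : (forall a, Symf (G a)) -> Symf W ->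
  pr n (fun l => rsum G l * W l) =
  sum_over (seq 1 n) (fun a => pr (n - a) (fun l => G a l * W (a :: l))).
Proof.
  intros HG HW; rewrite <- pr_rsum.
  2:{ intros a u v Huv; rewrite (HG a u v Huv); f_equal; apply HW; auto. }
  apply pr_ext; intros l _.
  rewrite <- rsum_scal_r; apply rsum_ext; intros x t Hp.
  rewrite (HW _ _ Hp); reflexivity.
Qed.

(** * The Nazarov-Sklyanin operator and its self-adjointness *)

Definition SymW (G : nat -> list nat -> R) : Prop := forall k, Symf (G k).

(* [G k] is the coefficient of [w^k], [k >= 1], of a series in an extra letter [w]. *)
Definition iota (g : list nat -> R) (k : nat) (l : list nat) : R := INR k * g (k :: l).
(** The operator [sum_m w^m m d/dp_m]: a part [m] is absorbed into the marked letter. *)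
Definition Ap (G : nat -> list nat -> R) (k : nat) (l : list nat) : R :=
  sum_over (seq 1 (k - 1)) (fun m => INR m * G (k - m)%nat (m :: l)).
(** The operator [sum_x p_x w^(-x)], truncated to the positive powers of [w]. *)
Definition Am (G : nat -> list nat -> R) (k : nat) (l : list nat) : R :=
  rsum (fun x t => G (k + x)%nat t) l.
Definition Kop (G : nat -> list nat -> R) (k : nat) (l : list nat) : R := INR k * G k l.
Definition Lop (theta : R) (G : nat -> list nat -> R) (k : nat) (l : list nat) : R :=
  (1 - theta) * Kop G k l + Ap G k l + theta * Am G k l.

Lemma seq_sum_rev1 n f :
  sum_over (seq 1 n) f = sum_over (seq 1 n) (fun m => f (n + 1 - m)%nat).
Proof.
  destruct n as [|n]; [reflexivity|].
  change (seq 1 (S n)) with (seq (0 + 1) (S n)).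
  rewrite !sum_over_seq_shift, sum_over_seq_rev.
  apply sum_over_ext; intros i Hi; apply in_seq in Hi; f_equal; lia.
Qed.

(** Pairs [k, a >= 1] with [k + a <= n], grouped on the right by [s = k + a]. *)
Lemma sum_triangle n f :
  sum_over (seq 1 n) (fun k => sum_over (seq 1 (n - k)) (fun a => f k a)) =
  sum_over (seq 1 n) (fun s => sum_over (seq 1 (s - 1)) (fun m => f (s - m)%nat m)).
Proof.
  induction n as [|n IH]; [reflexivity|].
  rewrite sum_over_seq_S.
  replace (S n - (1 + n))%nat with 0%nat by lia; cbn [seq]; rewrite sum_over_nil, Rplus_0_r.
  rewrite (sum_over_seq_S 1 n), <- IH.
  rewrite (sum_over_ext (seq 1 n) _ (fun k => sum_over (seq 1 (n - k)) (fun a => f k a) +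
    f k (n + 1 - k)%nat)).
  - rewrite sum_over_plus; f_equal.
    replace (1 + n - 1)%nat with n by lia; rewrite seq_sum_rev1.
    apply sum_over_ext; intros i Hi; apply in_seq in Hi; f_equal; lia.
  - intros k Hk; apply in_seq in Hk.
    replace (S n - k)%nat with (S (n - k)) by lia.
    rewrite sum_over_seq_S; do 2 f_equal; lia.
Qed.

Lemma Symf_rsum G : SymW G -> Symf (rsum G).
Proof. intros H l l' Hp; apply rsum_perm; auto. Qed.

Lemma Symf_cons (g : list nat -> R) a : Symf g -> Symf (fun l => g (a :: l)).
Proof. intros H l l' Hp; apply H; constructor; exact Hp. Qed.

Lemma Symf_plus f g : Symf f -> Symf g -> Symf (fun l => f l + g l).
Proof. intros Hf Hg l l' Hp; rewrite (Hf l l'), (Hg l l'); auto. Qed.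

Lemma Symf_mult f g : Symf f -> Symf g -> Symf (fun l => f l * g l).
Proof. intros Hf Hg l l' Hp; rewrite (Hf l l'), (Hg l l'); auto. Qed.

Lemma Symf_scal c f : Symf f -> Symf (fun l => c * f l).
Proof. intros Hf l l' Hp; rewrite (Hf l l'); auto. Qed.

Lemma Symf_sum {A} (m : list A) F : (forall y, Symf (F y)) -> Symf (fun l => sum_over m (fun y => F y l)).
Proof. intros HF l l' Hp; apply sum_over_ext; intros y _; apply HF, Hp. Qed.

Lemma SymW_iota g : Symf g -> SymW (iota g).
Proof. intros H k; apply Symf_scal, Symf_cons, H. Qed.

Lemma SymW_Ap G : SymW G -> SymW (Ap G).
Proof.
  intros H k; apply Symf_sum; intros m; apply Symf_scal, Symf_cons, H.
Qed.

Lemma SymW_Am G : SymW G -> SymW (Am G).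
Proof. intros H k; apply Symf_rsum; intros x; apply H. Qed.

Lemma SymW_Lop theta G : SymW G -> SymW (Lop theta G).
Proof.
  intros H k; unfold Lop, Kop; repeat apply Symf_plus; repeat apply Symf_scal.
  - apply H.
  - apply SymW_Ap, H.
  - apply SymW_Am, H.
Qed.

(** The weight that turns [pr] into the Jack inner product: coefficients are [f mu / mfact mu] and
    [zee mu / theta ^ length mu = mfact mu * omega theta mu], so one factor [mfact mu] remains in
    the denominator. *)
Definition omega (theta : R) (l : list nat) : R := prodR (map (fun x => INR x / theta) l).

Lemma omega_cons theta a l : omega theta (a :: l) = INR a / theta * omega theta l.
Proof. reflexivity. Qed.

Lemma Symf_prodR (f : nat -> R) : Symf (fun l => prodR (map f l)).
Proof.
  intros l l' Hp; unfold prodR; induction Hp; cbn; try lra.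
  rewrite IHHp; ring.
Qed.

Lemma Symf_omega theta : Symf (omega theta).
Proof. apply Symf_prodR. Qed.

Definition pin theta n (f g : list nat -> R) : R := pr n (fun l => f l * g l * omega theta l).
(** The extension to series in [w] for which the powers [w^k] are orthonormal. *)
Definition piw theta n (G H : nat -> list nat -> R) : R :=
  sum_over (seq 1 n) (fun k => pin theta (n - k) (G k) (H k)).

Lemma pin_sym theta n f g : pin theta n f g = pin theta n g f.
Proof. apply pr_ext; intros; ring. Qed.

Lemma piw_sym theta n G H : piw theta n G H = piw theta n H G.
Proof. apply sum_over_ext; intros; apply pin_sym. Qed.

(** The adjoint of [p_a] is [(a / theta) d/dp_a], and [iota] contains the factor [a]; so [rsum] and
    [iota] are adjoint up to [/ theta]. *)
Lemma pin_rsum theta n G g : SymW G -> Symf g ->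
  pin theta n (rsum G) g = / theta * piw theta n G (iota g).
Proof.
  intros HG Hg; unfold pin.
  rewrite (pr_ext n _ (fun l => rsum G l * (g l * omega theta l))) by (intros; ring).
  rewrite (pr_adj n G (fun l => g l * omega theta l)); auto using Symf_mult, Symf_omega.
  unfold piw; rewrite <- sum_over_scal; apply sum_over_ext; intros a _.
  unfold pin; rewrite <- pr_scal; apply pr_ext; intros l _.
  unfold iota; rewrite omega_cons; unfold Rdiv; ring.
Qed.

(** The same adjoint, with the shift of the power of [w] regrouped by [sum_triangle]. It makes
    [theta * Am] the adjoint of [Ap], hence the coefficients in [Lop]. *)
Lemma piw_Am theta n G H : SymW G -> SymW H ->
  piw theta n (Am G) H = / theta * piw theta n G (Ap H).
Proof.
  intros HG HH; unfold piw, pin.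
  transitivity (sum_over (seq 1 n) (fun k => sum_over (seq 1 (n - k)) (fun a =>
    / theta * pr (n - (k + a)) (fun l => G (k + a)%nat l * (INR a * H k (a :: l)) * omega theta l)))).
  - apply sum_over_ext; intros k _.
    rewrite (pr_ext _ _ (fun l => Am G k l * (H k l * omega theta l))) by (intros; ring).
    unfold Am.
    rewrite (pr_adj (n - k) (fun x t => G (k + x)%nat t) (fun l => H k l * omega theta l));
      [|intros a; apply HG|apply Symf_mult; [apply HH|apply Symf_omega]].
    apply sum_over_ext; intros a _.
    rewrite <- pr_scal, <- Nat.sub_add_distr; apply pr_ext; intros l _.
    rewrite omega_cons; unfold Rdiv; ring.
  - rewrite (sum_triangle n (fun k a => / theta * pr (n - (k + a)) (fun l => G (k + a)%nat l *
      (INR a * H k (a :: l)) * omega theta l))).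
    rewrite <- sum_over_scal; apply sum_over_ext; intros s Hs; apply in_seq in Hs.
    rewrite sum_over_scal; f_equal.
    rewrite (pr_ext (n - s) (fun l => G s l * Ap H s l * omega theta l)
      (fun l => sum_over (seq 1 (s - 1)) (fun m => G s l * (INR m * H (s - m)%nat (m :: l)) * omega theta l))).
    + rewrite pr_sum_over; apply sum_over_ext; intros m Hm; apply in_seq in Hm.
      replace (s - m + m)%nat with s by lia; reflexivity.
    + intros l _; unfold Ap; rewrite sum_over_scal_r, sum_over_scal; reflexivity.
Qed.

Lemma piw_lin theta n a b c F G K H :
  piw theta n (fun k l => a * F k l + b * G k l + c * K k l) H =
  a * piw theta n F H + b * piw theta n G H + c * piw theta n K H.
Proof.
  unfold piw; rewrite <- !sum_over_scal, <- !sum_over_plus; apply sum_over_ext; intros k _.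
  unfold pin; rewrite <- !pr_scal, <- !pr_plus; apply pr_ext; intros; ring.
Qed.

Lemma piw_ext theta n F G H :
  (forall k l, F k l = G k l) -> piw theta n F H = piw theta n G H.
Proof.
  intros E; apply sum_over_ext; intros k _; apply pr_ext; intros l _; rewrite E; ring.
Qed.

Lemma piw_Lop theta n G H : theta <> 0 -> SymW G -> SymW H ->
  piw theta n (Lop theta G) H = piw theta n G (Lop theta H).
Proof.
  intros Ht HG HH.
  rewrite (piw_sym _ _ G).
  rewrite !(piw_ext _ _ (Lop theta _) (fun k l => (1 - theta) * Kop _ k l + 1 * Ap _ k l + theta * Am _ k l))
    by (intros; unfold Lop; ring).
  rewrite !piw_lin, (piw_Am _ _ G H), (piw_Am _ _ H G); auto.
  rewrite (piw_sym _ _ H (Ap G)), (piw_sym _ _ G (Ap H)).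
  assert (piw theta n (Kop G) H = piw theta n (Kop H) G) as ->.
  { unfold piw; apply sum_over_ext; intros k _; apply pr_ext; intros; unfold Kop; ring. }
  field; auto.
Qed.

(** * The commutant of [Lop] *)

(** The three pieces of the Calogero-Sutherland operator in power sums, each summed over its
    indices: [n^2 p_n d_n], then [i j p_(i+j) d_i d_j], then [(i+j) p_i p_j d_(i+j)]. *)
Definition D0 (g : list nat -> R) (l : list nat) : R :=
  rsum (fun x t => INR x * INR x * g (x :: t)) l.
Definition Dp (g : list nat -> R) (l : list nat) : R :=
  rsum (fun x t => sum_over (seq 1 (x - 1)) (fun m => INR m * (INR x - INR m) *
    g ((x - m)%nat :: m :: t))) l.
Definition Dm (g : list nat -> R) (l : list nat) : R :=
  rsum (fun x t => rsum (fun y u => (INR x + INR y) * g ((x + y)%nat :: u)) t) l.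

Definition D2 (theta : R) (g : list nat -> R) (l : list nat) : R :=
  rsum (Lop theta (iota g)) l.

Lemma D2_split theta g l :
  D2 theta g l = (1 - theta) * D0 g l + Dp g l + theta * Dm g l.
Proof.
  unfold D2, D0, Dp, Dm; rewrite <- !rsum_scal, <- !rsum_plus.
  apply rsum_ext; intros x t _; unfold Lop, Kop, Ap, Am, iota.
  f_equal; [f_equal; [ring|]|].
  - apply sum_over_ext; intros m Hm; apply in_seq in Hm.
    rewrite minus_INR by lia; ring.
  - f_equal; apply rsum_ext; intros y u _; rewrite plus_INR; ring.
Qed.

(* [Cop] commutes with [Lop] and restricts to [D2] along [iota], so all vectors
   [Lprod ds (iota J)] are eigenvectors of [Cop]. *)
Definition Cop (theta : R) (G : nat -> list nat -> R) (k : nat) (l : list nat) : R :=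
  D2 theta (G k) l + (1 - theta) * Kop (Kop G) k l + 2 * Ap (Kop G) k l
  + 2 * theta * Kop (Am G) k l.

Section Linearity.
Variables (a b c : R) (F G H : nat -> list nat -> R).
Let S3 k l := a * F k l + b * G k l + c * H k l.

Lemma Ap_lin k l : Ap S3 k l = a * Ap F k l + b * Ap G k l + c * Ap H k l.
Proof.
  unfold Ap, S3; rewrite <- !sum_over_scal, <- !sum_over_plus.
  apply sum_over_ext; intros; ring.
Qed.

Lemma Am_lin k l : Am S3 k l = a * Am F k l + b * Am G k l + c * Am H k l.
Proof.
  unfold Am, S3; rewrite <- !rsum_scal, <- !rsum_plus; apply rsum_ext; intros; ring.
Qed.

Lemma D0_lin k l : D0 (S3 k) l = a * D0 (F k) l + b * D0 (G k) l + c * D0 (H k) l.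
Proof.
  unfold D0, S3; rewrite <- !rsum_scal, <- !rsum_plus; apply rsum_ext; intros; ring.
Qed.

Lemma Dp_lin k l : Dp (S3 k) l = a * Dp (F k) l + b * Dp (G k) l + c * Dp (H k) l.
Proof.
  unfold Dp, S3; rewrite <- !rsum_scal, <- !rsum_plus; apply rsum_ext; intros.
  rewrite <- !sum_over_scal, <- !sum_over_plus; apply sum_over_ext; intros; ring.
Qed.

Lemma Dm_lin k l : Dm (S3 k) l = a * Dm (F k) l + b * Dm (G k) l + c * Dm (H k) l.
Proof.
  unfold Dm, S3; rewrite <- !rsum_scal, <- !rsum_plus; apply rsum_ext; intros.
  rewrite <- !rsum_scal, <- !rsum_plus; apply rsum_ext; intros; ring.
Qed.
End Linearity.

(** In [Ap (D0 G)] the operator [D0] also picks the entry [m] inserted by [Ap]; this pick is the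
    correction. The next five commutators have the same origin: the added sum collects the terms in
    which one operator acts on a letter produced or consumed by the other. *)
Lemma comm_D0_Ap G k l : SymW G ->
  Ap (fun k => D0 (G k)) k l = D0 (Ap G k) l +
  sum_over (seq 1 (k - 1)) (fun m => INR m * (INR m * INR m * G (k - m)%nat (m :: l))).
Proof.
  intros HG; unfold Ap, D0.
  rewrite (rsum_ext _ (fun x t => sum_over (seq 1 (k - 1)) (fun m =>
    INR m * (INR x * INR x * G (k - m)%nat (x :: m :: t))))).
  - rewrite rsum_sum_over, <- sum_over_plus; apply sum_over_ext; intros m _.
    cbn [rsum]; rewrite rsum_scal; ring.
  - intros x t _; rewrite <- sum_over_scal; apply sum_over_ext; intros m _.
    rewrite (HG _ (m :: x :: t) (x :: m :: t)) by apply perm_swap; ring.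
Qed.

Lemma comm_D0_Am G k l :
  D0 (Am G k) l = Am (fun k => D0 (G k)) k l +
  rsum (fun x t => INR x * INR x * G (k + x)%nat t) l.
Proof.
  unfold Am, D0; rewrite (rsum_swap2 (fun x y u => INR y * INR y * G (k + x)%nat (y :: u))).
  rewrite <- rsum_plus; apply rsum_ext; intros x t _; cbn [rsum].
  rewrite rsum_scal; ring.
Qed.

Lemma comm_Dp_Ap G k l : SymW G ->
  Ap (fun k => Dp (G k)) k l = Dp (Ap G k) l +
  sum_over (seq 1 (k - 1)) (fun m => INR m * sum_over (seq 1 (m - 1)) (fun i =>
    INR i * (INR m - INR i) * G (k - m)%nat ((m - i)%nat :: i :: l))).
Proof.
  intros HG; unfold Ap, Dp.
  rewrite (rsum_ext _ (fun x t => sum_over (seq 1 (k - 1)) (fun m =>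
    INR m * sum_over (seq 1 (x - 1)) (fun i => INR i * (INR x - INR i) *
      G (k - m)%nat ((x - i)%nat :: i :: m :: t))))).
  - rewrite rsum_sum_over, <- sum_over_plus; apply sum_over_ext; intros m _.
    cbn [rsum]; rewrite rsum_scal; ring.
  - intros x t _.
    rewrite (sum_over_ext (seq 1 (k - 1)) _ (fun m => sum_over (seq 1 (x - 1)) (fun i =>
      INR m * (INR i * (INR x - INR i) * G (k - m)%nat ((x - i)%nat :: i :: m :: t)))))
      by (intros; rewrite sum_over_scal; reflexivity).
    rewrite (sum_over_swap (seq 1 (k - 1))); apply sum_over_ext; intros i _.
    rewrite <- sum_over_scal; apply sum_over_ext; intros m _.
    rewrite (HG _ (m :: (x - i)%nat :: i :: t) ((x - i)%nat :: i :: m :: t)); [ring|].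
    rewrite perm_swap; constructor; apply perm_swap.
Qed.

Lemma comm_Dp_Am G k l :
  Dp (Am G k) l = Am (fun k => Dp (G k)) k l +
  2 * rsum (fun x t => sum_over (seq 1 (x - 1)) (fun m =>
        INR m * (INR x - INR m) * G (k + x - m)%nat (m :: t))) l.
Proof.
  unfold Am, Dp; rewrite (rsum_swap2 (fun x y u => sum_over (seq 1 (y - 1)) (fun m =>
    INR m * (INR y - INR m) * G (k + x)%nat ((y - m)%nat :: m :: u)))).
  rewrite <- rsum_scal, <- rsum_plus; apply rsum_ext; intros x t _; cbn [rsum].
  rewrite (sum_over_ext _ _ (fun m =>
    INR m * (INR x - INR m) * G (k + x - m)%nat (m :: t) +
    INR m * (INR x - INR m) * G (k + m)%nat ((x - m)%nat :: t) +
    INR m * (INR x - INR m) * rsum (fun y u => G (k + y)%nat ((x - m)%nat :: m :: u)) t)).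
  - rewrite !sum_over_plus, rsum_sum_over.
    (* The pieces [m] and [x - m] of the part [x] play symmetric roles: reversing the sum makes
       their contributions equal, hence the factor 2. *)
    assert (sum_over (seq 1 (x - 1)) (fun m => INR m * (INR x - INR m) *
              G (k + m)%nat ((x - m)%nat :: t)) =
            sum_over (seq 1 (x - 1)) (fun m => INR m * (INR x - INR m) *
              G (k + x - m)%nat (m :: t))) as ->.
    { rewrite seq_sum_rev1; apply sum_over_ext; intros m Hm; apply in_seq in Hm.
      replace (x - 1 + 1 - m)%nat with (x - m)%nat by lia.
      replace (x - (x - m))%nat with m by lia.
      replace (k + (x - m))%nat with (k + x - m)%nat by lia.
      rewrite minus_INR by lia; ring. }
    rewrite (sum_over_ext _ (fun y => rsum _ t) (fun m => INR m * (INR x - INR m) *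
      rsum (fun y u => G (k + y)%nat ((x - m)%nat :: m :: u)) t))
      by (intros; rewrite rsum_scal; reflexivity).
    ring.
  - intros m Hm; apply in_seq in Hm.
    replace (k + (x - m))%nat with (k + x - m)%nat by lia; ring.
Qed.

Lemma comm_Dm_Ap G k l : SymW G ->
  Ap (fun k => Dm (G k)) k l = Dm (Ap G k) l +
  2 * sum_over (seq 1 (k - 1)) (fun m => INR m * rsum (fun y u =>
    (INR m + INR y) * G (k - m)%nat ((m + y)%nat :: u)) l).
Proof.
  intros HG; unfold Ap, Dm.
  rewrite (rsum_ext (fun x t => rsum (fun y u => (INR x + INR y) *
    sum_over (seq 1 (k - 1)) (fun m => INR m * G (k - m)%nat (m :: (x + y)%nat :: u))) t)
   (fun x t => sum_over (seq 1 (k - 1)) (fun m => INR m * rsum (fun y u =>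
     (INR x + INR y) * G (k - m)%nat ((x + y)%nat :: m :: u)) t))).
  - rewrite rsum_sum_over, <- sum_over_scal, <- sum_over_plus.
    apply sum_over_ext; intros m _; cbn [rsum]; rewrite rsum_scal, rsum_plus.
    rewrite (rsum_ext (fun y t' => (INR y + INR m) * G (k - m)%nat ((y + m)%nat :: t'))
      (fun y u => (INR m + INR y) * G (k - m)%nat ((m + y)%nat :: u))).
    + ring.
    + intros; rewrite (Nat.add_comm m); ring.
  - intros x t _.
    rewrite <- (sum_over_ext (seq 1 (k - 1)) (fun m => rsum (fun y u => INR m *
       ((INR x + INR y) * G (k - m)%nat ((x + y)%nat :: m :: u))) t))
      by (intros; rewrite rsum_scal; reflexivity).
    rewrite <- rsum_sum_over; apply rsum_ext; intros y u _.
    rewrite <- sum_over_scal; apply sum_over_ext; intros m _.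
    rewrite (HG _ (m :: (x + y)%nat :: u) ((x + y)%nat :: m :: u)) by apply perm_swap; ring.
Qed.

Lemma comm_Dm_Am G k l :
  Dm (Am G k) l = Am (fun k => Dm (G k)) k l +
  rsum (fun x t => rsum (fun y u => (INR x + INR y) * G (k + x + y)%nat u) t) l.
Proof.
  unfold Am, Dm.
  rewrite (rsum_swap2 (fun z x t => rsum (fun y u => (INR x + INR y) *
    G (k + z)%nat ((x + y)%nat :: u)) t)).
  rewrite <- rsum_plus; apply rsum_ext; intros x t _.
  rewrite (rsum_swap2 (fun z y u => (INR x + INR y) * G (k + z)%nat ((x + y)%nat :: u))).
  rewrite <- rsum_plus; apply rsum_ext; intros y u _; cbn [rsum].
  rewrite rsum_scal, Nat.add_assoc; ring.
Qed.

Lemma comm_mixed G k l : posl l -> (1 <= k)%nat ->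
  Am (Ap (Kop G)) k l = Kop (Am (Ap G)) k l
  + rsum (fun x t => sum_over (seq 1 (x - 1)) (fun m =>
        INR m * (INR x - INR m) * G (k + x - m)%nat (m :: t))) l
  - sum_over (seq 1 (k - 1)) (fun m => INR m * rsum (fun y u =>
      (INR m + INR y) * G (k - m)%nat ((m + y)%nat :: u)) l).
Proof.
  intros Hl Hk; unfold Kop at 2, Am.
  rewrite <- (sum_over_ext (seq 1 (k - 1)) (fun m => rsum (fun y u => INR m *
       ((INR m + INR y) * G (k - m)%nat ((m + y)%nat :: u))) l))
      by (intros; rewrite rsum_scal; reflexivity).
  rewrite <- rsum_sum_over, <- rsum_scal, <- rsum_plus, <- rsum_minus.
  apply rsum_ext; intros x t Hp.
  assert (1 <= x)%nat as Hx.
  { apply (Permutation_Forall Hp) in Hl; inversion Hl; auto. }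
  unfold Ap, Kop; rewrite <- sum_over_scal.
  cut (sum_over (seq 1 (k + x - 1)) (fun m => INR m * (INR x - INR m) * G (k + x - m)%nat (m :: t))
   = sum_over (seq 1 (x - 1)) (fun m => INR m * (INR x - INR m) * G (k + x - m)%nat (m :: t))
   - sum_over (seq 1 (k - 1)) (fun m => INR m * ((INR m + INR x) * G (k - m)%nat ((m + x)%nat :: t)))).
  { intros E. 
    match goal with |- _ = ?b + ?s1 - ?s2 => replace (b + s1 - s2) with (b + (s1 - s2)) by ring end.
    rewrite <- E, <- sum_over_plus.
    apply sum_over_ext; intros m Hm; apply in_seq in Hm.
    rewrite minus_INR, plus_INR by lia; ring. }
  (* The range of [m] is cut at [m = x], where the factor [x - m] vanishes. The terms beyond it,
     shifted by [x], form the second sum with a minus sign. *)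
  replace (k + x - 1)%nat with ((x - 1) + S (k - 1))%nat by lia.
  rewrite seq_app, sum_over_app; cbn [seq]; rewrite sum_over_cons.
  replace (1 + (x - 1))%nat with x by lia.
  replace (S x) with (1 + x)%nat by lia.
  rewrite sum_over_seq_shift.
  rewrite (sum_over_ext (seq 1 (k - 1)) _ (fun m => -1 * (INR m * ((INR m + INR x) * G (k - m)%nat ((m + x)%nat :: t))))).
  - rewrite sum_over_scal; ring.
  - intros m Hm; apply in_seq in Hm.
    replace (k + x - (m + x))%nat with (k - m)%nat by lia; rewrite plus_INR; ring.
Qed.

(** The weights read by [Kop] on the two sides, [k - m] and [k - m - i], differ by one of the two
    absorbed parts. [T] and [T'] are the two choices of that part; they have equal sums by symmetry
    and together give the factor [m + i]. *)
Lemma comm_ApAp G k l : SymW G ->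
  Ap (Kop (Ap G)) k l + Ap (Kop (Ap G)) k l = Ap (Ap (Kop G)) k l + Ap (Ap (Kop G)) k l +
  sum_over (seq 1 (k - 1)) (fun m => INR m * sum_over (seq 1 (m - 1)) (fun i =>
    INR i * (INR m - INR i) * G (k - m)%nat ((m - i)%nat :: i :: l))).
Proof.
  intros HG.
  set (T := fun m i => INR m * INR i * INR i * G (k - (m + i))%nat (m :: i :: l)).
  set (T' := fun m i => INR m * INR i * INR m * G (k - (m + i))%nat (m :: i :: l)).
  assert (E1 : Ap (Kop (Ap G)) k l = Ap (Ap (Kop G)) k l +
    sum_over (seq 1 (k - 1)) (fun m => sum_over (seq 1 (k - 1 - m)) (T m))).
  { unfold Ap, Kop; rewrite <- sum_over_plus; apply sum_over_ext; intros m Hm.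
    apply in_seq in Hm; rewrite <- !sum_over_scal.
    replace (k - 1 - m)%nat with (k - m - 1)%nat by lia.
    rewrite <- sum_over_plus; apply sum_over_ext; intros i Hi; apply in_seq in Hi.
    unfold T; replace (k - (m + i))%nat with (k - m - i)%nat by lia.
    rewrite (HG _ (i :: m :: l) (m :: i :: l)) by apply perm_swap.
    rewrite (minus_INR (k - m) i) by lia; ring. }
  assert (E2 : sum_over (seq 1 (k - 1)) (fun m => sum_over (seq 1 (k - 1 - m)) (T m)) =
     sum_over (seq 1 (k - 1)) (fun m => sum_over (seq 1 (k - 1 - m)) (T' m))).
  { rewrite (sum_triangle _ T), (sum_triangle _ T'); apply sum_over_ext; intros s Hs.
    apply in_seq in Hs.
    rewrite seq_sum_rev1; apply sum_over_ext; intros m Hm; apply in_seq in Hm.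
    unfold T, T'. replace (s - 1 + 1 - m)%nat with (s - m)%nat by lia.
    replace (s - (s - m))%nat with m by lia.
    replace (s - m + m)%nat with (m + (s - m))%nat by lia.
    rewrite (HG _ (m :: (s - m)%nat :: l) ((s - m)%nat :: m :: l)) by apply perm_swap; ring. }
  rewrite E1 at 1; rewrite E2, E1.
  rewrite (sum_triangle _ T), (sum_triangle _ T').
  set (u := Ap (Ap (Kop G)) k l).
  rewrite (sum_over_ext (seq 1 (k - 1)) (fun m => INR m * _) (fun s =>
    sum_over (seq 1 (s - 1)) (fun m => T (s - m)%nat m) +
    sum_over (seq 1 (s - 1)) (fun m => T' (s - m)%nat m))).
  - rewrite sum_over_plus; ring.
  - intros s Hs; apply in_seq in Hs; rewrite <- sum_over_scal, <- sum_over_plus.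
    apply sum_over_ext; intros m Hm; apply in_seq in Hm; unfold T, T'.
    replace (s - m + m)%nat with s by lia.
    rewrite minus_INR by lia; ring.
Qed.

Lemma comm_AmAm G k l :
  2 * Kop (Am (Am G)) k l = 2 * Am (Kop (Am G)) k l -
  rsum (fun x t => rsum (fun y u => (INR x + INR y) * G (k + x + y)%nat u) t) l.
Proof.
  rewrite (rsum_ext (fun x t => rsum (fun y u => (INR x + INR y) * G (k + x + y)%nat u) t)
    (fun x t => rsum (fun y u => INR x * G (k + x + y)%nat u) t +
                rsum (fun y u => INR y * G (k + x + y)%nat u) t))
    by (intros; rewrite <- rsum_plus; apply rsum_ext; intros; ring).
  rewrite rsum_plus, (rsum_swap2 (fun x y u => INR y * G (k + x + y)%nat u)).
  rewrite (rsum_ext (fun x t => rsum (fun y u => INR x * G (k + y + x)%nat u) t)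
    (fun x t => rsum (fun y u => INR x * G (k + x + y)%nat u) t))
    by (intros; apply rsum_ext; intros; do 2 f_equal; lia).
  unfold Kop, Am.
  rewrite (rsum_ext (fun x t => INR (k + x) * _) (fun x t =>
    INR k * rsum (fun y u => G (k + x + y)%nat u) t + rsum (fun y u => INR x * G (k + x + y)%nat u) t))
    by (intros; rewrite rsum_scal, plus_INR; ring).
  rewrite rsum_plus, rsum_scal; ring.
Qed.

Lemma comm_K_Ap G k l :
  Kop (Kop (Ap G)) k l + Ap (Kop (Kop G)) k l = 2 * Kop (Ap (Kop G)) k l +
  sum_over (seq 1 (k - 1)) (fun m => INR m * (INR m * INR m * G (k - m)%nat (m :: l))).
Proof.
  unfold Kop, Ap; rewrite <- !sum_over_scal, <- !sum_over_plus.
  apply sum_over_ext; intros m Hm; apply in_seq in Hm; rewrite minus_INR by lia; ring.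
Qed.

Lemma comm_K_Am G k l :
  Kop (Kop (Am G)) k l + Am (Kop (Kop G)) k l = 2 * Kop (Am (Kop G)) k l +
  rsum (fun x t => INR x * INR x * G (k + x)%nat t) l.
Proof.
  unfold Kop, Am; rewrite <- !rsum_scal, <- !rsum_plus.
  apply rsum_ext; intros x t _; rewrite plus_INR; ring.
Qed.

Lemma Lop_S3 theta G :
  Lop theta G = fun k l => (1 - theta) * Kop G k l + 1 * Ap G k l + theta * Am G k l.
Proof.
  extensionality k; extensionality l; unfold Lop; ring.
Qed.

Lemma Cop_S3 theta G :
  Cop theta G = fun k l =>
    1 * ((1 - theta) * D0 (G k) l + 1 * Dp (G k) l + theta * Dm (G k) l)
    + 1 * ((1 - theta) * Kop (Kop G) k l + 2 * Ap (Kop G) k l + (2 * theta) * Kop (Am G) k l)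
    + 0 * 0.
Proof.
  extensionality k; extensionality l; unfold Cop; rewrite D2_split; ring.
Qed.

Lemma Ap_Cop theta G k l : Ap (Cop theta G) k l =
  (1 - theta) * Ap (fun k => D0 (G k)) k l + Ap (fun k => Dp (G k)) k l
  + theta * Ap (fun k => Dm (G k)) k l + (1 - theta) * Ap (Kop (Kop G)) k l
  + 2 * Ap (Ap (Kop G)) k l + 2 * theta * Ap (Kop (Am G)) k l.
Proof.
  rewrite Cop_S3, (Ap_lin 1 1 0 (fun k l => (1 - theta) * D0 (G k) l + 1 * Dp (G k) l + theta * Dm (G k) l)
    (fun k l => (1 - theta) * Kop (Kop G) k l + 2 * Ap (Kop G) k l + (2 * theta) * Kop (Am G) k l)
    (fun _ _ => 0)).
  rewrite (Ap_lin _ _ _ (fun k => D0 (G k)) (fun k => Dp (G k)) (fun k => Dm (G k))), Ap_lin; ring.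
Qed.

Lemma Am_Cop theta G k l : Am (Cop theta G) k l =
  (1 - theta) * Am (fun k => D0 (G k)) k l + Am (fun k => Dp (G k)) k l
  + theta * Am (fun k => Dm (G k)) k l + (1 - theta) * Am (Kop (Kop G)) k l
  + 2 * Am (Ap (Kop G)) k l + 2 * theta * Am (Kop (Am G)) k l.
Proof.
  rewrite Cop_S3, (Am_lin 1 1 0 (fun k l => (1 - theta) * D0 (G k) l + 1 * Dp (G k) l + theta * Dm (G k) l)
    (fun k l => (1 - theta) * Kop (Kop G) k l + 2 * Ap (Kop G) k l + (2 * theta) * Kop (Am G) k l)
    (fun _ _ => 0)).
  rewrite (Am_lin _ _ _ (fun k => D0 (G k)) (fun k => Dp (G k)) (fun k => Dm (G k))), Am_lin; ring.
Qed.

Lemma Kop_S3 a b c F G H :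
  Kop (fun k l => a * F k l + b * G k l + c * H k l) =
  fun k l => a * Kop F k l + b * Kop G k l + c * Kop H k l.
Proof. extensionality k; extensionality l; unfold Kop; ring. Qed.

Lemma D_Kop G k l : D0 (Kop G k) l = INR k * D0 (G k) l /\
  Dp (Kop G k) l = INR k * Dp (G k) l /\ Dm (Kop G k) l = INR k * Dm (G k) l.
Proof.
  assert (E : Kop G k = (fun k' l => INR k * G k' l + 0 * G k' l + 0 * G k' l) k)
    by (extensionality u; unfold Kop; ring).
  rewrite E, D0_lin, Dp_lin, Dm_lin; repeat split; ring.
Qed.

Lemma D2_Lop theta G k l : D2 theta (Lop theta G k) l =
  (1 - theta) * ((1 - theta) * (INR k * D0 (G k) l) + D0 (Ap G k) l + theta * D0 (Am G k) l)
  + ((1 - theta) * (INR k * Dp (G k) l) + Dp (Ap G k) l + theta * Dp (Am G k) l)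
  + theta * ((1 - theta) * (INR k * Dm (G k) l) + Dm (Ap G k) l + theta * Dm (Am G k) l).
Proof.
  destruct (D_Kop G k l) as (F1 & F2 & F3).
  rewrite D2_split, Lop_S3, (D0_lin _ _ _ (Kop G) (Ap G) (Am G)),
    (Dp_lin _ _ _ (Kop G) (Ap G) (Am G)), (Dm_lin _ _ _ (Kop G) (Ap G) (Am G)), F1, F2, F3.
  ring.
Qed.

Lemma Ap_Kop_Lop theta G k l : Ap (Kop (Lop theta G)) k l =
  (1 - theta) * Ap (Kop (Kop G)) k l + Ap (Kop (Ap G)) k l + theta * Ap (Kop (Am G)) k l.
Proof. rewrite Lop_S3, Kop_S3, Ap_lin; ring. Qed.

Lemma Am_Lop theta G k l : Am (Lop theta G) k l =
  (1 - theta) * Am (Kop G) k l + Am (Ap G) k l + theta * Am (Am G) k l.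
Proof. rewrite Lop_S3, Am_lin; ring. Qed.

Lemma Kop_eq G k l : Kop G k l = INR k * G k l.
Proof. reflexivity. Qed.

Lemma Cop_Lop theta G k l : SymW G -> posl l -> (1 <= k)%nat ->
  Cop theta (Lop theta G) k l = Lop theta (Cop theta G) k l.
Proof.
  intros HG Hl Hk.
  unfold Lop at 2; rewrite Ap_Cop, Am_Cop.
  unfold Cop at 1; rewrite D2_Lop, Ap_Kop_Lop, (Kop_eq (Am (Lop theta G))), Am_Lop.
  rewrite (Kop_eq (Kop (Lop theta G))), (Kop_eq (Lop theta G)); unfold Lop at 1.
  rewrite (Kop_eq (Cop theta G)); unfold Cop; rewrite D2_split.
  rewrite (comm_D0_Ap G k l HG), (comm_Dp_Ap G k l HG), (comm_Dm_Ap G k l HG).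
  rewrite comm_D0_Am, comm_Dp_Am, comm_Dm_Am.
  pose proof (comm_ApAp G k l HG) as E1.
  pose proof (comm_AmAm G k l) as E2.
  pose proof (comm_K_Ap G k l) as E3.
  pose proof (comm_K_Am G k l) as E4.
  pose proof (comm_mixed G k l Hl Hk) as E5.
  rewrite !(Kop_eq (Kop _)), !Kop_eq in *.
  match type of E1 with _ = _ + ?s => set (S1 := s) in * end.
  match type of E2 with _ = _ - ?s => set (S2 := s) in * end.
  match type of E3 with _ = _ + ?s => set (S3 := s) in * end.
  match type of E4 with _ = _ + ?s => set (S4 := s) in * end.
  match type of E5 with _ = _ + ?s - ?t => set (S5 := s) in *; set (S6 := t) in * end.
  (* Five of the six correction sums are eliminated. [S5] stays as an atom, since [comm_mixed]
     determines only [S5 - S6], and it cancels in the final identity. *)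
  assert (S1 = 2 * Ap (Kop (Ap G)) k l - 2 * Ap (Ap (Kop G)) k l) as -> by lra.
  assert (S2 = 2 * Am (Kop (Am G)) k l - 2 * (INR k * Am (Am G) k l)) as -> by lra.
  assert (S3 = INR k * (INR k * Ap G k l) + Ap (Kop (Kop G)) k l - 2 * (INR k * Ap (Kop G) k l)) as -> by lra.
  assert (S4 = INR k * (INR k * Am G k l) + Am (Kop (Kop G)) k l - 2 * (INR k * Am (Kop G) k l)) as -> by lra.
  assert (S6 = INR k * Am (Ap G) k l + S5 - Am (Ap (Kop G)) k l) as -> by lra.
  ring.
Qed.

Lemma Cop_iota theta g k l : Symf g -> Cop theta (iota g) k l = iota (D2 theta g) k l.
Proof.
  intros Hg; unfold Cop; rewrite D2_split; unfold iota at 7; rewrite D2_split.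
  unfold D0, Dp, Dm; cbn [rsum]; unfold iota, Kop, Ap, Am.
  rewrite (rsum_ext (fun x t => INR x * INR x * (INR k * g (k :: x :: t)))
    (fun x t => INR k * (INR x * INR x * g (x :: k :: t)))).
  2:{ intros x t _; rewrite (Hg (k :: x :: t) (x :: k :: t)) by apply perm_swap; ring. }
  rewrite rsum_scal.
  rewrite (rsum_ext (fun x t => sum_over _ _) (fun x t => INR k *
    sum_over (seq 1 (x - 1)) (fun m => INR m * (INR x - INR m) * g ((x - m)%nat :: m :: k :: t)))).
  2:{ intros x t _; rewrite <- sum_over_scal; apply sum_over_ext; intros m _.
      rewrite (Hg (k :: (x - m)%nat :: m :: t) ((x - m)%nat :: m :: k :: t)); [ring|].
      rewrite perm_swap; constructor; apply perm_swap. }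
  rewrite rsum_scal.
  rewrite (rsum_ext (fun x t => rsum (fun y u => (INR x + INR y) * (INR k * g (k :: (x + y)%nat :: u))) t)
    (fun x t => INR k * rsum (fun y u => (INR x + INR y) * g ((x + y)%nat :: k :: u)) t)).
  2:{ intros x t _; rewrite <- rsum_scal; apply rsum_ext; intros y u _.
      rewrite (Hg (k :: (x + y)%nat :: u) ((x + y)%nat :: k :: u)) by apply perm_swap; ring. }
  rewrite rsum_scal, rsum_plus.
  rewrite (rsum_ext (fun y t' => (INR y + INR k) * g ((y + k)%nat :: t'))
    (fun y u => (INR k + INR y) * g ((k + y)%nat :: u)))
    by (intros; rewrite (Nat.add_comm k); ring).
  rewrite (rsum_ext (fun x t => INR (k + x) * g ((k + x)%nat :: t))
    (fun y u => (INR k + INR y) * g ((k + y)%nat :: u)))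
    by (intros; rewrite plus_INR; ring).
  (* Averaging over the exchange of [m] and [k - m] replaces the weight [2 (k - m)] by [k]. *)
  assert (2 * sum_over (seq 1 (k - 1)) (fun m => INR m * (INR (k - m) * (INR (k - m) * g ((k - m)%nat :: m :: l)))) =
    INR k * sum_over (seq 1 (k - 1)) (fun m => INR m * (INR k - INR m) * g ((k - m)%nat :: m :: l))) as ->.
  { rewrite <- Rplus_diag, seq_sum_rev1 at 1; rewrite <- sum_over_plus, <- sum_over_scal.
    apply sum_over_ext; intros m Hm; apply in_seq in Hm.
    replace (k - 1 + 1 - m)%nat with (k - m)%nat by lia.
    replace (k - (k - m))%nat with m by lia.
    rewrite (Hg (m :: (k - m)%nat :: l) ((k - m)%nat :: m :: l)) by apply perm_swap.
    rewrite minus_INR by lia; ring. }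
  ring.
Qed.

(** At [w^1] the sum [Ap] is empty, and the equation for [Lop] expresses [theta * Am] through [a].
    Substituting it into the equation for [Cop] isolates [D2]. *)
Lemma D2_of_lowest theta G a e l :
  Lop theta G 1 l = a * G 1%nat l -> Cop theta G 1 l = e * G 1%nat l ->
  D2 theta (G 1%nat) l = (e - 2 * a + 1 - theta) * G 1%nat l.
Proof.
  unfold Lop, Cop, Kop, Ap; cbn [seq Nat.sub INR]; rewrite !sum_over_nil; intros; lra.
Qed.

Lemma Lop_ext theta F G k l : posl l -> (1 <= k)%nat ->
  (forall k l, posl l -> (1 <= k)%nat -> F k l = G k l) ->
  Lop theta F k l = Lop theta G k l.
Proof.
  intros Hl Hk E; unfold Lop, Kop, Ap, Am; rewrite E by auto; f_equal; [f_equal|f_equal].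
  - apply sum_over_ext; intros m Hm; apply in_seq in Hm.
    rewrite E; auto; [constructor; auto; lia|lia].
  - apply rsum_ext; intros x t Hp.
    apply (Permutation_Forall Hp) in Hl; inversion Hl; subst; rewrite E; auto; lia.
Qed.

Lemma Lop_sub theta F G d k l :
  Lop theta (fun k l => F k l - d * G k l) k l = Lop theta F k l - d * Lop theta G k l.
Proof.
  assert ((fun k l => F k l - d * G k l) = fun k l => 1 * F k l + (- d) * G k l + 0 * G k l) as ->
    by (extensionality u; extensionality v; ring).
  unfold Lop; rewrite Ap_lin, Am_lin; unfold Kop; ring.
Qed.

Lemma Lop_scal theta G c k l : Lop theta (fun k l => c * G k l) k l = c * Lop theta G k l.
Proof.
  assert ((fun k l => c * G k l) = fun k l => c * G k l + 0 * G k l + 0 * G k l) as ->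
    by (extensionality u; extensionality v; ring).
  unfold Lop; rewrite Ap_lin, Am_lin; unfold Kop; ring.
Qed.

Lemma Cop_sub theta F G d k l :
  Cop theta (fun k l => F k l - d * G k l) k l = Cop theta F k l - d * Cop theta G k l.
Proof.
  assert ((fun k l => F k l - d * G k l) = fun k l => 1 * F k l + (- d) * G k l + 0 * G k l) as ->
    by (extensionality u; extensionality v; ring).
  unfold Cop; rewrite !D2_split, !Kop_S3, D0_lin, Dp_lin, Dm_lin, Ap_lin.
  rewrite !(Kop_eq (Am _)), Am_lin; ring.
Qed.

(** Polynomials in [Lop] are kept in factored form, so that factors can be permuted and chosen to
    vanish at prescribed eigenvalues. *)
Fixpoint Lprod theta (ds : list R) (G : nat -> list nat -> R) : nat -> list nat -> R :=
  match ds with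
  | [] => G
  | d :: ds => fun k l => Lop theta (Lprod theta ds G) k l - d * Lprod theta ds G k l
  end.

Lemma SymW_sub F G d : SymW F -> SymW G -> SymW (fun k l => F k l - d * G k l).
Proof. intros HF HG k l l' Hp; rewrite (HF k l l'), (HG k l l'); auto. Qed.

Lemma SymW_Lprod theta ds G : SymW G -> SymW (Lprod theta ds G).
Proof.
  intros HG; induction ds as [|d ds IH]; cbn; auto.
  apply SymW_sub; auto using SymW_Lop.
Qed.

Lemma Cop_Lprod theta ds G e :
  SymW G -> (forall k l, posl l -> (1 <= k)%nat -> Cop theta G k l = e * G k l) ->
  forall k l, posl l -> (1 <= k)%nat ->
  Cop theta (Lprod theta ds G) k l = e * Lprod theta ds G k l.
Proof.
  intros HG H; induction ds as [|d ds IH]; intros k l Hl Hk; cbn [Lprod]; auto.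
  rewrite Cop_sub, Cop_Lop, IH by auto using SymW_Lprod.
  rewrite (Lop_ext _ _ (fun k l => e * Lprod theta ds G k l)), Lop_scal; auto; ring.
Qed.

Lemma Lprod_swap theta a b G :
  Lprod theta [a; b] G = Lprod theta [b; a] G.
Proof.
  extensionality k; extensionality l; cbn [Lprod]; rewrite !Lop_sub; ring.
Qed.

Lemma Lprod_app theta ds es G : Lprod theta (ds ++ es) G = Lprod theta ds (Lprod theta es G).
Proof. induction ds as [|d ds IH]; cbn [app Lprod]; auto; rewrite IH; reflexivity. Qed.

Lemma Lprod_perm theta ds es G : Permutation ds es -> Lprod theta ds G = Lprod theta es G.
Proof.
  induction 1; cbn [Lprod]; auto.
  - rewrite IHPermutation; reflexivity.
  - exact (Lprod_swap theta y x (Lprod theta l G)).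
  - congruence.
Qed.

Definition Hom (n : nat) (g : list nat -> R) := forall l, list_sum l <> n -> g l = 0.
Definition HomW (n : nat) (G : nat -> list nat -> R) :=
  forall k l, (k + list_sum l)%nat <> n -> G k l = 0.

Lemma HomW_iota n g : Hom n g -> HomW n (iota g).
Proof. intros H k l Hl; unfold iota; rewrite H; [ring|exact Hl]. Qed.

Lemma HomW_Lop theta n G : HomW n G -> HomW n (Lop theta G).
Proof.
  intros H k l Hl; unfold Lop, Kop, Ap, Am.
  rewrite H, sum_over_0, rsum_0; auto; [ring| |].
  - intros x t Hp; apply H; rewrite (Permutation_list_sum Hp) in Hl; simpl in Hl; lia.
  - intros m Hm; apply in_seq in Hm; rewrite H; [ring|simpl; lia].
Qed.

Lemma HomW_Lprod theta n ds G : HomW n G -> HomW n (Lprod theta ds G).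
Proof.
  intros HG; induction ds as [|d ds IH]; cbn; auto.
  intros k l Hl; rewrite (HomW_Lop _ _ _ IH k l Hl), (IH k l Hl); ring.
Qed.

Lemma Hom_rsum n G : HomW n G -> Hom n (rsum G).
Proof.
  intros H l Hl; apply rsum_0; intros x t Hp; apply H.
  rewrite (Permutation_list_sum Hp) in Hl; simpl in Hl; lia.
Qed.

Fixpoint Lpow theta K G : nat -> list nat -> R :=
  match K with O => G | S K => Lop theta (Lpow theta K G) end.

(* Meaningful for [K >= 1]; the truncation makes [Dop 0 = Dop 1]. *)
Definition Dop theta K (g : list nat -> R) : list nat -> R :=
  rsum (Lpow theta (K - 1) (iota g)).

(** * Coefficients in the variables x *)

Lemma rsum_exchange F l m :
  rsum (fun x t => rsum (fun y u => F x t y u) m) l =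
  rsum (fun y u => rsum (fun x t => F x t y u) l) m.
Proof.
  revert F; induction m as [|b m IH]; intros F; cbn [rsum].
  - apply rsum_0; reflexivity.
  - rewrite rsum_plus, <- IH; reflexivity.
Qed.

(* [Lc] of the definitions, through [rsum]. *)
Fixpoint Lx (mu nu : list nat) : R :=
  match mu with
  | [] => if forallb (Nat.eqb 0) nu then 1 else 0
  | m :: mu' => rsum (fun x t => if Nat.leb m x then Lx mu' ((x - m)%nat :: t) else 0) nu
  end.

Lemma Lx_Symf_r mu : Symf (Lx mu).
Proof.
  induction mu as [|m mu IH]; intros u v Huv; cbn [Lx].
  - assert (forallb (Nat.eqb 0) u = forallb (Nat.eqb 0) v) as ->; [|reflexivity].
    induction Huv as [| | |]; cbn [forallb]; try congruence.
    rewrite !Bool.andb_assoc, (Bool.andb_comm (Nat.eqb 0 y)); reflexivity.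
  - apply rsum_perm; auto; intros x u' v' Hp.
    destruct (Nat.leb m x); auto; apply IH; constructor; exact Hp.
Qed.

Lemma rsum_positions H nu :
  sumR (map (fun j => H (nth j nu 0%nat) (firstn j nu ++ skipn (S j) nu)) (seq 0 (length nu)))
  = rsum H nu.
Proof.
  revert H; induction nu as [|x t IH]; intros H; [reflexivity|].
  cbn [length seq rsum]; cbn [map].
  rewrite <- seq_shift, map_map.
  rewrite <- IH; reflexivity.
Qed.

Lemma Lc_Lx mu nu : Lc mu nu = Lx mu nu.
Proof.
  revert nu; induction mu as [|m mu IH]; intros nu; [reflexivity|].
  cbn [Lc Lx]; rewrite <- rsum_positions.
  f_equal; apply map_ext; intros j.
  destruct (Nat.leb m (nth j nu 0%nat)); [|reflexivity].
  rewrite IH; apply Lx_Symf_r; unfold decr.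
  symmetry; apply Permutation_middle.
Qed.

Lemma rsum_if (b : bool) F l : rsum (fun x t => if b then F x t else 0) l = if b then rsum F l else 0.
Proof. destruct b; [reflexivity|apply rsum_0; reflexivity]. Qed.

(** The factors [p_a] and [p_b] fall either on one variable, which loses [a + b], or on two
    different ones. Both cases are symmetric in [a] and [b]. *)
Lemma Lx_swap a b mu nu : Lx (a :: b :: mu) nu = Lx (b :: a :: mu) nu.
Proof.
  cbn [Lx rsum].
  assert (E : forall a b, rsum (fun x t => if Nat.leb a x then
      (if Nat.leb b (x - a) then Lx mu ((x - a - b)%nat :: t) else 0) +
      rsum (fun y u => if Nat.leb b y then Lx mu ((y - b)%nat :: (x - a)%nat :: u) else 0) t else 0) nu =
    rsum (fun x t => if Nat.leb (a + b) x then Lx mu ((x - (a + b))%nat :: t) else 0) nu +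
    rsum (fun x t => rsum (fun y u => if (Nat.leb a x && Nat.leb b y)%bool then
       Lx mu ((y - b)%nat :: (x - a)%nat :: u) else 0) t) nu).
  { clear; intros a b; rewrite <- rsum_plus; apply rsum_ext; intros x t _.
    destruct (Nat.leb_spec a x).
    - f_equal.
      destruct (Nat.leb_spec b (x - a)), (Nat.leb_spec (a + b) x); try lia; auto.
      rewrite Nat.sub_add_distr; reflexivity.
    - destruct (Nat.leb_spec (a + b) x); [lia|].
      rewrite rsum_0; [ring|reflexivity]. }
  rewrite !E, (Nat.add_comm b a); f_equal.
  rewrite rsum_swap2; apply rsum_ext; intros x t _; apply rsum_ext; intros y u _.
  rewrite Bool.andb_comm; destruct (_ && _)%bool; auto.
  apply Lx_Symf_r, perm_swap.
Qed.

Lemma Lx_Symf_l nu : Symf (fun mu => Lx mu nu).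
Proof.
  intros u v Huv; revert nu; induction Huv; intros nu.
  - reflexivity.
  - cbn [Lx]; apply rsum_ext; intros y t _; rewrite IHHuv; reflexivity.
  - apply Lx_swap.
  - rewrite IHHuv1; auto.
Qed.

Lemma Lx_zero mu nu : posl mu -> Lx mu (0%nat :: nu) = Lx mu nu.
Proof.
  intros Hm; revert nu; induction Hm as [|m mu Hm Hmu IH]; intros nu; cbn [Lx rsum].
  - reflexivity.
  - destruct (Nat.leb_spec m 0); [lia|].
    rewrite Rplus_0_l; apply rsum_ext; intros x t _.
    destruct (Nat.leb m x); [|reflexivity].
    rewrite <- (IH ((x - m)%nat :: t)); apply Lx_Symf_r, perm_swap.
Qed.

(* Euler's identity in the first variable: every factor [p_m] contributes [m]. *)
Lemma Lx_euler l a b :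
  rsum (fun m t => if Nat.leb m a then INR m * Lx t ((a - m)%nat :: b) else 0) l =
  INR a * Lx l (a :: b).
Proof.
  revert a b; induction l as [|m l IH]; intros a b.
  - cbn [rsum Lx forallb]; destruct a; cbn; ring.
  - cbn [rsum].
    rewrite (rsum_ext _ (fun m' t => (if Nat.leb m a then
        (if Nat.leb m' (a - m) then INR m' * Lx t ((a - m - m')%nat :: b) else 0) else 0) +
      rsum (fun x u => if Nat.leb m x then
        (if Nat.leb m' a then INR m' * Lx t ((a - m')%nat :: (x - m)%nat :: u) else 0) else 0) b)).
    + rewrite rsum_plus, rsum_if, IH, rsum_exchange.
      rewrite (rsum_ext (fun x u => rsum _ l) (fun x u => INR a * (if Nat.leb m x then
         Lx l ((x - m)%nat :: a :: u) else 0))).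
      * rewrite rsum_scal; cbn [Lx rsum].
        destruct (Nat.leb_spec m a); [rewrite minus_INR by lia|]; ring.
      * intros x u _; rewrite rsum_if; destruct (Nat.leb m x); [|ring].
        rewrite IH; f_equal; apply Lx_Symf_r, perm_swap.
    + intros m' t _; cbn [Lx rsum].
      destruct (Nat.leb_spec m' a).
      * rewrite Rmult_plus_distr_l; f_equal.
        -- destruct (Nat.leb_spec m (a - m')), (Nat.leb_spec m a), (Nat.leb_spec m' (a - m));
             try lia; try ring.
           replace (a - m' - m)%nat with (a - m - m')%nat by lia; reflexivity.
        -- rewrite <- rsum_scal; apply rsum_ext; intros x u _.
           destruct (Nat.leb m x); [|ring]. f_equal; apply Lx_Symf_r, perm_swap.
      * destruct (Nat.leb_spec m a); [destruct (Nat.leb_spec m' (a - m)); [lia|]|];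
          rewrite rsum_0; try ring; intros x u _; destruct (Nat.leb m x); reflexivity.
Qed.

(* [X f nu] is the coefficient of [x^nu] in the symmetric function [f]. *)
Definition X (f : list nat -> R) (nu : list nat) : R :=
  pr (list_sum nu) (fun l => f l * Lx l nu).

Lemma X_perm f nu nu' : Permutation nu nu' -> X f nu = X f nu'.
Proof.
  intros Hp; unfold X; rewrite (Permutation_list_sum Hp); apply pr_ext; intros l _.
  rewrite (Lx_Symf_r l nu nu'); auto.
Qed.

Lemma X_zero f nu : X f (0%nat :: nu) = X f nu.
Proof.
  apply pr_ext; intros l Hl; apply partitions_spec in Hl; rewrite Lx_zero; tauto.
Qed.

Lemma X_scal c f nu : X (fun l => c * f l) nu = c * X f nu.
Proof. unfold X; rewrite <- pr_scal; apply pr_ext; intros; ring. Qed.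

Lemma X_plus f g nu : X (fun l => f l + g l) nu = X f nu + X g nu.
Proof. unfold X; rewrite <- pr_plus; apply pr_ext; intros; ring. Qed.

Lemma X_minus f g nu : X (fun l => f l - g l) nu = X f nu - X g nu.
Proof. unfold X; rewrite <- pr_minus; apply pr_ext; intros; ring. Qed.

Lemma X_sum_over {A} (m : list A) F nu :
  X (fun l => sum_over m (fun y => F y l)) nu = sum_over m (fun y => X (F y) nu).
Proof.
  unfold X; rewrite <- pr_sum_over; apply pr_ext; intros; rewrite <- sum_over_scal_r; reflexivity.
Qed.

Lemma X_ext f g nu : (forall l, In l (partitions (list_sum nu)) -> f l = g l) -> X f nu = X g nu.
Proof. intros H; apply pr_ext; intros l Hl; rewrite H; auto. Qed.

Lemma pr_rsum_out n F m :
  pr n (fun l => rsum (fun x t => F x t l) m) = rsum (fun x t => pr n (F x t)) m.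
Proof.
  revert F; induction m as [|a m IH]; intros F; cbn [rsum].
  - apply pr_0; reflexivity.
  - rewrite pr_plus, IH; reflexivity.
Qed.

(** The coefficient of [x^nu] in [p_a G_a] is a sum over the variable that receives the factor of
    degree [a]; its exponent must be at least [a]. *)
Lemma X_rsum G nu : SymW G ->
  X (rsum G) nu =
  rsum (fun x t => sum_over (seq 1 x) (fun a => X (G a) ((x - a)%nat :: t))) nu.
Proof.
  intros HG; unfold X at 1; rewrite (pr_adj _ G (fun l => Lx l nu)); auto using Lx_Symf_l.
  rewrite (sum_over_ext _ _ (fun a => rsum (fun x t =>
    if Nat.leb a x then X (G a) ((x - a)%nat :: t) else 0) nu)).
  - rewrite <- rsum_sum_over; apply rsum_ext; intros x t Hp.
    assert (x <= list_sum nu)%nat as Hx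
      by (rewrite (Permutation_list_sum Hp); simpl; lia).
    replace (list_sum nu) with (x + (list_sum nu - x))%nat by lia.
    rewrite seq_app, sum_over_app, (sum_over_0 (seq (1 + x) _)), Rplus_0_r.
    + apply sum_over_ext; intros a Ha; apply in_seq in Ha.
      destruct (Nat.leb_spec a x); [reflexivity|lia].
    + intros a Ha; apply in_seq in Ha; destruct (Nat.leb_spec a x); [lia|reflexivity].
  - intros a _; cbn [Lx].
    rewrite (pr_ext _ _ (fun l => rsum (fun x t =>
      if Nat.leb a x then G a l * Lx l ((x - a)%nat :: t) else 0) nu)).
    + rewrite pr_rsum_out; apply rsum_ext; intros x t Hp.
      destruct (Nat.leb_spec a x); [|apply pr_0; reflexivity].
      unfold X; f_equal; rewrite (Permutation_list_sum Hp); simpl; lia.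
    + intros l _; rewrite <- rsum_scal; apply rsum_ext; intros x t _.
      destruct (Nat.leb a x); ring.
Qed.

(** The chain rule [x_1 d/dx_1 = sum_m m x_1^m d/dp_m], read at the exponent [a] of [x_1]. *)
Lemma X_cons f a b : Symf f ->
  sum_over (seq 1 a) (fun m => INR m * X (fun l => f (m :: l)) ((a - m)%nat :: b)) =
  INR a * X f (a :: b).
Proof.
  intros Hf; unfold X at 2; rewrite <- pr_scal.
  rewrite (pr_ext _ _ (fun l => rsum (fun m t => if Nat.leb m a then
     INR m * Lx t ((a - m)%nat :: b) else 0) l * f l))
    by (intros; rewrite Lx_euler; ring).
  rewrite (pr_adj _ (fun m t => if Nat.leb m a then INR m * Lx t ((a - m)%nat :: b) else 0)); auto.
  2:{ intros m u v Huv; destruct (Nat.leb m a); auto; f_equal; apply Lx_Symf_l, Huv. }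
  replace (list_sum (a :: b)) with (a + list_sum b)%nat by reflexivity.
  rewrite seq_app, sum_over_app, (sum_over_0 (seq (1 + a) _)), Rplus_0_r.
  - apply sum_over_ext; intros m Hm; apply in_seq in Hm; unfold X; rewrite <- pr_scal.
    replace (list_sum ((a - m)%nat :: b)) with (a + list_sum b - m)%nat by (simpl; lia).
    apply pr_ext; intros l _; destruct (Nat.leb_spec m a); [ring|lia].
  - intros m Hm; apply in_seq in Hm; apply pr_0; intros l _.
    destruct (Nat.leb_spec m a); [lia|ring].
Qed.

(* Coefficient of [x_1^a x^b] in [sum_k x_1^k G_k]. *)
Definition XW (G : nat -> list nat -> R) (a : nat) (b : list nat) : R :=
  sum_over (seq 1 a) (fun k => X (G k) ((a - k)%nat :: b)).

Lemma XW_perm G a b b' : Permutation b b' -> XW G a b = XW G a b'.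
Proof. intros Hp; apply sum_over_ext; intros k _; apply X_perm; constructor; exact Hp. Qed.

Lemma XW_iota g a b : Symf g -> XW (iota g) a b = INR a * X g (a :: b).
Proof.
  intros Hg; rewrite <- X_cons by auto; apply sum_over_ext; intros k _.
  unfold iota; apply (X_scal (INR k) (fun l => g (k :: l))).
Qed.

Lemma X_tau G nu : SymW G -> X (rsum G) nu = rsum (XW G) nu.
Proof. intros HG; rewrite X_rsum; auto. Qed.

Lemma sum_triangle0 x f :
  sum_over (seq 0 (S x)) (fun c => sum_over (seq 1 c) (fun s => f (c - s)%nat s)) =
  sum_over (seq 0 (S x)) (fun c => sum_over (seq 1 (x - c)) (fun s => f c s)).
Proof.
  pose proof (sum_triangle (S x) (fun k a => f (k - 1)%nat a)) as E.
  change (seq 1 (S x)) with (seq (0 + 1) (S x)) in E.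
  rewrite !sum_over_seq_shift in E.
  rewrite (sum_over_ext (seq 0 (S x)) (fun c => sum_over (seq 1 (x - c)) _)
    (fun i => sum_over (seq 1 (S x - (i + 1))) (fun a => f (i + 1 - 1)%nat a))).
  - rewrite E; apply sum_over_ext; intros c Hc.
    replace (c + 1 - 1)%nat with c by lia; apply sum_over_ext; intros s Hs; f_equal; lia.
  - intros c Hc; replace (S x - (c + 1))%nat with (x - c)%nat by lia.
    apply sum_over_ext; intros; f_equal; lia.
Qed.

(** Coefficients of [x_1 (G(x_1) - G(x_i)) / (x_1 - x_i)]. On the left the quotient is written as a
    polynomial; on the right [x_1 / (x_1 - x_i)] is expanded as the geometric series in [x_i / x_1],
    with [c] its index. *)
Lemma exchange_quotient (g : nat -> nat -> nat -> R) a x :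
  (forall s y z, g s y z = g s z y) ->
  sum_over (seq 1 a) (fun k => sum_over (seq 0 (S x)) (fun c => g (k + c)%nat (x - c)%nat (a - k)%nat)) =
  sum_over (seq 0 (S x)) (fun c =>
    sum_over (seq 1 (a + c)) (fun s => g s (a + c - s)%nat (x - c)%nat) -
    sum_over (seq 1 (x - c)) (fun s => g s (x - c - s)%nat (a + c)%nat)).
Proof.
  intros Hg; rewrite sum_over_minus.
  rewrite (sum_over_ext (seq 0 (S x)) (fun c => sum_over (seq 1 (x - c)) _)
    (fun c => sum_over (seq 1 (x - c)) (fun s => g s (a + c)%nat (x - c - s)%nat)))
    by (intros; apply sum_over_ext; auto).
  rewrite <- (sum_triangle0 x (fun c s => g s (a + c)%nat (x - c - s)%nat)).
  rewrite sum_over_swap, <- sum_over_minus; apply sum_over_ext; intros c Hc; apply in_seq in Hc.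
  replace (a + c)%nat with (c + a)%nat by lia.
  rewrite seq_app, sum_over_app.
  rewrite (sum_over_ext (seq 1 c) (fun s => g s (a + (c - s))%nat _)
    (fun s => g s (c + a - s)%nat (x - c)%nat)).
  - replace (1 + c)%nat with (1 + c)%nat by lia; rewrite sum_over_seq_shift.
    rewrite (sum_over_ext (seq 1 a) (fun i => g (i + c)%nat (c + a - (i + c))%nat (x - c)%nat)
      (fun k => g (k + c)%nat (x - c)%nat (a - k)%nat)); [ring|].
    intros k Hk; rewrite Hg; f_equal; lia.
  - intros s Hs; apply in_seq in Hs; f_equal; lia.
Qed.

(** With [w = x_1], [Lop] is the Dunkl-type operator [x_1 d/dx_1 - theta n + theta sum_(i >= 2) x_1
    / (x_1 - x_i) (1 - s_(1i))] in [n = S (length b)] variables, where [s_(1i)] exchanges [x_1] and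
    [x_i]. *)
Lemma XW_Lop theta G a b : SymW G ->
  XW (Lop theta G) a b =
  (INR a - theta * INR (S (length b))) * XW G a b +
  theta * rsum (fun x t => sum_over (seq 0 (S x)) (fun c =>
     XW G (a + c) ((x - c)%nat :: t) - XW G (x - c) ((a + c)%nat :: t))) b.
Proof.
  intros HG.
  assert (Ek : forall k, (1 <= k <= a)%nat -> X (Lop theta G k) ((a - k)%nat :: b) =
    (1 - theta) * INR k * X (G k) ((a - k)%nat :: b)
    + sum_over (seq 1 (k - 1)) (fun m => INR m * X (fun l => G (k - m)%nat (m :: l)) ((a - k)%nat :: b))
    + theta * sum_over (seq 1 (a - k)) (fun c => X (G (k + c)%nat) ((a - k - c)%nat :: b))
    + theta * rsum (fun x t => sum_over (seq 1 x) (fun c => X (G (k + c)%nat) ((x - c)%nat :: (a - k)%nat :: t))) b).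
  { intros k Hk; unfold Lop.
    rewrite (X_plus (fun l => (1 - theta) * Kop G k l + Ap G k l) (fun l => theta * Am G k l)).
    rewrite (X_plus (fun l => (1 - theta) * Kop G k l) (Ap G k)).
    rewrite !X_scal; unfold Am; rewrite (X_rsum (fun x => G (k + x)%nat)) by (intros u; apply HG).
    cbn [rsum]; unfold Kop; rewrite X_scal.
    unfold Ap; rewrite (X_sum_over _ (fun m l => INR m * G (k - m)%nat (m :: l))).
    rewrite (sum_over_ext _ (fun y => X _ _) (fun m => INR m * X (fun l => G (k - m)%nat (m :: l)) ((a - k)%nat :: b)))
      by (intros m _; apply (X_scal (INR m) (fun l => G (k - m)%nat (m :: l)))).
    ring. }
  (* By [X_cons], [Ap] differentiates the coefficients of the powers of [w] in [x_1]; together with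
     [Kop] it makes up [x_1 d/dx_1]. *)
  assert (EB : sum_over (seq 1 a) (fun k => sum_over (seq 1 (k - 1)) (fun m =>
      INR m * X (fun l => G (k - m)%nat (m :: l)) ((a - k)%nat :: b))) =
    sum_over (seq 1 a) (fun s => INR (a - s) * X (G s) ((a - s)%nat :: b))).
  { transitivity (sum_over (seq 1 a) (fun s => sum_over (seq 1 (a - s)) (fun m =>
      INR m * X (fun l => G s (m :: l)) ((a - (s + m))%nat :: b)))).
    - rewrite (sum_triangle a (fun s m => INR m * X (fun l => G s (m :: l)) ((a - (s + m))%nat :: b))).
      apply sum_over_ext; intros k Hk; apply sum_over_ext; intros m Hm; apply in_seq in Hk, Hm.
      replace (k - m + m)%nat with k by lia; reflexivity.
    - apply sum_over_ext; intros s Hs; rewrite <- X_cons by apply HG.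
      apply sum_over_ext; intros m Hm; rewrite Nat.sub_add_distr; reflexivity. }
  (* The terms of [Am] in which [p_c] contributes [x_1^c] itself: the index [s] is reached from
     [s - 1] pairs. *)
  assert (EC : sum_over (seq 1 a) (fun k => sum_over (seq 1 (a - k)) (fun c =>
      X (G (k + c)%nat) ((a - k - c)%nat :: b))) =
    sum_over (seq 1 a) (fun s => INR (s - 1) * X (G s) ((a - s)%nat :: b))).
  { rewrite (sum_triangle a (fun k c => X (G (k + c)%nat) ((a - k - c)%nat :: b))).
    apply sum_over_ext; intros s Hs; apply in_seq in Hs.
    rewrite (sum_over_ext _ _ (fun _ => 1 * X (G s) ((a - s)%nat :: b))).
    - rewrite sum_over_scal_r; f_equal.
      generalize 1%nat at 1; induction (s - 1)%nat as [|n IH]; intros j; [reflexivity|].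
      cbn [seq]; rewrite sum_over_cons, IH, S_INR; ring.
    - intros m Hm; apply in_seq in Hm.
      replace (s - m + m)%nat with s by lia.
      replace (a - (s - m) - m)%nat with (a - s)%nat by lia; ring. }
  (* The terms in which [p_c] contributes a power of another variable. [Am] starts at [c = 1];
     supplying [c = 0] costs [XW G a b] for each of the [length b] variables. *)
  assert (ED : sum_over (seq 1 a) (fun k => rsum (fun x t => sum_over (seq 1 x) (fun c =>
       X (G (k + c)%nat) ((x - c)%nat :: (a - k)%nat :: t))) b) =
     rsum (fun x t => sum_over (seq 0 (S x)) (fun c =>
       XW G (a + c) ((x - c)%nat :: t) - XW G (x - c) ((a + c)%nat :: t))) b - INR (length b) * XW G a b).
  { rewrite <- rsum_sum_over.
    assert (INR (length b) * XW G a b = rsum (fun x t => XW G a b) b) as ->.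
    { rewrite (rsum_ext _ (fun x t => 1 * XW G a b)) by (intros; ring).
      rewrite rsum_scal_r, (rsum_fst (fun _ => 1)); f_equal.
      clear; induction b as [|x b IH]; [reflexivity|].
      cbn [length]; rewrite sum_over_cons, S_INR, IH; ring. }
    rewrite <- rsum_minus; apply rsum_ext; intros x t Hp.
    rewrite (XW_perm G a b _ Hp); unfold XW.
    rewrite <- (exchange_quotient (fun s y z => X (G s) (y :: z :: t)) a x)
      by (intros; apply X_perm, perm_swap).
    rewrite <- sum_over_minus; apply sum_over_ext; intros k _.
    change (seq 0 (S x)) with (0%nat :: seq 1 x); rewrite sum_over_cons.
    rewrite Nat.add_0_r, Nat.sub_0_r, (X_perm (G k) ((a - k)%nat :: x :: t) (x :: (a - k)%nat :: t))
      by apply perm_swap.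
    ring. }
  unfold XW at 1.
  rewrite (sum_over_ext _ _ (fun k =>
    (1 - theta) * INR k * X (G k) ((a - k)%nat :: b)
    + sum_over (seq 1 (k - 1)) (fun m => INR m * X (fun l => G (k - m)%nat (m :: l)) ((a - k)%nat :: b))
    + theta * sum_over (seq 1 (a - k)) (fun c => X (G (k + c)%nat) ((a - k - c)%nat :: b))
    + theta * rsum (fun x t => sum_over (seq 1 x) (fun c => X (G (k + c)%nat) ((x - c)%nat :: (a - k)%nat :: t))) b))
    by (intros k Hk; apply in_seq in Hk; apply Ek; lia).
  rewrite !sum_over_plus, !sum_over_scal, EB, EC, ED.
  transitivity (sum_over (seq 1 a) (fun k => (INR a - theta) * X (G k) ((a - k)%nat :: b)) +
    theta * (rsum (fun x t => sum_over (seq 0 (S x)) (fun c =>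
       XW G (a + c) ((x - c)%nat :: t) - XW G (x - c) ((a + c)%nat :: t))) b - INR (length b) * XW G a b)).
  - f_equal; rewrite <- sum_over_scal, <- !sum_over_plus; apply sum_over_ext; intros k Hk.
    apply in_seq in Hk; rewrite !minus_INR by lia; cbn [INR]; ring.
  - rewrite sum_over_scal; fold (XW G a b); rewrite S_INR; ring.
Qed.

(** For [a < x] the terms with [c <= x - a] cancel in pairs under [c -> x - a - c]. There remain the
    exchange of the two exponents, present only for [x < a], and strictly more spread pairs: this is
    the triangularity. *)
Lemma exchange_normal (F : nat -> nat -> R) a x :
  sum_over (seq 0 (S x)) (fun c => F (a + c)%nat (x - c)%nat - F (x - c)%nat (a + c)%nat) =
  (if Nat.ltb x a then F a x - F x a else 0) +
  sum_over (seq 1 (Nat.min a x)) (fun c =>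
    F (Nat.max a x + c)%nat (Nat.min a x - c)%nat - F (Nat.min a x - c)%nat (Nat.max a x + c)%nat).
Proof.
  destruct (Nat.le_gt_cases x a) as [H|H].
  - rewrite Nat.max_l, Nat.min_r by lia.
    change (seq 0 (S x)) with (0%nat :: seq 1 x); rewrite sum_over_cons.
    rewrite Nat.add_0_r, Nat.sub_0_r; f_equal.
    destruct (Nat.ltb_spec x a); [reflexivity|].
    replace x with a by lia; ring.
  - rewrite Nat.max_r, Nat.min_l by lia.
    destruct (Nat.ltb_spec x a); [lia|].
    replace (S x) with (S (x - a) + a)%nat by lia.
    rewrite seq_app, sum_over_app; f_equal.
    + rewrite sum_over_minus.
      rewrite (sum_over_seq_rev (x - a) (fun c => F (x - c)%nat (a + c)%nat)).
      apply Rminus_diag_eq, sum_over_ext; intros c Hc; apply in_seq in Hc; f_equal; lia.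
    + replace (0 + S (x - a))%nat with (1 + (x - a))%nat by lia.
      rewrite sum_over_seq_shift; apply sum_over_ext; intros c Hc; apply in_seq in Hc.
      replace (a + (c + (x - a)))%nat with (x + c)%nat by lia.
      replace (x - (c + (x - a)))%nat with (a - c)%nat by lia; reflexivity.
Qed.

(** * Majorization *)

(* [ple l m] is dominance of [l] by [m] in terms of the dual partial sums; unlike
   partial sums these do not require sorted lists. *)
Definition Pt (t : nat) (l : list nat) : nat := list_sum (map (fun x => x - t)%nat l).
Definition ple (l m : list nat) : Prop := forall t, (Pt t l <= Pt t m)%nat.

Lemma Pt_perm t l m : Permutation l m -> Pt t l = Pt t m.
Proof. intros H; apply Permutation_list_sum, Permutation_map, H. Qed.

Lemma Pt_cons t x l : Pt t (x :: l) = ((x - t) + Pt t l)%nat.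
Proof. reflexivity. Qed.

Lemma ple_perm l l' m m' : Permutation l l' -> Permutation m m' -> ple l m -> ple l' m'.
Proof.
  intros H1 H2 H t; rewrite <- (Pt_perm t l l'), <- (Pt_perm t m m'); auto.
Qed.

Lemma ple_refl_perm l m : Permutation l m -> ple l m.
Proof. intros H t; rewrite (Pt_perm t l m); auto. Qed.

Lemma ple_trans l m n : ple l m -> ple m n -> ple l n.
Proof. intros H1 H2 t; specialize (H1 t); specialize (H2 t); lia. Qed.

Lemma spread_ple a x t c : (c <= Nat.min a x)%nat ->
  ple (a :: x :: t) ((Nat.max a x + c)%nat :: (Nat.min a x - c)%nat :: t).
Proof. intros Hc s; rewrite !Pt_cons; lia. Qed.

Lemma spread_strict a x t c : (1 <= c <= Nat.min a x)%nat ->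
  ~ ple ((Nat.max a x + c)%nat :: (Nat.min a x - c)%nat :: t) (a :: x :: t).
Proof. intros Hc H; specialize (H (Nat.min a x)); rewrite !Pt_cons in H; lia. Qed.

(** * Triangularity and leading coefficients *)

Definition supp (mu : list nat) (G : nat -> list nat -> R) : Prop :=
  forall a b, XW G a b <> 0 -> ple (a :: b) mu.

Lemma supp_eq0 mu G a b : supp mu G -> ~ ple (a :: b) mu -> XW G a b = 0.
Proof. intros HS Hn; destruct (Req_dec (XW G a b) 0); auto; exfalso; auto. Qed.

Lemma spread_term mu G a x t c : supp mu G -> (c <= Nat.min a x)%nat ->
  ~ ple ((Nat.max a x + c)%nat :: (Nat.min a x - c)%nat :: t) mu ->
  XW G (Nat.max a x + c) ((Nat.min a x - c)%nat :: t) -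
  XW G (Nat.min a x - c) ((Nat.max a x + c)%nat :: t) = 0.
Proof.
  intros HS Hc Hn; rewrite !(supp_eq0 mu G); auto; [ring|].
  intros H; apply Hn; eapply ple_perm; [apply perm_swap|reflexivity|exact H].
Qed.

(** If [a :: b] is not below [mu], no exponent on the right of [XW_Lop] is either, because all of
    them are equally or more spread. *)
Lemma supp_Lop theta mu G : SymW G -> supp mu G -> supp mu (Lop theta G).
Proof.
  intros HG HS a b Hne.
  destruct (Classical_Prop.classic (ple (a :: b) mu)) as [H|Hn]; auto.
  exfalso; apply Hne; rewrite XW_Lop by auto.
  rewrite (supp_eq0 mu G a b), rsum_0; auto; [ring|].
  intros x t Hp.
  rewrite (exchange_normal (fun y z => XW G y (z :: t))).
  assert (Hn' : ~ ple (a :: x :: t) mu).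
  { intros H; apply Hn; eapply ple_perm; [|reflexivity|exact H].
    constructor; symmetry; exact Hp. }
  rewrite sum_over_0.
  - rewrite Rplus_0_r, !(supp_eq0 mu G); auto; [destruct (Nat.ltb x a); ring|].
    intros H; apply Hn'; eapply ple_perm; [apply perm_swap|reflexivity|exact H].
  - intros c Hc; apply in_seq in Hc; apply (spread_term mu); auto; [lia|].
    intros H; apply Hn'; eapply ple_trans; [apply spread_ple|exact H]; lia.
Qed.

(* [G] is constant on the [S_N]-orbit of [x^mu], apart from its dependence on
   the exponent of [x_1]. *)
Definition rep (mu : list nat) (G : nat -> list nat -> R) (t : nat -> R) : Prop :=
  forall a b, Permutation (a :: b) mu -> XW G a b = t a.

(** Action of [Lop] on leading coefficients: on the orbit of [mu] the spread terms of
    [exchange_normal] vanish, and only exchanges with a smaller exponent remain. *)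
Definition Bop (theta : R) (mu : list nat) (t : nat -> R) (b : nat) : R :=
  (INR b - theta * INR (length mu)) * t b +
  theta * sum_over mu (fun x => if Nat.ltb x b then t b - t x else 0).

Lemma rep_Lop theta mu G t : SymW G -> supp mu G -> rep mu G t ->
  rep mu (Lop theta G) (Bop theta mu t).
Proof.
  intros HG HS HR a b Hp; rewrite XW_Lop by auto; unfold Bop.
  rewrite <- (Permutation_length Hp), <- (sum_over_perm _ _ _ Hp), sum_over_cons.
  rewrite (HR a b Hp), Nat.ltb_irrefl, Rplus_0_l; cbn [length].
  f_equal; f_equal; rewrite <- rsum_fst; apply rsum_ext; intros x u Hq.
  rewrite (exchange_normal (fun y z => XW G y (z :: u))).
  assert (Hp' : Permutation (a :: x :: u) mu)
    by (rewrite <- Hp; constructor; symmetry; exact Hq).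
  rewrite sum_over_0.
  - rewrite (HR a (x :: u)), (HR x (a :: u)); auto; [ring|].
    rewrite perm_swap; exact Hp'.
  - intros c Hc; apply in_seq in Hc; apply (spread_term mu); auto; [lia|].
    intros H; apply (spread_strict a x u c); [lia|].
    eapply ple_trans; [exact H|apply ple_refl_perm; symmetry; exact Hp'].
Qed.

Lemma XW_sub F G d a b : XW (fun k l => F k l - d * G k l) a b = XW F a b - d * XW G a b.
Proof.
  unfold XW; rewrite <- sum_over_scal, <- sum_over_minus; apply sum_over_ext; intros k _.
  rewrite (X_minus (F k) (fun l => d * G k l)), X_scal; reflexivity.
Qed.

Fixpoint Bprod theta mu (ds : list R) (t : nat -> R) : nat -> R :=
  match ds with
  | [] => t
  | d :: ds => fun b => Bop theta mu (Bprod theta mu ds t) b - d * Bprod theta mu ds t b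
  end.

Lemma supp_sub mu F G d : supp mu F -> supp mu G -> supp mu (fun k l => F k l - d * G k l).
Proof.
  intros HF HG a b; rewrite XW_sub; intros Hne.
  destruct (Req_dec (XW F a b) 0) as [E1|]; auto.
  destruct (Req_dec (XW G a b) 0) as [E2|]; auto.
  exfalso; apply Hne; rewrite E1, E2; ring.
Qed.

Lemma supp_rep_Lprod theta mu ds G t : SymW G -> supp mu G -> rep mu G t ->
  supp mu (Lprod theta ds G) /\ rep mu (Lprod theta ds G) (Bprod theta mu ds t).
Proof.
  intros HG HS HR; induction ds as [|d ds [IH1 IH2]]; cbn [Lprod Bprod]; auto.
  pose proof (SymW_Lprod theta ds G HG).
  split; [apply supp_sub; auto using supp_Lop|].
  intros a b Hp; rewrite XW_sub, (rep_Lop theta mu _ _ H IH1 IH2 a b Hp), (IH2 a b Hp); reflexivity.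
Qed.

(** * Linear dependence and orthogonal expansions *)

(** Gaussian elimination on the coordinate [x]: a vector [i0] with [v i0 x <> 0] is a pivot that
    clears this coordinate in the others, and its own coefficient is then forced; if there is no
    pivot, the coordinate is dropped. *)
Lemma lin_dep {A I : Type} (dec : forall i j : I, {i = j} + {i <> j}) (S : list A) :
  forall (L : list I) (v : I -> A -> R), NoDup L -> (length S < length L)%nat ->
  exists c : I -> R, (exists i, In i L /\ c i <> 0) /\
    forall x, In x S -> sum_over L (fun i => c i * v i x) = 0.
Proof.
  induction S as [|x S IH]; intros L v HL Hlen.
  - destruct L as [|i L]; [simpl in Hlen; lia|].
    exists (fun _ => 1); split; [exists i; split; [left; auto|lra]|intros x []].
  - destruct (Classical_Prop.classic (exists i, In i L /\ v i x <> 0)) as [(i0 & Hi0 & Hv)|Hn].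
    + destruct (in_split _ _ Hi0) as (L1 & L2 & ->).
      assert (Hp : Permutation (L1 ++ i0 :: L2) (i0 :: L1 ++ L2))
        by (symmetry; apply Permutation_middle).
      pose proof (Permutation_NoDup Hp HL) as HN; inversion HN; subst.
      destruct (IH (L1 ++ L2) (fun i y => v i y - v i x / v i0 x * v i0 y)) as (c & (i & Hi & Hc) & Hs);
        [assumption|rewrite (Permutation_length Hp) in Hlen; simpl in Hlen; lia|].
      exists (fun i => if dec i i0 then - sum_over (L1 ++ L2) (fun j => c j * (v j x / v i0 x)) else c i).
      split.
      * exists i; split; [eapply Permutation_in; [symmetry; exact Hp|right; auto]|].
        destruct (dec i i0); [subst; contradiction|auto].
      * intros y Hy; rewrite (sum_over_perm _ _ _ Hp), sum_over_cons.
        destruct (dec i0 i0) as [_|]; [|congruence].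
        rewrite (sum_over_ext (L1 ++ L2) (fun i => (if dec i i0 then _ else c i) * v i y) (fun i => c i * v i y)).
        2:{ intros j Hj; cbv beta; destruct (dec j i0); [subst; contradiction|reflexivity]. }
        destruct Hy as [<-|Hy].
        -- rewrite (sum_over_ext (L1 ++ L2) (fun j => c j * (v j x / v i0 x))
             (fun j => c j * v j x * / v i0 x)) by (intros; unfold Rdiv; ring).
           rewrite sum_over_scal_r; field; auto.
        -- specialize (Hs y Hy).
           rewrite (sum_over_ext _ _ (fun j => c j * v j y - c j * (v j x / v i0 x) * v i0 y)) in Hs
             by (intros; ring).
           rewrite sum_over_minus, sum_over_scal_r in Hs; lra.
    + destruct (IH L v HL) as (c & Hc & Hs); [simpl in Hlen; lia|].
      exists c; split; auto; intros y [<-|Hy]; auto.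
      apply sum_over_0; intros i Hi.
      destruct (Req_dec (v i x) 0) as [->|]; [ring|exfalso; eauto].
Qed.

Lemma list_nat_eq_dec (l m : list nat) : {l = m} + {l <> m}.
Proof. apply list_eq_dec, Nat.eq_dec. Qed.

Lemma pin_lin theta n a b f g h :
  pin theta n (fun l => a * f l + b * g l) h = a * pin theta n f h + b * pin theta n g h.
Proof.
  unfold pin; rewrite <- !pr_scal, <- pr_plus; apply pr_ext; intros; ring.
Qed.

Lemma pin_sum_over {A} theta n (m : list A) (F : A -> list nat -> R) h :
  pin theta n (fun l => sum_over m (fun y => F y l)) h = sum_over m (fun y => pin theta n (F y) h).
Proof.
  unfold pin; rewrite <- pr_sum_over; apply pr_ext; intros.
  rewrite Rmult_assoc, <- sum_over_scal_r; apply sum_over_ext; intros; ring.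
Qed.

Lemma pin_scal theta n c f h : pin theta n (fun l => c * f l) h = c * pin theta n f h.
Proof. unfold pin; rewrite <- pr_scal; apply pr_ext; intros; ring. Qed.

Lemma pin_ext theta n f f' g g' :
  (forall l, In l (partitions n) -> f l = f' l) ->
  (forall l, In l (partitions n) -> g l = g' l) -> pin theta n f g = pin theta n f' g'.
Proof. intros H H'; apply pr_ext; intros l Hl; rewrite H, H'; auto. Qed.

(** A dimension count. The residual [w] of [v] is orthogonal to every [f k], and [w] with the [f k]
    is one vector more than there are coordinates. Pairing a linear dependence with [f k] kills the
    coefficient of [f k]; the coefficient of [w] is then nonzero, so [w] vanishes. *)
Lemma orthogonal_span theta n (f : list nat -> list nat -> R) :
  (forall k k', In k (partitions n) -> In k' (partitions n) -> k <> k' ->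
     pin theta n (f k) (f k') = 0) ->
  (forall k, In k (partitions n) -> pin theta n (f k) (f k) <> 0) ->
  forall v mu, In mu (partitions n) ->
  v mu = sum_over (partitions n) (fun k => pin theta n v (f k) / pin theta n (f k) (f k) * f k mu).
Proof.
  intros Ho Hn v.
  set (c0 := fun k => pin theta n v (f k) / pin theta n (f k) (f k)).
  set (w := fun l => 1 * v l + (-1) * sum_over (partitions n) (fun k => c0 k * f k l)).
  set (vv := fun o : option (list nat) => match o with None => w | Some k => f k end).
  assert (dec : forall o o' : option (list nat), {o = o'} + {o <> o'})
    by (decide equality; apply list_nat_eq_dec).
  assert (Hw : forall k, In k (partitions n) -> pin theta n w (f k) = 0).
  { intros k Hk; unfold w; rewrite (pin_lin theta n 1 (-1) v (fun l => sum_over _ _)).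
    rewrite (pin_sum_over theta n _ (fun k l => c0 k * f k l)).
    rewrite (sum_over_single list_nat_eq_dec _ _ k); auto using NoDup_partitions.
    - rewrite pin_scal; unfold c0; field; auto.
    - intros k' Hk' Hne; rewrite pin_scal, Ho; auto; ring. }
  destruct (lin_dep dec (partitions n) (None :: map Some (partitions n)) vv)
    as (c & (i & Hi & Hc) & Hs).
  - constructor.
    + rewrite in_map_iff; intros (x & Hx & _); discriminate.
    + apply FinFun.Injective_map_NoDup; [intros x y; congruence|apply NoDup_partitions].
  - simpl; rewrite length_map; lia.
  - assert (Hz : forall k, In k (partitions n) ->
      pin theta n (fun mu => sum_over (None :: map Some (partitions n)) (fun i => c i * vv i mu)) (f k) = 0).
    { intros k Hk; rewrite (pin_ext _ _ _ (fun _ => 0 * 0) _ (f k)); auto.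
      - rewrite (pin_scal theta n 0 (fun _ => 0)); ring.
      - intros l Hl; rewrite Hs; auto; ring. }
    assert (HS : forall k, In k (partitions n) -> c (Some k) = 0).
    { intros k Hk; specialize (Hz k Hk).
      rewrite (pin_sum_over theta n _ (fun i l => c i * vv i l)), sum_over_cons, sum_over_map in Hz.
      rewrite pin_scal in Hz; cbn [vv] in Hz; rewrite Hw in Hz by auto.
      rewrite (sum_over_single list_nat_eq_dec _ _ k) in Hz; auto using NoDup_partitions.
      - rewrite pin_scal in Hz; cbn [vv] in Hz.
        apply Rmult_eq_reg_r with (pin theta n (f k) (f k)); [lra|auto].
      - intros k' Hk' Hne; rewrite pin_scal; cbn [vv]; rewrite Ho; auto; ring. }
    assert (HN : c None <> 0).
    { destruct Hi as [<-|Hi]; auto.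
      apply in_map_iff in Hi; destruct Hi as (k & <- & Hk); exfalso; auto. }
    intros mu Hmu; specialize (Hs mu Hmu); rewrite sum_over_cons, sum_over_map in Hs.
    rewrite (sum_over_0 (partitions n)) in Hs by (intros k Hk; rewrite HS; auto; ring).
    cbn [vv] in Hs; unfold w in Hs.
    change (v mu = sum_over (partitions n) (fun k => c0 k * f k mu)).
    apply Rmult_eq_reg_l with (c None); auto; lra.
Qed.

(** * Combinatorics of the order *)

Lemma Pt_step t l : Pt t l = (Pt (S t) l + length (filter (Nat.ltb t) l))%nat.
Proof.
  induction l as [|x l IH]; [reflexivity|].
  rewrite !Pt_cons, IH; cbn [filter].
  destruct (Nat.ltb_spec t x); cbn [length]; lia.
Qed.

Lemma count_gt t l :
  length (filter (Nat.ltb t) l) = (length (filter (Nat.ltb (S t)) l) + count_occ Nat.eq_dec l (S t))%nat.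
Proof.
  induction l as [|x l IH]; [reflexivity|].
  cbn [filter count_occ].
  destruct (Nat.ltb_spec t x), (Nat.ltb_spec (S t) x), (Nat.eq_dec x (S t)); cbn [length]; lia.
Qed.

(** Multiplicities are second differences of [Pt t l] in [t]. *)
Lemma Pt_inj l m : desc l -> desc m -> posl l -> posl m ->
  (forall t, Pt t l = Pt t m) -> l = m.
Proof.
  intros Hl Hm Pl Pm H; apply desc_perm_eq; auto.
  apply (Permutation_count_occ Nat.eq_dec); intros [|t].
  - assert (E : forall u, posl u -> count_occ Nat.eq_dec u 0%nat = 0%nat).
    { intros u Hu; apply count_occ_not_In; intros Hi.
      unfold posl in Hu; rewrite Forall_forall in Hu; apply Hu in Hi; lia. }
    rewrite !E; auto.
  - pose proof (Pt_step t l); pose proof (Pt_step t m).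
    pose proof (Pt_step (S t) l); pose proof (Pt_step (S t) m).
    pose proof (count_gt t l); pose proof (count_gt t m).
    pose proof (H t); pose proof (H (S t)); pose proof (H (S (S t))); lia.
Qed.

Lemma ple_antisym n k k' : In k (partitions n) -> In k' (partitions n) ->
  ple k k' -> ple k' k -> k = k'.
Proof.
  intros H H' L L'; apply partitions_spec in H, H'.
  apply Pt_inj; try tauto; intros t; specialize (L t); specialize (L' t); lia.
Qed.

Lemma Pt_vanish t l : (list_sum l <= t)%nat -> Pt t l = 0%nat.
Proof.
  induction l as [|x l IH]; intros H; [reflexivity|].
  rewrite Pt_cons, IH; simpl in H; lia.
Qed.

(** A numerical statistic strictly increasing for [ple], on which inductions along the order run. By
    [sum_squares_rank] it is also half of the sum of [x^2 + x] over the parts, which is how it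
    enters the quadratic eigenvalue. *)
Definition rank (n : nat) (l : list nat) : nat := list_sum (map (fun t => Pt t l) (seq 0 n)).

Lemma rank_strict n k k' : In k (partitions n) -> In k' (partitions n) ->
  ple k k' -> k <> k' -> (rank n k < rank n k')%nat.
Proof.
  intros H H' L Hne; unfold rank.
  assert (E : exists t, In t (seq 0 n) /\ (Pt t k < Pt t k')%nat).
  { apply Classical_Prop.NNPP; intros Hn; apply Hne, (ple_antisym n); auto; intros t.
    destruct (Nat.lt_ge_cases (Pt t k) (Pt t k')) as [Hlt|]; [|auto].
    destruct (Nat.lt_ge_cases t n) as [Ht|Ht].
    - exfalso; apply Hn; exists t; split; auto; apply in_seq; lia.
    - apply partitions_spec in H'; rewrite Pt_vanish; lia. }
  clear Hne; destruct E as (t & Ht & Hlt); revert Ht; generalize (seq 0 n).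
  induction l as [|s l IH]; intros []; simpl.
  - subst; assert (list_sum (map (fun t => Pt t k) l) <= list_sum (map (fun t => Pt t k') l))%nat; [|lia].
    clear IH; induction l as [|s l IH]; simpl; [lia|]; specialize (L s); lia.
  - apply IH in H0; specialize (L s); lia.
Qed.

(** Legendre duality with partial sums: for a decreasing list, [Pt t l] is the maximum over [k] of
    [list_sum (firstn k l) - k * t]. This is the upper bound; [desc_Pt_firstn] finds where it is
    attained. *)
Lemma firstn_le_Pt t k l : (list_sum (firstn k l) <= Pt t l + k * t)%nat.
Proof.
  revert k; induction l as [|x l IH]; intros [|k]; simpl; try lia.
  rewrite Pt_cons; specialize (IH k); lia.
Qed.

Lemma desc_Pt_firstn t l : desc l -> exists k, (Pt t l + k * t)%nat = list_sum (firstn k l).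
Proof.
  induction l as [|x l IH]; [exists 0%nat; reflexivity|].
  intros [H1 H2]; destruct (Nat.le_gt_cases x t) as [Hx|Hx].
  - exists 0%nat; cbn [firstn]; rewrite Pt_cons.
    assert (Pt t l = 0)%nat; [|simpl; lia].
    clear -H1 Hx; induction l as [|y l IH]; [reflexivity|].
    rewrite Pt_cons, IH; [specialize (H1 y); simpl in H1; lia|].
    intros z Hz; apply H1; right; auto.
  - destruct (IH H2) as (k & Hk); exists (S k); cbn [firstn]; rewrite Pt_cons; simpl; lia.
Qed.

Lemma dominates_ple lam nu : desc nu -> dominates lam nu -> ple nu lam.
Proof.
  intros Hd H t; destruct (desc_Pt_firstn t nu Hd) as (k & Hk).
  specialize (H k); pose proof (firstn_le_Pt t k lam); lia.
Qed.

(** Exponent vectors may contain zeros and come in any order; [part] recovers the underlying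
    diagram. *)
Definition nz (l : list nat) : list nat := filter (fun x => negb (Nat.eqb x 0)) l.
Definition part (l : list nat) : list nat := isort (nz l).

Lemma posl_nz l : posl (nz l).
Proof.
  apply Forall_forall; intros x Hx; apply filter_In in Hx; destruct Hx as [_ Hx].
  destruct (Nat.eqb_spec x 0); [discriminate|lia].
Qed.

Lemma Permutation_nz l : exists k, Permutation l (repeat 0%nat k ++ nz l).
Proof.
  induction l as [|x l (k & IH)]; [exists 0%nat; reflexivity|].
  cbn [nz filter]; destruct (Nat.eqb_spec x 0) as [->|].
  - exists (S k); simpl; constructor; exact IH.
  - exists k; cbn [negb]; rewrite IH at 1; apply Permutation_middle.
Qed.

Lemma list_sum_part l : list_sum (part l) = list_sum l.
Proof.
  unfold part; rewrite (Permutation_list_sum (isort_perm _)).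
  destruct (Permutation_nz l) as (k & Hk); rewrite (Permutation_list_sum Hk).
  rewrite list_sum_app; replace (list_sum (repeat 0%nat k)) with 0%nat; [reflexivity|].
  clear Hk; induction k; simpl; auto.
Qed.

Lemma part_partitions l : In (part l) (partitions (list_sum l)).
Proof.
  rewrite <- list_sum_part; unfold part at 2; rewrite (Permutation_list_sum (isort_perm _)).
  apply isort_partitions, posl_nz.
Qed.

Lemma Pt_part t l : Pt t (part l) = Pt t l.
Proof.
  unfold part; rewrite (Pt_perm t _ _ (isort_perm (nz l))).
  destruct (Permutation_nz l) as (k & Hk); rewrite (Pt_perm t _ _ Hk); unfold Pt.
  rewrite map_app, list_sum_app.
  replace (list_sum (map (fun x => x - t)%nat (repeat 0%nat k))) with 0%nat; [reflexivity|].
  clear Hk; induction k; simpl; auto.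
Qed.

Lemma ple_part l m : ple l m <-> ple (part l) m.
Proof. split; intros H t; specialize (H t); rewrite Pt_part in *; auto. Qed.

Lemma X_part f nu : X f (part nu) = X f nu.
Proof.
  unfold part; rewrite (X_perm f _ _ (isort_perm (nz nu))).
  destruct (Permutation_nz nu) as (k & Hk); rewrite (X_perm f _ _ Hk).
  clear Hk; induction k as [|k IH]; simpl; [reflexivity|]; rewrite X_zero; exact IH.
Qed.

(** The range of values is generalized to any duplicate-free [S] covering the parts, so that it
    stays fixed while [mu] shrinks in the induction. *)
Lemma zee_count S mu : NoDup S -> incl mu S -> ~ In 0%nat S ->
  prodR (map (fun i => INR (i ^ mult i mu * fact (mult i mu))) S) =
  prodR (map INR mu) * mfact mu.
Proof.
  intros HS Hi H0; unfold mult; revert Hi; induction mu as [|x mu IH]; intros Hi.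
  - cbn; clear; rewrite Rmult_1_l; induction S as [|y S IH]; cbn; auto.
    unfold prodR in IH; cbn in IH; rewrite IH; cbn; ring.
  - cbn [map mfact]; unfold prodR in *; cbn [map fold_right].
    rewrite (Rmult_comm (INR (count_occ _ _ _))).
    transitivity ((INR x * INR (count_occ Nat.eq_dec (x :: mu) x)) *
      (fold_right Rmult 1 (map INR mu) * mfact mu)); [|ring].
    rewrite <- IH by (eapply incl_cons_inv; exact Hi).
    assert (HxS : In x S) by (apply Hi; left; auto).
    destruct (in_split _ _ HxS) as (S1 & S2 & ->).
    assert (Hp : Permutation (S1 ++ x :: S2) (x :: S1 ++ S2))
      by (symmetry; apply Permutation_middle).
    pose proof (Permutation_NoDup Hp HS) as HN; inversion HN; subst.
    rewrite !(Symf_prodR _ _ _ Hp).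
    unfold prodR; cbn [map fold_right]; rewrite <- Rmult_assoc; f_equal.
    + cbn [count_occ]; destruct (Nat.eq_dec x x); [|congruence].
      rewrite !mult_INR, !pow_INR; rewrite fact_simpl, mult_INR.
      cbn [pow]; ring.
    + f_equal; apply map_ext_in; intros y Hy; cbn [count_occ].
      destruct (Nat.eq_dec x y); [subst; contradiction|reflexivity].
Qed.

Lemma zee_mfact mu : posl mu -> zee mu = prodR (map INR mu) * mfact mu.
Proof.
  intros Hp; apply zee_count; [apply seq_NoDup| |rewrite in_seq; lia].
  intros x Hx; apply in_seq; pose proof (list_sum_in mu x Hx).
  unfold posl in Hp; rewrite Forall_forall in Hp; apply Hp in Hx; lia.
Qed.

Lemma omega_prod theta mu : theta <> 0 -> omega theta mu = prodR (map INR mu) * / theta ^ length mu.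
Proof.
  intros Ht; induction mu as [|x mu IH]; [cbn; field|].
  rewrite omega_cons, IH; unfold prodR; cbn; field; split; auto; apply pow_nonzero; auto.
Qed.

Lemma omega_pos theta mu : 0 < theta -> posl mu -> 0 < omega theta mu.
Proof.
  intros Ht; induction 1 as [|x mu Hx Hmu IH]; [cbn; lra|].
  rewrite omega_cons; apply Rmult_lt_0_compat; auto.
  apply Rdiv_lt_0_compat; auto; apply lt_0_INR; lia.
Qed.

Lemma pin_nonneg theta n f : 0 < theta -> 0 <= pin theta n f f.
Proof.
  intros Ht; apply sum_over_nonneg; intros l Hl; apply partitions_spec in Hl.
  apply Rmult_le_pos; [|left; apply Rinv_0_lt_compat, mfact_pos].
  apply Rmult_le_pos; [apply Rle_0_sqr|left; apply omega_pos; tauto].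
Qed.

Lemma pin_definite theta n f : 0 < theta -> pin theta n f f = 0 ->
  forall l, In l (partitions n) -> f l = 0.
Proof.
  intros Ht H l Hl.
  pose proof Hl as Hl'; apply partitions_spec in Hl'.
  assert (f l * f l * omega theta l / mfact l = 0) as E.
  { apply (sum_over_zero_term (partitions n) (fun l => f l * f l * omega theta l / mfact l)); auto.
    intros m Hm; apply partitions_spec in Hm.
    apply Rmult_le_pos; [|left; apply Rinv_0_lt_compat, mfact_pos].
    apply Rmult_le_pos; [apply Rle_0_sqr|left; apply omega_pos; tauto]. }
  pose proof (mfact_pos l); pose proof (omega_pos theta l Ht ltac:(tauto)).
  assert (f l * f l = 0).
  { apply Rmult_eq_reg_r with (omega theta l / mfact l).
    - unfold Rdiv in *; rewrite Rmult_0_l, <- E; ring.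
    - apply Rgt_not_eq, Rdiv_lt_0_compat; auto. }
  nra.
Qed.

Lemma piw_Lprod theta n ds G H : theta <> 0 -> SymW G -> SymW H ->
  piw theta n (Lprod theta ds G) H = piw theta n G (Lprod theta ds H).
Proof.
  intros Ht; revert G H; induction ds as [|d ds IH]; intros G H HG HH; [reflexivity|].
  assert (forall F K, SymW F -> SymW K ->
    piw theta n (fun k l => Lop theta F k l - d * F k l) K =
    piw theta n F (fun k l => Lop theta K k l - d * K k l)) as E.
  { intros F K HF HK; rewrite (piw_sym _ _ F).
    rewrite (piw_ext _ _ (fun k l => Lop theta F k l - d * F k l)
      (fun k l => 1 * Lop theta F k l + (- d) * F k l + 0 * F k l)) by (intros; ring).
    rewrite (piw_ext _ _ (fun k l => Lop theta K k l - d * K k l)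
      (fun k l => 1 * Lop theta K k l + (- d) * K k l + 0 * K k l)) by (intros; ring).
    rewrite !piw_lin, piw_Lop, (piw_sym _ _ (Lop theta K)), (piw_sym _ _ K); auto. }
  cbn [Lprod]; rewrite E, IH by auto using SymW_Lprod, SymW_sub, SymW_Lop.
  change (fun k l => Lop theta H k l - d * H k l) with (Lprod theta [d] H).
  rewrite <- Lprod_app, (Lprod_perm theta (ds ++ [d]) (d :: ds)); [reflexivity|].
  symmetry; apply Permutation_cons_append.
Qed.

Lemma pin_tau_sym theta n ds f g : theta <> 0 -> Symf f -> Symf g ->
  pin theta n (rsum (Lprod theta ds (iota f))) g = pin theta n f (rsum (Lprod theta ds (iota g))).
Proof.
  intros Ht Hf Hg; rewrite (pin_sym _ _ f).
  rewrite !pin_rsum, piw_Lprod, piw_sym; auto using SymW_Lprod, SymW_iota.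
Qed.

(** * Jack functions as joint eigenfunctions *)

Section Jack.
Variables (theta : R) (jc : list nat -> list nat -> R).
Hypotheses (Htheta : 0 < theta) (Hjack : IsJack theta jc).

(** [J_lam] in the encoding by derivatives: the coefficient of [p_l] times [mfact l], extended to
    unsorted lists by sorting and by 0 to the other degrees, where [jc] is unconstrained. *)
Definition fJ (lam l : list nat) : R :=
  if Nat.eqb (list_sum l) (list_sum lam) then jc lam (isort l) * mfact l else 0.

Lemma Symf_fJ lam : Symf (fJ lam).
Proof.
  intros l m Hp; unfold fJ; rewrite (Permutation_list_sum Hp), (isort_eq l m Hp).
  rewrite (mfact_Symf l m Hp); reflexivity.
Qed.

Lemma Hom_fJ lam : Hom (list_sum lam) (fJ lam).
Proof. intros l Hl; unfold fJ; destruct (Nat.eqb_spec (list_sum l) (list_sum lam)); tauto. Qed.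

Lemma fJ_partitions n lam mu : In lam (partitions n) -> In mu (partitions n) ->
  fJ lam mu = jc lam mu * mfact mu.
Proof.
  intros Hl Hm; apply partitions_spec in Hl, Hm; unfold fJ.
  destruct (Nat.eqb_spec (list_sum mu) (list_sum lam)); [|lia].
  rewrite isort_id; tauto.
Qed.

Lemma X_fJ n lam nu : In lam (partitions n) -> list_sum nu = n -> X (fJ lam) nu = mcoef jc lam nu.
Proof.
  intros Hl Hn; unfold X, mcoef, pr; rewrite Hn.
  pose proof (proj1 (partitions_spec _ _) Hl) as (_ & _ & ->).
  apply sum_over_ext; intros mu Hmu.
  rewrite (fJ_partitions n), Lc_Lx by auto; field; apply mfact_neq0.
Qed.

Lemma X_fJ_supp n lam nu : In lam (partitions n) -> X (fJ lam) nu <> 0 -> ple nu lam.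
Proof.
  intros Hl HX; apply ple_part; rewrite <- X_part in HX.
  destruct (Hjack n lam Hl) as (_ & H & _).
  pose proof (proj1 (partitions_spec _ _) Hl) as (_ & _ & Hs).
  destruct (Nat.eq_dec (list_sum nu) n) as [E|E].
  - pose proof (part_partitions nu) as Hp; rewrite E in Hp.
    rewrite (X_fJ n) in HX; auto; [|rewrite list_sum_part; auto].
    apply dominates_ple; [apply isort_desc|auto].
  - exfalso; apply HX, pr_0; intros l Hl'; apply partitions_spec in Hl'.
    rewrite Hom_fJ; [ring|rewrite list_sum_part in Hl'; lia].
Qed.

Lemma X_fJ_diag n lam nu : In lam (partitions n) -> Permutation nu lam -> X (fJ lam) nu = 1.
Proof.
  intros Hl Hp; rewrite (X_perm _ _ _ Hp), (X_fJ n); auto.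
  - apply (Hjack n lam Hl).
  - apply partitions_spec in Hl; tauto.
Qed.

Lemma pin_fJ n lam nu : In lam (partitions n) -> In nu (partitions n) ->
  pin theta n (fJ lam) (fJ nu) = pinner theta (jc lam) (jc nu) n.
Proof.
  intros Hl Hn; unfold pin, pinner, pr; apply sum_over_ext; intros mu Hmu.
  rewrite !(fJ_partitions n) by auto.
  apply partitions_spec in Hmu; rewrite zee_mfact, omega_prod by (tauto || lra).
  field; split; [apply pow_nonzero; lra|apply mfact_neq0].
Qed.

Lemma fJ_orth n k k' : In k (partitions n) -> In k' (partitions n) -> k <> k' ->
  pin theta n (fJ k) (fJ k') = 0.
Proof. intros Hk Hk' Hne; rewrite pin_fJ by auto; apply (Hjack n k Hk); auto. Qed.

(** A zero norm would make [J_k] vanish by definiteness, against its leading coefficient 1. *)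
Lemma fJ_norm n k : In k (partitions n) -> pin theta n (fJ k) (fJ k) <> 0.
Proof.
  intros Hk H0; pose proof (X_fJ_diag n k k Hk (Permutation_refl _)) as E.
  rewrite (X_ext _ (fun _ => 0 * 0)) in E.
  - rewrite (X_scal 0 (fun _ => 0)) in E; lra.
  - intros l Hl; rewrite (pin_definite theta n (fJ k)); auto; [ring|].
    apply partitions_spec in Hk; destruct Hk as (_ & _ & E'); rewrite E' in Hl; exact Hl.
Qed.

Definition jcoef n (v : list nat -> R) k := pin theta n v (fJ k) / pin theta n (fJ k) (fJ k).

Lemma fJ_expand n v mu : In mu (partitions n) ->
  v mu = sum_over (partitions n) (fun k => jcoef n v k * fJ k mu).
Proof. apply orthogonal_span; [apply fJ_orth|apply fJ_norm]. Qed.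

Lemma X_expand n v nu : list_sum nu = n ->
  X v nu = sum_over (partitions n) (fun k => jcoef n v k * X (fJ k) nu).
Proof.
  intros Hn; rewrite (X_ext v (fun l => sum_over (partitions n) (fun k => jcoef n v k * fJ k l))).
  - rewrite (X_sum_over _ (fun k l => jcoef n v k * fJ k l)).
    apply sum_over_ext; intros k _; apply X_scal.
  - rewrite Hn; intros l Hl; apply fJ_expand; auto.
Qed.

(* A symmetric function supported on monomials below [lam] is a combination of
   the [J_k] with [k] below [lam]: look at a maximal [k] in its expansion. *)
Lemma jcoef_supp n v lam :
  (forall nu, In nu (partitions n) -> X v nu <> 0 -> ple nu lam) ->
  forall k, In k (partitions n) -> jcoef n v k <> 0 -> ple k lam.
Proof.
  intros HS.
  assert (Hb : exists B, forall k, In k (partitions n) -> (rank n k <= B)%nat).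
  { exists (list_sum (map (rank n) (partitions n))); intros k Hk.
    apply list_sum_in, in_map, Hk. }
  destruct Hb as (B & HB).
  assert (forall m k, In k (partitions n) -> (B - rank n k < m)%nat -> jcoef n v k <> 0 -> ple k lam) as Hm;
    [|intros k Hk; apply (Hm (S (B - rank n k))); auto].
  induction m as [|m IH]; intros k Hk Hr Hc; [lia|].
  pose proof (proj1 (partitions_spec _ _) Hk) as (_ & _ & Hs).
  destruct (Req_dec (X v k) 0) as [E|E]; auto.
  destruct (Classical_Prop.classic (exists k', In k' (partitions n) /\ k' <> k /\
      jcoef n v k' <> 0 /\ X (fJ k') k <> 0)) as [(k' & Hk' & Hne & Hc' & HX)|Hn].
  - assert (Hle : ple k k') by (apply (X_fJ_supp n); auto).
    assert (rank n k < rank n k')%nat by (apply rank_strict; auto).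
    pose proof (HB k' Hk').
    eapply ple_trans; [exact Hle|]; apply IH; auto; lia.
  - exfalso; apply Hc; rewrite (X_expand n v k Hs) in E.
    rewrite (sum_over_single list_nat_eq_dec _ _ k) in E; auto using NoDup_partitions.
    + rewrite (X_fJ_diag n k k) in E; auto; lra.
    + intros k' Hk' Hne.
      destruct (Req_dec (jcoef n v k') 0) as [->|Hc']; [ring|].
      destruct (Req_dec (X (fJ k') k) 0) as [->|HX]; [ring|].
      exfalso; apply Hn; exists k'; auto.
Qed.

(** The coefficient of [x^lam] in [rsum (Lprod theta ds (iota J_lam))]: [rsum] adds up the leading
    coefficients over the choice of the distinguished variable. *)
Definition eigen (lam : list nat) (ds : list R) : R :=
  sum_over lam (Bprod theta lam ds INR).

Lemma supp_iota_fJ n lam : In lam (partitions n) ->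
  supp lam (iota (fJ lam)) /\ rep lam (iota (fJ lam)) INR.
Proof.
  intros Hl; split.
  - intros a b; rewrite XW_iota by apply Symf_fJ; intros H.
    apply (X_fJ_supp n); auto; intros E; apply H; rewrite E; ring.
  - intros a b Hp; rewrite XW_iota by apply Symf_fJ.
    rewrite (X_fJ_diag n); auto; ring.
Qed.

(** Triangularity of the operator on [J_lam] admits only [J_k] with [k] below [lam]; moved onto
    [J_k] by self-adjointness, it forces [lam] below [k]. So [k = lam], and comparing coefficients
    of [x^lam] gives the eigenvalue. *)
Lemma jack_eigen_partition n lam ds mu : In lam (partitions n) -> In mu (partitions n) ->
  rsum (Lprod theta ds (iota (fJ lam))) mu = eigen lam ds * fJ lam mu.
Proof.
  intros Hl Hm.
  set (D := fun k => rsum (Lprod theta ds (iota (fJ k)))).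
  assert (Hth : theta <> 0) by lra.
  assert (HX : forall k nu, X (D k) nu = rsum (XW (Lprod theta ds (iota (fJ k)))) nu)
    by (intros; apply X_tau, SymW_Lprod, SymW_iota, Symf_fJ).
  assert (HS : forall k nu, In k (partitions n) -> X (D k) nu <> 0 -> ple nu k).
  { intros k nu Hk; rewrite HX; intros H.
    destruct (supp_iota_fJ n k Hk) as [H1 H2].
    destruct (supp_rep_Lprod theta k ds _ _ (SymW_iota _ (Symf_fJ k)) H1 H2) as [H3 _].
    apply Classical_Prop.NNPP; intros Hn; apply H, rsum_0; intros x t Hp.
    apply (supp_eq0 k); auto; intros H'; apply Hn.
    eapply ple_perm; [symmetry; exact Hp|reflexivity|exact H']. }
  assert (Hc : forall k, In k (partitions n) -> k <> lam -> jcoef n (D lam) k = 0).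
  { intros k Hk Hne; destruct (Req_dec (jcoef n (D lam) k) 0) as [|Hc]; auto.
    exfalso; apply Hne, (ple_antisym n); auto.
    - apply (jcoef_supp n (D lam)); auto.
    - apply (jcoef_supp n (D k)); auto; intros H; apply Hc; unfold jcoef in *.
      unfold D in *; rewrite pin_tau_sym, pin_sym by auto using Symf_fJ.
      apply Rmult_eq_reg_r with (/ pin theta n (fJ lam) (fJ lam));
        [|apply Rinv_neq_0_compat, fJ_norm; auto].
      unfold Rdiv in *; rewrite (Rmult_comm _ (/ pin theta n (fJ k) (fJ k))), Rmult_assoc, H; ring. }
  assert (E : jcoef n (D lam) lam = eigen lam ds).
  { pose proof (proj1 (partitions_spec _ _) Hl) as (_ & _ & Hs).
    pose proof (X_expand n (D lam) lam Hs) as E.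
    rewrite (sum_over_single list_nat_eq_dec _ _ lam) in E; auto using NoDup_partitions.
    2:{ intros k Hk Hne; rewrite Hc; auto; ring. }
    rewrite (X_fJ_diag n lam lam), Rmult_1_r in E; auto.
    rewrite <- E, HX; unfold eigen; rewrite <- rsum_fst.
    destruct (supp_iota_fJ n lam Hl) as [H1 H2].
    destruct (supp_rep_Lprod theta lam ds _ _ (SymW_iota _ (Symf_fJ lam)) H1 H2) as [_ H4].
    apply rsum_ext; intros x t Hp; apply H4; symmetry; exact Hp. }
  change (D lam mu = eigen lam ds * fJ lam mu).
  rewrite (fJ_expand n (D lam) mu Hm).
  rewrite (sum_over_single list_nat_eq_dec _ _ lam); auto using NoDup_partitions.
  - rewrite E; reflexivity.
  - intros k Hk Hne; rewrite Hc; auto; ring.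
Qed.

Lemma jack_eigen n lam ds l : In lam (partitions n) -> posl l ->
  rsum (Lprod theta ds (iota (fJ lam))) l = eigen lam ds * fJ lam l.
Proof.
  intros Hl Hp.
  pose proof (proj1 (partitions_spec _ _) Hl) as (_ & _ & Hs).
  destruct (Nat.eq_dec (list_sum l) n) as [E|E].
  - rewrite (Symf_rsum _ (SymW_Lprod theta ds _ (SymW_iota _ (Symf_fJ lam))) l (isort l))
      by (symmetry; apply isort_perm).
    rewrite (Symf_fJ lam l (isort l)) by (symmetry; apply isort_perm).
    apply (jack_eigen_partition n); auto; rewrite <- E; apply isort_partitions; auto.
  - rewrite (Hom_rsum n), (Hom_fJ lam); [ring|lia| |lia].
    apply HomW_Lprod, HomW_iota; rewrite <- Hs; apply Hom_fJ.
Qed.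
End Jack.

(** * Monotonicity of the quadratic eigenvalue *)

(** The sum of [(x - y)^+] over ordered pairs of parts, the interaction term of the quadratic
    eigenvalue. *)
Definition natdiff (k : list nat) : nat := list_sum (map (fun y => Pt y k) k).

Lemma list_sum_map_plus {A} (f g : A -> nat) l :
  list_sum (map (fun x => f x + g x)%nat l) = (list_sum (map f l) + list_sum (map g l))%nat.
Proof. induction l as [|x l IH]; simpl; lia. Qed.

Lemma list_sum_map_le {A} (f g : A -> nat) l :
  (forall x, f x <= g x)%nat -> (list_sum (map f l) <= list_sum (map g l))%nat.
Proof. intros H; induction l as [|x l IH]; simpl; [lia|]; specialize (H x); lia. Qed.

Lemma list_sum_map_const {A} c (l : list A) : list_sum (map (fun _ => c) l) = (length l * c)%nat.
Proof. induction l as [|x l IH]; simpl; lia. Qed.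

(** The sum over all pairs of [(x - y)^+ + y = (y - x)^+ + x]. *)
Lemma Pt_swap_sum k l :
  (list_sum (map (fun y => Pt y l) k) + length l * list_sum k =
   list_sum (map (fun x => Pt x k) l) + length k * list_sum l)%nat.
Proof.
  revert l; induction k as [|y k IH]; intros l.
  - change (fun x => Pt x []) with (fun _ : nat => 0%nat); rewrite list_sum_map_const; simpl; lia.
  - cbn [map length]; change (list_sum (?a :: ?b)) with (a + list_sum b)%nat.
    specialize (IH l).
    assert (list_sum (map (fun x => Pt x (y :: k)) l) =
      list_sum (map (fun x => (y - x) + Pt x k)%nat l)) as -> by reflexivity.
    rewrite (list_sum_map_plus (fun x => (y - x)%nat) (fun x => Pt x k)).
    assert (Pt y l + length l * y = list_sum (map (fun x => y - x)%nat l) + list_sum l)%nat; [|lia].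
    clear; induction l as [|x l IH]; [reflexivity|].
    rewrite Pt_cons; cbn [map length]; change (list_sum (?a :: ?b)) with (a + list_sum b)%nat; lia.
Qed.

(** Dominance is used twice, at the parts of [k] and at the parts of [l]; [Pt_swap_sum] joins the
    two resulting mixed sums. *)
Lemma natdiff_mono k l : ple k l -> list_sum k = list_sum l ->
  (natdiff k + length l * list_sum k <= natdiff l + length k * list_sum k)%nat.
Proof.
  intros H Hs; unfold natdiff.
  pose proof (list_sum_map_le (fun y => Pt y k) (fun y => Pt y l) k (fun t => H t)).
  pose proof (list_sum_map_le (fun y => Pt y k) (fun y => Pt y l) l (fun t => H t)).
  pose proof (Pt_swap_sum k l); rewrite <- Hs in *; lia.
Qed.

Lemma sum_over_INR {A} (l : list A) (f : A -> nat) :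
  sum_over l (fun x => INR (f x)) = INR (list_sum (map f l)).
Proof.
  induction l as [|x l IH]; [reflexivity|].
  rewrite sum_over_cons, IH; cbn [map]; change (list_sum (?a :: ?b)) with (a + list_sum b)%nat.
  rewrite plus_INR; reflexivity.
Qed.

Lemma square_rank n x : (x <= n)%nat ->
  (x * x + x = 2 * list_sum (map (fun t => x - t) (seq 0 n)))%nat.
Proof.
  revert n; induction x as [|x IH]; intros n H.
  - assert (list_sum (map (fun t => 0 - t)%nat (seq 0 n)) = 0)%nat; [|lia].
    generalize (seq 0 n); induction l; simpl; auto.
  - destruct n as [|n]; [lia|]; specialize (IH n ltac:(lia)).
    cbn [seq map]; rewrite <- seq_shift, map_map.
    change (list_sum (?a :: ?b)) with (a + list_sum b)%nat.
    rewrite (map_ext (fun t => S x - S t)%nat (fun t => x - t)%nat) by (intros; lia); lia.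
Qed.

Lemma sum_squares_rank n k : list_sum k = n ->
  (list_sum (map (fun x => x * x) k) + n = 2 * rank n k)%nat.
Proof.
  intros Hk.
  assert (E : rank n k = list_sum (map (fun x => list_sum (map (fun t => x - t) (seq 0 n))) k)%nat).
  { unfold rank, Pt; clear Hk; generalize (seq 0 n) as s; induction s as [|t s IH].
    - simpl; induction k; simpl; auto.
    - cbn [map]; change (list_sum (?a :: ?b)) with (a + list_sum b)%nat; rewrite IH.
      rewrite <- list_sum_map_plus; reflexivity. }
  rewrite E; assert (Hx : forall x, In x k -> (x <= n)%nat) by (rewrite <- Hk; apply list_sum_in).
  rewrite <- Hk at 1; clear E Hk; induction k as [|x k IH]; [reflexivity|].
  cbn [map]; change (list_sum (?a :: ?b)) with (a + list_sum b)%nat.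
  pose proof (square_rank n x (Hx x (or_introl eq_refl))).
  specialize (IH (fun y Hy => Hx y (or_intror Hy))); lia.
Qed.

(** The list [[0]] selects [D2]. In this form [rank] increases strictly with dominance, and the
    terms in [theta] increase weakly by [natdiff_mono]. *)
Lemma eigen_quadratic theta n k : list_sum k = n ->
  eigen theta k [0] = 2 * INR (rank n k) - INR n - theta * INR (length k * n) + theta * INR (natdiff k).
Proof.
  intros Hk; unfold eigen; cbn [Bprod]; unfold Bop.
  rewrite (sum_over_ext _ _ (fun b => INR (b * b) + (- theta * INR (length k)) * INR b +
    theta * sum_over k (fun x => INR (b - x)))).
  - rewrite !sum_over_plus, !sum_over_scal.
    pose proof (sum_over_INR k (fun b => b)) as E1; rewrite map_id, Hk in E1.
    change (sum_over k INR = INR n) in E1; rewrite E1.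
    rewrite (sum_over_INR k (fun b => (b * b)%nat)).
    pose proof (sum_squares_rank n k Hk) as E; apply (f_equal INR) in E.
    rewrite plus_INR, mult_INR in E; cbn [INR] in E.
    replace (INR (list_sum (map (fun x => x * x)%nat k))) with (2 * INR (rank n k) - INR n) by lra.
    rewrite mult_INR; unfold natdiff, Pt.
    rewrite <- sum_over_INR; rewrite sum_over_swap.
    rewrite (sum_over_ext k (fun y => sum_over k (fun x => INR (x - y)))
      (fun x => INR (list_sum (map (fun x0 => x0 - x)%nat k)))).
    + ring.
    + intros y _; apply sum_over_INR.
  - intros b _; rewrite mult_INR.
    rewrite (sum_over_ext k (fun x => if Nat.ltb x b then INR b - INR x else 0) (fun x => INR (b - x))).
    + ring.
    + intros x _; destruct (Nat.ltb_spec x b); [rewrite minus_INR by lia; reflexivity|].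
      replace (b - x)%nat with 0%nat by lia; reflexivity.
Qed.

Lemma eigen_quadratic_strict theta n k l : 0 < theta ->
  In k (partitions n) -> In l (partitions n) -> ple k l -> k <> l ->
  eigen theta k [0] < eigen theta l [0].
Proof.
  intros Ht Hk Hl H Hne.
  pose proof (rank_strict n k l Hk Hl H Hne) as Hr; apply lt_INR in Hr.
  apply partitions_spec in Hk, Hl; destruct Hk as (_ & _ & Hk), Hl as (_ & _ & Hl).
  rewrite (eigen_quadratic theta n k Hk), (eigen_quadratic theta n l Hl).
  pose proof (natdiff_mono k l H ltac:(lia)) as Hd; apply le_INR in Hd.
  rewrite !plus_INR, Hk in Hd. nra.
Qed.

(** * The value at [x_1 = ... = x_N = 1] *)

Definition ev (N n : nat) (f : list nat -> R) : R := pr n (fun l => f l * INR N ^ length l).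

Lemma Symf_pow c : Symf (fun l => c ^ length l).
Proof. intros l m Hp; rewrite (Permutation_length Hp); reflexivity. Qed.

Lemma ev_rsum N n G : SymW G ->
  ev N n (rsum G) = INR N * sum_over (seq 1 n) (fun a => ev N (n - a) (G a)).
Proof.
  intros HG; unfold ev; rewrite (pr_adj n G (fun l => INR N ^ length l)); auto using Symf_pow.
  rewrite <- sum_over_scal; apply sum_over_ext; intros a _; rewrite <- pr_scal.
  apply pr_ext; intros l _; cbn [length pow]; ring.
Qed.

Lemma ev_ext N n f g : (forall l, In l (partitions n) -> f l = g l) -> ev N n f = ev N n g.
Proof. intros H; apply pr_ext; intros l Hl; rewrite H; auto. Qed.

Lemma ev_lin N n a b f g : ev N n (fun l => a * f l + b * g l) = a * ev N n f + b * ev N n g.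
Proof. unfold ev; rewrite <- !pr_scal, <- pr_plus; apply pr_ext; intros; ring. Qed.

Section Lowering.
Variables (theta : R) (u : nat -> list nat -> R) (d : R).
Hypotheses (Hu : SymW u)
  (Hd : forall k l, posl l -> (1 <= k)%nat -> Lop theta u k l = d * u k l).

(* The [w^1] component of [Lop u = d u]. *)
Lemma lowest_component l : posl l ->
  theta * rsum (fun a t => u (S a) t) l = (d - 1 + theta) * u 1%nat l.
Proof.
  intros Hl; pose proof (Hd 1%nat l Hl ltac:(lia)) as E.
  unfold Lop, Kop, Ap, Am in E; cbn [seq Nat.sub INR] in E; rewrite sum_over_nil in E.
  change (fun x t => u (1 + x)%nat t) with (fun x t => u (S x) t) in E; lra.
Qed.

(** In [lowest_component] the sums start at [w^2]. Adding the [w^1] term once for each of the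
    [length nu] variables completes them to [XW u (S x)]. *)
Lemma X_lowest nu :
  (d - 1 + theta + theta * INR (length nu)) * X (u 1%nat) nu =
  theta * rsum (fun x t => XW u (S x) t) nu.
Proof.
  assert (E : (d - 1 + theta) * X (u 1%nat) nu = theta * X (rsum (fun a => u (S a))) nu).
  { rewrite <- !X_scal; apply X_ext; intros l Hl; apply partitions_spec in Hl.
    symmetry; apply lowest_component; tauto. }
  rewrite X_rsum in E by (intros a; apply Hu).
  rewrite Rmult_plus_distr_r, E, Rmult_assoc, <- Rmult_plus_distr_l; f_equal.
  assert (INR (length nu) * X (u 1%nat) nu = rsum (fun x t => X (u 1%nat) nu) nu) as ->.
  { rewrite (rsum_ext _ (fun x t => 1 * X (u 1%nat) nu)) by (intros; ring).
    rewrite rsum_scal_r, (rsum_fst (fun _ => 1)); f_equal.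
    clear; induction nu as [|x b IH]; [reflexivity|].
    cbn [length]; rewrite sum_over_cons, S_INR, IH; ring. }
  rewrite <- rsum_plus; apply rsum_ext; intros x t Hp.
  unfold XW; change (seq 1 (S x)) with (seq (0 + 1) (S x)); rewrite sum_over_seq_shift.
  change (seq 0 (S x)) with (0%nat :: seq 1 x); rewrite sum_over_cons, Rplus_comm; f_equal.
  - rewrite (X_perm _ _ _ Hp); f_equal; f_equal; lia.
  - apply sum_over_ext; intros a Ha; replace (a + 1)%nat with (S a) by lia; reflexivity.
Qed.

(** The same completion at [1^N]: every power sum equals [N], so the missing [w^1] term is added [N]
    times. *)
Lemma ev_lowest N n : (1 <= n)%nat ->
  (d - 1 + theta + theta * INR N) * ev N (n - 1) (u 1%nat) = theta * ev N n (rsum u).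
Proof.
  intros Hn.
  assert (E : (d - 1 + theta) * ev N (n - 1) (u 1%nat) = theta * ev N (n - 1) (rsum (fun a => u (S a)))).
  { transitivity (ev N (n - 1) (fun l => (d - 1 + theta) * u 1%nat l + 0 * 0)).
    - rewrite (ev_lin N (n - 1) _ _ (u 1%nat) (fun _ => 0)); ring.
    - transitivity (ev N (n - 1) (fun l => theta * rsum (fun a => u (S a)) l + 0 * 0)).
      + apply ev_ext; intros l Hl; apply partitions_spec in Hl.
        rewrite <- (lowest_component l) by tauto; reflexivity.
      + rewrite (ev_lin N (n - 1) _ _ (rsum _) (fun _ => 0)); ring. }
  rewrite ev_rsum in E by (intros a; apply Hu); rewrite ev_rsum by auto.
  rewrite Rmult_plus_distr_r, E, Rmult_assoc, <- Rmult_plus_distr_l; f_equal.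
  rewrite <- Rmult_plus_distr_l; f_equal.
  destruct n as [|n]; [lia|]; change (seq 1 (S n)) with (1%nat :: seq 2 n).
  replace (S n - 1)%nat with n by lia; rewrite sum_over_cons, Rplus_comm; f_equal.
  - f_equal; lia.
  - change 2%nat with (1 + 1)%nat; rewrite sum_over_seq_shift; apply sum_over_ext; intros a Ha.
    replace (a + 1)%nat with (S a) by lia; reflexivity.
Qed.
End Lowering.

(** * Removing the last box of the last row *)

(** The diagonal entries of [Bop], which is triangular: its value at [b] involves only values
    [x < b] besides [b]. *)
Definition dval theta (mu : list nat) (b : nat) : R :=
  INR b - theta * INR (length mu) + theta * sum_over mu (fun x => if Nat.ltb x b then 1 else 0).

(** Cayley-Hamilton for a triangular operator. The innermost factor, applied first, belongs to the
    smallest value in [Q]; once all smaller values are killed, the factor of [y] kills [y]. *)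
Lemma Bprod_vanish theta mu Q t : desc Q ->
  (forall y q, In y mu -> In q Q -> (y <= q)%nat -> In y Q) ->
  forall y, In y Q -> Bprod theta mu (map (dval theta mu) Q) t y = 0.
Proof.
  induction Q as [|p Q IH]; intros HQ Hc y Hy; [destruct Hy|].
  destruct HQ as [Hp HQ].
  assert (Hc' : forall y q, In y mu -> In q Q -> (y <= q)%nat -> In y Q).
  { intros z q Hz Hq Hle; destruct (Hc z q Hz (or_intror Hq) Hle) as [<-|]; auto.
    specialize (Hp q Hq); replace p with q by lia; auto. }
  specialize (IH HQ Hc'); cbn [map Bprod]; set (t' := Bprod theta mu _ t) in *.
  assert (E : Bop theta mu t' y = dval theta mu y * t' y).
  { unfold Bop, dval.
    rewrite (sum_over_ext mu (fun x => if Nat.ltb x y then t' y - t' x else 0)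
      (fun x => (if Nat.ltb x y then 1 else 0) * t' y)).
    - rewrite sum_over_scal_r; ring.
    - intros x Hx; destruct (Nat.ltb_spec x y); [|ring].
      assert (In x Q); [|rewrite (IH x); auto; ring].
      destruct (Hc x y Hx Hy ltac:(lia)) as [E|]; auto; exfalso; subst x.
      destruct Hy as [->|Hy]; [lia|specialize (Hp y Hy); lia]. }
  rewrite E; destruct Hy as [->|Hy]; [ring|rewrite (IH y Hy); ring].
Qed.

(** No entry of [mu] is below [b], so every [Bop] acts there by its diagonal entry. *)
Lemma Bprod_least theta mu ds t b : (forall x, In x mu -> (b <= x)%nat) ->
  Bprod theta mu ds t b = fold_right (fun d r => (dval theta mu b - d) * r) (t b) ds.
Proof.
  intros Hb.
  induction ds as [|d ds IH]; cbn [Bprod fold_right]; [reflexivity|].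
  rewrite <- IH; unfold Bop, dval; rewrite !sum_over_0; [ring| |];
    intros x Hx; specialize (Hb x Hx); destruct (Nat.ltb_spec x b); lra || lia.
Qed.

(** Only [x < s < b] is delicate. Equality [Pt s t = Pt s mu] would give [t] at least [length mu]
    entries above [s], hence a sum of at least [Pt s mu + s * length mu = n], whereas [t] sums to
    [n - S x]. *)
Lemma remove_corner_ple mu lam x t b n :
  list_sum mu = n -> list_sum (S x :: t) = n ->
  (forall y, In y mu -> (b <= y)%nat) -> (1 <= b)%nat ->
  (forall s, (Pt s lam + (if Nat.leb s (b - 1) then 1 else 0) = Pt s mu)%nat) ->
  ple (S x :: t) mu -> ple (x :: t) lam.
Proof.
  intros Hmu Ht Hb Hb1 Hlam H s.
  pose proof (H s) as Hs; pose proof (Hlam s) as Ls; rewrite Pt_cons in *.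
  destruct (Nat.leb_spec s (b - 1)); [|lia].
  destruct (Nat.le_gt_cases s x); [lia|].
  assert (Pmu : forall r, (r <= b)%nat -> (Pt r mu + length mu * r = n)%nat).
  { intros r Hr; rewrite <- Hmu; clear -Hb Hr; induction mu as [|y mu IH]; [reflexivity|].
    rewrite Pt_cons; cbn [length]; change (list_sum (y :: mu)) with (y + list_sum mu)%nat.
    specialize (IH (fun z Hz => Hb z (or_intror Hz))); specialize (Hb y (or_introl eq_refl)); lia. }
  pose proof (Pmu s ltac:(lia)); pose proof (Pmu (S s) ltac:(lia)).
  pose proof (H (S s)) as Hs1; rewrite Pt_cons in Hs1.
  assert (Hgen : (s * (Pt s t - Pt (S s) t) + Pt s t <= list_sum t)%nat).
  { rewrite (Pt_step s t); replace (Pt (S s) t + _ - Pt (S s) t)%nat with (length (filter (Nat.ltb s) t)) by lia.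
    clear; induction t as [|y t IH]; [simpl; lia|].
    rewrite Pt_cons; cbn [filter]; change (list_sum (y :: t)) with (y + list_sum t)%nat.
    destruct (Nat.ltb_spec s y); cbn [length]; lia. }
  change (list_sum (S x :: t)) with (S x + list_sum t)%nat in Ht.
  replace (S x - S s)%nat with 0%nat in Hs1 by lia.
  replace (x - s)%nat with 0%nat by lia; replace (S x - s)%nat with 0%nat in Hs by lia.
  destruct (Nat.le_gt_cases (Pt s t) (Pt s lam)); [lia|exfalso].
  assert (Pt s t = Pt s mu) by lia.
  assert (length mu <= Pt s t - Pt (S s) t)%nat by lia. nia.
Qed.

Lemma D2_Lprod theta g l : D2 theta g l = rsum (Lprod theta [0] (iota g)) l.
Proof. apply rsum_ext; intros x t _; cbn [Lprod]; ring. Qed.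

Lemma Bprod_app theta mu ds es t : Bprod theta mu (ds ++ es) t = Bprod theta mu ds (Bprod theta mu es t).
Proof. induction ds as [|d ds IH]; cbn [app Bprod]; [|rewrite IH]; reflexivity. Qed.

Lemma desc_app_inv l1 l2 : desc (l1 ++ l2) -> desc l1 /\ desc l2 /\
  forall x y, In x l1 -> In y l2 -> (y <= x)%nat.
Proof.
  induction l1 as [|a l1 IH]; cbn [app]; intros H; [repeat split; auto; intros x y []|].
  destruct H as [H1 H2], (IH H2) as (I1 & I2 & I3); repeat split; auto with datatypes.
  intros x y [<-|Hx] Hy; auto with datatypes.
Qed.

Lemma desc_filter p l : desc l -> desc (filter p l).
Proof.
  induction l as [|a l IH]; cbn; auto; intros [H1 H2].
  destruct (p a); cbn; auto; split; auto; intros y Hy; apply filter_In in Hy; apply H1; tauto.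
Qed.

Lemma desc_snoc l b : desc l -> (forall x, In x l -> (b <= x)%nat) -> desc (l ++ [b]).
Proof.
  induction l as [|a l IH]; cbn; intros H Hb; [repeat split; intros y []|].
  destruct H as [H1 H2]; split; [|apply IH; auto].
  intros y Hy; apply in_app_iff in Hy; destruct Hy as [Hy|[<-|[]]]; auto.
Qed.

Lemma sum_over_const {A} c (l : list A) : sum_over l (fun _ => c) = INR (length l) * c.
Proof.
  induction l as [|x l IH]; [rewrite sum_over_nil; simpl; ring|].
  cbn [length]; rewrite sum_over_cons, S_INR, IH; ring.
Qed.

Lemma dval_least theta mu b : (forall x, In x mu -> (b <= x)%nat) ->
  dval theta mu b = INR b - theta * INR (length mu).
Proof.
  intros Hb; unfold dval; rewrite sum_over_0; [ring|].
  intros x Hx; specialize (Hb x Hx); destruct (Nat.ltb_spec x b); [lia|reflexivity].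
Qed.

Lemma dval_lt theta mu b x : 0 < theta -> (forall y, In y mu -> (b <= y)%nat) ->
  (b < x)%nat -> dval theta mu b < dval theta mu x.
Proof.
  intros Ht Hb Hx; rewrite dval_least by auto; unfold dval.
  apply lt_INR in Hx.
  assert (0 <= sum_over mu (fun y => if Nat.ltb y x then 1 else 0)); [|nra].
  apply sum_over_nonneg; intros y _; destruct (Nat.ltb y x); lra.
Qed.

Lemma X_pad f k nu : X f (repeat 0%nat k ++ nu) = X f nu.
Proof. induction k as [|k IH]; [reflexivity|]; cbn [repeat app]; rewrite X_zero; exact IH. Qed.

Lemma Pt_pad s k nu : Pt s (repeat 0%nat k ++ nu) = Pt s nu.
Proof. induction k as [|k IH]; [reflexivity|]; cbn [repeat app]; rewrite Pt_cons, IH; lia. Qed.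

Section Corner.
Variables (theta : R) (jc : list nat -> list nat -> R).
Hypotheses (Htheta : 0 < theta) (Hjack : IsJack theta jc).
Variables (n : nat) (rl : list nat) (b : nat).
Let mu := rl ++ [b].
Let lamh := rl ++ [(b - 1)%nat].
Let lam := part lamh.
Hypothesis Hmu : In mu (partitions (S n)).

Let f := fJ jc mu.
Let db := dval theta mu b.
(** One factor for each row longer than the last one; the product spares the eigenvalue [db] of the
    shortest length [b]. *)
Let ds := map (dval theta mu) (filter (fun x => negb (Nat.eqb x b)) mu).
Let u := Lprod theta ds (iota f).
(** The constant of [D2_of_lowest] with [a = db]: the [D2]-eigenvalue of the [w]-component of
    [u]. *)
Let e' := eigen theta mu [0] - 2 * db + 1 - theta.

Lemma corner_facts : desc mu /\ posl mu /\ list_sum mu = S n /\ (1 <= b)%nat /\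
  (forall x, In x rl -> (b <= x)%nat) /\ (forall x, In x mu -> (b <= x)%nat) /\
  db = INR b - theta * INR (length mu).
Proof.
  pose proof (proj1 (partitions_spec _ _) Hmu) as (H1 & H2 & H3).
  destruct (desc_app_inv _ _ H1) as (_ & _ & H4).
  assert (H5 : forall x, In x rl -> (b <= x)%nat) by (intros x Hx; apply H4; auto with datatypes).
  assert (H6 : forall x, In x mu -> (b <= x)%nat).
  { intros x Hx; apply in_app_iff in Hx; destruct Hx as [Hx|[<-|[]]]; auto. }
  repeat split; auto.
  - apply Forall_app in H2; destruct H2 as [_ H2]; inversion H2; auto.
  - apply dval_least, H6.
Qed.

Lemma SymW_u : SymW u.
Proof. apply SymW_Lprod, SymW_iota, Symf_fJ. Qed.

(* [u] spans the kernel of [Lop - db] on the cyclic space of [iota f]: the norm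
   of [(Lop - db) u] is a multiple of a vanishing eigenvalue. *)
Lemma Lop_u k l : posl l -> (1 <= k)%nat -> Lop theta u k l = db * u k l.
Proof.
  destruct corner_facts as (H1 & H2 & H3 & H4 & H5 & H6 & H7).
  set (Q := filter (fun x => negb (Nat.eqb x b)) mu ++ [b]).
  set (v := Lprod theta (map (dval theta mu) Q) (iota f)).
  assert (Ev : forall k l, v k l = Lop theta u k l - db * u k l).
  { intros k' l'; unfold v, Q; rewrite map_app.
    rewrite (Lprod_perm theta _ (db :: ds)) by (symmetry; apply Permutation_cons_append).
    reflexivity. }
  assert (HQ : forall t y, In y mu -> Bprod theta mu (map (dval theta mu) Q) t y = 0).
  { assert (HmQ : forall y, In y mu -> In y Q).
    { intros y Hy; unfold Q; apply in_app_iff.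
      destruct (Nat.eqb_spec y b) as [->|Hne]; [right; left; auto|left].
      apply filter_In; split; auto; destruct (Nat.eqb_spec y b); auto. }
    intros t y Hy; apply Bprod_vanish; auto.
    apply desc_snoc; [apply desc_filter, H1|].
    intros x Hx; apply filter_In in Hx; apply H6; tauto. }
  assert (Hth : theta <> 0) by lra.
  assert (Hf : Symf f) by apply Symf_fJ.
  assert (Hn : piw theta (S n) v v = 0).
  { unfold v at 1; rewrite piw_Lprod by (auto using SymW_iota; apply SymW_Lprod, SymW_iota, Hf).
    unfold v; rewrite <- Lprod_app, piw_sym.
    set (dd := _ ++ _).
    pose proof (pin_rsum theta (S n) (Lprod theta dd (iota f)) f
      (SymW_Lprod _ _ _ (SymW_iota _ Hf)) Hf) as E.
    assert (pin theta (S n) (rsum (Lprod theta dd (iota f))) f = 0).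
    { rewrite (pin_ext _ _ _ (fun _ => 0 * 0) _ f); [rewrite (pin_scal _ _ 0 (fun _ => 0)); ring| |auto].
      intros l' Hl'; unfold f; rewrite (jack_eigen_partition theta jc Htheta Hjack (S n)) by auto.
      unfold eigen; rewrite sum_over_0; [ring|].
      intros x Hx; unfold dd; rewrite Bprod_app; apply HQ, Hx. }
    apply Rmult_eq_reg_l with (/ theta); [lra|apply Rinv_neq_0_compat; auto]. }
  intros Hl Hk.
  enough (v k l = 0) by (rewrite Ev in H; lra).
  assert (HW : HomW (S n) v).
  { apply HomW_Lprod, HomW_iota; rewrite <- H3; apply Hom_fJ. }
  destruct (Nat.eq_dec (k + list_sum l) (S n)) as [E|E]; [|apply HW, E].
  assert (HvS : SymW v) by apply SymW_Lprod, SymW_iota, Hf.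
  rewrite (HvS k l (isort l)) by (symmetry; apply isort_perm).
  apply (pin_definite theta (S n - k)); auto.
  - apply (sum_over_zero_term (seq 1 (S n)) (fun k => pin theta (S n - k) (v k) (v k))); auto.
    + intros; apply pin_nonneg; auto.
    + apply in_seq; lia.
  - replace (S n - k)%nat with (list_sum l) by lia; apply isort_partitions, Hl.
Qed.

Lemma D2_u l : posl l -> D2 theta (u 1%nat) l = e' * u 1%nat l.
Proof.
  intros Hl; apply D2_of_lowest; [apply Lop_u; auto|].
  apply Cop_Lprod; auto using SymW_iota, Symf_fJ.
  - apply SymW_iota, Symf_fJ.
  - intros k m Hm Hk; rewrite Cop_iota by apply Symf_fJ.
    unfold iota; rewrite D2_Lprod; unfold f.
    rewrite (jack_eigen theta jc Htheta Hjack (S n)); auto; [ring|constructor; auto].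
Qed.

Lemma list_sum_lamh : list_sum lamh = n.
Proof.
  destruct corner_facts as (_ & _ & H3 & H4 & _); unfold mu, lamh in *.
  rewrite list_sum_app in *; simpl in *; lia.
Qed.

Lemma Pt_corner s : (Pt s lamh + (if Nat.leb s (b - 1) then 1 else 0) = Pt s mu)%nat.
Proof.
  destruct corner_facts as (_ & _ & _ & H4 & _); unfold lamh, mu, Pt.
  rewrite !map_app, !list_sum_app; simpl; destruct (Nat.leb_spec s (b - 1)); lia.
Qed.

Lemma supp_rep_u : supp mu u /\ rep mu u (Bprod theta mu ds INR).
Proof.
  destruct (supp_iota_fJ theta jc Hjack (S n) mu Hmu).
  apply supp_rep_Lprod; auto; apply SymW_iota, Symf_fJ.
Qed.

Lemma X_u1_supp nu : list_sum nu = n -> X (u 1%nat) nu <> 0 -> ple nu lam.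
Proof.
  destruct corner_facts as (H1 & H2 & H3 & H4 & H5 & H6 & H7).
  (* Padding by [length mu] zeros does not change the coefficient but makes the factor
     [db - 1 + theta + theta * length nu'] of [X_lowest] positive, as [db = b - theta * length mu]
     and [b >= 1]. *)
  intros Hs HX; set (nu' := repeat 0%nat (length mu) ++ nu).
  pose proof (X_lowest theta u db SymW_u Lop_u nu') as E.
  assert (Hlen : length nu' = (length mu + length nu)%nat)
    by (unfold nu'; rewrite length_app, repeat_length; reflexivity).
  assert (Hle : ple nu' lamh).
  { apply Classical_Prop.NNPP; intros Hn; apply HX.
    rewrite <- (X_pad _ (length mu)); fold nu'.
    rewrite (rsum_0 _ nu') in E.
    - rewrite Rmult_0_r in E; apply Rmult_integral in E; destruct E as [E|E]; auto.
      exfalso; rewrite H7, Hlen, plus_INR in E.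
      apply le_INR in H4; cbn [INR] in H4; pose proof (pos_INR (length nu)); nra.
    - intros x t Hp; apply (supp_eq0 mu); [apply supp_rep_u|].
      intros H; apply Hn; eapply ple_perm; [symmetry; exact Hp|reflexivity|].
      apply (remove_corner_ple mu lamh x t b (S n)); auto; [|apply Pt_corner].
      apply Permutation_list_sum in Hp.
      unfold nu' in Hp; rewrite list_sum_app in Hp.
      replace (list_sum (repeat 0%nat (length mu))) with 0%nat in Hp
        by (clear; induction (length mu); simpl; auto).
      simpl in *; lia. }
  intros s; unfold lam; rewrite Pt_part; specialize (Hle s); unfold nu' in Hle.
  rewrite Pt_pad in Hle; exact Hle.
Qed.

(** In [X_lowest] at [lamh], raising a row of length [x >= b] leaves the order ideal of [mu], as
    [Pt x] shows; only raising the row [b - 1], back to [mu], contributes. Its coefficient is [b]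
    times the differences of [dval theta mu b] with the entries of [ds], nonzero by [dval_lt]. *)
Lemma X_u1_lam : X (u 1%nat) lam <> 0.
Proof.
  destruct corner_facts as (H1 & H2 & H3 & H4 & H5 & H6 & H7).
  unfold lam; rewrite X_part; intros HX.
  pose proof (X_lowest theta u db SymW_u Lop_u lamh) as E; rewrite HX, Rmult_0_r in E.
  set (c := Bprod theta mu ds INR b).
  rewrite (rsum_ext _ (fun x _ => if Nat.eqb x (b - 1) then c else 0)) in E.
  2:{ intros x t Hp; destruct (Nat.eqb_spec x (b - 1)) as [->|Hne].
      - replace (S (b - 1)) with b by lia; apply supp_rep_u.
        assert (Permutation (rl) t) as <-.
        { unfold lamh in Hp; rewrite <- Permutation_cons_append in Hp.
          eapply Permutation_cons_inv; exact Hp. }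
        apply Permutation_cons_append.
      - assert (Hx : (b <= x)%nat).
        { assert (In x lamh) as Hi by (eapply Permutation_in; [symmetry; exact Hp|left; auto]).
          apply in_app_iff in Hi; destruct Hi as [Hi|[Hi|[]]]; auto; congruence. }
        apply (supp_eq0 mu); [apply supp_rep_u|]; intros H.
        specialize (H x); pose proof (Pt_corner x) as Hc.
        rewrite (Pt_perm x _ _ Hp), Pt_cons in Hc; rewrite Pt_cons in H.
        destruct (Nat.leb_spec x (b - 1)); lia. }
  rewrite (rsum_fst (fun x => if Nat.eqb x (b - 1) then c else 0)) in E.
  unfold lamh in E; rewrite sum_over_app, sum_over_cons, sum_over_nil, Nat.eqb_refl in E.
  rewrite sum_over_0 in E.
  2:{ intros x Hx; specialize (H5 x Hx); destruct (Nat.eqb_spec x (b - 1)); [lia|reflexivity]. }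
  assert (c = 0) as Hc by nra.
  unfold c in Hc; rewrite Bprod_least in Hc by auto.
  assert (Hds : forall d, In d ds -> dval theta mu b - d <> 0).
  { intros d Hd; apply in_map_iff in Hd; destruct Hd as (x & <- & Hx).
    apply filter_In in Hx; destruct Hx as [Hx Hne].
    destruct (Nat.eqb_spec x b); [discriminate|].
    specialize (H6 x Hx) as Hle.
    pose proof (dval_lt theta mu b x Htheta H6 ltac:(lia)); lra. }
  revert Hc Hds; generalize ds as es; induction es as [|d es IH]; cbn [fold_right]; intros Hc Hds.
  - apply (not_0_INR b); [lia|exact Hc].
  - apply Rmult_integral in Hc; destruct Hc as [Hc|Hc].
    + apply (Hds d); auto with datatypes.
    + apply IH; auto with datatypes.
Qed.

(** Every [k] in the Jack expansion of [u 1] lies below [lam] and has the eigenvalue [e'], and so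
    does [lam] itself. Strict monotonicity of the quadratic eigenvalue leaves only [k = lam]. *)
Lemma u1_proportional : exists c, c <> 0 /\
  forall l, In l (partitions n) -> u 1%nat l = c * fJ jc lam l.
Proof.
  assert (Hlam : In lam (partitions n)).
  { unfold lam; pose proof (part_partitions lamh) as H; rewrite list_sum_lamh in H; exact H. }
  assert (Hle : forall k, In k (partitions n) -> jcoef theta jc n (u 1%nat) k <> 0 -> ple k lam).
  { apply jcoef_supp; auto; intros nu Hnu; apply X_u1_supp; apply partitions_spec in Hnu; tauto. }
  assert (Hs : list_sum lam = n) by (apply partitions_spec in Hlam; tauto).
  assert (Hth : theta <> 0) by lra.
  assert (He : forall k, In k (partitions n) -> jcoef theta jc n (u 1%nat) k <> 0 ->
    eigen theta k [0] = e').
  { intros k Hk Hc.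
    assert (E : pin theta n (fun l => e' * u 1%nat l) (fJ jc k) =
                pin theta n (u 1%nat) (fun l => eigen theta k [0] * fJ jc k l)).
    { rewrite (pin_ext _ _ _ (rsum (Lprod theta [0] (iota (u 1%nat)))) _ (fJ jc k)).
      - rewrite pin_tau_sym by (auto using Symf_fJ; apply SymW_u).
        apply pin_ext; auto; intros l Hl; apply (jack_eigen_partition theta jc Htheta Hjack n); auto.
      - intros l Hl; rewrite <- D2_Lprod, D2_u; auto; apply partitions_spec in Hl; tauto.
      - auto. }
    rewrite (pin_sym _ _ (u 1%nat)), !pin_scal, (pin_sym _ _ (fJ jc k) (u 1%nat)) in E.
    apply Rmult_eq_reg_r with (pin theta n (u 1%nat) (fJ jc k)); auto.
    intros H; apply Hc; unfold jcoef; rewrite H; unfold Rdiv; ring. }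
  assert (Hc : jcoef theta jc n (u 1%nat) lam <> 0).
  { intros Hc; apply X_u1_lam; rewrite (X_expand theta jc Htheta Hjack n _ _ Hs).
    apply sum_over_0; intros k Hk.
    destruct (Req_dec (jcoef theta jc n (u 1%nat) k) 0) as [->|Hck]; [ring|].
    destruct (Req_dec (X (fJ jc k) lam) 0) as [->|HX]; [ring|].
    apply (X_fJ_supp theta jc Hjack n) in HX; auto.
    rewrite (ple_antisym n k lam) in Hck; auto; contradiction. }
  exists (jcoef theta jc n (u 1%nat) lam); split; auto.
  intros l Hl; rewrite (fJ_expand theta jc Htheta Hjack n _ l Hl).
  rewrite (sum_over_single list_nat_eq_dec _ _ lam); auto using NoDup_partitions.
  intros k Hk Hne.
  destruct (Req_dec (jcoef theta jc n (u 1%nat) k) 0) as [->|Hck]; [ring|exfalso].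
  pose proof (eigen_quadratic_strict theta n k lam Htheta Hk Hlam (Hle k Hk Hck) Hne).
  rewrite (He k Hk Hck), (He lam Hlam Hc) in H; lra.
Qed.

(** The factor in [ev_lowest] is [b - 1 + theta + theta * (N - length mu)], positive because
    [length mu <= N]. If [J_mu] vanished at [1^N], then so would [J_lam]. *)
Lemma ev_corner N : (length mu <= N)%nat ->
  ev N n (fJ jc lam) <> 0 -> ev N (S n) f <> 0.
Proof.
  destruct corner_facts as (H1 & H2 & H3 & H4 & H5 & H6 & H7).
  intros HN Hlam Hmu0.
  pose proof (ev_lowest theta u db SymW_u Lop_u N (S n) ltac:(lia)) as E.
  replace (S n - 1)%nat with n in E by lia.
  destruct u1_proportional as (c & Hc & Hu).
  rewrite (ev_ext N n (u 1%nat) (fun l => c * fJ jc lam l + 0 * 0)) in E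
    by (intros; rewrite Hu by auto; ring).
  rewrite (ev_lin N n c 0 (fJ jc lam) (fun _ => 0)) in E.
  rewrite (ev_ext N (S n) (rsum u) (fun l => eigen theta mu ds * f l + 0 * 0)) in E.
  2:{ intros l Hl; unfold u, f; rewrite (jack_eigen_partition theta jc Htheta Hjack (S n)); auto; ring. }
  rewrite (ev_lin N (S n) _ 0 f (fun _ => 0)), Hmu0 in E.
  rewrite H7 in E; apply le_INR in HN; apply le_INR in H4; cbn [INR] in H4.
  assert (0 < INR b - theta * INR (length mu) - 1 + theta + theta * INR N) by nra.
  assert (c * ev N n (fJ jc lam) <> 0) by (apply Rmult_integral_contrapositive; auto).
  apply H0; apply Rmult_eq_reg_l with (INR b - theta * INR (length mu) - 1 + theta + theta * INR N); lra.
Qed.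
End Corner.

Lemma length_nz l : (length (part l) <= length l)%nat.
Proof.
  unfold part; rewrite (Permutation_length (isort_perm _)); unfold nz.
  induction l as [|x l IH]; cbn; [lia|]; destruct (negb _); cbn; lia.
Qed.

Theorem jack_ev_neq0 theta jc N n lam : 0 < theta -> IsJack theta jc ->
  In lam (partitions n) -> (length lam <= N)%nat -> ev N n (fJ jc lam) <> 0.
Proof.
  intros Ht Hj; revert lam; induction n as [|n IH]; intros lam Hl HN.
  - pose proof (X_fJ_diag theta jc Hj 0 lam lam Hl (Permutation_refl _)) as E.
    destruct Hl as [<-|[]].
    assert (ev N 0 (fJ jc []) = X (fJ jc []) []) as ->; [reflexivity|lra].
  - destruct (exists_last (l := lam)) as (rl & b & ->).
    { intros ->; apply partitions_spec in Hl; simpl in Hl; lia. }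
    apply (ev_corner theta jc Ht Hj n rl b Hl N HN).
    apply IH.
    + pose proof (part_partitions (rl ++ [(b - 1)%nat])) as H.
      rewrite (list_sum_lamh theta n rl b Hl) in H; exact H.
    + pose proof (length_nz (rl ++ [(b - 1)%nat])); rewrite !length_app in *; simpl in *; lia.
Qed.

(** * Formal power series *)

Lemma sum_f_R0_seq f n : sum_f_R0 f n = sum_over (seq 0 (S n)) f.
Proof.
  induction n as [|n IH]; [cbn; ring|].
  rewrite sum_over_seq_S, <- IH; reflexivity.
Qed.

Definition ps_add (f g : nat -> R) (n : nat) : R := f n + g n.
Definition ps_opp (f : nat -> R) (n : nat) : R := - f n.
Definition ps_sub (f g : nat -> R) (n : nat) : R := f n - g n.
Definition ps_zero (n : nat) : R := 0.
Definition ps_const (c : R) (n : nat) : R := c * ps_one n.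
Definition ps_X (n : nat) : R := if Nat.eqb n 1 then 1 else 0.
Definition geo (a : R) (n : nat) : R := a ^ n.
Definition ps_euler (f : nat -> R) (n : nat) : R := INR n * f n.

Lemma ps_mul_seq f g n :
  ps_mul f g n = sum_over (seq 0 (S n)) (fun j => f j * g (n - j)%nat).
Proof. apply sum_f_R0_seq. Qed.

Lemma sum_triangle2 n f :
  sum_over (seq 0 (S n)) (fun j => sum_over (seq 0 (S j)) (fun i => f i (j - i)%nat)) =
  sum_over (seq 0 (S n)) (fun i => sum_over (seq 0 (S (n - i))) (fun k => f i k)).
Proof.
  induction n as [|n IH]; [cbn; ring|].
  rewrite sum_over_seq_S, IH, (sum_over_seq_S 0 (S n) (fun i => sum_over _ _)).
  rewrite (sum_over_ext (seq 0 (S n)) (fun i => sum_over (seq 0 (S (S n - i))) _)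
    (fun i => sum_over (seq 0 (S (n - i))) (fun k => f i k) + f i (S n - i)%nat)).
  - rewrite sum_over_plus, Rplus_assoc; f_equal; change (0 + S n)%nat with (S n).
    rewrite (sum_over_seq_S 0 (S n) (fun i => f i (S n - i)%nat)); change (0 + S n)%nat with (S n).
    f_equal; rewrite Nat.sub_diag; cbn; ring.
  - intros i Hi; apply in_seq in Hi.
    replace (S n - i)%nat with (S (n - i)) by lia; apply sum_over_seq_S.
Qed.

Lemma ps_mul_comm f g : ps_mul f g = ps_mul g f.
Proof.
  extensionality n; rewrite !ps_mul_seq, sum_over_seq_rev; apply sum_over_ext; intros j Hj.
  apply in_seq in Hj; replace (n - (n - j))%nat with j by lia; ring.
Qed.

Lemma ps_mul_assoc f g h : ps_mul f (ps_mul g h) = ps_mul (ps_mul f g) h.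
Proof.
  extensionality n; rewrite !ps_mul_seq.
  rewrite (sum_over_ext _ (fun j => ps_mul f g j * _) (fun j => sum_over (seq 0 (S j)) (fun i =>
    f i * g (j - i)%nat * h (n - (i + (j - i)))%nat))).
  - rewrite (sum_triangle2 n (fun i k => f i * g k * h (n - (i + k))%nat)).
    apply sum_over_ext; intros i Hi; rewrite ps_mul_seq, <- sum_over_scal.
    apply sum_over_ext; intros k _; rewrite Nat.sub_add_distr; ring.
  - intros j Hj; rewrite ps_mul_seq, <- sum_over_scal_r; apply sum_over_ext; intros i Hi.
    apply in_seq in Hi; replace (i + (j - i))%nat with j by lia; reflexivity.
Qed.

Lemma ps_mul_const_l c f n : ps_mul (ps_const c) f n = c * f n.
Proof.
  rewrite ps_mul_seq, (sum_over_single Nat.eq_dec _ _ 0%nat); auto using seq_NoDup.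
  - unfold ps_const, ps_one; cbn [Nat.eqb]; rewrite Nat.sub_0_r; ring.
  - left; reflexivity.
  - intros j _ Hj; unfold ps_const, ps_one; destruct (Nat.eqb_spec j 0); [contradiction|ring].
Qed.

Lemma ps_const_1 : ps_const 1 = ps_one.
Proof. extensionality n; unfold ps_const; ring. Qed.

Lemma ps_mul_1_l f : ps_mul ps_one f = f.
Proof. rewrite <- ps_const_1; extensionality n; rewrite ps_mul_const_l; ring. Qed.

Lemma ps_mul_add_l f g h : ps_mul (ps_add f g) h = ps_add (ps_mul f h) (ps_mul g h).
Proof.
  extensionality n; unfold ps_add; rewrite !ps_mul_seq, <- sum_over_plus.
  apply sum_over_ext; intros; ring.
Qed.

Lemma ps_ring_theory :
  ring_theory ps_zero ps_one ps_add ps_mul ps_sub ps_opp (@eq (nat -> R)).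
Proof.
  constructor; intros; auto using ps_mul_1_l, ps_mul_comm, ps_mul_assoc, ps_mul_add_l;
    extensionality n; unfold ps_zero, ps_add, ps_opp, ps_sub; ring.
Qed.
Add Ring ps_ring : ps_ring_theory.

Lemma ps_mul_X_0 f : ps_mul ps_X f 0%nat = 0.
Proof. rewrite ps_mul_seq; cbn; ring. Qed.

Lemma ps_mul_X_S f n : ps_mul ps_X f (S n) = f n.
Proof.
  rewrite ps_mul_seq, (sum_over_single Nat.eq_dec _ _ 1%nat); auto using seq_NoDup.
  - unfold ps_X; cbn [Nat.eqb]; replace (S n - 1)%nat with n by lia; ring.
  - apply in_seq; lia.
  - intros j _ Hj; unfold ps_X; destruct (Nat.eqb_spec j 1); [contradiction|ring].
Qed.

Definition lin (a : R) : nat -> R := ps_sub ps_one (ps_mul (ps_const a) ps_X).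

Lemma lin_geo a : ps_mul (lin a) (geo a) = ps_one.
Proof.
  transitivity (ps_sub (geo a) (ps_mul ps_X (ps_mul (ps_const a) (geo a)))); [unfold lin; ring|].
  extensionality n; unfold ps_sub; destruct n as [|n].
  - rewrite ps_mul_X_0; unfold geo, ps_one; cbn; ring.
  - rewrite ps_mul_X_S, ps_mul_const_l; unfold geo, ps_one; cbn; ring.
Qed.

Lemma ps_euler_mul f g : ps_euler (ps_mul f g) = ps_add (ps_mul (ps_euler f) g) (ps_mul f (ps_euler g)).
Proof.
  extensionality n; unfold ps_euler, ps_add; rewrite !ps_mul_seq, <- sum_over_plus, <- sum_over_scal.
  apply sum_over_ext; intros j Hj; apply in_seq in Hj; rewrite minus_INR by lia; ring.
Qed.

Lemma ps_euler_lin a : ps_euler (lin a) = ps_opp (ps_mul (ps_const a) ps_X).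
Proof.
  extensionality n; unfold ps_euler, lin, ps_sub, ps_opp; rewrite ps_mul_const_l.
  unfold ps_one, ps_X; destruct n as [|[|n]]; cbn [Nat.eqb INR]; ring.
Qed.

Definition powers (a : R) (n : nat) : R := if Nat.eqb n 0 then 0 else a ^ n.

Lemma powers_geo a : powers a = ps_mul (ps_mul (ps_const a) ps_X) (geo a).
Proof.
  extensionality n.
  replace (ps_mul (ps_mul (ps_const a) ps_X) (geo a)) with (ps_mul ps_X (ps_mul (ps_const a) (geo a))) by ring.
  destruct n as [|n]; [rewrite ps_mul_X_0; reflexivity|].
  rewrite ps_mul_X_S, ps_mul_const_l; reflexivity.
Qed.

Lemma ps_euler_lin_powers a : ps_euler (lin a) = ps_opp (ps_mul (lin a) (powers a)).
Proof.
  rewrite ps_euler_lin, powers_geo.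
  replace (ps_mul (lin a) (ps_mul (ps_mul (ps_const a) ps_X) (geo a)))
    with (ps_mul (ps_mul (ps_const a) ps_X) (ps_mul (lin a) (geo a))) by ring.
  rewrite lin_geo; ring.
Qed.

Definition ps_prod (l : list (nat -> R)) : nat -> R := fold_right ps_mul ps_one l.
Definition ps_sum (l : list (nat -> R)) : nat -> R := fold_right ps_add ps_zero l.

Lemma ps_euler_one : ps_euler ps_one = ps_zero.
Proof. extensionality n; unfold ps_euler, ps_one; destruct n; cbn [Nat.eqb INR]; unfold ps_zero; ring. Qed.

Lemma ps_euler_prod_lin ys : ps_euler (ps_prod (map lin ys)) =
  ps_opp (ps_mul (ps_prod (map lin ys)) (ps_sum (map powers ys))).
Proof.
  unfold ps_prod, ps_sum; induction ys as [|y ys IH]; cbn [map fold_right].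
  - rewrite ps_euler_one; ring.
  - rewrite ps_euler_mul, IH, ps_euler_lin_powers; ring.
Qed.

Lemma ps_prod_lin_cancel ys f g :
  ps_mul f (ps_prod (map lin ys)) = ps_mul g (ps_prod (map lin ys)) -> f = g.
Proof.
  revert f g; induction ys as [|y ys IH]; intros f g H.
  - cbn in H; unfold ps_prod in H; cbn in H.
    transitivity (ps_mul f ps_one); [ring|rewrite H; ring].
  - assert (E : ps_mul f (lin y) = ps_mul g (lin y)).
    { apply IH; cbn in H; unfold ps_prod in *; cbn in H; rewrite <- !ps_mul_assoc; exact H. }
    apply (f_equal (fun h => ps_mul h (geo y))) in E.
    rewrite <- !ps_mul_assoc, lin_geo in E.
    transitivity (ps_mul f ps_one); [ring|rewrite E; ring].
Qed.

(** From [z d/dz log (1 - y z) = - sum_(k >= 1) y^k z^k]: the product formula becomes a difference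
    of power sums. *)
Lemma log_derivative A ys h :
  ps_mul A (ps_prod (map (fun y => lin (y - h)) ys)) = ps_prod (map lin ys) ->
  ps_euler A = ps_mul A (ps_sub (ps_sum (map (fun y => powers (y - h)) ys)) (ps_sum (map powers ys))).
Proof.
  intros H.
  assert (Em : forall F : R -> nat -> R, map (fun y => F (y - h)) ys = map F (map (fun y => y - h) ys))
    by (intros; rewrite map_map; reflexivity).
  rewrite (Em lin) in H; rewrite (Em powers).
  pose proof (f_equal ps_euler H) as E.
  rewrite ps_euler_mul, !ps_euler_prod_lin, <- H in E.
  apply (ps_prod_lin_cancel (map (fun y => y - h) ys)).
  set (Q := ps_prod _) in *; set (S1 := ps_sum (map powers (map _ _))) in *; set (S2 := ps_sum _) in *.
  transitivity (ps_add (ps_mul A (ps_mul Q S1))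
     (ps_add (ps_mul (ps_euler A) Q) (ps_mul A (ps_opp (ps_mul Q S1))))); [ring|].
  rewrite E; ring.
Qed.

Definition ps_scale (s : R) (f : nat -> R) (n : nat) : R := f n * s ^ n.

Lemma ps_scale_mul s f g : ps_scale s (ps_mul f g) = ps_mul (ps_scale s f) (ps_scale s g).
Proof.
  extensionality n; unfold ps_scale; rewrite !ps_mul_seq, <- sum_over_scal_r.
  apply sum_over_ext; intros j Hj; apply in_seq in Hj.
  replace n with (j + (n - j))%nat at 2 by lia; rewrite pow_add; ring.
Qed.

Lemma ps_scale_lin s a : ps_scale s (lin a) = lin (a * s).
Proof.
  extensionality n; unfold ps_scale, lin, ps_sub; rewrite !ps_mul_const_l.
  unfold ps_one, ps_X; destruct n as [|[|n]]; cbn [Nat.eqb pow]; ring.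
Qed.

Lemma ps_scale_prod s l : ps_scale s (ps_prod l) = ps_prod (map (ps_scale s) l).
Proof.
  unfold ps_prod; induction l as [|f l IH]; cbn [map fold_right].
  - extensionality n; unfold ps_scale, ps_one; destruct n; cbn [Nat.eqb pow]; ring.
  - rewrite ps_scale_mul, IH; reflexivity.
Qed.

(** * Eigenvalues and moments *)

(* Coefficient of the leading term [x^mu] of [Lop^(K-1) (iota J_mu)], as a function
   of the exponent [b] of the distinguished variable. *)
Definition tval theta mu (b : nat) (K : nat) : R :=
  match K with O => 0 | S K => Bprod theta mu (repeat 0 K) INR b end.

Lemma tval_SS theta mu b K : tval theta mu b (S (S K)) =
  (INR b - theta * INR (length mu)) * tval theta mu b (S K) +
  theta * sum_over mu (fun x => if Nat.ltb x b then tval theta mu b (S K) - tval theta mu x (S K) else 0).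
Proof. cbn [tval repeat Bprod]; unfold Bop; ring. Qed.

(** An empty row changes the shift [theta * length mu] and the sum over smaller values by opposite
    amounts, because [tval] vanishes at [b = 0]. *)
Lemma tval_pad theta mu k b K : tval theta (mu ++ repeat 0%nat k) b K = tval theta mu b K.
Proof.
  assert (H0 : forall nu K, tval theta nu 0 K = 0).
  { intros nu [|K']; [reflexivity|]; induction K' as [|K' IH]; [reflexivity|].
    rewrite tval_SS, IH, sum_over_0; [ring|].
    intros x _; destruct (Nat.ltb_spec x 0); [lia|reflexivity]. }
  destruct K as [|K]; [reflexivity|]; revert b; induction K as [|K IH]; intros b; [reflexivity|].
  rewrite !tval_SS, sum_over_app, IH.
  rewrite (sum_over_ext mu _ (fun x => if Nat.ltb x b then tval theta mu b (S K) - tval theta mu x (S K) else 0))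
    by (intros; rewrite IH; reflexivity).
  destruct b as [|b]; [rewrite H0, (sum_over_0 (repeat 0%nat k)); [ring|]|].
  - intros x _; destruct (Nat.ltb_spec x 0); [lia|reflexivity].
  - rewrite (sum_over_ext (repeat 0%nat k) _ (fun _ => tval theta mu (S b) (S K))).
    + rewrite sum_over_const, length_app, repeat_length, plus_INR; ring.
    + intros x Hx; apply repeat_spec in Hx; subst; rewrite IH, H0; cbn [Nat.ltb Nat.leb]; ring.
Qed.

Fixpoint coords theta (i : nat) (l : list nat) : list R :=
  match l with [] => [] | x :: t => (INR x - theta * INR i) :: coords theta (S i) t end.

Section Eigenvalue.
Variables (theta : R) (mu : list nat).
Let n := length mu.

Definition Vser (b : nat) : nat -> R := ps_add ps_one (tval theta mu b).

(** Adding 1 to the generating series makes the right side independent of [b]: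
    [(1 - z Bop) Vser = 1 + theta n z], since [Bop] maps the constant 1 to [b - theta n]. The
    diagonal part of [Bop] is then kept on the left. *)
Lemma Vser_eq b : ps_mul (Vser b) (lin (dval theta mu b)) =
  ps_sub (lin (- theta * INR n))
    (ps_mul (ps_mul (ps_const theta) ps_X)
       (fun K => sum_over mu (fun x => if Nat.ltb x b then Vser x K else 0))).
Proof.
  set (S1 := fun K => sum_over mu (fun x => if Nat.ltb x b then Vser x K else 0)).
  transitivity (ps_sub (Vser b) (ps_mul ps_X (ps_mul (ps_const (dval theta mu b)) (Vser b)))); [unfold lin; ring|].
  transitivity (ps_sub (lin (- theta * INR n)) (ps_mul ps_X (ps_mul (ps_const theta) S1))); [|unfold S1; ring].
  extensionality K; unfold ps_sub, lin, ps_sub; rewrite ps_mul_const_l; destruct K as [|K].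
  - rewrite !ps_mul_X_0; unfold Vser, ps_add, ps_X; cbn; ring.
  - rewrite !ps_mul_X_S, !ps_mul_const_l; unfold S1, Vser, ps_add.
    destruct K as [|K].
    + unfold tval at 1; cbn [Bprod repeat]; unfold dval, ps_one, ps_X; cbn [Nat.eqb tval].
      rewrite (sum_over_ext mu (fun x => if Nat.ltb x b then 1 + 0 else 0) (fun x => if Nat.ltb x b then 1 else 0))
        by (intros x _; destruct (Nat.ltb x b); ring).
      unfold n; ring.
    + rewrite tval_SS; unfold ps_one, ps_X; cbn [Nat.eqb]; unfold dval.
      rewrite (sum_over_ext mu (fun x => if Nat.ltb x b then tval theta mu b (S K) - tval theta mu x (S K) else 0)
        (fun x => (if Nat.ltb x b then 1 else 0) * tval theta mu b (S K) -
                  (if Nat.ltb x b then 0 + tval theta mu x (S K) else 0)))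
        by (intros x _; destruct (Nat.ltb x b); ring).
      rewrite sum_over_minus, sum_over_scal_r; ring.
Qed.

(* The partial sums [P] over the last rows satisfy [P_i (1-(y_i-theta)z) =
   P_(i+1) (1-y_i z)]; rows of equal length contribute the same series. *)
Lemma Vser_suffix pre suf : desc mu -> mu = pre ++ suf ->
  ps_mul (ps_sub (lin (- theta * INR n)) (ps_mul (ps_mul (ps_const theta) ps_X)
      (fun K => sum_over suf (fun x => Vser x K))))
    (ps_prod (map (fun y => lin (y - theta)) (coords theta (length pre) suf))) =
  ps_mul (lin (- theta * INR n)) (ps_prod (map lin (coords theta (length pre) suf))).
Proof.
  intros Hd; revert pre; induction suf as [|b suf IH]; intros pre Hmu.
  - unfold ps_prod; cbn [coords map fold_right].
    replace (fun K => sum_over [] (fun x => Vser x K)) with ps_zero by reflexivity; ring.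
  - specialize (IH (pre ++ [b])); rewrite <- app_assoc, length_app in IH.
    replace (length pre + length [b])%nat with (S (length pre)) in IH by (simpl; lia).
    specialize (IH Hmu); unfold ps_prod in *; cbn [coords map fold_right].
    set (Q1 := fold_right ps_mul ps_one (map (fun y => lin (y - theta)) _)) in *.
    set (Q2 := fold_right ps_mul ps_one (map lin _)) in *.
    set (L0 := lin (- theta * INR n)) in *.
    set (Ps := fun K => sum_over suf (fun x => Vser x K)) in *.
    assert (E1 : (fun K => sum_over (b :: suf) (fun x => Vser x K)) = ps_add (Vser b) Ps) by reflexivity.
    rewrite E1.
    set (y := INR b - theta * INR (length pre)).
    set (zt := ps_mul (ps_const theta) ps_X) in *.
    assert (E2 : ps_sub L0 (ps_mul zt Ps) = ps_mul (Vser b) (lin (y - theta))).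
    { set (e := sum_over suf (fun x => if Nat.ltb x b then 0 else 1)).
      assert (EP : Ps = ps_add (fun K => sum_over mu (fun x => if Nat.ltb x b then Vser x K else 0))
                          (ps_mul (ps_const e) (Vser b))).
      { rewrite Hmu in Hd; destruct (desc_app_inv _ _ Hd) as (_ & Hd2 & Hd3).
        destruct Hd2 as [Hd2 _].
        extensionality K; unfold ps_add at 1; rewrite ps_mul_const_l, Hmu, sum_over_app, sum_over_cons.
        rewrite Nat.ltb_irrefl, (sum_over_0 pre).
        - unfold e, Ps; rewrite <- sum_over_scal_r, Rplus_0_l, Rplus_0_l, <- sum_over_plus.
          apply sum_over_ext; intros x Hx; destruct (Nat.ltb_spec x b); [ring|].
          specialize (Hd2 x Hx); replace x with b by lia; ring.
        - intros x Hx; specialize (Hd3 x b Hx (or_introl eq_refl)).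
          destruct (Nat.ltb_spec x b); [lia|reflexivity]. }
      rewrite EP; pose proof (Vser_eq b) as EV; fold L0 zt in EV.
      transitivity (ps_sub (ps_mul (Vser b) (lin (dval theta mu b))) (ps_mul zt (ps_mul (ps_const e) (Vser b)))).
      { rewrite EV; ring. }
      assert (El : lin (y - theta) = ps_sub (lin (dval theta mu b)) (ps_mul zt (ps_const e))).
      { assert (Ed : y - theta = dval theta mu b + theta * e).
        { unfold y, dval, e; rewrite Hmu in Hd; destruct (desc_app_inv _ _ Hd) as (_ & _ & Hd3).
          rewrite Hmu, sum_over_app, sum_over_cons, Nat.ltb_irrefl, length_app, (sum_over_0 pre).
          - assert (sum_over suf (fun x => if Nat.ltb x b then 1 else 0) +
              sum_over suf (fun x => if Nat.ltb x b then 0 else 1) = INR (length suf)) as Es.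
            { rewrite <- sum_over_plus, <- (Rmult_1_r (INR _)), <- sum_over_const.
              apply sum_over_ext; intros x _; destruct (Nat.ltb x b); ring. }
            cbn [length]; rewrite plus_INR, S_INR, <- Es; ring.
          - intros x Hx; specialize (Hd3 x b Hx (or_introl eq_refl)).
            destruct (Nat.ltb_spec x b); [lia|reflexivity]. }
        rewrite Ed; unfold lin, zt.
        extensionality K; unfold ps_sub.
        replace (ps_mul (ps_mul (ps_const theta) ps_X) (ps_const e)) with
          (ps_mul (ps_const theta) (ps_mul (ps_const e) ps_X)) by ring.
        rewrite !ps_mul_const_l; ring. }
      rewrite El; ring. }
    assert (E3 : ps_sub L0 (ps_mul zt (ps_add (Vser b) Ps)) = ps_mul (Vser b) (lin y)).
    { assert (El : lin y = ps_sub (lin (y - theta)) zt).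
      { unfold lin, zt; extensionality K; unfold ps_sub; rewrite !ps_mul_const_l; ring. }
      transitivity (ps_sub (ps_sub L0 (ps_mul zt Ps)) (ps_mul zt (Vser b))); [ring|].
      rewrite E2, El; ring. }
    rewrite E3.
    transitivity (ps_mul (lin y) (ps_mul (ps_mul (Vser b) (lin (y - theta))) Q1)); [ring|].
    rewrite <- E2, IH; ring.
Qed.

Lemma eigenvalue_product : desc mu ->
  ps_mul (ps_sub ps_one (ps_mul (ps_mul (ps_const theta) ps_X) (fun K => sum_over mu (fun x => tval theta mu x K))))
    (ps_prod (map (fun y => lin (y - theta)) (coords theta 0 mu))) =
  ps_mul (lin (- theta * INR n)) (ps_prod (map lin (coords theta 0 mu))).
Proof.
  intros Hd; pose proof (Vser_suffix [] mu Hd eq_refl) as E0; cbn [length] in E0.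
  rewrite <- E0; f_equal.
  replace (fun K => sum_over mu (fun x => Vser x K)) with
    (ps_add (ps_const (INR n)) (fun K => sum_over mu (fun x => tval theta mu x K))).
  - unfold lin; set (H := fun K => _).
    transitivity (ps_sub (ps_add ps_one (ps_mul (ps_sub (ps_mul (ps_const theta) (ps_const (INR n)))
       (ps_mul (ps_const theta) (ps_const (INR n)))) ps_X)) (ps_mul (ps_mul (ps_const theta) ps_X) H)); [ring|].
    assert (E : ps_const (- theta * INR n) = ps_opp (ps_mul (ps_const theta) (ps_const (INR n)))).
    { extensionality K; unfold ps_opp; rewrite ps_mul_const_l; unfold ps_const; ring. }
    rewrite E; ring.
  - extensionality K; unfold Vser, ps_add, ps_const; rewrite sum_over_plus, sum_over_const; reflexivity.
Qed.
End Eigenvalue.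

Lemma sum_over_opp {A} (l : list A) f : sum_over l (fun x => - f x) = - sum_over l f.
Proof.
  induction l as [|x l IH]; rewrite ?sum_over_nil, ?sum_over_cons, ?IH; ring.
Qed.

Lemma ps_sum_eval (F : R -> nat -> R) ys k : ps_sum (map F ys) k = sum_over ys (fun y => F y k).
Proof.
  unfold ps_sum; induction ys as [|y ys IH]; [reflexivity|].
  cbn [map fold_right]; unfold ps_add at 1; rewrite IH; reflexivity.
Qed.

Lemma coords_seq theta j l :
  coords theta j l = map (fun i => INR (nth i l 0%nat) - theta * INR (j + i)) (seq 0 (length l)).
Proof.
  revert j; induction l as [|x l IH]; intros j; [reflexivity|].
  cbn [coords length seq map]; rewrite IH, <- seq_shift, map_map; f_equal.
  - rewrite Nat.add_0_r; reflexivity.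
  - apply map_ext; intros i; cbn [nth]; do 3 f_equal; lia.
Qed.

Definition hhat theta N lam K : R :=
  sum_over lam (fun x => tval theta lam x K) / (INR N * (theta * INR N) ^ K).

(* [What] is [1 - z h(z)] and [Ahat] is [(1 - z h(z)) / (1 + z)]. *)
Definition What (h : nat -> R) (k : nat) : R := match k with O => 1 | S K => - h K end.
Definition Ahat (h : nat -> R) : nat -> R := ps_mul (What h) (geo (-1)).

Definition ycoord theta N lam i : R := INR (nth i lam 0%nat) / (theta * INR N) - INR i / INR N.

(** Power sums of the [y_i] minus those of the [y_i - 1/N]; to leading order [k] times the moment of
    order [k - 1]. *)
Definition cdiff theta N lam k : R :=
  sum_over (seq 0 N) (fun i => ycoord theta N lam i ^ k - (ycoord theta N lam i - / INR N) ^ k).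

Lemma desc_repeat0 k : desc (repeat 0%nat k).
Proof. induction k; cbn; auto; split; auto; intros y Hy; apply repeat_spec in Hy; lia. Qed.

Lemma desc_pad l k : desc l -> desc (l ++ repeat 0%nat k).
Proof.
  induction l as [|a l IH]; cbn [app desc]; intros H; [apply desc_repeat0|].
  destruct H as [H1 H2]; split; auto.
  intros y Hy; apply in_app_iff in Hy; destruct Hy as [Hy|Hy]; auto.
  apply repeat_spec in Hy; lia.
Qed.

(** Zero rows pad [lam] to [N] coordinates. Scaling [z] by [/ (theta * INR N)] turns the coordinates
    into the [y_i], the shift [theta] into [1/N], and [1 + theta N z] into the factor [1 + z]
    divided out in [Ahat]. *)
Lemma Ahat_euler theta N lam : 0 < theta -> (1 <= N)%nat -> desc lam -> (length lam <= N)%nat ->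
  ps_euler (Ahat (hhat theta N lam)) =
  ps_opp (ps_mul (Ahat (hhat theta N lam)) (cdiff theta N lam)).
Proof.
  intros Ht HN Hd Hl.
  assert (HN' : INR N <> 0) by (apply not_0_INR; lia).
  set (mu := lam ++ repeat 0%nat (N - length lam)).
  assert (Hlen : length mu = N) by (unfold mu; rewrite length_app, repeat_length; lia).
  pose proof (eigenvalue_product theta mu (desc_pad _ _ Hd)) as E; rewrite Hlen in E.
  set (s := / (theta * INR N)) in *.
  apply (f_equal (ps_scale s)) in E; rewrite !ps_scale_mul, !ps_scale_prod, !map_map in E.
  set (ys := map (ycoord theta N lam) (seq 0 N)).
  assert (Ey : coords theta 0 mu = map (fun y => y * (theta * INR N)) ys).
  { rewrite coords_seq, Hlen; unfold ys; rewrite map_map; apply map_ext; intros i.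
    unfold ycoord, mu; cbn [Nat.add].
    assert (nth i (lam ++ repeat 0%nat (N - length lam)) 0%nat = nth i lam 0%nat) as ->.
    { destruct (Nat.lt_ge_cases i (length lam)); [apply app_nth1; auto|].
      rewrite app_nth2, nth_repeat, nth_overflow by auto; reflexivity. }
    field; split; auto; lra. }
  rewrite Ey, !map_map in E.
  rewrite (map_ext (fun x => ps_scale s (lin (x * (theta * INR N) - theta))) (fun y => lin (y - / INR N))) in E.
  2:{ intros y; rewrite ps_scale_lin; f_equal; unfold s; field; split; auto; lra. }
  rewrite (map_ext (fun x => ps_scale s (lin (x * (theta * INR N)))) lin) in E.
  2:{ intros y; rewrite ps_scale_lin; f_equal; unfold s; field; split; auto; lra. }
  rewrite ps_scale_lin in E.
  replace (- theta * INR N * s) with (-1) in E by (unfold s; field; split; auto; lra).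
  match type of E with ps_mul (ps_scale s ?w) _ = _ =>
    assert (EW : ps_scale s w = What (hhat theta N lam)) end.
  { set (Hh := fun K : nat => _).
    replace (ps_mul (ps_mul (ps_const theta) ps_X) Hh) with (ps_mul ps_X (ps_mul (ps_const theta) Hh)) by ring.
    extensionality k; unfold ps_scale, ps_sub; destruct k as [|K].
    - rewrite ps_mul_X_0; unfold ps_one; cbn; ring.
    - rewrite ps_mul_X_S, ps_mul_const_l; unfold ps_one, Hh, hhat; cbn [Nat.eqb What].
      unfold mu; rewrite sum_over_app, (sum_over_0 (repeat 0%nat _)).
      + rewrite (sum_over_ext lam _ (fun x => tval theta lam x K)) by (intros; apply tval_pad).
        unfold s; cbn [pow]; rewrite pow_inv; field; repeat split; auto; try lra.
        apply pow_nonzero, Rmult_integral_contrapositive; split; auto; lra.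
      + intros x Hx; apply repeat_spec in Hx; rewrite Hx, tval_pad.
        destruct K as [|K]; [reflexivity|]; induction K as [|K IH]; [reflexivity|].
        rewrite tval_SS, IH, sum_over_0; [ring|].
        intros z _; destruct (Nat.ltb_spec z 0); [lia|reflexivity]. }
  rewrite EW in E.
  assert (EA : ps_mul (Ahat (hhat theta N lam)) (ps_prod (map (fun y => lin (y - / INR N)) ys)) =
    ps_prod (map lin ys)).
  { unfold Ahat.
    transitivity (ps_mul (geo (-1)) (ps_mul (What (hhat theta N lam))
      (ps_prod (map (fun y => lin (y - / INR N)) ys)))); [ring|].
    rewrite E; transitivity (ps_mul (ps_mul (lin (-1)) (geo (-1))) (ps_prod (map lin ys))); [ring|].
    rewrite lin_geo; ring. }
  rewrite (log_derivative _ _ _ EA).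
  assert (EC : ps_sub (ps_sum (map (fun y => powers (y - / INR N)) ys)) (ps_sum (map powers ys)) =
    ps_opp (cdiff theta N lam)).
  { extensionality k; unfold ps_sub, ps_opp, cdiff.
    rewrite (ps_sum_eval (fun y => powers (y - / INR N))), (ps_sum_eval powers).
    unfold ys; rewrite !sum_over_map, <- sum_over_minus.
    rewrite <- sum_over_opp.
    apply sum_over_ext; intros i _; unfold powers; destruct k as [|k]; cbn [Nat.eqb pow]; ring. }
  rewrite EC; ring.
Qed.

Lemma moment_sum theta N lam k : (1 <= N)%nat ->
  INR N * moment theta N lam k = sum_over (seq 0 N) (fun i => ycoord theta N lam i ^ k).
Proof.
  intros HN; assert (INR N <> 0) by (apply not_0_INR; lia).
  unfold moment; rewrite sum_f_R0_seq; replace (S (N - 1)) with N by lia.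
  unfold ycoord; field; auto.
Qed.

(** Binomial expansion of [(y - 1/N)^(k+1)]: the term [i = k] is the moment on the left, and each
    lower one carries a power of [1/N]. *)
Lemma cdiff_moment theta N lam k : (1 <= N)%nat ->
  INR (S k) * moment theta N lam k = cdiff theta N lam (S k) +
  sum_over (seq 0 k) (fun i => C (S k) i * (-1) ^ (S k - i) * / INR N ^ (k - i) * moment theta N lam i).
Proof.
  intros HN; assert (HN' : INR N <> 0) by (apply not_0_INR; lia).
  assert (E : cdiff theta N lam (S k) = - sum_over (seq 0 (S k)) (fun i =>
     C (S k) i * (- / INR N) ^ (S k - i) * (INR N * moment theta N lam i))).
  { unfold cdiff.
    rewrite (sum_over_ext (seq 0 (S k)) _ (fun i => sum_over (seq 0 N) (fun j =>
      C (S k) i * (- / INR N) ^ (S k - i) * ycoord theta N lam j ^ i)))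
      by (intros; rewrite moment_sum, sum_over_scal by auto; reflexivity).
    rewrite sum_over_swap, <- sum_over_opp.
    apply sum_over_ext; intros j _; set (y := ycoord theta N lam j).
    unfold Rminus at 2; rewrite binomial, sum_f_R0_seq, sum_over_seq_S, Nat.add_0_l, Nat.sub_diag.
    assert (C (S k) (S k) = 1) as ->.
    { unfold C; rewrite Nat.sub_diag; change (fact 0) with 1%nat; rewrite INR_1; field; apply INR_fact_neq_0. }
    rewrite (sum_over_ext (seq 0 (S k)) (fun i => C (S k) i * y ^ i * (- / INR N) ^ (S k - i))
      (fun i => C (S k) i * (- / INR N) ^ (S k - i) * y ^ i)) by (intros; ring).
    cbn [pow]; ring. }
  rewrite E, sum_over_seq_S, Nat.add_0_l.
  replace (S k - k)%nat with 1%nat by lia.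
  assert (EC : C (S k) k = INR (S k)).
  { unfold C; replace (S k - k)%nat with 1%nat by lia.
    rewrite (fact_simpl k), mult_INR; change (fact 1) with 1%nat; rewrite INR_1.
    field; apply INR_fact_neq_0. }
  rewrite EC, pow_1.
  rewrite (sum_over_ext (seq 0 k) (fun i => C (S k) i * (-1) ^ (S k - i) * / INR N ^ (k - i) * moment theta N lam i)
    (fun i => C (S k) i * (- / INR N) ^ (S k - i) * (INR N * moment theta N lam i))).
  - field; auto.
  - intros i Hi; apply in_seq in Hi.
    replace (S k - i)%nat with (S (k - i)) by lia; cbn [pow].
    replace (- / INR N) with ((-1) * / INR N) by ring.
    rewrite Rpow_mult_distr, pow_inv; field; split; auto; apply pow_nonzero; auto.
Qed.

(** * Lagrange inversion *)

Fixpoint ps_pow (f : nat -> R) (m : nat) : nat -> R :=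
  match m with O => ps_one | S m => ps_mul f (ps_pow f m) end.

Lemma ps_mul_Xpow j f k : ps_mul (ps_pow ps_X j) f k = if Nat.ltb k j then 0 else f (k - j)%nat.
Proof.
  revert k; induction j as [|j IH]; intros k; cbn [ps_pow].
  - rewrite ps_mul_1_l, Nat.sub_0_r; reflexivity.
  - rewrite <- ps_mul_assoc; destruct k as [|k]; [rewrite ps_mul_X_0; reflexivity|].
    rewrite ps_mul_X_S, IH; reflexivity.
Qed.

Lemma ps_mul_at0 f g : ps_mul f g 0%nat = f 0%nat * g 0%nat.
Proof. rewrite ps_mul_seq; cbn; ring. Qed.

Lemma ps_euler_pow f m :
  ps_euler (ps_pow f (S m)) = ps_mul (ps_const (INR (S m))) (ps_mul (ps_pow f m) (ps_euler f)).
Proof.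
  induction m as [|m IH].
  - cbn [ps_pow]; rewrite INR_1, ps_const_1.
    replace (ps_mul f ps_one) with f by ring; ring.
  - change (ps_pow f (S (S m))) with (ps_mul f (ps_pow f (S m))).
    rewrite ps_euler_mul, IH; cbn [ps_pow].
    assert (ps_const (INR (S (S m))) = ps_add ps_one (ps_const (INR (S m)))) as ->.
    { extensionality n; unfold ps_add, ps_const; rewrite (S_INR (S m)); ring. }
    ring.
Qed.

Section Lagrange.
Variable a : nat -> R.
(** With [v = w], [beta / v] is the bracket in the theorem and [gamma = 1 / (1 + v)] its geometric
    series. *)
Let beta := ps_add ps_one (ps_mul ps_X a).
Let gamma := geo (-1).

(* [Lam g = a g + (g - g 0)/v - g 0] in the series variable [v]. *)
Definition Lam (g : nat -> R) (n : nat) : R :=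
  ps_mul a g n + g (S n) - (if Nat.eqb n 0 then g 0%nat else 0).

Fixpoint Lam_pow (K : nat) (g : nat -> R) : nat -> R :=
  match K with O => g | S K => Lam (Lam_pow K g) end.

Definition Ecoef (K : nat) : R := Lam_pow K ps_one 0%nat.

(** Multiplied by [v], [Lam] becomes multiplication by [beta] minus [g 0] times [1 + v]; in this
    form it can be iterated in closed form. *)
Lemma Lam_X g : ps_mul ps_X (Lam g) =
  ps_sub (ps_mul beta g) (ps_mul (ps_const (g 0%nat)) (lin (-1))).
Proof.
  assert (Hb : ps_mul beta g = ps_add g (ps_mul ps_X (ps_mul a g))) by (unfold beta; ring).
  rewrite Hb; extensionality n; unfold ps_sub, ps_add; rewrite ps_mul_const_l.
  unfold lin, ps_sub; rewrite ps_mul_const_l; destruct n as [|n].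
  - rewrite !ps_mul_X_0; unfold ps_one, ps_X; cbn; ring.
  - rewrite !ps_mul_X_S; unfold Lam, ps_one, ps_X; destruct n; cbn [Nat.eqb]; ring.
Qed.

Lemma Lam_pow_X m : ps_mul (ps_pow ps_X m) (Lam_pow m ps_one) =
  ps_sub (ps_pow beta m)
    (ps_mul (lin (-1)) (fun k => sum_over (seq 0 m) (fun j =>
       Ecoef j * ps_mul (ps_pow ps_X j) (ps_pow beta (m - 1 - j)) k))).
Proof.
  induction m as [|m IH].
  - cbn [ps_pow Lam_pow seq].
    replace (fun k => sum_over [] (fun j => Ecoef j * ps_mul (ps_pow ps_X j) (ps_pow beta (0 - 1 - j)) k))
      with ps_zero by reflexivity; ring.
  - cbn [ps_pow Lam_pow].
    transitivity (ps_mul (ps_pow ps_X m) (ps_mul ps_X (Lam (Lam_pow m ps_one)))); [ring|].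
    rewrite Lam_X; fold (Ecoef m).
    transitivity (ps_sub (ps_mul beta (ps_mul (ps_pow ps_X m) (Lam_pow m ps_one)))
      (ps_mul (lin (-1)) (ps_mul (ps_const (Ecoef m)) (ps_pow ps_X m)))); [ring|].
    rewrite IH; set (S1 := fun k => sum_over (seq 0 m) _).
    set (S2 := fun k => sum_over (seq 0 (S m)) _).
    assert (E : S2 = ps_add (ps_mul beta S1) (ps_mul (ps_const (Ecoef m)) (ps_pow ps_X m))).
    { extensionality k; unfold S2, ps_add; rewrite sum_over_seq_S, ps_mul_const_l, Nat.add_0_l.
      replace (S m - 1 - m)%nat with 0%nat by lia; cbn [ps_pow].
      replace (ps_mul (ps_pow ps_X m) ps_one) with (ps_pow ps_X m) by ring; f_equal.
      unfold S1; rewrite ps_mul_seq.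
      rewrite (sum_over_ext (seq 0 (S k)) _ (fun i => sum_over (seq 0 m) (fun j => Ecoef j *
        (beta i * ps_mul (ps_pow ps_X j) (ps_pow beta (m - 1 - j)) (k - i)%nat))))
        by (intros; rewrite <- sum_over_scal; apply sum_over_ext; intros; ring).
      rewrite sum_over_swap; apply sum_over_ext; intros j Hj; apply in_seq in Hj.
      rewrite sum_over_scal, <- ps_mul_seq; f_equal.
      replace (S m - 1 - j)%nat with (S (m - 1 - j)) by lia; cbn [ps_pow].
      replace (ps_mul (ps_pow ps_X j) (ps_mul beta (ps_pow beta (m - 1 - j))))
        with (ps_mul beta (ps_mul (ps_pow ps_X j) (ps_pow beta (m - 1 - j)))) by ring; reflexivity. }
    rewrite E; ring.
Qed.

(** [Lam_pow_X] solved for [beta^m] and multiplied by [g]. Below [v^m] the first term drops out; at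
    [v^m] it gives its constant term. *)
Lemma beta_pow_coef m g k :
  ps_mul (ps_pow beta m) g k = ps_mul (ps_pow ps_X m) (ps_mul (Lam_pow m ps_one) g) k +
  sum_over (seq 0 m) (fun j => Ecoef j *
     ps_mul (ps_pow ps_X j) (ps_mul (ps_mul (lin (-1)) g) (ps_pow beta (m - 1 - j))) k).
Proof.
  set (S1 := fun k => sum_over (seq 0 m) (fun j =>
       Ecoef j * ps_mul (ps_pow ps_X j) (ps_pow beta (m - 1 - j)) k)).
  assert (E : ps_pow beta m = ps_add (ps_mul (ps_pow ps_X m) (Lam_pow m ps_one)) (ps_mul (lin (-1)) S1)).
  { rewrite Lam_pow_X; fold S1; ring. }
  rewrite E.
  replace (ps_mul (ps_add (ps_mul (ps_pow ps_X m) (Lam_pow m ps_one)) (ps_mul (lin (-1)) S1)) g)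
    with (ps_add (ps_mul (ps_pow ps_X m) (ps_mul (Lam_pow m ps_one) g)) (ps_mul (ps_mul (lin (-1)) g) S1)) by ring.
  unfold ps_add at 1; f_equal; unfold S1; rewrite ps_mul_seq.
  rewrite (sum_over_ext (seq 0 (S k)) _ (fun i => sum_over (seq 0 m) (fun j => Ecoef j *
        (ps_mul (lin (-1)) g i * ps_mul (ps_pow ps_X j) (ps_pow beta (m - 1 - j)) (k - i)%nat))))
        by (intros; rewrite <- sum_over_scal; apply sum_over_ext; intros; ring).
  rewrite sum_over_swap; apply sum_over_ext; intros j _.
  rewrite sum_over_scal, <- ps_mul_seq; f_equal.
  replace (ps_mul (ps_pow ps_X j) (ps_mul (ps_mul (lin (-1)) g) (ps_pow beta (m - 1 - j))))
    with (ps_mul (ps_mul (lin (-1)) g) (ps_mul (ps_pow ps_X j) (ps_pow beta (m - 1 - j)))) by ring.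
  reflexivity.
Qed.

(** At [S k], the coefficient of [w^(-1)] in [(a + 1/w)^(k+1) / (1 + w)], that is [k + 1] times the
    formula of the theorem. *)
Definition bcoef (k : nat) : R := match k with O => 0 | S k => ps_mul (ps_pow beta (S k)) gamma k end.

Lemma Xpow_high m g k : (k < m)%nat -> ps_mul (ps_pow ps_X m) g k = 0.
Proof. intros H; rewrite ps_mul_Xpow; destruct (Nat.ltb_spec k m); [reflexivity|lia]. Qed.

Lemma lagrange_A K : bcoef (S K) = sum_over (seq 0 (S K)) (fun j => Ecoef j * ps_pow beta (K - j) (K - j)%nat).
Proof.
  cbn [bcoef]; rewrite beta_pow_coef, Xpow_high, Rplus_0_l by lia.
  apply sum_over_ext; intros j Hj; apply in_seq in Hj; f_equal.
  rewrite ps_mul_Xpow; destruct (Nat.ltb_spec K j); [lia|].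
  unfold gamma; rewrite lin_geo, ps_mul_1_l; do 2 f_equal; lia.
Qed.

Lemma gamma_eq : ps_sub ps_one (ps_mul ps_X gamma) = gamma.
Proof.
  transitivity (ps_sub (ps_mul (lin (-1)) gamma) (ps_mul ps_X gamma)); [unfold gamma; rewrite lin_geo; reflexivity|].
  unfold lin; assert (ps_const (-1) = ps_opp ps_one) as ->.
  { extensionality n; unfold ps_const, ps_opp; ring. }
  ring.
Qed.

(** A derivative has no residue; here it is the derivative of [(beta / v)^i]. *)
Lemma residue_derivative i : (1 <= i)%nat ->
  ps_mul (ps_pow beta (i - 1)) (ps_sub beta (ps_euler beta)) i = 0.
Proof.
  intros Hi; destruct i as [|i]; [lia|]; replace (S i - 1)%nat with i by lia.
  pose proof (f_equal (fun f => f (S i)) (ps_euler_pow beta i)) as E; cbv beta in E.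
  rewrite ps_mul_const_l in E; unfold ps_euler at 1 in E.
  replace (ps_mul (ps_pow beta i) (ps_sub beta (ps_euler beta))) with
    (ps_sub (ps_pow beta (S i)) (ps_mul (ps_pow beta i) (ps_euler beta))) by (cbn [ps_pow]; ring).
  unfold ps_sub; apply Rmult_eq_reg_l in E; [lra|apply not_0_INR; lia].
Qed.

(** The factor [gamma] cancels [1 + v], and [beta - v beta'] then kills the terms [j < K] of
    [beta_pow_coef] by [residue_derivative]. *)
Lemma lagrange_E K : ps_mul (ps_pow beta K) (ps_mul gamma (ps_sub beta (ps_euler beta))) K = Ecoef K.
Proof.
  rewrite beta_pow_coef, ps_mul_Xpow, Nat.ltb_irrefl, Nat.sub_diag, sum_over_0.
  - rewrite !ps_mul_at0.
    assert (ps_sub beta (ps_euler beta) 0%nat = 1) as ->.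
    { unfold ps_sub, ps_euler, beta, ps_add; rewrite ps_mul_X_0; unfold ps_one; cbn; ring. }
    change (gamma 0%nat) with 1; fold (Ecoef K); ring.
  - intros j Hj; apply in_seq in Hj; rewrite ps_mul_Xpow.
    destruct (Nat.ltb_spec K j); [lia|].
    replace (ps_mul (ps_mul (lin (-1)) (ps_mul gamma (ps_sub beta (ps_euler beta)))) (ps_pow beta (K - 1 - j)))
      with (ps_mul (ps_mul (lin (-1)) gamma) (ps_mul (ps_pow beta (K - 1 - j)) (ps_sub beta (ps_euler beta)))) by ring.
    unfold gamma; rewrite lin_geo, ps_mul_1_l.
    replace (K - 1 - j)%nat with (K - j - 1)%nat by lia.
    rewrite residue_derivative by lia; ring.
Qed.

Lemma ps_euler_X : ps_euler ps_X = ps_X.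
Proof. extensionality n; unfold ps_euler, ps_X; destruct n as [|[|n]]; cbn [Nat.eqb INR]; ring. Qed.

Lemma euler_Xgamma : ps_euler (ps_mul ps_X gamma) = ps_mul ps_X (ps_mul gamma gamma).
Proof.
  assert (E : ps_euler gamma = ps_opp (ps_mul ps_X (ps_mul gamma gamma))).
  { assert (El : ps_euler (ps_mul (lin (-1)) gamma) = ps_zero).
    { unfold gamma; rewrite lin_geo; apply ps_euler_one. }
    rewrite ps_euler_mul, ps_euler_lin in El.
    assert (Ec : ps_const (-1) = ps_opp ps_one).
    { extensionality n; unfold ps_const, ps_opp; ring. }
    rewrite Ec in El.
    transitivity (ps_mul (ps_mul (lin (-1)) gamma) (ps_euler gamma));
      [unfold gamma; rewrite lin_geo; ring|].
    transitivity (ps_sub (ps_mul gamma (ps_add (ps_mul (ps_opp (ps_mul (ps_opp ps_one) ps_X)) gamma)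
       (ps_mul (lin (-1)) (ps_euler gamma)))) (ps_mul ps_X (ps_mul gamma gamma))); [ring|].
    rewrite El; ring. }
  rewrite ps_euler_mul, ps_euler_X, E.
  transitivity (ps_mul (ps_mul ps_X gamma) (ps_sub ps_one (ps_mul ps_X gamma))); [ring|].
  rewrite gamma_eq; ring.
Qed.

(** Product rule for [v d/dv] on [beta^(K+1) v gamma], with [v d/dv (v gamma) = v gamma^2]; the
    remaining terms are [lagrange_E]. *)
Lemma lagrange_gamma2 K : ps_mul (ps_pow beta (S K)) (ps_mul gamma gamma) K = INR (S K) * Ecoef K.
Proof.
  pose proof (f_equal (fun f => f (S K)) (ps_euler_mul (ps_pow beta (S K)) (ps_mul ps_X gamma))) as E.
  cbv beta in E; rewrite euler_Xgamma, ps_euler_pow in E; unfold ps_add, ps_euler at 1 in E.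
  replace (ps_mul (ps_pow beta (S K)) (ps_mul ps_X (ps_mul gamma gamma))) with
    (ps_mul ps_X (ps_mul (ps_pow beta (S K)) (ps_mul gamma gamma))) in E by ring.
  replace (ps_mul (ps_pow beta (S K)) (ps_mul ps_X gamma)) with
    (ps_mul ps_X (ps_mul (ps_pow beta K) (ps_mul gamma beta))) in E by (cbn [ps_pow]; ring).
  replace (ps_mul (ps_mul (ps_const (INR (S K))) (ps_mul (ps_pow beta K) (ps_euler beta))) (ps_mul ps_X gamma))
    with (ps_mul ps_X (ps_mul (ps_const (INR (S K))) (ps_mul (ps_pow beta K) (ps_mul gamma (ps_euler beta))))) in E by ring.
  rewrite !ps_mul_X_S, ps_mul_const_l in E.
  rewrite <- lagrange_E.
  replace (ps_mul (ps_pow beta K) (ps_mul gamma (ps_sub beta (ps_euler beta)))) with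
    (ps_sub (ps_mul (ps_pow beta K) (ps_mul gamma beta)) (ps_mul (ps_pow beta K) (ps_mul gamma (ps_euler beta)))) by ring.
  unfold ps_sub; lra.
Qed.

(** Newton's identities for [1 - sum_K Ecoef K z^(K+1)] with power sums [bcoef]. In [lagrange_A],
    [1 = v gamma + gamma] splits the coefficient of [v^i] in [beta^i] into [bcoef i] and a part that
    resums to [lagrange_gamma2]. *)
Lemma lagrange K : bcoef (S K) = INR (S K) * Ecoef K + sum_over (seq 0 K) (fun j => Ecoef j * bcoef (K - j)).
Proof.
  assert (Ei : forall i, ps_pow beta i i = bcoef i + ps_mul (ps_pow beta i) gamma i).
  { intros i; destruct i as [|i]; [cbn [bcoef ps_pow]; rewrite ps_mul_1_l; unfold ps_one, gamma, geo; cbn; ring|].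
    cbn [bcoef].
    rewrite <- gamma_eq at 2.
    replace (ps_mul (ps_pow beta (S i)) (ps_sub ps_one (ps_mul ps_X gamma))) with
      (ps_sub (ps_pow beta (S i)) (ps_mul ps_X (ps_mul (ps_pow beta (S i)) gamma))) by ring.
    unfold ps_sub; rewrite ps_mul_X_S; ring. }
  rewrite lagrange_A, (sum_over_ext _ _ (fun j => Ecoef j * bcoef (K - j) +
    Ecoef j * ps_mul (ps_pow beta (K - j)) gamma (K - j)%nat)) by (intros; rewrite Ei; ring).
  rewrite sum_over_plus, Rplus_comm; f_equal.
  - rewrite <- lagrange_gamma2, beta_pow_coef, Xpow_high, Rplus_0_l by lia.
    apply sum_over_ext; intros j Hj; apply in_seq in Hj; f_equal.
    rewrite ps_mul_Xpow; destruct (Nat.ltb_spec K j); [lia|].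
    replace (S K - 1 - j)%nat with (K - j)%nat by lia.
    replace (ps_mul (ps_mul (lin (-1)) (ps_mul gamma gamma)) (ps_pow beta (K - j))) with
      (ps_mul (ps_mul (lin (-1)) gamma) (ps_mul (ps_pow beta (K - j)) gamma)) by ring.
    unfold gamma at 2; rewrite lin_geo, ps_mul_1_l; reflexivity.
  - rewrite sum_over_seq_S, Nat.add_0_l, Nat.sub_diag; cbn [bcoef]; ring.
Qed.

(* Limits of the normalized eigenvalues. *)
Definition eta (K : nat) : R := match K with O => 0 | S K => Lam_pow K a 0%nat end.

Lemma Lam_one : Lam ps_one = ps_sub a ps_one.
Proof.
  extensionality n; unfold Lam, ps_sub, ps_one; replace (ps_mul a (fun n => if Nat.eqb n 0 then 1 else 0)) with a.
  - destruct n; cbn [Nat.eqb]; ring.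
  - fold ps_one; change (a = ps_mul a ps_one); ring.
Qed.

Lemma Lam_pow_sub K f g n : Lam_pow K (ps_sub f g) n = Lam_pow K f n - Lam_pow K g n.
Proof.
  revert n; induction K as [|K IH]; intros n; cbn [Lam_pow]; [reflexivity|].
  assert (E : Lam_pow K (ps_sub f g) = ps_sub (Lam_pow K f) (Lam_pow K g))
    by (extensionality k; apply IH).
  rewrite E; unfold Lam.
  replace (ps_mul a (ps_sub (Lam_pow K f) (Lam_pow K g))) with
    (ps_sub (ps_mul a (Lam_pow K f)) (ps_mul a (Lam_pow K g))) by ring.
  unfold ps_sub; destruct (Nat.eqb n 0); ring.
Qed.

Lemma Lam_pow_S K g : Lam_pow (S K) g = Lam_pow K (Lam g).
Proof. induction K as [|K IH]; [reflexivity|]; cbn [Lam_pow] in *; rewrite IH; reflexivity. Qed.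

(** From [Lam 1 = a - 1] and linearity. In generating series it is the division by [1 + z] that
    defines [Ahat]. *)
Lemma Ecoef_eta K : Ecoef K = match K with O => 1 | S K' => eta K - Ecoef K' end.
Proof.
  destruct K as [|K]; [reflexivity|].
  unfold Ecoef; rewrite Lam_pow_S, Lam_one, Lam_pow_sub; reflexivity.
Qed.

Lemma Ahat_eta : Ahat eta = What Ecoef.
Proof.
  assert (E : What eta = ps_mul (lin (-1)) (What Ecoef)).
  { replace (lin (-1)) with (ps_add ps_one ps_X).
    2:{ unfold lin; extensionality n; unfold ps_add, ps_sub; rewrite ps_mul_const_l; ring. }
    replace (ps_mul (ps_add ps_one ps_X) (What Ecoef)) with
      (ps_add (What Ecoef) (ps_mul ps_X (What Ecoef))) by ring.
    extensionality n; unfold ps_add; destruct n as [|n]; [rewrite ps_mul_X_0; cbn; ring|].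
    rewrite ps_mul_X_S; cbn [What]; rewrite Ecoef_eta; destruct n as [|n]; cbn [What eta]; ring. }
  unfold Ahat; rewrite E.
  transitivity (ps_mul (ps_mul (lin (-1)) (geo (-1))) (What Ecoef)); [ring|].
  rewrite lin_geo; ring.
Qed.

(** The limiting counterpart of [Ahat_euler], with [bcoef] in place of [cdiff]. *)
Lemma Ahat_eta_euler : ps_euler (Ahat eta) = ps_opp (ps_mul (Ahat eta) bcoef).
Proof.
  rewrite Ahat_eta; extensionality n; unfold ps_euler, ps_opp.
  rewrite ps_mul_comm, ps_mul_seq; destruct n as [|K]; [cbn; ring|].
  rewrite sum_over_seq_rev, (sum_over_ext (seq 0 (S (S K))) _ (fun j => What Ecoef j * bcoef (S K - j))).
  2:{ intros j Hj; apply in_seq in Hj; replace (S K - (S K - j))%nat with j by lia; ring. }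
  change (seq 0 (S (S K))) with (0%nat :: seq (0 + 1) (S K)); rewrite sum_over_cons, sum_over_seq_shift.
  rewrite sum_over_seq_S; cbn [What Nat.add].
  replace (S K - 0)%nat with (S K) by lia; replace (S K - (K + 1))%nat with 0%nat by lia; cbn [bcoef].
  fold (bcoef (S K)); rewrite lagrange.
  rewrite (sum_over_ext (seq 0 K) (fun i => What Ecoef (i + 1) * bcoef (S K - (i + 1)))
    (fun i => (-1) * (Ecoef i * bcoef (K - i)))).
  - rewrite sum_over_scal; ring.
  - intros i Hi; replace (i + 1)%nat with (S i) by lia; cbn [What].
    replace (S K - S i)%nat with (K - i)%nat by lia; ring.
Qed.
End Lagrange.

Lemma ps_shift_X f : ps_shift 1 f = ps_mul ps_X f.
Proof.
  extensionality n; unfold ps_shift; destruct n as [|n]; [rewrite ps_mul_X_0; reflexivity|].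
  rewrite ps_mul_X_S; cbn [Nat.ltb Nat.leb]; f_equal; lia.
Qed.

Lemma lln_formula_bcoef theta c k :
  INR (S k) * lln_formula theta c k =
  bcoef (fun n => / theta * ps_mul w_plus_1 (Uw c) n) (S k).
Proof.
  unfold lln_formula; set (a := fun n => / theta * ps_mul w_plus_1 (Uw c) n).
  assert (E : ls_add (0%nat, a) (1%nat, ps_one) = (1%nat, ps_add ps_one (ps_mul ps_X a))).
  { unfold ls_add; cbn [Nat.max Nat.sub]; f_equal; rewrite ps_shift_X.
    extensionality n; unfold ps_add, ps_shift; cbn [Nat.ltb Nat.leb]; rewrite Nat.sub_0_r; ring. }
  rewrite E.
  assert (Ep : forall f m, ls_pow (1%nat, f) m = (m, ps_pow f m)).
  { intros f m; induction m as [|m IH]; [reflexivity|]; cbn [ls_pow]; rewrite IH; reflexivity. }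
  rewrite Ep; unfold ls_mul, ls_scale, ls_coef_m1.
  rewrite Nat.add_0_r; cbn [bcoef]; unfold geo; field; apply not_0_INR; lia.
Qed.

(** * Binomial coefficients *)

Lemma binomR_n_0 n : binomR n 0 = 1.
Proof.
  unfold binomR; cbn [Nat.leb]; unfold C; rewrite Nat.sub_0_r; change (fact 0) with 1%nat.
  rewrite INR_1; field; apply INR_fact_neq_0.
Qed.

Lemma binomR_0_S k : binomR 0 (S k) = 0.
Proof. reflexivity. Qed.

Lemma binomR_n_n n : binomR n n = 1.
Proof.
  unfold binomR; rewrite Nat.leb_refl; unfold C; rewrite Nat.sub_diag; change (fact 0) with 1%nat.
  rewrite INR_1; field; apply INR_fact_neq_0.
Qed.

Lemma binomR_gt n k : (n < k)%nat -> binomR n k = 0.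
Proof. intros H; unfold binomR; destruct (Nat.leb_spec k n); [lia|reflexivity]. Qed.

Lemma binomR_pascal n k : binomR (S n) (S k) = binomR n k + binomR n (S k).
Proof.
  destruct (Nat.lt_trichotomy k n) as [H|[->|H]].
  - unfold binomR; destruct (Nat.leb_spec (S k) (S n)), (Nat.leb_spec k n), (Nat.leb_spec (S k) n); try lia.
    symmetry; apply pascal; auto.
  - rewrite !binomR_n_n, binomR_gt by lia; ring.
  - rewrite !binomR_gt by lia; ring.
Qed.

Lemma binomR_nonneg n k : 0 <= binomR n k.
Proof.
  revert k; induction n as [|n IH]; intros [|k]; rewrite ?binomR_n_0, ?binomR_0_S, ?binomR_pascal; try lra.
  pose proof (IH k); pose proof (IH (S k)); lra.
Qed.

Lemma binomR_mul n s : INR n * binomR n s = INR s * binomR n s + INR (S s) * binomR n (S s).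
Proof.
  revert s; induction n as [|n IH]; intros s.
  - rewrite binomR_0_S; destruct s; [cbn [INR]; ring|rewrite binomR_0_S; ring].
  - destruct s as [|s].
    + rewrite binomR_pascal, !binomR_n_0; specialize (IH 0%nat); rewrite binomR_n_0 in IH.
      rewrite S_INR in *; cbn [INR] in *; lra.
    + rewrite !binomR_pascal; pose proof (IH s) as E1; pose proof (IH (S s)) as E2.
      rewrite !S_INR in *; nra.
Qed.

Lemma vandermonde i j s :
  sum_over (seq 0 (S s)) (fun b => binomR i (s - b) * binomR j b) = binomR (i + j) s.
Proof.
  revert s; induction j as [|j IH]; intros s.
  - rewrite (sum_over_single Nat.eq_dec _ _ 0%nat); auto using seq_NoDup.
    + rewrite binomR_n_0, Nat.sub_0_r, Nat.add_0_r; ring.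
    + left; reflexivity.
    + intros [|b] _ Hb; [contradiction|rewrite binomR_0_S; ring].
  - replace (i + S j)%nat with (S (i + j)) by lia; destruct s as [|s].
    + cbn [seq]; rewrite sum_over_cons, sum_over_nil, !binomR_n_0; ring.
    + rewrite binomR_pascal, <- !IH.
      change (seq 0 (S (S s))) with (0%nat :: seq (0 + 1) (S s)).
      rewrite !sum_over_cons, !sum_over_seq_shift, !binomR_n_0.
      rewrite (sum_over_ext (seq 0 (S s)) (fun b => binomR i (S s - (b + 1)) * binomR (S j) (b + 1))
        (fun b => binomR i (s - b) * binomR j b + binomR i (S s - (b + 1)) * binomR j (b + 1))).
      * rewrite sum_over_plus; ring.
      * intros b _; replace (b + 1)%nat with (S b) by lia; rewrite binomR_pascal.
        replace (S s - S b)%nat with (s - b)%nat by lia; ring.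
Qed.

Lemma chu q s b :
  sum_over (seq 0 (S q)) (fun a => binomR (q - a) s * binomR a b) = binomR (S q) (S (s + b)).
Proof.
  revert b; induction q as [|q IH]; intros b.
  - cbn [seq Nat.sub]; rewrite sum_over_cons, sum_over_nil.
    destruct s as [|s], b as [|b]; rewrite ?binomR_n_0, ?binomR_0_S; cbn [Nat.add];
      rewrite ?binomR_pascal, ?binomR_0_S, ?binomR_n_0; ring.
  - change (seq 0 (S (S q))) with (0%nat :: seq (0 + 1) (S q)); rewrite sum_over_cons, sum_over_seq_shift.
    rewrite Nat.sub_0_r.
    rewrite (sum_over_ext _ _ (fun a => binomR (q - a) s * binomR (S a) b))
      by (intros; replace (x + 1)%nat with (S x) by lia; reflexivity).
    destruct b as [|b].
    + rewrite (sum_over_ext _ _ (fun a => binomR (q - a) s * binomR a 0)) by (intros; rewrite !binomR_n_0; ring).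
      rewrite IH, binomR_n_0, Nat.add_0_r, (binomR_pascal (S q) s); ring.
    + rewrite (sum_over_ext _ _ (fun a => binomR (q - a) s * binomR a b + binomR (q - a) s * binomR a (S b)))
        by (intros; rewrite binomR_pascal; ring).
      rewrite sum_over_plus, !IH, binomR_0_S.
      replace (s + S b)%nat with (S (s + b)) by lia; rewrite (binomR_pascal (S q) (S (s + b))); ring.
Qed.

(** [chu] at [b = 0] without its end terms. The end [a = q] contributes 1 when [s = 0]; this is the
    origin of the term [- g 0] in [Lam]. *)
Lemma hockey q s : (1 <= q)%nat ->
  sum_over (seq 1 (q - 1)) (fun a => binomR (q - a) s) =
  binomR q (S s) - (if Nat.eqb s 0 then binomR q 0 else 0).
Proof.
  intros Hq; pose proof (chu q s 0) as E.
  rewrite sum_over_seq_S in E; replace (seq 0 q) with (0%nat :: seq 1 (q - 1)) in E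
    by (destruct q; [lia|cbn; rewrite Nat.sub_0_r; reflexivity]).
  rewrite sum_over_cons, Nat.sub_0_r, !binomR_n_0, Nat.add_0_r, Nat.add_0_l, Nat.sub_diag in E.
  rewrite (sum_over_ext _ _ (fun a => binomR (q - a) s)) in E by (intros; rewrite binomR_n_0; ring).
  rewrite binomR_pascal in E; destruct s; [rewrite !binomR_n_0 in *|rewrite binomR_0_S in E]; cbn [Nat.eqb]; lra.
Qed.

Lemma chu_inner q s b : (1 <= q)%nat -> (1 <= b)%nat ->
  sum_over (seq 1 (q - 1)) (fun a => binomR (q - a) s * binomR a b) =
  binomR q (s + b + 1) + (if Nat.eqb s 0 then 0 else binomR q (s + b)).
Proof.
  intros Hq Hb; pose proof (chu q s b) as E.
  rewrite sum_over_seq_S in E; replace (seq 0 q) with (0%nat :: seq 1 (q - 1)) in E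
    by (destruct q; [lia|cbn; rewrite Nat.sub_0_r; reflexivity]).
  destruct b as [|b]; [lia|].
  rewrite sum_over_cons, binomR_0_S, Nat.add_0_l, Nat.sub_diag, (binomR_pascal q) in E.
  replace (s + S b + 1)%nat with (S (s + S b)) by lia.
  destruct s; [rewrite !binomR_n_0 in E|rewrite binomR_0_S in E]; cbn [Nat.eqb Nat.add] in *; lra.
Qed.

(** * Taylor coefficients at [p = 1^N] *)

(* [Wt N sigma] is the functional [f -> sum_i prod_j binom(i_j, sigma_j)
   d^r f / dp_(i_1) ... dp_(i_r)] at [p = 1^N], in the pairing [pr]. *)
Fixpoint Wt (N : nat) (sg l : list nat) : R :=
  match sg with
  | [] => INR N ^ length l
  | s :: sg => rsum (fun x t => binomR x s * Wt N sg t) l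
  end.

Lemma Symf_Wt N sg : Symf (Wt N sg).
Proof.
  induction sg as [|s sg IH]; [apply Symf_pow|].
  change (Symf (rsum (fun x t => binomR x s * Wt N sg t))).
  apply Symf_rsum; intros x; apply Symf_scal, IH.
Qed.

(** The factor [p_a] either takes its value [N] or is differentiated by exactly one letter of
    [sg]. *)
Lemma Wt_cons N sg a l :
  Wt N sg (a :: l) = INR N * Wt N sg l + rsum (fun s sg' => binomR a s * Wt N sg' l) sg.
Proof.
  revert l; induction sg as [|s sg IH]; intros l; cbn [Wt rsum]; [cbn [length pow]; ring|].
  rewrite (rsum_ext (fun y t' => binomR y s * Wt N sg (a :: t')) (fun y t =>
    INR N * (binomR y s * Wt N sg t) + rsum (fun s' sg' => binomR a s' * (binomR y s * Wt N sg' t)) sg)).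
  - rewrite rsum_plus, rsum_scal, rsum_exchange.
    rewrite (rsum_ext (fun y u => rsum _ l) (fun s' sg' => binomR a s' * rsum (fun x t => binomR x s * Wt N sg' t) l))
      by (intros; apply rsum_scal).
    ring.
  - intros y t _; rewrite IH, Rmult_plus_distr_l; f_equal; [ring|].
    rewrite <- rsum_scal; apply rsum_ext; intros; ring.
Qed.

Definition BF N n (f : list nat -> R) (sg : list nat) : R := pr n (fun l => f l * Wt N sg l).
Definition BW N n (G : nat -> list nat -> R) (s : nat) (sg : list nat) : R :=
  sum_over (seq 1 n) (fun k => binomR k s * pr (n - k) (fun l => G k l * Wt N sg l)).

(** [vI], [vT] and [vL] are [iota], [rsum] and [Lop] read on Taylor data. They are finite
    combinations that do not depend on the degree [n], so they commute with the summation over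
    degrees. *)
Definition vI (phi : list nat -> R) (s : nat) (sg : list nat) : R :=
  INR s * phi (s :: sg) + INR (S s) * phi (S s :: sg).
Definition vT (N : nat) (psi : nat -> list nat -> R) (sg : list nat) : R :=
  INR N * psi 0%nat sg + rsum psi sg.
Definition vL (theta : R) (N : nat) (psi : nat -> list nat -> R) (s : nat) (sg : list nat) : R :=
  (1 - theta) * (INR s * psi s sg + INR (S s) * psi (S s) sg)
  + sum_over (seq 0 (S s)) (fun b =>
      INR b * psi (s - b)%nat (b :: sg) + INR (S b) * psi (s - b)%nat (S b :: sg))
  + theta * INR N * (psi (S s) sg - (if Nat.eqb s 0 then psi 0%nat sg else 0))
  + theta * rsum (fun b sg' => psi (s + b + 1)%nat sg' + (if Nat.eqb s 0 then 0 else psi (s + b)%nat sg')) sg.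

Lemma Wt_mul N s sg l :
  rsum (fun x t => INR x * binomR x s * Wt N sg t) l =
  INR s * Wt N (s :: sg) l + INR (S s) * Wt N (S s :: sg) l.
Proof.
  cbn [Wt]; rewrite <- !rsum_scal, <- rsum_plus; apply rsum_ext; intros x t _.
  rewrite binomR_mul; ring.
Qed.

Lemma BW_iota N n f s sg : Symf f -> BW N n (iota f) s sg = vI (BF N n f) s sg.
Proof.
  intros Hf; unfold vI, BF; rewrite <- !pr_scal, <- pr_plus.
  rewrite (pr_ext n _ (fun l => rsum (fun x t => INR x * binomR x s * Wt N sg t) l * f l))
    by (intros; rewrite Wt_mul; ring).
  rewrite (pr_adj n (fun x t => INR x * binomR x s * Wt N sg t)); auto.
  - apply sum_over_ext; intros k _; rewrite <- pr_scal; apply pr_ext; intros; unfold iota; ring.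
  - intros x u v Huv; cbv beta; rewrite (Symf_Wt N sg u v Huv); reflexivity.
Qed.

Lemma pr_rsum_in {n} (F : nat -> list nat -> list nat -> R) sg :
  pr n (fun l => rsum (fun s sg' => F s sg' l) sg) = rsum (fun s sg' => pr n (F s sg')) sg.
Proof. apply (pr_rsum_out n F). Qed.

Lemma BF_tau N n G sg : SymW G -> BF N n (rsum G) sg = vT N (BW N n G) sg.
Proof.
  intros HG; unfold BF; rewrite pr_adj; auto using Symf_Wt.
  unfold vT, BW; rewrite rsum_sum_over, <- sum_over_scal, <- sum_over_plus.
  apply sum_over_ext; intros a _.
  rewrite (pr_ext _ _ (fun l => INR N * (G a l * Wt N sg l) +
    rsum (fun s sg' => binomR a s * (G a l * Wt N sg' l)) sg)).
  - rewrite pr_plus, pr_scal, binomR_n_0, Rmult_1_l; f_equal.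
    rewrite (pr_rsum_in (fun s sg' l => binomR a s * (G a l * Wt N sg' l))).
    apply rsum_ext; intros s sg' _; apply pr_scal.
  - intros l _; rewrite Wt_cons, Rmult_plus_distr_l; f_equal; [ring|].
    rewrite <- rsum_scal; apply rsum_ext; intros; ring.
Qed.

(** Vandermonde's identity divides [binom(k + m, s)] between the marked letter [k] and the new
    differentiation index [m]. *)
Lemma BW_Ap N n G s sg : SymW G ->
  BW N n (Ap G) s sg = sum_over (seq 0 (S s)) (fun b =>
      INR b * BW N n G (s - b) (b :: sg) + INR (S b) * BW N n G (s - b) (S b :: sg)).
Proof.
  intros HG; unfold BW at 1.
  transitivity (sum_over (seq 1 n) (fun k => sum_over (seq 1 (n - k)) (fun m =>
     binomR (k + m) s * INR m * pr (n - (k + m)) (fun l => G k (m :: l) * Wt N sg l)))).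
  - rewrite (sum_triangle n (fun k m => binomR (k + m) s * INR m * pr (n - (k + m)) (fun l => G k (m :: l) * Wt N sg l))).
    apply sum_over_ext; intros k Hk; apply in_seq in Hk.
    rewrite (pr_ext _ _ (fun l => sum_over (seq 1 (k - 1)) (fun m => INR m * (G (k - m)%nat (m :: l) * Wt N sg l))))
      by (intros l _; unfold Ap; rewrite <- sum_over_scal_r; apply sum_over_ext; intros; ring).
    rewrite pr_sum_over, <- sum_over_scal; apply sum_over_ext; intros m Hm; apply in_seq in Hm.
    replace (k - m + m)%nat with k by lia; rewrite pr_scal; ring.
  - transitivity (sum_over (seq 1 n) (fun k => sum_over (seq 0 (S s)) (fun b =>
      binomR k (s - b) * pr (n - k) (fun l => G k l * (INR b * Wt N (b :: sg) l + INR (S b) * Wt N (S b :: sg) l))))).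
    + apply sum_over_ext; intros k _.
      transitivity (pr (n - k) (fun l => rsum (fun m t => binomR (k + m) s * INR m * Wt N sg t) l * G k l)).
      * rewrite (pr_adj (n - k) (fun m t => binomR (k + m) s * INR m * Wt N sg t)); [|intros m u v Huv; cbv beta; rewrite (Symf_Wt N sg u v Huv); reflexivity|apply HG].
        apply sum_over_ext; intros m _; rewrite <- pr_scal, Nat.sub_add_distr; apply pr_ext; intros; ring.
      * rewrite (sum_over_ext _ _ (fun b => pr (n - k) (fun l => binomR k (s - b) * (G k l * (INR b * Wt N (b :: sg) l + INR (S b) * Wt N (S b :: sg) l)))))
          by (intros; symmetry; apply pr_scal).
        rewrite <- pr_sum_over; apply pr_ext; intros l _.
        rewrite (sum_over_ext _ _ (fun b => rsum (fun m t => binomR k (s - b) * binomR m b * (INR m * Wt N sg t)) l * G k l)).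
        -- rewrite sum_over_scal_r, <- rsum_sum_over; f_equal; apply rsum_ext; intros m t _.
           rewrite sum_over_scal_r, vandermonde; ring.
        -- intros b _; rewrite <- Wt_mul, <- rsum_scal, <- rsum_scal, <- rsum_scal_r.
           apply rsum_ext; intros; ring.
    + rewrite sum_over_swap; apply sum_over_ext; intros b _; unfold BW.
      rewrite <- !sum_over_scal, <- sum_over_plus; apply sum_over_ext; intros k _.
      rewrite (pr_ext _ _ (fun l => INR b * (G k l * Wt N (b :: sg) l) + INR (S b) * (G k l * Wt N (S b :: sg) l)))
        by (intros; ring).
      rewrite pr_plus, !pr_scal; ring.
Qed.

(** The marked degree and the absorbed part are summed with their total [q] fixed; [hockey] and
    [chu_inner] evaluate these sums as binomials in [q]. *)
Lemma BW_Am N n G s sg : SymW G -> posl sg ->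
  BW N n (Am G) s sg = INR N * (BW N n G (S s) sg - (if Nat.eqb s 0 then BW N n G 0 sg else 0))
  + rsum (fun b sg' => BW N n G (s + b + 1) sg' + (if Nat.eqb s 0 then 0 else BW N n G (s + b) sg')) sg.
Proof.
  intros HG Hsg; unfold BW at 1.
  transitivity (sum_over (seq 1 n) (fun q => sum_over (seq 1 (q - 1)) (fun a =>
    binomR (q - a) s * (INR N * pr (n - q) (fun l => G q l * Wt N sg l) +
      rsum (fun b sg' => binomR a b * pr (n - q) (fun l => G q l * Wt N sg' l)) sg)))).
  - transitivity (sum_over (seq 1 n) (fun k => sum_over (seq 1 (n - k)) (fun a =>
      binomR k s * pr (n - (k + a)) (fun l => G (k + a)%nat l * Wt N sg (a :: l))))).
    + apply sum_over_ext; intros k _; rewrite sum_over_scal; f_equal; unfold Am.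
      rewrite (pr_adj (n - k) (fun x t => G (k + x)%nat t)); [|intros x; apply HG|apply Symf_Wt].
      apply sum_over_ext; intros; rewrite Nat.sub_add_distr; reflexivity.
    + rewrite (sum_triangle n (fun k a => binomR k s * pr (n - (k + a)) (fun l => G (k + a)%nat l * Wt N sg (a :: l)))).
      apply sum_over_ext; intros q Hq; apply in_seq in Hq; apply sum_over_ext; intros a Ha; apply in_seq in Ha.
      replace (q - a + a)%nat with q by lia; f_equal.
      rewrite (pr_ext _ _ (fun l => INR N * (G q l * Wt N sg l) +
        rsum (fun b sg' => binomR a b * (G q l * Wt N sg' l)) sg)).
      * rewrite pr_plus, pr_scal; f_equal.
        rewrite (pr_rsum_in (fun b sg' l => binomR a b * (G q l * Wt N sg' l))).
        apply rsum_ext; intros; apply pr_scal.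
      * intros l _; rewrite Wt_cons, Rmult_plus_distr_l; f_equal; [ring|].
        rewrite <- rsum_scal; apply rsum_ext; intros; ring.
  - set (P := fun q sg => pr (n - q) (fun l => G q l * Wt N sg l)).
    transitivity (sum_over (seq 1 n) (fun q =>
      INR N * ((binomR q (S s) - (if Nat.eqb s 0 then binomR q 0 else 0)) * P q sg) +
      rsum (fun b sg' => (binomR q (s + b + 1) + (if Nat.eqb s 0 then 0 else binomR q (s + b))) * P q sg') sg)).
    + apply sum_over_ext; intros q Hq; apply in_seq in Hq.
      rewrite <- hockey by lia.
      rewrite (sum_over_ext _ _ (fun a => binomR (q - a) s * (INR N * P q sg) +
        rsum (fun b sg' => binomR (q - a) s * binomR a b * P q sg') sg)).
      * rewrite sum_over_plus, sum_over_scal_r; f_equal; [ring|].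
        rewrite <- rsum_sum_over; apply rsum_ext; intros b sg' Hp.
        rewrite sum_over_scal_r, chu_inner; auto; [lia|].
        apply (Permutation_Forall Hp) in Hsg; inversion Hsg; auto.
      * intros a _; rewrite Rmult_plus_distr_l; f_equal; rewrite <- rsum_scal; apply rsum_ext.
        intros; unfold P; ring.
    + unfold BW; fold P.
      rewrite sum_over_plus, sum_over_scal; f_equal.
      * f_equal; destruct (Nat.eqb s 0); [rewrite <- sum_over_minus|rewrite Rminus_0_r];
          apply sum_over_ext; intros; unfold P; ring.
      * rewrite <- rsum_sum_over; apply rsum_ext; intros b sg' _.
        destruct (Nat.eqb s 0); [rewrite Rplus_0_r|rewrite <- sum_over_plus];
          apply sum_over_ext; intros; unfold P; ring.
Qed.

Lemma BW_Lop theta N n G s sg : SymW G -> posl sg ->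
  BW N n (Lop theta G) s sg = vL theta N (BW N n G) s sg.
Proof.
  intros HG Hsg; unfold vL; rewrite <- BW_Ap, Rplus_assoc by auto.
  rewrite (Rmult_assoc theta), <- Rmult_plus_distr_l, <- BW_Am by auto.
  unfold BW; rewrite <- !sum_over_scal, <- !sum_over_plus, <- !sum_over_scal, <- !sum_over_plus.
  apply sum_over_ext; intros k _.
  rewrite (pr_ext _ _ (fun l => (1 - theta) * INR k * (G k l * Wt N sg l) + 1 * (Ap G k l * Wt N sg l)
    + theta * (Am G k l * Wt N sg l))) by (intros; unfold Lop, Kop; ring).
  rewrite !pr_plus, !pr_scal.
  pose proof (binomR_mul k s); set (p := pr (n - k) (fun l => G k l * Wt N sg l)).
  transitivity ((1 - theta) * (INR k * binomR k s) * p + binomR k s * pr (n - k) (fun l => Ap G k l * Wt N sg l)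
    + theta * (binomR k s * pr (n - k) (fun l => Am G k l * Wt N sg l))); [ring|].
  rewrite H; ring.
Qed.

Fixpoint vLpow theta N K psi : nat -> list nat -> R :=
  match K with O => psi | S K => vL theta N (vLpow theta N K psi) end.

Definition vD theta N K (phi : list nat -> R) : list nat -> R := vT N (vLpow theta N (K - 1) (vI phi)).

(** A letter 0 enters only with coefficient 0, so agreement on lists of positive letters
    propagates. *)
Lemma vL_ext theta N psi psi' s sg : posl sg ->
  (forall s sg, posl sg -> psi s sg = psi' s sg) -> vL theta N psi s sg = vL theta N psi' s sg.
Proof.
  intros Hs H; unfold vL; rewrite !H by auto.
  apply f_equal2; [apply f_equal2; [apply f_equal2; [reflexivity|]|reflexivity]|].
  - apply sum_over_ext; intros b _; rewrite (H _ (S b :: sg)) by (constructor; auto; lia).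
    f_equal; destruct b; [cbn [INR]; ring|rewrite H; auto; constructor; auto; lia].
  - f_equal; apply rsum_ext; intros b sg' Hp.
    apply (Permutation_Forall Hp) in Hs; inversion Hs; subst; rewrite !H; auto.
Qed.

Lemma SymW_Lpow theta K G : SymW G -> SymW (Lpow theta K G).
Proof. intros H; induction K as [|K IH]; cbn [Lpow]; auto using SymW_Lop. Qed.

Lemma vT_ext N psi psi' sg : posl sg ->
  (forall s sg, posl sg -> psi s sg = psi' s sg) -> vT N psi sg = vT N psi' sg.
Proof.
  intros Hs H; unfold vT; rewrite H by auto; f_equal; apply rsum_ext; intros b sg' Hp.
  apply (Permutation_Forall Hp) in Hs; inversion Hs; subst; auto.
Qed.

Lemma vLpow_ext theta N K psi psi' : (forall s sg, posl sg -> psi s sg = psi' s sg) ->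
  forall s sg, posl sg -> vLpow theta N K psi s sg = vLpow theta N K psi' s sg.
Proof. intros H; induction K as [|K IH]; cbn [vLpow]; auto; intros; apply vL_ext; auto. Qed.

Lemma vD_ext theta N K phi phi' sg : posl sg ->
  (forall sg, posl sg -> phi sg = phi' sg) -> vD theta N K phi sg = vD theta N K phi' sg.
Proof.
  intros Hs H; apply vT_ext; auto; apply vLpow_ext; intros s tg Ht; unfold vI.
  rewrite (H (S s :: tg)) by (constructor; auto; lia); f_equal.
  destruct s; [cbn [INR]; ring|rewrite H; auto; constructor; auto; lia].
Qed.

Lemma BF_Dop theta N n K f sg : Symf f -> posl sg ->
  BF N n (Dop theta K f) sg = vD theta N K (BF N n f) sg.
Proof.
  intros Hf Hs; unfold Dop, vD; rewrite BF_tau by auto using SymW_Lpow, SymW_iota.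
  apply vT_ext; auto; clear sg Hs.
  induction (K - 1)%nat as [|K' IH]; intros s sg Hs; cbn [Lpow vLpow].
  - apply BW_iota, Hf.
  - rewrite BW_Lop by auto using SymW_Lpow, SymW_iota; apply vL_ext; auto.
Qed.

Lemma Symf_Dop theta K f : Symf f -> Symf (Dop theta K f).
Proof. intros Hf; apply Symf_rsum, SymW_Lpow, SymW_iota, Hf. Qed.

Definition Dword theta (ks : list nat) (f : list nat -> R) : list nat -> R :=
  fold_right (Dop theta) f ks.
Definition vDword theta N (ks : list nat) (phi : list nat -> R) : list nat -> R :=
  fold_right (vD theta N) phi ks.

Lemma BF_Dword theta N n ks f sg : Symf f -> posl sg ->
  BF N n (Dword theta ks f) sg = vDword theta N ks (BF N n f) sg.
Proof.
  intros Hf; revert sg; induction ks as [|K ks IH]; intros sg Hs; [reflexivity|].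
  unfold Dword, vDword in *; cbn [fold_right]; rewrite BF_Dop; auto.
  - apply vD_ext; auto.
  - clear -Hf; induction ks as [|K ks IH]; cbn [fold_right]; auto using Symf_Dop.
Qed.

(** * Limits *)

Lemma Un_cv_ext u v l : (forall n, u n = v n) -> Un_cv u l -> Un_cv v l.
Proof. intros H; assert (u = v) as -> by (extensionality n; auto); auto. Qed.

Lemma Un_cv_eventually u v l : (exists n0, forall n, (n0 <= n)%nat -> u n = v n) -> Un_cv u l -> Un_cv v l.
Proof.
  intros (n0 & H) Hu eps He; destruct (Hu eps He) as (n1 & H1).
  exists (Nat.max n0 n1); intros n Hn; rewrite <- H by lia; apply H1; lia.
Qed.

Lemma Un_cv_const c : Un_cv (fun _ => c) c.
Proof. intros eps He; exists 0%nat; intros n _; rewrite Rdist_eq; auto. Qed.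

Lemma Un_cv_scal u l c : Un_cv u l -> Un_cv (fun n => c * u n) (c * l).
Proof. intros H; apply CV_mult; auto using Un_cv_const. Qed.

Lemma Un_cv_scal0 u c : c = 0 -> Un_cv (fun n => c * u n) 0.
Proof. intros ->; apply (Un_cv_ext (fun _ => 0)); [intros; ring|apply Un_cv_const]. Qed.

Lemma Un_cv_sum_over {A} (m : list A) (u : A -> nat -> R) l :
  (forall y, In y m -> Un_cv (u y) (l y)) ->
  Un_cv (fun n => sum_over m (fun y => u y n)) (sum_over m l).
Proof.
  induction m as [|y m IH]; intros H.
  - exact (Un_cv_const 0).
  - apply (Un_cv_ext (fun n => u y n + sum_over m (fun y => u y n))); [reflexivity|].
    rewrite sum_over_cons; apply CV_plus; [|apply IH]; auto with datatypes.
Qed.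

Lemma Un_cv_rsum (u : nat -> list nat -> nat -> R) l sg :
  (forall x t, Permutation sg (x :: t) -> Un_cv (u x t) (l x t)) ->
  Un_cv (fun n => rsum (fun x t => u x t n) sg) (rsum l sg).
Proof.
  revert u l; induction sg as [|a sg IH]; intros u l H; cbn [rsum].
  - exact (Un_cv_const 0).
  - apply CV_plus; [apply H; reflexivity|].
    apply (IH (fun y t' => u y (a :: t')) (fun y t' => l y (a :: t'))).
    intros x t Hp; apply H; rewrite Hp; apply perm_swap.
Qed.

Lemma Un_cv_prod (u : list (nat -> R)) (l : list R) :
  Forall2 Un_cv u l -> Un_cv (fun n => prodR (map (fun f => f n) u)) (prodR l).
Proof.
  induction 1; [exact (Un_cv_const 1)|].
  unfold prodR in *; cbn [map fold_right]; apply CV_mult; auto.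
Qed.

Lemma Un_cv_inv_INR : Un_cv (fun N => / INR N) 0.
Proof.
  intros eps He; destruct (archimed_cor1 eps He) as (n0 & H1 & H2).
  exists n0; intros n Hn; unfold Rdist; rewrite Rminus_0_r.
  assert (0 < INR n0) by (apply lt_0_INR; auto).
  assert (INR n0 <= INR n) by (apply le_INR; lia).
  rewrite Rabs_pos_eq by (left; apply Rinv_0_lt_compat; lra).
  eapply Rle_lt_trans; [|exact H1]; apply Rinv_le_contravar; auto.
Qed.

Definition ser (b : nat -> R) (s : R) : Prop := Un_cv (fun n => sum_f_R0 b n) s.

Lemma ser_ext b b' s : (forall n, b n = b' n) -> ser b s -> ser b' s.
Proof. intros H; assert (b = b') as -> by (extensionality n; auto); auto. Qed.

Lemma ser_plus b b' s s' : ser b s -> ser b' s' -> ser (fun n => b n + b' n) (s + s').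
Proof.
  intros H H'; eapply Un_cv_ext; [|apply CV_plus; [exact H|exact H']].
  intros n; cbv beta; rewrite !sum_f_R0_seq, sum_over_plus; reflexivity.
Qed.

Lemma ser_scal c b s : ser b s -> ser (fun n => c * b n) (c * s).
Proof.
  intros H; eapply Un_cv_ext; [|apply (Un_cv_scal _ _ c H)].
  intros n; cbv beta; rewrite !sum_f_R0_seq, sum_over_scal; reflexivity.
Qed.

Lemma ser_minus b b' s s' : ser b s -> ser b' s' -> ser (fun n => b n - b' n) (s - s').
Proof.
  intros H H'; apply (ser_ext (fun n => b n + (-1) * b' n)); [intros; ring|].
  replace (s - s') with (s + (-1) * s') by ring; apply ser_plus, ser_scal; auto.
Qed.

Lemma ser_zero : ser (fun _ => 0) 0.
Proof.
  eapply Un_cv_ext; [|apply (Un_cv_const 0)].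
  intros n; cbv beta; rewrite sum_f_R0_seq, sum_over_0; auto.
Qed.

Lemma ser_scal0 c b x : c = 0 -> ser (fun n => c * b n) (c * x).
Proof. intros ->; rewrite Rmult_0_l; apply (ser_ext (fun _ => 0)); [intros; ring|apply ser_zero]. Qed.

Lemma ser_sum_over {A} (m : list A) (b : A -> nat -> R) s :
  (forall y, In y m -> ser (b y) (s y)) -> ser (fun n => sum_over m (fun y => b y n)) (sum_over m s).
Proof.
  induction m as [|y m IH]; intros H; [apply ser_zero|].
  apply (ser_ext (fun n => b y n + sum_over m (fun y => b y n))); [reflexivity|].
  rewrite sum_over_cons; apply ser_plus; [|apply IH]; auto with datatypes.
Qed.

Lemma ser_rsum (b : nat -> list nat -> nat -> R) s sg :
  (forall x t, Permutation sg (x :: t) -> ser (b x t) (s x t)) ->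
  ser (fun n => rsum (fun x t => b x t n) sg) (rsum s sg).
Proof.
  revert b s; induction sg as [|a sg IH]; intros b s H; cbn [rsum]; [apply ser_zero|].
  apply ser_plus; [apply H; reflexivity|].
  apply (IH (fun y t' => b y (a :: t')) (fun y t' => s y (a :: t'))).
  intros x t Hp; apply H; rewrite Hp; apply perm_swap.
Qed.

Lemma ser_unique b s s' : ser b s -> ser b s' -> s = s'.
Proof. apply UL_sequence. Qed.

Lemma posl_cons_inv x t sg : posl sg -> Permutation sg (x :: t) -> (1 <= x)%nat /\ posl t.
Proof. intros Hs Hp; apply (Permutation_Forall Hp) in Hs; inversion Hs; auto. Qed.

Definition SerF (b : nat -> list nat -> R) (phi : list nat -> R) : Prop :=
  forall sg, posl sg -> ser (fun n => b n sg) (phi sg).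
Definition SerW (b : nat -> nat -> list nat -> R) (psi : nat -> list nat -> R) : Prop :=
  forall s sg, posl sg -> ser (fun n => b n s sg) (psi s sg).

Lemma SerW_vI b phi : SerF b phi -> SerW (fun n => vI (b n)) (vI phi).
Proof.
  intros H s sg Hs; unfold vI; apply ser_plus.
  - destruct s as [|s]; [apply ser_scal0; reflexivity|].
    apply ser_scal, H; constructor; auto; lia.
  - apply ser_scal, H; constructor; auto; lia.
Qed.

Lemma SerW_vL theta N b psi : SerW b psi -> SerW (fun n => vL theta N (b n)) (vL theta N psi).
Proof.
  intros H s sg Hs; unfold vL; apply ser_plus; [apply ser_plus; [apply ser_plus|]|].
  - apply ser_scal, ser_plus; apply ser_scal, H, Hs.
  - apply (ser_sum_over (seq 0 (S s)) (fun y n => INR y * b n (s - y)%nat (y :: sg) + INR (S y) * b n (s - y)%nat (S y :: sg))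
      (fun y => INR y * psi (s - y)%nat (y :: sg) + INR (S y) * psi (s - y)%nat (S y :: sg))).
    intros y _; apply ser_plus.
    + destruct y as [|y]; [apply ser_scal0; reflexivity|].
      apply ser_scal, H; constructor; auto; lia.
    + apply ser_scal, H; constructor; auto; lia.
  - apply ser_scal, ser_minus; [apply H, Hs|].
    destruct (Nat.eqb s 0); [apply H, Hs|apply ser_zero].
  - apply ser_scal.
    apply (ser_rsum (fun x t n => b n (s + x + 1)%nat t + (if Nat.eqb s 0 then 0 else b n (s + x)%nat t))
      (fun x t => psi (s + x + 1)%nat t + (if Nat.eqb s 0 then 0 else psi (s + x)%nat t))).
    intros x t Hp; destruct (posl_cons_inv _ _ _ Hs Hp).
    apply ser_plus; [apply H; auto|destruct (Nat.eqb s 0); [apply ser_zero|apply H; auto]].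
Qed.

Lemma SerF_vT N b psi : SerW b psi -> SerF (fun n => vT N (b n)) (vT N psi).
Proof.
  intros H sg Hs; unfold vT; apply ser_plus; [apply ser_scal, H, Hs|].
  apply (ser_rsum (fun x t n => b n x t)); intros x t Hp.
  destruct (posl_cons_inv _ _ _ Hs Hp); apply H; auto.
Qed.

Lemma SerF_vDword theta N ks b phi :
  SerF b phi -> SerF (fun n => vDword theta N ks (b n)) (vDword theta N ks phi).
Proof.
  intros H; induction ks as [|K ks IH]; [exact H|].
  apply SerF_vT; generalize (K - 1)%nat as K'; induction K' as [|K' IH']; cbn [vLpow].
  - apply SerW_vI, IH.
  - apply SerW_vL, IH'.
Qed.

(** * The limit [N -> oo] *)

Section Scaling.
Variables (theta : R) (gam : nat -> R).
Hypothesis Htheta : theta <> 0.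

Definition gprod (sg : list nat) : R := prodR (map gam sg).

(** Each letter of [sg] carries one power of [N] and one factor [gam]; [d] is the additional power
    gained from the operators. *)
Definition scaleF (d : nat) (l : R) (Phi : nat -> list nat -> R) : Prop :=
  forall sg, posl sg ->
    Un_cv (fun N => Phi N sg / INR N ^ (d + length sg)) (l * gprod sg).
Definition scaleW (d : nat) (g : nat -> R) (Psi : nat -> nat -> list nat -> R) : Prop :=
  forall s sg, posl sg ->
    Un_cv (fun N => Psi N s sg / INR N ^ (d + length sg)) (g s * gprod sg).

Definition Aser (s : nat) : R := / theta * (INR s * gam s + INR (S s) * gam (S s)).

Lemma Un_cv_lower u l e e' : (e < e')%nat ->
  Un_cv (fun N => u N / INR N ^ e) l -> Un_cv (fun N => u N / INR N ^ e') 0.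
Proof.
  intros He H; replace 0 with (l * 0) by ring.
  assert (Hp : forall k, (1 <= k)%nat -> Un_cv (fun N => / INR N ^ k) 0).
  { induction k as [|k IH]; intros Hk; [lia|].
    destruct k as [|k].
    - apply (Un_cv_ext (fun N => / INR N)); [intros; cbn [pow]; rewrite Rmult_1_r; reflexivity|apply Un_cv_inv_INR].
    - replace 0 with (0 * 0) by ring.
      apply (Un_cv_ext (fun N => / INR N * / INR N ^ S k));
        [intros; change (INR n ^ S (S k)) with (INR n * INR n ^ S k); rewrite Rinv_mult; reflexivity|].
      apply CV_mult; [apply Un_cv_inv_INR|apply IH; lia]. }
  apply (Un_cv_ext (fun N => u N / INR N ^ e * / INR N ^ (e' - e))).
  - intros N; unfold Rdiv; rewrite Rmult_assoc, <- Rinv_mult, <- pow_add; do 3 f_equal; lia.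
  - apply CV_mult; [exact H|apply Hp; lia].
Qed.

Lemma gprod_cons s sg : gprod (s :: sg) = gam s * gprod sg.
Proof. reflexivity. Qed.

Lemma scaleW_vI d l Phi : scaleF d l Phi ->
  scaleW (d + 1) (fun s => l * (theta * Aser s)) (fun N => vI (Phi N)).
Proof.
  intros H s sg Hs; unfold vI.
  apply (Un_cv_ext (fun N => INR s * (Phi N (s :: sg) / INR N ^ (d + length (s :: sg))) +
    INR (S s) * (Phi N (S s :: sg) / INR N ^ (d + length (S s :: sg))))).
  - intros N; cbn [length]; replace (d + S (length sg))%nat with (d + 1 + length sg)%nat by lia.
    unfold Rdiv; ring.
  - replace (l * (theta * Aser s) * gprod sg) with
      (INR s * (l * gprod (s :: sg)) + INR (S s) * (l * gprod (S s :: sg)))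
      by (rewrite !gprod_cons; unfold Aser; field; auto).
    apply CV_plus.
    + destruct s as [|s]; [rewrite Rmult_0_l; apply Un_cv_scal0; reflexivity|].
      apply Un_cv_scal, H; constructor; auto; lia.
    + apply Un_cv_scal, H; constructor; auto; lia.
Qed.

(** Two terms gain a power of [N]: the new letter created by [Ap] and the explicit [N] from [Am].
    The diagonal term and the contractions with [sg] are of lower order. The survivors form
    [theta * Lam]. *)
Lemma scaleW_vL d g Psi : scaleW d g Psi ->
  scaleW (d + 1) (fun s => theta * Lam Aser g s) (fun N => vL theta N (Psi N)).
Proof.
  intros H s sg Hs; unfold vL.
  assert (Hlow : forall s sg' e, posl sg' -> (d + length sg' < e)%nat ->
    Un_cv (fun N => Psi N s sg' / INR N ^ e) 0).
  { intros s' sg' e Hp He; eapply Un_cv_lower; [exact He|apply H, Hp]. }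
  set (e := (d + 1 + length sg)%nat).
  replace (theta * Lam Aser g s * gprod sg) with
    ((1 - theta) * (INR s * 0 + INR (S s) * 0) +
     sum_over (seq 0 (S s)) (fun b => INR b * (g (s - b)%nat * gprod (b :: sg)) + INR (S b) * (g (s - b)%nat * gprod (S b :: sg)))
     + theta * (g (S s) * gprod sg - (if Nat.eqb s 0 then g 0%nat * gprod sg else 0)) + theta * rsum (fun b sg' => 0 + 0) sg).
  - apply (Un_cv_eventually (fun N =>
      (1 - theta) * (INR s * (Psi N s sg / INR N ^ e) + INR (S s) * (Psi N (S s) sg / INR N ^ e))
      + sum_over (seq 0 (S s)) (fun b => INR b * (Psi N (s - b)%nat (b :: sg) / INR N ^ (d + length (b :: sg)))
           + INR (S b) * (Psi N (s - b)%nat (S b :: sg) / INR N ^ (d + length (S b :: sg))))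
      + theta * (Psi N (S s) sg / INR N ^ (d + length sg) - (if Nat.eqb s 0 then Psi N 0%nat sg / INR N ^ (d + length sg) else 0))
      + theta * rsum (fun b sg' => Psi N (s + b + 1)%nat sg' / INR N ^ e +
          (if Nat.eqb s 0 then 0 else Psi N (s + b)%nat sg' / INR N ^ e)) sg)).
    + exists 1%nat; intros N HN.
      assert (HN' : INR N <> 0) by (apply not_0_INR; lia).
      unfold Rdiv; rewrite !Rmult_plus_distr_r.
      apply f_equal2; [apply f_equal2; [apply f_equal2|]|].
      * ring.
      * rewrite <- sum_over_scal_r; apply sum_over_ext; intros b _; cbn [length].
        replace (d + S (length sg))%nat with e by (unfold e; lia); ring.
      * unfold e; replace (d + 1 + length sg)%nat with (S (d + length sg)) by lia; cbn [pow].
        assert (INR N ^ (d + length sg) <> 0) by (apply pow_nonzero; auto).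
        destruct (Nat.eqb s 0); field; auto.
      * rewrite Rmult_assoc, <- rsum_scal_r; f_equal; apply rsum_ext; intros b sg' _.
        destruct (Nat.eqb s 0); ring.
    + apply CV_plus; [apply CV_plus; [apply CV_plus|]|].
      * apply Un_cv_scal, CV_plus; apply Un_cv_scal, Hlow; auto; unfold e; lia.
      * apply (Un_cv_sum_over _ (fun b N => INR b * (Psi N (s - b)%nat (b :: sg) / INR N ^ (d + length (b :: sg)))
           + INR (S b) * (Psi N (s - b)%nat (S b :: sg) / INR N ^ (d + length (S b :: sg))))).
        intros b _; apply CV_plus.
        -- destruct b as [|b]; [rewrite Rmult_0_l; apply Un_cv_scal0; reflexivity|].
           apply Un_cv_scal, H; constructor; auto; lia.
        -- apply Un_cv_scal, H; constructor; auto; lia.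
      * apply Un_cv_scal, CV_minus; [apply H, Hs|].
        destruct (Nat.eqb s 0); [apply H, Hs|apply Un_cv_const].
      * apply Un_cv_scal.
        apply (Un_cv_rsum (fun b sg' N => Psi N (s + b + 1)%nat sg' / INR N ^ e +
          (if Nat.eqb s 0 then 0 else Psi N (s + b)%nat sg' / INR N ^ e)) (fun _ _ => 0 + 0)).
        intros x t Hp; destruct (posl_cons_inv _ _ _ Hs Hp).
        apply Permutation_length in Hp; cbn [length] in Hp.
        apply CV_plus; [apply Hlow; auto; unfold e; lia|].
        destruct (Nat.eqb s 0); [apply Un_cv_const|apply Hlow; auto; unfold e; lia].
  - rewrite (rsum_0 (fun b sg' => 0 + 0)) by (intros; ring).
    unfold Lam; rewrite ps_mul_seq.
    rewrite (sum_over_ext (seq 0 (S s)) (fun b => INR b * _ + _)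
      (fun b => theta * (Aser b * g (s - b)%nat) * gprod sg)).
    + rewrite sum_over_scal_r, sum_over_scal; destruct (Nat.eqb_spec s 0); [|]; ring.
    + intros b _; rewrite !gprod_cons; unfold Aser; field; auto.
Qed.

Lemma scaleF_vT d g Psi : scaleW d g Psi -> scaleF (d + 1) (g 0%nat) (fun N => vT N (Psi N)).
Proof.
  intros H sg Hs; unfold vT; rewrite <- (Rplus_0_r (_ * _)).
  apply (Un_cv_eventually (fun N => Psi N 0%nat sg / INR N ^ (d + length sg) +
    rsum (fun s sg' => Psi N s sg' / INR N ^ (d + 1 + length sg)) sg)).
  - exists 1%nat; intros N HN; assert (HN' : INR N <> 0) by (apply not_0_INR; lia).
    unfold Rdiv at 3; rewrite Rmult_plus_distr_r, <- rsum_scal_r; f_equal.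
    replace (d + 1 + length sg)%nat with (S (d + length sg)) by lia; cbn [pow].
    assert (INR N ^ (d + length sg) <> 0) by (apply pow_nonzero; auto); field; auto.
  - apply CV_plus; [apply H, Hs|].
    rewrite <- (rsum_0 (fun _ _ => 0) sg) by reflexivity.
    apply (Un_cv_rsum (fun s sg' N => Psi N s sg' / INR N ^ (d + 1 + length sg)) (fun _ _ => 0)).
    intros x t Hp; destruct (posl_cons_inv _ _ _ Hs Hp).
    apply Permutation_length in Hp; cbn [length] in Hp.
    eapply Un_cv_lower; [|apply H; auto]; lia.
Qed.

Lemma Lam_scal A c g s : Lam A (fun s => c * g s) s = c * Lam A g s.
Proof.
  unfold Lam; rewrite !ps_mul_seq.
  rewrite (sum_over_ext _ _ (fun j => c * (A j * g (s - j)%nat))) by (intros; ring).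
  rewrite sum_over_scal; destruct (Nat.eqb s 0); ring.
Qed.

(** The [K + 1] powers of [N] come one from [vI], [K - 1] from [vL] and one from [vT], matching the
    denominator of [hhat]. *)
Lemma scaleF_vD d l Phi K : (1 <= K)%nat -> scaleF d l Phi ->
  scaleF (d + (K + 1)) (l * (theta ^ K * eta Aser K)) (fun N => vD theta N K (Phi N)).
Proof.
  intros HK H; destruct K as [|K]; [lia|]; unfold vD; replace (S K - 1)%nat with K by lia.
  assert (E : scaleW (d + 1 + K) (fun s => theta ^ K * Lam_pow Aser K (fun s => l * (theta * Aser s)) s)
    (fun N => vLpow theta N K (vI (Phi N)))).
  { induction K as [|K IH]; cbn [vLpow].
    - intros s sg Hs; replace (d + 1 + 0)%nat with (d + 1)%nat by lia.
      cbn [Lam_pow pow]; rewrite Rmult_1_l; apply (scaleW_vI d l Phi H s sg Hs).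
    - pose proof (scaleW_vL _ _ _ (IH ltac:(lia))) as E.
      intros s sg Hs; specialize (E s sg Hs).
      replace (d + 1 + K + 1)%nat with (d + 1 + S K)%nat in E by lia.
      rewrite Lam_scal, <- Rmult_assoc in E; exact E. }
  apply scaleF_vT in E; replace (d + 1 + K + 1)%nat with (d + (S K + 1))%nat in E by lia.
  replace (l * (theta ^ S K * eta Aser (S K))) with
    (theta ^ K * Lam_pow Aser K (fun s => l * (theta * Aser s)) 0%nat); [exact E|].
  assert (Es : forall m s, Lam_pow Aser m (fun s => l * (theta * Aser s)) s = l * theta * Lam_pow Aser m Aser s).
  { induction m as [|m IH]; intros s; cbn [Lam_pow]; [ring|].
    rewrite <- Lam_scal; f_equal; extensionality j; apply IH. }
  rewrite Es; cbn [eta pow]; ring.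
Qed.

Lemma scaleF_vDword Phi ks : scaleF 0 1 Phi -> posl ks ->
  scaleF (list_sum (map (fun K => K + 1)%nat ks)) (prodR (map (fun K => theta ^ K * eta Aser K) ks))
    (fun N => vDword theta N ks (Phi N)).
Proof.
  intros H; induction 1 as [|K ks HK Hks IH]; [exact H|].
  cbn [map]; change (list_sum (?a :: ?b)) with (a + list_sum b)%nat.
  change (prodR (?a :: ?b)) with (a * prodR b).
  rewrite Nat.add_comm, (Rmult_comm (_ * _) (prodR _)).
  apply (scaleF_vD _ _ (fun N => vDword theta N ks (Phi N))); auto.
Qed.
End Scaling.

(** * Sums over boxes and set partitions *)

Definition upd (e : nat -> nat) (i x j : nat) : nat := if Nat.eqb j i then x else e j.

(** Box sums over named indices instead of positions in a list: a set partition regroups the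
    indices, and with environments the sums can be reordered and factored. *)
Fixpoint envsum (K : nat) (J : list nat) (f : (nat -> nat) -> R) (e : nat -> nat) : R :=
  match J with
  | [] => f e
  | i :: J => sum_over (seq 1 K) (fun x => envsum K J f (upd e i x))
  end.

Lemma upd_same e i x : upd e i x i = x.
Proof. unfold upd; rewrite Nat.eqb_refl; reflexivity. Qed.

Lemma upd_other e i x j : j <> i -> upd e i x j = e j.
Proof. intros H; unfold upd; destruct (Nat.eqb_spec j i); [contradiction|reflexivity]. Qed.

Lemma map_upd e i x J : ~ In i J -> map (upd e i x) J = map e J.
Proof. intros H; apply map_ext_in; intros j Hj; apply upd_other; intros ->; auto. Qed.

Lemma envsum_ext K I f g e : (forall e, f e = g e) -> envsum K I f e = envsum K I g e.
Proof. intros H; replace g with f by (extensionality u; auto); reflexivity. Qed.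

Lemma envsum_boxsum_gen K I J f e : NoDup I -> (forall i, In i I -> ~ In i J) ->
  envsum K I (fun e => f (map e J ++ map e I)) e = boxsum (length I) K (fun l => f (map e J ++ l)).
Proof.
  revert J e; induction I as [|i I IH]; intros J e HI HJ; cbn [envsum length boxsum].
  - reflexivity.
  - inversion HI; subst; apply sum_over_ext; intros x _.
    rewrite (envsum_ext _ _ _ (fun e => f (map e (J ++ [i]) ++ map e I)))
      by (intros; rewrite map_app, <- app_assoc; reflexivity).
    rewrite IH; auto.
    + f_equal; extensionality l; rewrite map_app; cbn [map]; rewrite upd_same, <- app_assoc.
      rewrite map_upd by (apply HJ; left; auto); reflexivity.
    + intros j Hj Hin; apply in_app_iff in Hin; destruct Hin as [Hin|[<-|[]]]; auto.
      apply (HJ j); auto with datatypes.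
Qed.

Lemma envsum_boxsum K I f e : NoDup I ->
  envsum K I (fun e => f (map e I)) e = boxsum (length I) K f.
Proof. intros HI; apply (envsum_boxsum_gen K I [] f e HI); auto. Qed.

Lemma envsum_perm K I I' f e : NoDup I -> Permutation I I' -> envsum K I f e = envsum K I' f e.
Proof.
  intros HN Hp; revert e HN; induction Hp; intros e HN; cbn [envsum].
  - reflexivity.
  - inversion HN; subst; apply sum_over_ext; intros; apply IHHp; auto.
  - rewrite sum_over_swap; apply sum_over_ext; intros a _; apply sum_over_ext; intros b _.
    f_equal; extensionality j; unfold upd.
    inversion HN as [|? ? Hn _]; subst.
    destruct (Nat.eqb_spec j x), (Nat.eqb_spec j y); subst; auto.
    exfalso; apply Hn; left; auto.
  - rewrite IHHp1, IHHp2; auto; eapply Permutation_NoDup; eassumption.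
Qed.

Lemma envsum_app K I J f e : envsum K (I ++ J) f e = envsum K I (envsum K J f) e.
Proof.
  revert e; induction I as [|i I IH]; intros e; cbn [app envsum]; [reflexivity|].
  apply sum_over_ext; intros; apply IH.
Qed.

Definition depends (I : list nat) (f : (nat -> nat) -> R) : Prop :=
  forall e e', (forall i, In i I -> e i = e' i) -> f e = f e'.

Lemma envsum_factor K I J f g e : depends I f -> (forall j, In j J -> ~ In j I) ->
  envsum K J (fun e => f e * g e) e = f e * envsum K J g e.
Proof.
  intros Hf; revert e; induction J as [|j J IH]; intros e HJ; cbn [envsum]; [reflexivity|].
  rewrite <- sum_over_scal; apply sum_over_ext; intros x _.
  rewrite IH by auto with datatypes; f_equal; apply Hf; intros i Hi; apply upd_other.
  intros ->; apply (HJ j); auto with datatypes.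
Qed.

Lemma envsum_indep K I J f e e' : depends (J ++ I) f -> (forall j, In j J -> e j = e' j) ->
  envsum K I f e = envsum K I f e'.
Proof.
  revert J e e'; induction I as [|i I IH]; intros J e e' Hf He; cbn [envsum].
  - apply Hf; rewrite app_nil_r; auto.
  - apply sum_over_ext; intros x _; apply (IH (J ++ [i])).
    + rewrite <- app_assoc; exact Hf.
    + intros j Hj; unfold upd; destruct (Nat.eqb_spec j i) as [->|Hne]; auto.
      apply in_app_iff in Hj; destruct Hj as [Hj|[Hj|[]]]; auto; congruence.
Qed.

Lemma envsum_scal_r K I f c e : envsum K I (fun e => f e * c) e = envsum K I f e * c.
Proof.
  revert e; induction I as [|i I IH]; intros e; cbn [envsum]; [reflexivity|].
  rewrite <- sum_over_scal_r; apply sum_over_ext; auto.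
Qed.

Lemma depends_prod (G : list nat -> (nat -> nat) -> R) P :
  (forall B, In B P -> depends B (G B)) -> depends (concat P) (fun e => prodR (map (fun B => G B e) P)).
Proof.
  intros H e e' He; f_equal; apply map_ext_in; intros B HB; apply (H B HB).
  intros i Hi; apply He, in_concat; eauto.
Qed.

(** Fubini: the blocks are disjoint and each factor depends on the indices of its own block. *)
Lemma envsum_prod K (G : list nat -> (nat -> nat) -> R) P e :
  NoDup (concat P) -> (forall B, In B P -> depends B (G B)) ->
  envsum K (concat P) (fun e => prodR (map (fun B => G B e) P)) e =
  prodR (map (fun B => envsum K B (G B) e) P).
Proof.
  induction P as [|B P IH]; intros HN HG; [reflexivity|].
  cbn [concat] in *; rewrite envsum_app.
  assert (HD : forall i, In i B -> ~ In i (concat P)).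
  { clear -HN; induction B as [|b B IHB]; intros i Hi; [destruct Hi|].
    inversion HN as [|? ? Hb HN']; subst; destruct Hi as [<-|Hi]; [|apply IHB; auto].
    intros H; apply Hb, in_app_iff; auto. }
  cbn [map]; change (prodR (?a :: ?b)) with (a * prodR b).
  rewrite <- IH; [|clear -HN; induction B; auto; inversion HN; auto|auto with datatypes].
  rewrite <- envsum_scal_r.
  rewrite (envsum_ext _ _ _ (fun e' => G B e' *
     envsum K (concat P) (fun e0 => prodR (map (fun B0 => G B0 e0) P)) e)); [reflexivity|].
  intros e'; change (fun e0 => prodR (map (fun B0 => G B0 e0) (B :: P))) with
    (fun e0 => G B e0 * prodR (map (fun B0 => G B0 e0) P)).
  rewrite (envsum_factor K B (concat P) (G B)); auto with datatypes.
  - f_equal; apply (envsum_indep K _ []); [|intros j []].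
    apply depends_prod; auto with datatypes.
  - intros j Hj Hj'; apply (HD j); auto.
Qed.

Lemma ins_block_split x k P : (k < length P)%nat ->
  exists P1 B P2, P = P1 ++ B :: P2 /\ ins_block x k P = P1 ++ (x :: B) :: P2.
Proof.
  intros Hk; destruct (nth_split P [] Hk) as (P1 & P2 & E & El).
  exists P1, (nth k P []), P2; split; auto; unfold ins_block.
  assert (E1 : firstn k P = P1) by (rewrite E, firstn_app, El, Nat.sub_diag, <- El, firstn_all; cbn; apply app_nil_r).
  assert (E2 : skipn (S k) P = P2).
  { rewrite E, skipn_app, El; replace (S k - k)%nat with 1%nat by lia.
    rewrite skipn_all2 by lia; reflexivity. }
  rewrite E1, E2; reflexivity.
Qed.

Lemma length_ins_block x k P : (k < length P)%nat -> length (ins_block x k P) = length P.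
Proof.
  intros Hk; destruct (ins_block_split x k P Hk) as (P1 & B & P2 & -> & ->).
  rewrite !length_app; reflexivity.
Qed.

Lemma setparts_spec l P : In P (setparts l) ->
  Permutation (concat P) l /\ Forall (fun B => B <> []) P.
Proof.
  revert P; induction l as [|x l IH]; cbn [setparts]; intros P HP.
  - destruct HP as [<-|[]]; split; constructor.
  - apply in_flat_map in HP; destruct HP as (Q & HQ & HP); destruct (IH Q HQ) as [H1 H2].
    destruct HP as [<-|HP].
    + cbn [concat app]; split; [constructor; exact H1|constructor; auto; discriminate].
    + apply in_map_iff in HP; destruct HP as (k & <- & Hk); apply in_seq in Hk.
      destruct (ins_block_split x k Q ltac:(lia)) as (P1 & B & P2 & E & ->); subst Q.
      rewrite concat_app in *; cbn [concat app] in *; split.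
      * rewrite <- H1; symmetry; apply Permutation_middle.
      * apply Forall_app in H2; destruct H2 as [H2 H3]; inversion H3; subst.
        apply Forall_app; split; auto; constructor; auto; discriminate.
Qed.

(** The Moebius function of the lattice of set partitions, from [P] to the one-block partition. *)
Definition moebius (P : list (list nat)) : R := (-1) ^ (length P - 1) * INR (fact (length P - 1)).

Lemma setparts_nonempty x l P : In P (setparts (x :: l)) -> (1 <= length P)%nat.
Proof.
  intros HP; apply setparts_spec in HP; destruct HP as [H _]; destruct P; [|simpl; lia].
  apply Permutation_nil in H; discriminate.
Qed.

(** A partition of the remaining elements into [p] blocks extends by a new singleton or by insertion
    into one of its blocks, and [(-1)^p p! + p (-1)^(p-1) (p-1)! = 0]. *)
Lemma sum_moebius x y l : sum_over (setparts (x :: y :: l)) moebius = 0.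
Proof.
  cbn [setparts]; fold (setparts (y :: l)); rewrite sum_over_flat_map.
  apply sum_over_0; intros P HP; apply setparts_nonempty in HP.
  rewrite sum_over_cons, sum_over_map.
  rewrite (sum_over_ext _ _ (fun _ => moebius P)).
  - rewrite sum_over_const, length_seq; unfold moebius; cbn [length].
    destruct (length P) as [|p]; [lia|]; replace (S (S p) - 1)%nat with (S p) by lia.
    replace (S p - 1)%nat with p by lia; rewrite fact_simpl, mult_INR; cbn [pow]; ring.
  - intros k Hk; apply in_seq in Hk; unfold moebius; rewrite length_ins_block by lia; reflexivity.
Qed.

Lemma sum_over_setparts_one x l g :
  sum_over (setparts (x :: l)) (fun P => if Nat.eqb (length P) 1 then g P else 0) = g [x :: l].
Proof.
  revert x g; induction l as [|y l IH]; intros x g; [cbn; ring|].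
  remember (y :: l) as l' eqn:El; cbn [setparts]; rewrite sum_over_flat_map.
  rewrite (sum_over_ext _ _ (fun P => if Nat.eqb (length P) 1 then g (ins_block x 0 P) else 0)).
  - subst l'; rewrite (IH y (fun P => g (ins_block x 0 P))); reflexivity.
  - subst l'; intros P HP; apply setparts_nonempty in HP.
    rewrite sum_over_cons, sum_over_map; cbn [length].
    destruct P as [|B [|B' P]]; [simpl in HP; lia|cbn; ring|].
    cbn [length Nat.eqb]; rewrite sum_over_0; [ring|].
    intros k Hk; apply in_seq in Hk; rewrite length_ins_block by (cbn [length]; lia); reflexivity.
Qed.

Definition pbin (is sg : list nat) : R :=
  prodR (map (fun p => binomR (fst p) (snd p)) (combine is sg)).

Lemma pbin_map (e : nat -> nat) sg (J : list nat) :
  pbin (map e J) (map (fun b => nth b sg 0%nat) J) = prodR (map (fun b => binomR (e b) (nth b sg 0%nat)) J).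
Proof.
  unfold pbin; induction J as [|j J IH]; [reflexivity|].
  cbn [map combine fst snd]; change (prodR (?a :: ?b)) with (a * prodR b); rewrite IH; reflexivity.
Qed.

Lemma prodR_concat (f : nat -> R) P :
  prodR (map f (concat P)) = prodR (map (fun B => prodR (map f B)) P).
Proof.
  induction P as [|B P IH]; [reflexivity|]; cbn [concat map]; rewrite map_app.
  change (prodR (?a :: ?b)) with (a * prodR b); rewrite <- IH.
  unfold prodR; induction (map f B) as [|x l IHl]; cbn; [ring|rewrite IHl; ring].
Qed.

Lemma prodR_mult {A} (f g : A -> R) l :
  prodR (map (fun x => f x * g x) l) = prodR (map f l) * prodR (map g l).
Proof.
  unfold prodR; induction l as [|x l IH]; cbn; [ring|rewrite IH; ring].
Qed.

Lemma map_nth_seq (sg : list nat) : map (fun b => nth b sg 0%nat) (seq 0 (length sg)) = sg.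
Proof.
  induction sg as [|s sg IH]; [reflexivity|].
  cbn [length seq map]; rewrite <- seq_shift, map_map; cbn [nth]; f_equal; exact IH.
Qed.

Lemma boxsum_block D K sg P : In P (setparts (seq 0 (length sg))) ->
  boxsum (length sg) K (fun is => pbin is sg *
     prodR (map (fun B => D (map (fun b => nth b is 0%nat) B)) P)) =
  prodR (map (fun B => boxsum (length B) K (fun is => pbin is (map (fun b => nth b sg 0%nat) B) * D is)) P).
Proof.
  intros HP; apply setparts_spec in HP; destruct HP as [Hp _].
  set (I := seq 0 (length sg)) in *.
  assert (HI : NoDup I) by apply seq_NoDup.
  assert (HN : NoDup (concat P)) by (eapply Permutation_NoDup; [symmetry; exact Hp|auto]).
  replace (length sg) with (length I) by apply length_seq.
  rewrite <- (envsum_boxsum K I _ (fun _ => 0%nat)) by auto.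
  rewrite <- (envsum_perm K (concat P) I) by auto.
  set (G := fun B e => prodR (map (fun b => binomR (e b) (nth b sg 0%nat)) B) * D (map e B)).
  rewrite (envsum_ext _ _ _ (fun e => prodR (map (fun B => G B e) P))).
  - rewrite envsum_prod; auto.
    + f_equal; apply map_ext_in; intros B HB.
      rewrite <- (envsum_boxsum K B _ (fun _ => 0%nat)).
      * apply envsum_ext; intros e; unfold G; rewrite pbin_map; reflexivity.
      * clear -HN HB; induction P as [|B' P IH]; [destruct HB|].
        cbn [concat] in HN; destruct HB as [->|HB].
        -- eapply NoDup_app_remove_r; exact HN.
        -- apply IH; auto; eapply NoDup_app_remove_l; exact HN.
    + intros B _ e e' He; unfold G; f_equal; f_equal; apply map_ext_in; intros b Hb; rewrite He; auto.
  - intros e; unfold G; rewrite prodR_mult, <- prodR_concat.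
    rewrite (Symf_prodR _ _ _ Hp), <- pbin_map; unfold I at 2; rewrite map_nth_seq; f_equal.
    f_equal; apply map_ext_in; intros B HB; f_equal; apply map_ext_in; intros b Hb.
    assert (Hb' : (b < length sg)%nat).
    { assert (In b I) as Hi by (eapply Permutation_in; [exact Hp|apply in_concat; eauto]).
      apply in_seq in Hi; lia. }
    unfold I; rewrite (nth_indep _ 0%nat (e 0%nat)) by (rewrite length_map, length_seq; auto).
    rewrite map_nth, seq_nth; auto.
Qed.

Lemma boxsum_ext r K f g : (forall l, length l = r -> f l = g l) -> boxsum r K f = boxsum r K g.
Proof.
  revert f g; induction r as [|r IH]; intros f g H; cbn [boxsum]; [auto|].
  apply sum_over_ext; intros i _; apply IH; intros l Hl; apply H; cbn; lia.
Qed.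

Lemma boxsum_scal r K c f : boxsum r K (fun l => c * f l) = c * boxsum r K f.
Proof.
  revert f; induction r as [|r IH]; intros f; cbn [boxsum]; [reflexivity|].
  rewrite <- sum_over_scal; apply sum_over_ext; intros i _; apply (IH (fun l => f (i :: l))).
Qed.

Lemma boxsum_sum_over {A} r K (m : list A) f :
  boxsum r K (fun l => sum_over m (fun y => f y l)) = sum_over m (fun y => boxsum r K (f y)).
Proof.
  revert f; induction r as [|r IH]; intros f; cbn [boxsum]; [reflexivity|].
  rewrite sum_over_swap; apply sum_over_ext; intros i _; apply (IH (fun y l => f y (i :: l))).
Qed.

(** Since [F_N(1^N) = 1], the denominators of [dlnF] are 1. Box sums of products over blocks factor,
    so the transformed cumulants are the cumulants of the transformed derivatives [phi]. *)
Lemma cumulant_limit jc M N (phi : list nat -> R) sg :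
  dF jc M N [] = 1 ->
  (forall tg, posl tg -> Un_cv (fun K => boxsum (length tg) K (fun is => pbin is tg * dF jc M N is)) (phi tg)) ->
  posl sg ->
  Un_cv (fun K => boxsum (length sg) K (fun is => pbin is sg * dlnF jc M N is))
    (sum_over (setparts (seq 0 (length sg))) (fun P =>
       moebius P * prodR (map (fun B => phi (map (fun b => nth b sg 0%nat) B)) P))).
Proof.
  intros H1 H Hs.
  apply (Un_cv_ext (fun K => sum_over (setparts (seq 0 (length sg))) (fun P => moebius P *
    prodR (map (fun B => boxsum (length B) K (fun is => pbin is (map (fun b => nth b sg 0%nat) B) * dF jc M N is)) P)))).
  - intros K; symmetry.
    rewrite (boxsum_ext _ _ _ (fun is => sum_over (setparts (seq 0 (length sg))) (fun P => moebius P *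
      (pbin is sg * prodR (map (fun B => dF jc M N (map (fun b => nth b is 0%nat) B)) P))))).
    + rewrite (boxsum_sum_over _ _ _ (fun P is => moebius P *
        (pbin is sg * prodR (map (fun B => dF jc M N (map (fun b => nth b is 0%nat) B)) P)))).
      apply sum_over_ext; intros P HP.
      rewrite boxsum_scal, boxsum_block by auto; reflexivity.
    + intros is Hl; unfold dlnF; rewrite Hl, <- sum_over_scal; apply sum_over_ext; intros P _.
      rewrite H1, pow1; unfold moebius; field.
  - apply (Un_cv_sum_over _ (fun P K => moebius P *
      prodR (map (fun B => boxsum (length B) K (fun is => pbin is (map (fun b => nth b sg 0%nat) B) * dF jc M N is)) P))).
    intros P HP; apply Un_cv_scal; apply setparts_spec in HP; destruct HP as [Hp _].
    rewrite <- (map_map (fun B => map (fun b => nth b sg 0%nat) B) phi).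
    eapply Un_cv_ext; [|apply (Un_cv_prod (map (fun B K => boxsum (length B) K
       (fun is => pbin is (map (fun b => nth b sg 0%nat) B) * dF jc M N is)) P))].
    + intros K; cbv beta; rewrite map_map; reflexivity.
    + rewrite map_map; assert (HB : forall B, In B P -> posl (map (fun b => nth b sg 0%nat) B)).
      { intros B HB; apply Forall_forall; intros x Hx; apply in_map_iff in Hx.
        destruct Hx as (b & <- & Hb).
        assert (In b (seq 0 (length sg))) as Hi by (eapply Permutation_in; [exact Hp|apply in_concat; eauto]).
        apply in_seq in Hi; unfold posl in Hs; rewrite Forall_forall in Hs; apply Hs, nth_In; lia. }
      clear Hp; induction P as [|B P IH]; cbn [map]; constructor; auto with datatypes.
      specialize (H _ (HB B (or_introl eq_refl))); rewrite length_map in H; exact H.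
Qed.

Lemma length_concat_blocks (P : list (list nat)) :
  Forall (fun B => B <> []) P -> (length P <= length (concat P))%nat.
Proof.
  induction 1 as [|B P HB HP IH]; cbn [concat length]; [lia|].
  rewrite length_app; destruct B; [contradiction|cbn [length]; lia].
Qed.

Lemma block_lt P B r : Forall (fun B : list nat => B <> []) P -> length (concat P) = r -> In B P ->
  length P <> 1%nat -> (length B < r)%nat.
Proof.
  intros HP Hr HB Hl; destruct (in_split _ _ HB) as (P1 & P2 & ->).
  rewrite concat_app, length_app in Hr; cbn [concat] in Hr; rewrite !length_app in *.
  apply Forall_app in HP; destruct HP as [HP1 HP2]; inversion HP2; subst.
  apply length_concat_blocks in HP1, H2; cbn [length] in Hl; lia.
Qed.

(* By induction on [length sg]: in the cumulant formula the one-block partition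
   gives [Phi N sg], the other partitions have shorter blocks, and the signed sum
   of all the [moebius P] vanishes. *)
Lemma moments_scale (Phi : nat -> list nat -> R) gam :
  (forall k, (1 <= k)%nat -> Un_cv (fun N => Phi N [k] / INR N) (gam k)) ->
  (forall N, (1 <= N)%nat -> Phi N [] = 1) ->
  (forall sg, (2 <= length sg)%nat -> posl sg -> Un_cv (fun N => / INR N *
     sum_over (setparts (seq 0 (length sg))) (fun P =>
       moebius P * prodR (map (fun B => Phi N (map (fun b => nth b sg 0%nat) B)) P))) 0) ->
  scaleF gam 0 1 Phi.
Proof.
  intros H1 H0 H2.
  assert (forall m sg, (length sg < m)%nat -> posl sg ->
    Un_cv (fun N => Phi N sg / INR N ^ length sg) (gprod gam sg)) as Hm;
    [|intros sg Hs; rewrite Rmult_1_l; apply (Hm (S (length sg))); auto].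
  induction m as [|m IH]; intros sg Hl Hs; [lia|].
  destruct sg as [|s [|s' sg]].
  - apply (Un_cv_eventually (fun _ => 1)); [|exact (Un_cv_const 1)].
    exists 1%nat; intros N HN; rewrite H0 by auto; cbn [length pow]; field.
  - inversion Hs; subst; unfold gprod; cbn [map length]; unfold prodR; cbn [fold_right]; rewrite Rmult_1_r.
    apply (Un_cv_ext (fun N => Phi N [s] / INR N)); auto.
    intros N; cbn [pow]; rewrite Rmult_1_r; reflexivity.
  - remember (s :: s' :: sg) as tg eqn:Et.
    assert (Hlen : (2 <= length tg)%nat) by (rewrite Et; cbn; lia).
    set (r := length tg) in *.
    assert (Esq : seq 0 r = 0%nat :: 1%nat :: seq 2 (r - 2)).
    { destruct r as [|[|r']]; try lia; cbn [seq]; do 3 f_equal; lia. }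
    specialize (H2 tg Hlen Hs); fold r in H2.
    set (T := fun (P : list (list nat)) N => prodR (map (fun B => Phi N (map (fun b => nth b tg 0%nat) B)) P)) in *.
    assert (HT : forall P, In P (setparts (seq 0 r)) -> length P <> 1%nat ->
      Un_cv (fun N => T P N / INR N ^ r) (gprod gam tg)).
    { intros P HP Hne; apply setparts_spec in HP; destruct HP as [Hp HB].
      assert (Hlc : length (concat P) = r) by (rewrite (Permutation_length Hp), length_seq; auto).
      assert (Eg : gprod gam tg = prodR (map (fun B => gprod gam (map (fun b => nth b tg 0%nat) B)) P)).
      { unfold gprod; rewrite <- (map_nth_seq tg) at 1; fold r.
        rewrite (map_ext _ (fun B => prodR (map (fun b => gam (nth b tg 0%nat)) B)))
          by (intros; rewrite map_map; reflexivity).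
        rewrite <- prodR_concat, map_map; symmetry; apply Symf_prodR, Hp. }
      rewrite Eg.
      apply (Un_cv_ext (fun N => prodR (map (fun B => Phi N (map (fun b => nth b tg 0%nat) B) / INR N ^ length B) P))).
      - intros N; unfold T; rewrite <- Hlc; clear.
        unfold prodR; induction P as [|B P IH]; cbn [map fold_right concat]; [cbn; field|].
        rewrite IH, length_app, pow_add; unfold Rdiv; rewrite Rinv_mult; ring.
      - eapply Un_cv_ext; [|apply (Un_cv_prod (map (fun B N => Phi N (map (fun b => nth b tg 0%nat) B) / INR N ^ length B) P))].
        + intros N; cbv beta; rewrite map_map; reflexivity.
        + assert (HB' : forall B, In B P -> (length B < r)%nat) by (intros; eapply block_lt; eauto).
          assert (HBp : forall B, In B P -> posl (map (fun b => nth b tg 0%nat) B)).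
          { intros B HB2; apply Forall_forall; intros x Hx; apply in_map_iff in Hx.
            destruct Hx as (b & <- & Hb).
            assert (In b (seq 0 r)) as Hi by (eapply Permutation_in; [exact Hp|apply in_concat; eauto]).
            apply in_seq in Hi; unfold posl in Hs; rewrite Forall_forall in Hs; apply Hs, nth_In; unfold r in Hi; lia. }
          assert (Hr : (r <= m)%nat) by lia.
          clear -IH HB' HBp Hr; induction P as [|B P IHP]; cbn [map]; constructor; auto with datatypes.
          specialize (IH (map (fun b => nth b tg 0%nat) B)); rewrite length_map in IH.
          apply IH; auto with datatypes; specialize (HB' B (or_introl eq_refl)); lia. }
    set (oth := fun P : list (list nat) => if Nat.eqb (length P) 1 then 0 else 1).
    assert (Esum : forall N, sum_over (setparts (seq 0 r)) (fun P => moebius P * T P N) =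
      Phi N tg + sum_over (setparts (seq 0 r)) (fun P => moebius P * oth P * T P N)).
    { intros N; rewrite (sum_over_ext _ _ (fun P => (if Nat.eqb (length P) 1 then moebius P * T P N else 0) +
        moebius P * oth P * T P N)).
      - rewrite sum_over_plus; f_equal; rewrite Esq, sum_over_setparts_one, <- Esq.
        unfold moebius, T; cbn [length Nat.sub map fact pow]; unfold prodR; cbn [fold_right].
        rewrite INR_1; unfold r; rewrite map_nth_seq; lra.
      - intros P _; unfold oth; destruct (Nat.eqb (length P) 1); ring. }
    assert (Eoth : sum_over (setparts (seq 0 r)) (fun P => moebius P * oth P * gprod gam tg) = - gprod gam tg).
    { rewrite sum_over_scal_r.
      assert (sum_over (setparts (seq 0 r)) (fun P => moebius P * oth P) = -1) as ->; [|ring].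
      pose proof (sum_moebius 0 1 (seq 2 (r - 2))) as Em; rewrite <- Esq in Em.
      rewrite (sum_over_ext _ _ (fun P => (if Nat.eqb (length P) 1 then moebius P else 0) + moebius P * oth P)) in Em.
      - rewrite sum_over_plus, Esq, sum_over_setparts_one, <- Esq in Em.
        unfold moebius at 1 in Em; cbn in Em; lra.
      - intros P _; unfold oth; destruct (Nat.eqb (length P) 1); ring. }
    (* The cumulant is [o(N)], hence negligible against [N ^ r] with [r >= 2]. *)
    assert (L1 : Un_cv (fun N => sum_over (setparts (seq 0 r)) (fun P => moebius P * T P N) / INR N ^ r) 0).
    { apply (Un_cv_lower _ 0 1); [lia|].
      eapply Un_cv_ext; [|exact H2]; intros N; cbn [pow]; rewrite Rmult_1_r; unfold Rdiv; apply Rmult_comm. }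
    assert (L2 : Un_cv (fun N => sum_over (setparts (seq 0 r)) (fun P => moebius P * oth P * T P N) / INR N ^ r)
      (- gprod gam tg)).
    { rewrite <- Eoth.
      apply (Un_cv_ext (fun N => sum_over (setparts (seq 0 r)) (fun P => moebius P * oth P * (T P N / INR N ^ r)))).
      - intros N; unfold Rdiv; rewrite <- sum_over_scal_r; apply sum_over_ext; intros; ring.
      - apply (Un_cv_sum_over _ (fun P N => moebius P * oth P * (T P N / INR N ^ r))
          (fun P => moebius P * oth P * gprod gam tg)); intros P HP.
        unfold oth; destruct (Nat.eqb_spec (length P) 1) as [E|E].
        + replace (moebius P * 0 * gprod gam tg) with 0 by ring; apply Un_cv_scal0; ring.
        + apply Un_cv_scal, HT; auto. }
    replace (gprod gam tg) with (0 - - gprod gam tg) by ring.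
    eapply Un_cv_ext; [|apply (CV_minus _ _ _ _ L1 L2)].
    intros N; cbv beta; rewrite Esum; unfold Rdiv; ring.
Qed.

(** * Domination *)

(** The growth is shared as [x^n = sqrt(x)^n * sqrt(x)^n]: one half absorbs the new factor [1 + n]
    by Bernoulli's inequality, the other serves the induction hypothesis. *)
Lemma poly_le_exp m : forall x, 1 < x -> exists C, 0 <= C /\ forall n, (1 + INR n) ^ m <= C * x ^ n.
Proof.
  induction m as [|m IH]; intros x Hx.
  - exists 1; split; [lra|]; intros n; cbn [pow]; pose proof (pow_R1_Rle x n); lra.
  - assert (Hs : 1 < sqrt x) by (rewrite <- sqrt_1; apply sqrt_lt_1; lra).
    destruct (IH _ Hs) as (C & HC & H).
    set (z := sqrt x) in *.
    set (D := 1 + / (z - 1)).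
    assert (HD : forall n, 1 + INR n <= D * z ^ n).
    { intros n; pose proof (poly n (z - 1) ltac:(lra)) as Hp.
      replace (1 + (z - 1)) with z in Hp by ring.
      pose proof (pow_R1_Rle z n ltac:(lra)); unfold D.
      assert (0 < / (z - 1)) by (apply Rinv_0_lt_compat; lra).
      assert (INR n = / (z - 1) * (INR n * (z - 1))) as -> by (field; lra).
      assert (/ (z - 1) * (INR n * (z - 1)) <= / (z - 1) * z ^ n) by (apply Rmult_le_compat_l; lra).
      lra. }
    assert (0 < D) by (unfold D; assert (0 < / (z - 1)) by (apply Rinv_0_lt_compat; lra); lra).
    exists (D * C); split; [apply Rmult_le_pos; lra|]; intros n; cbn [pow].
    assert (x ^ n = z ^ n * z ^ n) as ->.
    { rewrite <- Rpow_mult_distr; unfold z; rewrite sqrt_sqrt by lra; reflexivity. }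
    specialize (H n); specialize (HD n).
    assert (0 <= (1 + INR n) ^ m) by (apply pow_le; pose proof (pos_INR n); lra).
    pose proof (pos_INR n).
    replace (D * C * (z ^ n * z ^ n)) with ((D * z ^ n) * (C * z ^ n)) by ring.
    apply Rmult_le_compat; lra.
Qed.

Lemma ser_dominated b c S : (forall n, Rabs (b n) <= c n) -> ser c S -> exists s, ser b s.
Proof.
  intros H HS.
  destruct (Rseries_CV_comp (fun n => Rabs (b n)) c) as (s' & Hs').
  - intros n; split; [apply Rabs_pos|apply H].
  - exists S; exact HS.
  - destruct (cv_cauchy_2 b) as (s & Hs); [|exists s; exact Hs].
    apply cauchy_abs, cv_cauchy_1; exists s'; exact Hs'.
Qed.

Lemma ser_partial_le c S : (forall n, 0 <= c n) -> ser c S -> forall n, sum_f_R0 c n <= S.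
Proof. intros H HS n; apply sum_incr; auto. Qed.

(** Beyond [K] each of the two series is bounded by the tail of [c], hence the factor 2. *)
Lemma ser_tail b b' c s s' S K :
  (forall n, Rabs (b n) <= c n) -> (forall n, Rabs (b' n) <= c n) ->
  (forall n, (n <= K)%nat -> b n = b' n) -> ser c S -> ser b s -> ser b' s' ->
  Rabs (s - s') <= 2 * (S - sum_f_R0 c K).
Proof.
  intros Hb Hb' HK HS Hs Hs'.
  assert (Hc : forall n, 0 <= c n) by (intros n; pose proof (Rabs_pos (b n)); specialize (Hb n); lra).
  assert (P : forall n, Rabs (sum_f_R0 (fun n => b n - b' n) n) <= 2 * (S - sum_f_R0 c K)).
  { intros n; eapply Rle_trans; [apply Rsum_abs|].
    assert (E : forall n, sum_f_R0 (fun i => Rabs (b i - b' i)) n + 2 * sum_f_R0 c (Nat.min n K) <= 2 * sum_f_R0 c n).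
    { clear n; induction n as [|n IH].
      - cbn [sum_f_R0 Nat.min]; rewrite (HK 0%nat) by lia.
        replace (b' 0%nat - b' 0%nat) with 0 by ring; rewrite Rabs_R0; lra.
      - cbn [sum_f_R0]; destruct (Nat.le_gt_cases (Datatypes.S n) K) as [Hn|Hn].
        + rewrite (Nat.min_l n) in IH by lia; rewrite Nat.min_l by lia; cbn [sum_f_R0].
          rewrite (HK (Datatypes.S n)) by lia.
          replace (b' (Datatypes.S n) - b' (Datatypes.S n)) with 0 by ring; rewrite Rabs_R0; lra.
        + rewrite (Nat.min_r n) in IH by lia; rewrite Nat.min_r by lia.
          pose proof (Rabs_triang (b (Datatypes.S n)) (- b' (Datatypes.S n))) as Ht; rewrite Rabs_Ropp in Ht.
          specialize (Hb (Datatypes.S n)); specialize (Hb' (Datatypes.S n)); unfold Rminus in *; lra. }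
    specialize (E n).
    destruct (Nat.le_gt_cases n K) as [Hn|Hn].
    - rewrite Nat.min_l in E by lia; pose proof (ser_partial_le c S Hc HS K); lra.
    - rewrite Nat.min_r in E by lia; pose proof (ser_partial_le c S Hc HS n); lra. }
  apply Rnot_lt_le; intros Hlt.
  pose proof (ser_minus _ _ _ _ Hs Hs') as Hd.
  destruct (Hd (Rabs (s - s') - 2 * (S - sum_f_R0 c K)) ltac:(lra)) as (n0 & Hn0).
  specialize (Hn0 n0 ltac:(lia)); specialize (P n0); unfold Rdist in Hn0; rewrite Rabs_minus_sym in Hn0.
  pose proof (Rabs_triang_inv (s - s') (sum_f_R0 (fun n => b n - b' n) n0)) as Ht.
  lra.
Qed.

Lemma lim_eq u l : Un_cv u l -> lim u = l.
Proof.
  intros H; unfold lim.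
  pose proof (epsilon_spec (inhabits 0) (fun l => Un_cv u l) (ex_intro _ l H)) as H'; cbv beta in H'.
  eapply UL_sequence; eassumption.
Qed.

Lemma boxsum_rsum r K F l :
  boxsum r K (fun is => rsum (fun x t => F x t is) l) = rsum (fun x t => boxsum r K (F x t)) l.
Proof.
  revert F; induction r as [|r IH]; intros F; cbn [boxsum]; [reflexivity|].
  rewrite rsum_sum_over; apply sum_over_ext; intros i _; apply (IH (fun x t is => F x t (i :: is))).
Qed.

Lemma ser_boxsum r K (b : list nat -> nat -> R) s :
  (forall is, length is = r -> ser (b is) (s is)) ->
  ser (fun n => boxsum r K (fun is => b is n)) (boxsum r K s).
Proof.
  revert b s; induction r as [|r IH]; intros b s H; cbn [boxsum]; [apply H; reflexivity|].
  apply (ser_sum_over (seq 1 K) (fun i n => boxsum r K (fun is => b (i :: is) n)) (fun i => boxsum r K (fun l => s (i :: l)))).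
  intros i _; apply (IH (fun is => b (i :: is)) (fun l => s (i :: l))).
  intros is Hl; apply H; cbn; lia.
Qed.

(** * Derivatives of [F_N] *)

(** Derivatives of [p_l] at [1^N] by removal of entries instead of falling factorials; [Wd_dmono]
    reconciles the two forms. *)
Fixpoint Wd (N : nat) (is l : list nat) : R :=
  match is with
  | [] => INR N ^ length l
  | i :: is => rsum (fun x t => if Nat.eqb x i then Wd N is t else 0) l
  end.

Lemma Symf_Wd N is : Symf (Wd N is).
Proof.
  induction is as [|i is IH]; [apply Symf_pow|].
  change (Symf (rsum (fun x t => if Nat.eqb x i then Wd N is t else 0))).
  apply Symf_rsum; intros x; destruct (Nat.eqb x i); [apply IH|intros u v _; reflexivity].
Qed.

Lemma dmono_over S l is : NoDup S -> incl is S ->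
  dmono l is = prodR (map (fun j => INR (falling (mult j l) (count_occ Nat.eq_dec is j))) S).
Proof.
  intros HS Hi; unfold dmono; set (g := fun j => INR _).
  assert (E : prodR (map g S) = prodR (map g (filter (fun j => if in_dec Nat.eq_dec j is then true else false) S))).
  { clear HS Hi; unfold prodR; induction S as [|j S IH]; [reflexivity|].
    cbn [map fold_right filter]; rewrite IH; destruct (in_dec Nat.eq_dec j is) as [H|H]; [reflexivity|].
    unfold g at 1; rewrite (proj1 (count_occ_not_In Nat.eq_dec is j) H); cbn; ring. }
  rewrite E; apply Symf_prodR, NoDup_Permutation.
  - apply NoDup_nodup.
  - apply NoDup_filter, HS.
  - intros x; rewrite nodup_In, filter_In; destruct (in_dec Nat.eq_dec x is); split; auto; tauto || (intros [_ H]; discriminate) .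
Qed.

Lemma count_rem1 l i : In i l -> forall j,
  count_occ Nat.eq_dec l j = (count_occ Nat.eq_dec (rem1 i l) j + (if Nat.eq_dec i j then 1 else 0))%nat.
Proof.
  intros Hi j; rewrite (count_occ_perm _ _ j (rem1_perm i l Hi)); cbn [count_occ].
  destruct (Nat.eq_dec i j); lia.
Qed.

Lemma dmono_cons l i is : dmono l (i :: is) = INR (mult i l) * dmono (rem1 i l) is.
Proof.
  set (S := nodup Nat.eq_dec (i :: is)).
  assert (HS : NoDup S) by apply NoDup_nodup.
  assert (HiS : incl (i :: is) S) by (intros x Hx; apply nodup_In, Hx).
  rewrite (dmono_over S l (i :: is)), (dmono_over S (rem1 i l) is) by (auto; eapply incl_cons_inv; eauto).
  destruct (in_split i S (HiS i (or_introl eq_refl))) as (S1 & S2 & ES).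
  assert (Hp : Permutation S (i :: S1 ++ S2)) by (rewrite ES; symmetry; apply Permutation_middle).
  rewrite !(Symf_prodR _ _ _ Hp); cbn [map]; change (prodR (?a :: ?b)) with (a * prodR b).
  pose proof (Permutation_NoDup Hp HS) as HN; inversion HN; subst.
  rewrite <- Rmult_assoc; apply f_equal2.
  - cbn [count_occ]; destruct (Nat.eq_dec i i) as [_|]; [|congruence].
    cbn [falling]; rewrite mult_INR; f_equal; f_equal; unfold mult.
    destruct (in_dec Nat.eq_dec i l) as [H|H].
    + rewrite (count_rem1 l i H i); destruct (Nat.eq_dec i i); [|congruence]; f_equal; lia.
    + rewrite (proj1 (count_occ_not_In Nat.eq_dec l i) H); f_equal.
      symmetry; apply count_occ_not_In; intros H'; apply H; eapply rem1_incl; eauto.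
  - f_equal; apply map_ext_in; intros j Hj; cbn [count_occ].
    destruct (Nat.eq_dec i j) as [->|Hne]; [contradiction|]; f_equal; f_equal; unfold mult.
    destruct (in_dec Nat.eq_dec i l) as [H|H].
    + rewrite (count_rem1 l i H j); destruct (Nat.eq_dec i j); [contradiction|lia].
    + assert (rem1 i l = l) as ->; [|reflexivity].
      clear -H; induction l as [|x l IH]; [reflexivity|]; cbn [rem1].
      destruct (Nat.eq_dec x i) as [->|]; [exfalso; apply H; left; auto|].
      rewrite IH; auto with datatypes.
Qed.

Lemma Wd_dmono N is l : (1 <= N)%nat -> Wd N is l = dmono l is * INR N ^ length l / INR N ^ length is.
Proof.
  intros HN; assert (HN' : INR N <> 0) by (apply not_0_INR; lia).
  revert l; induction is as [|i is IH]; intros l; cbn [Wd length].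
  - unfold dmono, prodR; cbn; field.
  - rewrite dmono_cons.
    rewrite (rsum_count _ l (nodup Nat.eq_dec (i :: l))).
    + rewrite (sum_over_single Nat.eq_dec _ _ i).
      * rewrite Nat.eqb_refl, IH; unfold mult; cbn [pow].
        destruct (in_dec Nat.eq_dec i l) as [H|H].
        -- rewrite (Permutation_length (rem1_perm i l H)); cbn [length pow].
           field; split; auto; apply pow_nonzero; auto.
        -- rewrite (proj1 (count_occ_not_In Nat.eq_dec l i) H); cbn [INR]; field; split; auto; apply pow_nonzero; auto.
      * apply NoDup_nodup.
      * apply nodup_In; left; auto.
      * intros x _ Hx; destruct (Nat.eqb_spec x i); [contradiction|ring].
    + intros x; destruct (Nat.eqb x i); [apply Symf_Wd|intros u v _; reflexivity].
    + apply NoDup_nodup.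
    + intros x Hx; apply nodup_In; right; auto.
Qed.

(** [Wt] with differentiated entries restricted to [1..K], as in a box sum; it equals [Wt] as soon
    as [K] bounds the positive entries of [l]. *)
Fixpoint WK (N K : nat) (sg l : list nat) : R :=
  match sg with
  | [] => INR N ^ length l
  | s :: sg => rsum (fun x t => if (Nat.leb 1 x && Nat.leb x K)%bool then binomR x s * WK N K sg t else 0) l
  end.

Lemma boxsum_Wd N K sg l : boxsum (length sg) K (fun is => pbin is sg * Wd N is l) = WK N K sg l.
Proof.
  revert l; induction sg as [|s sg IH]; intros l; cbn [length boxsum WK].
  - unfold pbin, prodR; cbn; ring.
  - rewrite (sum_over_ext _ _ (fun i => rsum (fun x t => if Nat.eqb x i then binomR i s * WK N K sg t else 0) l)).
    + rewrite <- rsum_sum_over; apply rsum_ext; intros x t _.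
      destruct (Nat.leb_spec 1 x), (Nat.leb_spec x K); cbn [andb].
      * rewrite (sum_over_single Nat.eq_dec _ _ x); auto using seq_NoDup.
        -- rewrite Nat.eqb_refl; reflexivity.
        -- apply in_seq; lia.
        -- intros i _ Hi; destruct (Nat.eqb_spec x i); [congruence|reflexivity].
      * apply sum_over_0; intros i Hi; apply in_seq in Hi; destruct (Nat.eqb_spec x i); [lia|reflexivity].
      * apply sum_over_0; intros i Hi; apply in_seq in Hi; destruct (Nat.eqb_spec x i); [lia|reflexivity].
      * apply sum_over_0; intros i Hi; apply in_seq in Hi; destruct (Nat.eqb_spec x i); [lia|reflexivity].
    + intros i _; cbn [Wd].
      rewrite (boxsum_ext _ _ _ (fun is => rsum (fun x t => if Nat.eqb x i then binomR i s * (pbin is sg * Wd N is t) else 0) l)).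
      * rewrite boxsum_rsum; apply rsum_ext; intros x t _; destruct (Nat.eqb x i).
        -- rewrite boxsum_scal, IH; reflexivity.
        -- rewrite (boxsum_ext _ _ _ (fun _ => 0 * 0)) by (intros; ring); rewrite (boxsum_scal _ _ 0 (fun _ => 0)); ring.
      * intros is _; rewrite <- rsum_scal; apply rsum_ext; intros x t _.
        destruct (Nat.eqb x i); [|ring].
        unfold pbin; cbn [combine map fst snd]; change (prodR (?a :: ?b)) with (a * prodR b); ring.
Qed.

Lemma WK_eq N K sg l : (forall x, In x l -> 1 <= x <= K)%nat -> WK N K sg l = Wt N sg l.
Proof.
  revert l; induction sg as [|s sg IH]; intros l H; cbn [WK Wt]; [reflexivity|].
  apply rsum_ext; intros x t Hp.
  assert (Hx : In x l) by (eapply Permutation_in; [symmetry; exact Hp|left; auto]).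
  apply H in Hx; destruct (Nat.leb_spec 1 x), (Nat.leb_spec x K); try lia; cbn [andb].
  rewrite IH; auto; intros y Hy; apply H; eapply Permutation_in; [symmetry; exact Hp|right; auto].
Qed.

Lemma binomR_le x s n : (x <= n)%nat -> binomR x s <= (1 + INR n) ^ s.
Proof.
  intros Hx.
  assert (binomR x s <= (1 + INR x) ^ s).
  { clear; revert s; induction x as [|x IH]; intros [|s]; rewrite ?binomR_n_0, ?binomR_0_S.
    - cbn; lra.
    - apply pow_le; cbn; lra.
    - cbn; lra.
    - rewrite binomR_pascal, S_INR; pose proof (IH s); pose proof (IH (S s)); cbn [pow] in *.
      assert ((1 + INR x) ^ s <= (1 + (INR x + 1)) ^ s) by (apply pow_incr; pose proof (pos_INR x); lra).
      assert (0 <= (1 + INR x) ^ s) by (apply pow_le; pose proof (pos_INR x); lra).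
      pose proof (pos_INR x); nra. }
  eapply Rle_trans; [exact H|]; apply pow_incr; apply le_INR in Hx; pose proof (pos_INR x); lra.
Qed.

(** A letter [s] costs [s] powers of [1 + n] for its binomial and one for the choice of the
    entry. *)
Definition sdeg (sg : list nat) : nat := list_sum (map S sg).

Lemma rsum_nonneg F l : (forall x t, Permutation l (x :: t) -> 0 <= F x t) -> 0 <= rsum F l.
Proof.
  intros H; apply Rle_trans with (rsum (fun _ _ => 0) l); [|apply rsum_le, H].
  right; symmetry; apply rsum_0; reflexivity.
Qed.

Lemma rsum_le_const c F l : (forall x t, Permutation l (x :: t) -> F x t <= c) -> rsum F l <= INR (length l) * c.
Proof.
  intros H; eapply Rle_trans; [apply (rsum_le _ (fun _ _ => c)), H|].
  rewrite (rsum_fst (fun _ => c)), sum_over_const; lra.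
Qed.

Lemma WK_bound N K n sg l : (1 <= N)%nat -> (length l <= n)%nat -> (forall x, In x l -> x <= n)%nat ->
  0 <= WK N K sg l <= (1 + INR n) ^ sdeg sg * INR N ^ length l.
Proof.
  intros HN; apply le_INR in HN; cbn [INR] in HN.
  revert l; induction sg as [|s sg IH]; intros l Hl Hx.
  - cbn; assert (0 <= INR N ^ length l) by (apply pow_le; lra); lra.
  - pose proof (pos_INR n) as Hn; cbn [WK].
    assert (P : forall x t, Permutation l (x :: t) ->
      0 <= (if (Nat.leb 1 x && Nat.leb x K)%bool then binomR x s * WK N K sg t else 0) <=
      (1 + INR n) ^ s * ((1 + INR n) ^ sdeg sg * INR N ^ length l)).
    { intros x t Hp.
      assert (Hlt : length l = S (length t)) by (rewrite (Permutation_length Hp); reflexivity).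
      destruct (IH t) as [I1 I2]; [lia|intros y Hy; apply Hx; eapply Permutation_in; [symmetry; exact Hp|right; auto]|].
      assert (INR N ^ length t <= INR N ^ length l) by (apply Rle_pow; [lra|lia]).
      assert (0 <= (1 + INR n) ^ sdeg sg) by (apply pow_le; lra).
      assert (0 <= INR N ^ length t) by (apply pow_le; lra).
      assert (WK N K sg t <= (1 + INR n) ^ sdeg sg * INR N ^ length l) by nra.
      pose proof (binomR_nonneg x s).
      pose proof (binomR_le x s n ltac:(apply Hx; eapply Permutation_in; [symmetry; exact Hp|left; auto])).
      assert (0 <= (1 + INR n) ^ s) by (apply pow_le; lra).
      destruct (_ && _)%bool; split; try lra.
      - apply Rmult_le_pos; auto.
      - apply Rmult_le_compat; auto.
      - apply Rmult_le_pos; auto; lra. }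
    split.
    + apply rsum_nonneg; intros x t Hp; apply (P x t Hp).
    + eapply Rle_trans; [apply rsum_le_const; intros x t Hp; apply (P x t Hp)|].
      unfold sdeg; cbn [map]; change (list_sum (S s :: map S sg)) with (S s + list_sum (map S sg))%nat.
      rewrite pow_add; cbn [pow].
      assert (INR (length l) <= 1 + INR n) by (apply le_INR in Hl; lra).
      assert (0 <= (1 + INR n) ^ s * ((1 + INR n) ^ sdeg sg * INR N ^ length l)).
      { repeat apply Rmult_le_pos; apply pow_le; lra. }
      unfold sdeg in *; nra.
Qed.

Lemma Wt_WK N sg n l : In l (partitions n) -> Wt N sg l = WK N n sg l.
Proof.
  intros Hl; apply partitions_spec in Hl; destruct Hl as (_ & H2 & H3).
  symmetry; apply WK_eq; intros x Hx; pose proof (list_sum_in l x Hx).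
  unfold posl in H2; rewrite Forall_forall in H2; apply H2 in Hx; lia.
Qed.

Lemma Wd_bound N is l n : (1 <= N)%nat -> (length l <= n)%nat ->
  0 <= Wd N is l <= (1 + INR n) ^ length is * INR N ^ length l.
Proof.
  intros HN; apply le_INR in HN; cbn [INR] in HN.
  revert l; induction is as [|i is IH]; intros l Hl.
  - cbn; assert (0 <= INR N ^ length l) by (apply pow_le; lra); lra.
  - pose proof (pos_INR n) as Hn; cbn [Wd].
    assert (P : forall x t, Permutation l (x :: t) ->
      0 <= (if Nat.eqb x i then Wd N is t else 0) <= (1 + INR n) ^ length is * INR N ^ length l).
    { intros x t Hp.
      assert (Hlt : length l = S (length t)) by (rewrite (Permutation_length Hp); reflexivity).
      destruct (IH t) as [I1 I2]; [lia|].
      assert (INR N ^ length t <= INR N ^ length l) by (apply Rle_pow; [lra|lia]).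
      assert (0 <= (1 + INR n) ^ length is) by (apply pow_le; lra).
      assert (0 <= INR N ^ length t) by (apply pow_le; lra).
      destruct (Nat.eqb x i); split; try lra; nra. }
    split.
    + apply rsum_nonneg; intros x t Hp; apply (P x t Hp).
    + eapply Rle_trans; [apply rsum_le_const; intros x t Hp; apply (P x t Hp)|].
      cbn [length pow]; assert (INR (length l) <= 1 + INR n) by (apply le_INR in Hl; lra).
      assert (0 <= (1 + INR n) ^ length is * INR N ^ length l) by (apply Rmult_le_pos; apply pow_le; lra).
      nra.
Qed.

Lemma Lpow_Lprod theta K G : Lprod theta (repeat 0 K) G = Lpow theta K G.
Proof.
  induction K as [|K IH]; [reflexivity|]; cbn [repeat Lprod Lpow]; rewrite IH.
  extensionality k; extensionality l; ring.
Qed.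

Definition hval theta lam K : R := sum_over lam (fun x => tval theta lam x K).

Lemma Dop_ext theta K g g' l : posl l -> (forall l, posl l -> g l = g' l) ->
  Dop theta K g l = Dop theta K g' l.
Proof.
  intros Hl H; apply rsum_ext; intros x t Hp; destruct (posl_cons_inv _ _ _ Hl Hp) as [Hx Ht].
  clear Hl Hp; revert x t Hx Ht.
  assert (forall m k l, posl l -> (1 <= k)%nat -> Lpow theta m (iota g) k l = Lpow theta m (iota g') k l) as Hm;
    [|intros; apply Hm; auto].
  induction m as [|m IH]; intros k u Hu Hk; cbn [Lpow].
  - unfold iota; rewrite H; auto; constructor; auto.
  - apply Lop_ext; auto.
Qed.

Lemma Lop_sum_over {A} theta (m : list A) (G : A -> nat -> list nat -> R) k l :
  Lop theta (fun k l => sum_over m (fun y => G y k l)) k l = sum_over m (fun y => Lop theta (G y) k l).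
Proof.
  unfold Lop, Kop, Ap, Am; rewrite !sum_over_plus, !sum_over_scal; f_equal; [f_equal|].
  - rewrite sum_over_swap; apply sum_over_ext; intros i _; rewrite sum_over_scal; reflexivity.
  - rewrite <- rsum_sum_over; reflexivity.
Qed.

Lemma Dop_sum_over {A} theta K (m : list A) (c : A -> R) (f : A -> list nat -> R) l :
  Dop theta K (fun l => sum_over m (fun y => c y * f y l)) l = sum_over m (fun y => c y * Dop theta K (f y) l).
Proof.
  unfold Dop.
  rewrite (sum_over_ext m _ (fun y => rsum (fun x t => c y * Lpow theta (K - 1) (iota (f y)) x t) l))
    by (intros; symmetry; apply rsum_scal).
  rewrite <- rsum_sum_over; apply rsum_ext; intros x t _.
  revert x t; induction (K - 1)%nat as [|j IH]; intros x t; cbn [Lpow].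
  - unfold iota; rewrite <- sum_over_scal; apply sum_over_ext; intros; ring.
  - assert (E : Lpow theta j (iota (fun l => sum_over m (fun y => c y * f y l))) =
      fun x t => sum_over m (fun y => c y * Lpow theta j (iota (f y)) x t))
      by (extensionality u; extensionality v; apply IH).
    rewrite E, (Lop_sum_over theta m (fun y x t => c y * Lpow theta j (iota (f y)) x t)).
    apply sum_over_ext; intros y _; apply Lop_scal.
Qed.

(** * Convergence under Assumption A *)

Section Main.
Variables (theta : R) (jc : list nat -> list nat -> R) (M : nat -> list nat -> R).
Hypotheses (Htheta : 0 < theta) (Hjack : IsJack theta jc)
  (HM : forall N, (1 <= N)%nat -> IsProbYN M N) (HA : AssumpA jc M).

Definition wsum N n : R :=
  sum_over (partitions n) (fun mu => Rabs (acoef jc M N mu) * INR N ^ length mu).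

Lemma wsum_nonneg N n : 0 <= wsum N n.
Proof.
  apply sum_over_nonneg; intros mu _; apply Rmult_le_pos; [apply Rabs_pos|apply pow_le, pos_INR].
Qed.

(** The radius [1 + eps / 2] is admissible and exceeds 1, so its powers dominate every polynomial in
    the degree. *)
Lemma wsum_summable N m : (1 <= N)%nat -> exists S, ser (fun n => (1 + INR n) ^ m * wsum N n) S.
Proof.
  intros HN; destruct HA as (eps & He & H).
  destruct (poly_le_exp m (1 + eps / 2)) as (C & HC & Hp); [lra|].
  destruct (H N HN (1 + eps / 2)) as (S & HS); [rewrite Rabs_pos_eq; lra|].
  apply (ser_dominated _ (fun n => C * (sum_over (partitions n) (fun lam =>
          Rabs (acoef jc M N lam) * INR N ^ length lam * Rabs (1 + eps / 2) ^ n))) (C * S)).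
  - intros n; pose proof (wsum_nonneg N n); pose proof (pos_INR n).
    assert (0 <= (1 + INR n) ^ m) by (apply pow_le; lra).
    rewrite Rabs_pos_eq by (apply Rmult_le_pos; auto).
    rewrite sum_over_scal_r, Rabs_pos_eq by lra; fold (wsum N n).
    specialize (Hp n).
    replace (C * (wsum N n * (1 + eps / 2) ^ n)) with ((C * (1 + eps / 2) ^ n) * wsum N n) by ring.
    apply Rmult_le_compat_r; auto.
  - apply ser_scal; exact HS.
Qed.

Definition bN N n (sg : list nat) : R :=
  sum_over (partitions n) (fun mu => acoef jc M N mu * Wt N sg mu).
Definition Phi N (sg : list nat) : R := lim (fun K => sum_f_R0 (fun n => bN N n sg) K).

Lemma sum_acoef_bound N n m (w : list nat -> R) : (1 <= N)%nat ->
  (forall mu, In mu (partitions n) -> 0 <= w mu <= (1 + INR n) ^ m * INR N ^ length mu) ->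
  Rabs (sum_over (partitions n) (fun mu => acoef jc M N mu * w mu)) <= (1 + INR n) ^ m * wsum N n.
Proof.
  intros HN Hw; eapply Rle_trans; [apply sum_over_Rabs|].
  unfold wsum; rewrite <- sum_over_scal; apply sum_over_le; intros mu Hmu.
  destruct (Hw mu Hmu) as [H1 H2]; rewrite Rabs_mult, (Rabs_pos_eq (w mu)) by auto.
  pose proof (Rabs_pos (acoef jc M N mu)); nra.
Qed.

Lemma partitions_bounds n mu : In mu (partitions n) ->
  (length mu <= n)%nat /\ (forall x, In x mu -> (x <= n)%nat).
Proof.
  intros H; apply partitions_spec in H; destruct H as (_ & H2 & H3); split.
  - rewrite <- H3; apply posl_length_sum, H2.
  - intros x Hx; rewrite <- H3; apply list_sum_in, Hx.
Qed.

Lemma WK_bound_partition N K n sg mu : (1 <= N)%nat -> In mu (partitions n) ->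
  0 <= WK N K sg mu <= (1 + INR n) ^ sdeg sg * INR N ^ length mu.
Proof. intros HN H; destruct (partitions_bounds n mu H); apply WK_bound; auto. Qed.

Lemma bN_bound N n sg : (1 <= N)%nat -> Rabs (bN N n sg) <= (1 + INR n) ^ sdeg sg * wsum N n.
Proof.
  intros HN; apply sum_acoef_bound; auto; intros mu Hmu.
  rewrite (Wt_WK N sg n) by auto; apply WK_bound_partition; auto.
Qed.

Lemma ser_bN N sg : (1 <= N)%nat -> ser (fun n => bN N n sg) (Phi N sg).
Proof.
  intros HN; destruct (wsum_summable N (sdeg sg) HN) as (S & HS).
  destruct (ser_dominated (fun n => bN N n sg) _ S (fun n => bN_bound N n sg HN) HS) as (s & Hs).
  unfold Phi; rewrite (lim_eq _ s); auto.
Qed.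

Lemma ser_dF N is : (1 <= N)%nat ->
  ser (fun n => sum_over (partitions n) (fun mu => acoef jc M N mu * Wd N is mu)) (dF jc M N is).
Proof.
  intros HN; destruct (wsum_summable N (length is) HN) as (S & HS).
  destruct (ser_dominated (fun n => sum_over (partitions n) (fun mu => acoef jc M N mu * Wd N is mu))
    (fun n => (1 + INR n) ^ length is * wsum N n) S) as (s & Hs); auto.
  - intros n; apply sum_acoef_bound; auto; intros mu Hmu; apply Wd_bound; auto;
      apply (proj1 (partitions_bounds n mu Hmu)).
  - unfold dF; rewrite (lim_eq _ s); auto.
    eapply Un_cv_ext; [|exact Hs]; intros K; cbv beta; f_equal; extensionality n.
    apply sum_over_ext; intros mu _; rewrite Wd_dmono by auto; unfold Rdiv; ring.
Qed.

(** Exchange of the sums over indices and over degrees. In degree at most [K] the bound [K] on the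
    indices is invisible, so the error is controlled by the tail of the dominating series. *)
Lemma box_limit N sg : (1 <= N)%nat ->
  Un_cv (fun K => boxsum (length sg) K (fun is => pbin is sg * dF jc M N is)) (Phi N sg).
Proof.
  intros HN; destruct (wsum_summable N (sdeg sg) HN) as (S & HS).
  set (c := fun n => (1 + INR n) ^ sdeg sg * wsum N n) in *.
  assert (E : forall K, ser (fun n => sum_over (partitions n) (fun mu => acoef jc M N mu * WK N K sg mu))
     (boxsum (length sg) K (fun is => pbin is sg * dF jc M N is))).
  { intros K; eapply ser_ext; [|apply (ser_boxsum (length sg) K (fun is n => pbin is sg *
      sum_over (partitions n) (fun mu => acoef jc M N mu * Wd N is mu)))].
    - intros n; cbv beta.
      rewrite (boxsum_ext _ _ _ (fun is => sum_over (partitions n) (fun mu => acoef jc M N mu * (pbin is sg * Wd N is mu))))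
        by (intros; rewrite <- sum_over_scal; apply sum_over_ext; intros; ring).
      rewrite (boxsum_sum_over _ _ _ (fun mu is => acoef jc M N mu * (pbin is sg * Wd N is mu))).
      apply sum_over_ext; intros mu _; rewrite boxsum_scal, boxsum_Wd; reflexivity.
    - intros is _; apply ser_scal, ser_dF, HN. }
  intros eps He; destruct (HS (eps / 2) ltac:(lra)) as (K0 & HK).
  exists K0; intros K HK0; specialize (HK K HK0); unfold Rdist in *.
  eapply Rle_lt_trans.
  - refine (ser_tail _ _ c _ _ S K _ _ _ HS (E K) (ser_bN N sg HN)).
    + intros n; apply sum_acoef_bound; auto; intros mu Hmu; apply WK_bound_partition; auto.
    + intros n; apply bN_bound, HN.
    + intros n Hn; apply sum_over_ext; intros mu Hmu; f_equal.
      apply WK_eq; intros x Hx; pose proof (proj2 (partitions_bounds n mu Hmu) x Hx).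
      apply partitions_spec in Hmu; destruct Hmu as (_ & H2 & _); unfold posl in H2.
      rewrite Forall_forall in H2; apply H2 in Hx; lia.
  - assert (0 <= S - sum_f_R0 c K).
    { pose proof (ser_partial_le c S) as Hle; specialize (Hle ltac:(intros n; apply Rmult_le_pos;
        [apply pow_le; pose proof (pos_INR n); lra|apply wsum_nonneg]) HS K); lra. }
    rewrite Rabs_minus_sym, Rabs_pos_eq in HK; lra.
Qed.

(** * The generating function in the Jack basis *)

Definition FN N n (l : list nat) : R :=
  sum_over (YN N n) (fun lam => M N lam / Jval jc N lam * fJ jc lam l).

Lemma YN_spec N n lam : In lam (YN N n) <-> In lam (partitions n) /\ (length lam <= N)%nat.
Proof. unfold YN; rewrite filter_In, Nat.leb_le; tauto. Qed.

Lemma FN_acoef N n mu : In mu (partitions n) -> FN N n mu = acoef jc M N mu * mfact mu.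
Proof.
  intros Hmu; unfold FN, acoef; rewrite <- sum_over_scal_r.
  pose proof (proj1 (partitions_spec _ _) Hmu) as (_ & _ & ->).
  apply sum_over_ext; intros lam Hl; apply YN_spec in Hl; destruct Hl as [Hl _].
  rewrite (fJ_partitions jc n) by auto; unfold Rdiv; ring.
Qed.

Lemma Symf_FN N n : Symf (FN N n).
Proof. apply Symf_sum; intros lam; apply Symf_scal, Symf_fJ. Qed.

Lemma bN_BF N n sg : bN N n sg = BF N n (FN N n) sg.
Proof.
  apply sum_over_ext; intros mu Hmu; rewrite FN_acoef by auto; field; apply mfact_neq0.
Qed.

Lemma Jval_neq0 N n lam : In lam (YN N n) -> Jval jc N lam = ev N n (fJ jc lam) /\ Jval jc N lam <> 0.
Proof.
  intros Hl; apply YN_spec in Hl; destruct Hl as [Hl HlN].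
  assert (E : Jval jc N lam = ev N n (fJ jc lam)).
  { unfold Jval, ev, pr; pose proof (proj1 (partitions_spec _ _) Hl) as (_ & _ & ->).
    apply sum_over_ext; intros mu Hmu; rewrite (fJ_partitions jc n) by auto; field; apply mfact_neq0. }
  split; auto; rewrite E; eapply jack_ev_neq0; eauto.
Qed.

Lemma Dop_fJ n K lam l : (1 <= K)%nat -> In lam (partitions n) -> posl l ->
  Dop theta K (fJ jc lam) l = hval theta lam K * fJ jc lam l.
Proof.
  intros HK Hl Hp; unfold Dop; rewrite <- Lpow_Lprod, (jack_eigen theta jc Htheta Hjack n) by auto.
  destruct K as [|K]; [lia|]; unfold hval, eigen, tval; replace (S K - 1)%nat with K by lia; reflexivity.
Qed.

Lemma Dword_FN N n ks l : posl ks -> posl l ->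
  Dword theta ks (FN N n) l =
  sum_over (YN N n) (fun lam => M N lam / Jval jc N lam * prodR (map (hval theta lam) ks) * fJ jc lam l).
Proof.
  intros Hks; revert l; induction Hks as [|K ks HK Hks IH]; intros l Hl.
  - apply sum_over_ext; intros; unfold prodR; cbn; ring.
  - unfold Dword in *; cbn [fold_right]; rewrite (Dop_ext _ _ _ _ l Hl IH).
    rewrite (Dop_sum_over theta K (YN N n) (fun lam => M N lam / Jval jc N lam * prodR (map (hval theta lam) ks)) (fJ jc)).
    apply sum_over_ext; intros lam Hlam; apply YN_spec in Hlam; destruct Hlam as [Hlam _].
    rewrite (Dop_fJ n) by auto; cbn [map]; change (prodR (?a :: ?b)) with (a * prodR b); ring.
Qed.

(** In each degree the operators multiply [J_lam] by its eigenvalues, and evaluation at [1^N], which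
    is [sg = []], cancels the denominator [J_lam(1^N)]. On the other side they act on the Taylor
    data. *)
Lemma ser_word N ks : (1 <= N)%nat -> posl ks ->
  ser (fun n => sum_over (YN N n) (fun lam => M N lam * prodR (map (hval theta lam) ks)))
    (vDword theta N ks (Phi N) []).
Proof.
  intros HN Hks.
  assert (H0 : posl []) by constructor.
  assert (HS : SerF (bN N) (Phi N)) by (intros sg _; apply ser_bN, HN).
  pose proof (SerF_vDword theta N ks _ _ HS [] H0) as H.
  eapply ser_ext; [|exact H]; intros n; cbv beta.
  replace (bN N n) with (BF N n (FN N n)) by (extensionality sg; symmetry; apply bN_BF).
  rewrite <- BF_Dword by auto using Symf_FN.
  unfold BF; rewrite (pr_ext n _ (fun l => sum_over (YN N n) (fun lam =>
    M N lam / Jval jc N lam * prodR (map (hval theta lam) ks) * (fJ jc lam l * INR N ^ length l)))).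
  - rewrite pr_sum_over; apply sum_over_ext; intros lam Hlam.
    rewrite pr_scal; destruct (Jval_neq0 N n lam Hlam) as [E Hne].
    change (pr n (fun l => fJ jc lam l * INR N ^ length l)) with (ev N n (fJ jc lam)).
    rewrite <- E; field; auto.
  - intros l Hl; apply partitions_spec in Hl; rewrite Dword_FN by tauto.
    rewrite <- sum_over_scal_r; apply sum_over_ext; intros; cbn [Wt]; ring.
Qed.

Lemma Phi_nil N : (1 <= N)%nat -> Phi N [] = 1.
Proof.
  intros HN; pose proof (ser_word N [] HN (Forall_nil _)) as H.
  destruct (HM N HN) as (_ & _ & H1).
  eapply ser_unique; [exact H|].
  eapply Un_cv_ext; [|exact H1]; intros K; cbv beta; f_equal; extensionality n.
  apply sum_over_ext; intros; unfold prodR; cbn; ring.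
Qed.

Lemma dF_nil N : (1 <= N)%nat -> dF jc M N [] = 1.
Proof.
  intros HN; rewrite <- (Phi_nil N HN); exact (ser_unique _ _ _ (ser_dF N [] HN) (ser_bN N [] HN)).
Qed.

Variable c : nat -> R.
Hypothesis HL : AssumpL jc M c.

(** Assumption L has the factor [k!] in the first-order condition only; the Taylor data use plain
    binomials throughout. *)
Definition gam (k : nat) : R := c k / INR (fact k).

Lemma cumulant_lim N sg : (1 <= N)%nat -> posl sg ->
  lim (fun K => boxsum (length sg) K (fun is => pbin is sg * dlnF jc M N is)) =
  sum_over (setparts (seq 0 (length sg))) (fun P =>
       moebius P * prodR (map (fun B => Phi N (map (fun b => nth b sg 0%nat) B)) P)).
Proof.
  intros HN Hs; apply lim_eq, cumulant_limit; auto using dF_nil, box_limit.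
Qed.

Lemma scale_Phi : scaleF gam 0 1 Phi.
Proof.
  destruct HL as [L1 L2]; apply moments_scale; [| |].
  - intros k Hk.
    apply (Un_cv_eventually (fun N => / INR (fact k) * (/ INR N * lim (fun K => sum_over (seq 1 K) (fun i =>
      INR (fact k) * binomR i k * dlnF jc M N [i]))))).
    + exists 1%nat; intros N HN.
      assert (Hs : posl [k]) by (constructor; auto).
      assert (lim (fun K => sum_over (seq 1 K) (fun i => INR (fact k) * binomR i k * dlnF jc M N [i])) =
        INR (fact k) * Phi N [k]) as ->.
      { apply lim_eq.
        pose proof (cumulant_limit jc M N (Phi N) [k] (dF_nil N HN) (fun tg _ => box_limit N tg HN) Hs) as Hc.
        cbn [length seq setparts flat_map app map] in Hc; rewrite sum_over_cons, sum_over_nil, Rplus_0_r in Hc.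
        unfold moebius in Hc at 1; cbn [length Nat.sub pow fact map nth] in Hc.
        change (prodR [Phi N [k]]) with (Phi N [k] * 1) in Hc.
        rewrite INR_1 in Hc; rewrite !Rmult_1_l, Rmult_1_r in Hc.
        eapply Un_cv_ext; [|apply (Un_cv_scal _ _ (INR (fact k)) Hc)].
        intros K; cbv beta; cbn [boxsum]; rewrite <- sum_over_scal; apply sum_over_ext; intros i _.
        unfold pbin, prodR; cbn; ring. }
      pose proof (INR_fact_neq_0 k); assert (INR N <> 0) by (apply not_0_INR; lia); field; auto.
    + unfold gam; replace (c k / INR (fact k)) with (/ INR (fact k) * c k) by (unfold Rdiv; ring).
      apply Un_cv_scal, L1, Hk.
  - apply Phi_nil.
  - intros sg Hl Hs; eapply Un_cv_eventually; [|apply (L2 sg Hl Hs)].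
    exists 1%nat; intros N HN; cbv beta; f_equal.
    rewrite <- (cumulant_lim N sg HN Hs); reflexivity.
Qed.

Definition Alim (n : nat) : R := / theta * ps_mul w_plus_1 (Uw c) n.

Lemma Aser_Alim : Aser theta gam = Alim.
Proof.
  extensionality s; unfold Aser, Alim; f_equal.
  assert (Hw : w_plus_1 = ps_add ps_one ps_X).
  { extensionality n; unfold w_plus_1, ps_add, ps_one, ps_X; destruct n as [|[|n]]; cbn; ring. }
  rewrite Hw; replace (ps_mul (ps_add ps_one ps_X) (Uw c)) with (ps_add (Uw c) (ps_mul ps_X (Uw c))) by ring.
  unfold ps_add; assert (Hg : forall j, INR (S j) * gam (S j) = Uw c j).
  { intros j; unfold gam, Uw; rewrite fact_simpl, mult_INR; field; split; [apply INR_fact_neq_0|apply not_0_INR; lia]. }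
  rewrite Hg; destruct s as [|s]; [rewrite ps_mul_X_0; cbn [INR]; ring|rewrite ps_mul_X_S, Hg; ring].
Qed.

(** * Law of large numbers *)

Definition LimE (g : nat -> list nat -> R) (l : R) : Prop :=
  exists e : nat -> R,
    (forall N, (1 <= N)%nat -> ser (fun n => sum_over (YN N n) (fun lam => M N lam * g N lam)) (e N)) /\
    Un_cv e l.

(* [Mult a l]: multiplication by [a] preserves asymptotic factorization. This class
   contains the [hhat K] and is closed under sums and products, hence contains
   every polynomial in them. *)
Definition hprod ks N lam : R := prodR (map (hhat theta N lam) ks).
Definition Good (f : nat -> list nat -> R) (l : R) : Prop :=
  forall ks, posl ks -> LimE (fun N lam => f N lam * hprod ks N lam) (l * prodR (map (eta Alim) ks)).
Definition Mult (a : nat -> list nat -> R) (l : R) : Prop :=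
  forall f phi, Good f phi -> Good (fun N lam => f N lam * a N lam) (phi * l).

Lemma LimE_ext g g' l :
  (forall N n lam, (1 <= N)%nat -> In lam (YN N n) -> g N lam = g' N lam) -> LimE g l -> LimE g' l.
Proof.
  intros H (e & He & Hl); exists e; split; auto; intros N HN.
  eapply ser_ext; [|apply (He N HN)]; intros n; apply sum_over_ext; intros lam Hlam.
  rewrite (H N n lam); auto.
Qed.

Lemma LimE_plus g g' l l' : LimE g l -> LimE g' l' -> LimE (fun N lam => g N lam + g' N lam) (l + l').
Proof.
  intros (e & He & Hl) (e' & He' & Hl'); exists (fun N => e N + e' N); split; [|apply CV_plus; auto].
  intros N HN; eapply ser_ext; [|apply ser_plus; [apply (He N HN)|apply (He' N HN)]].
  intros n; cbv beta; rewrite <- sum_over_plus; apply sum_over_ext; intros; ring.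
Qed.

Lemma LimE_seq u v g l : Un_cv u v -> LimE g l -> LimE (fun N lam => u N * g N lam) (v * l).
Proof.
  intros Hu (e & He & Hl); exists (fun N => u N * e N); split; [|apply CV_mult; auto].
  intros N HN; eapply ser_ext; [|apply ser_scal, (He N HN)].
  intros n; cbv beta; rewrite <- sum_over_scal; apply sum_over_ext; intros; ring.
Qed.

Lemma Mult_ext a a' l :
  (forall N n lam, (1 <= N)%nat -> In lam (YN N n) -> a N lam = a' N lam) -> Mult a l -> Mult a' l.
Proof.
  intros H Ha f phi Hf ks Hks; eapply LimE_ext; [|apply (Ha f phi Hf ks Hks)].
  intros N n lam HN Hl; cbv beta; rewrite (H N n lam); auto.
Qed.

Lemma Mult_plus a a' l l' : Mult a l -> Mult a' l' -> Mult (fun N lam => a N lam + a' N lam) (l + l').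
Proof.
  intros Ha Ha' f phi Hf ks Hks.
  replace (phi * (l + l') * prodR (map (eta Alim) ks)) with
    (phi * l * prodR (map (eta Alim) ks) + phi * l' * prodR (map (eta Alim) ks)) by ring.
  eapply LimE_ext; [|apply LimE_plus; [apply (Ha f phi Hf ks Hks)|apply (Ha' f phi Hf ks Hks)]].
  intros; cbv beta; ring.
Qed.

Lemma Mult_seq u v : Un_cv u v -> Mult (fun N _ => u N) v.
Proof.
  intros Hu f phi Hf ks Hks.
  replace (phi * v * prodR (map (eta Alim) ks)) with (v * (phi * prodR (map (eta Alim) ks))) by ring.
  eapply LimE_ext; [|apply (LimE_seq _ _ _ _ Hu (Hf ks Hks))]; intros; cbv beta; ring.
Qed.

Lemma Mult_mult a a' l l' : Mult a l -> Mult a' l' -> Mult (fun N lam => a N lam * a' N lam) (l * l').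
Proof.
  intros Ha Ha' f phi Hf ks Hks.
  pose proof (Ha' _ _ (Ha f phi Hf) ks Hks) as H; rewrite (Rmult_assoc phi) in H.
  eapply LimE_ext; [|exact H]; intros; cbv beta; ring.
Qed.

Lemma Mult_sum {A} (m : list A) (a : A -> nat -> list nat -> R) l :
  (forall y, In y m -> Mult (a y) (l y)) -> Mult (fun N lam => sum_over m (fun y => a y N lam)) (sum_over m l).
Proof.
  induction m as [|y m IH]; intros H.
  - apply (Mult_ext (fun _ _ => 0)); [reflexivity|apply Mult_seq, Un_cv_const].
  - rewrite sum_over_cons; apply (Mult_ext (fun N lam => a y N lam + sum_over m (fun y => a y N lam))); [reflexivity|].
    apply Mult_plus; [apply H; left; auto|apply IH; intros; apply H; right; auto].
Qed.

Lemma Mult_hhat K : Mult (fun N lam => hhat theta N lam K) (eta Alim K).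
Proof.
  destruct K as [|K].
  - apply (Mult_ext (fun _ _ => 0)); [|apply Mult_seq, Un_cv_const].
    intros; unfold hhat, tval; rewrite sum_over_0 by reflexivity; unfold Rdiv; ring.
  - intros f phi Hf ks Hks.
    replace (phi * eta Alim (S K) * prodR (map (eta Alim) ks)) with (phi * prodR (map (eta Alim) (S K :: ks)))
      by (cbn [map]; change (prodR (?a :: ?b)) with (a * prodR b); ring).
    eapply LimE_ext; [|apply Hf; constructor; auto; lia].
    intros; unfold hprod; cbn [map]; change (prodR (?a :: ?b)) with (a * prodR b); ring.
Qed.

(** [scaleF_vDword] at [sg = []]: the powers of [N] and [theta] there are exactly the denominators
    of the [hhat]. *)
Lemma Good_one : Good (fun _ _ => 1) 1.
Proof.
  intros ks Hks.
  exists (fun N => vDword theta N ks (Phi N) [] / prodR (map (fun K => INR N * (theta * INR N) ^ K) ks)).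
  split.
  - intros N HN; unfold Rdiv; rewrite Rmult_comm.
    eapply ser_ext; [|apply ser_scal, (ser_word N ks HN Hks)].
    intros n; cbv beta; rewrite <- sum_over_scal; apply sum_over_ext; intros lam _.
    rewrite Rmult_1_l, Rmult_comm, Rmult_assoc; f_equal; unfold hprod.
    clear Hks; induction ks as [|K ks IH]; unfold prodR in *; cbn [map fold_right]; [field|].
    rewrite <- IH, Rinv_mult; unfold hhat, hval, Rdiv; ring.
  - assert (H : scaleF gam (list_sum (map (fun K => K + 1)%nat ks))
      (prodR (map (fun K => theta ^ K * eta (Aser theta gam) K) ks)) (fun N => vDword theta N ks (Phi N)))
      by (apply scaleF_vDword; auto using scale_Phi; lra).
    specialize (H [] (Forall_nil _)); rewrite Aser_Alim in H.
    unfold gprod in H; cbn [map length] in H; rewrite Nat.add_0_r in H; change (prodR []) with 1 in H.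
    apply (Un_cv_scal _ _ (/ prodR (map (fun K => theta ^ K) ks))) in H.
    assert (Hne : prodR (map (fun K => theta ^ K) ks) <> 0).
    { clear -Htheta; unfold prodR; induction ks as [|K ks IH]; cbn [map fold_right]; [lra|].
      apply Rmult_integral_contrapositive; split; auto; apply pow_nonzero; lra. }
    replace (1 * prodR (map (eta Alim) ks)) with (/ prodR (map (fun K => theta ^ K) ks) *
      (prodR (map (fun K => theta ^ K * eta Alim K) ks) * 1)) by (rewrite (prodR_mult (fun K => theta ^ K) (eta Alim)); field; auto).
    eapply Un_cv_ext; [|exact H]; intros N; cbv beta.
    assert (E : prodR (map (fun K => INR N * (theta * INR N) ^ K) ks) =
      prodR (map (fun K => theta ^ K) ks) * INR N ^ list_sum (map (fun K => (K + 1)%nat) ks)).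
    { clear; unfold prodR; induction ks as [|K ks IH]; cbn [map fold_right]; [cbn; ring|].
      change (list_sum (?a :: ?b)) with (a + list_sum b)%nat.
      rewrite IH, pow_add, Rpow_mult_distr, Nat.add_comm; cbn [Nat.add pow]; ring. }
    rewrite E; unfold Rdiv; rewrite Rinv_mult; ring.
Qed.

Lemma Ahat_0 h : Ahat h 0%nat = 1.
Proof. unfold Ahat; rewrite ps_mul_at0; cbn; ring. Qed.

Lemma Mult_Ahat k : Mult (fun N lam => Ahat (hhat theta N lam) k) (Ahat (eta Alim) k).
Proof.
  unfold Ahat; rewrite ps_mul_seq.
  apply (Mult_ext (fun N lam => sum_over (seq 0 (S k)) (fun j => What (hhat theta N lam) j * geo (-1) (k - j)))).
  - intros; rewrite ps_mul_seq; reflexivity.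
  - apply (Mult_sum _ (fun j N lam => What (hhat theta N lam) j * geo (-1) (k - j))); intros j _.
    apply Mult_mult; [|apply Mult_seq, Un_cv_const].
    destruct j as [|j]; cbn [What]; [apply Mult_seq, Un_cv_const|].
    apply (Mult_ext (fun N lam => -1 * hhat theta N lam j)); [intros; ring|].
    replace (- eta Alim j) with (-1 * eta Alim j) by ring.
    apply (Mult_mult (fun _ _ => -1)); [apply Mult_seq, Un_cv_const|apply Mult_hhat].
Qed.

Lemma newton A q k : A 0%nat = 1 -> q 0%nat = 0 -> ps_euler A = ps_opp (ps_mul A q) ->
  q (S k) = - INR (S k) * A (S k) + -1 * sum_over (seq 1 k) (fun j => A j * q (S k - j)%nat).
Proof.
  intros HA0 Hq H; pose proof (f_equal (fun f => f (S k)) H) as E; cbv beta in E.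
  unfold ps_euler, ps_opp in E; rewrite ps_mul_seq in E.
  rewrite sum_over_seq_S in E; cbn [Nat.add] in E; rewrite Nat.sub_diag, Hq in E.
  change (seq 0 (S k)) with (0%nat :: seq 1 k) in E; rewrite sum_over_cons, HA0, Nat.sub_0_r in E; lra.
Qed.

(** The same Newton identities express [cdiff] through [Ahat] for each diagram and [bcoef] through
    the limit of [Ahat], so the limits follow by induction. *)
Lemma Mult_cdiff k : Mult (fun N lam => cdiff theta N lam k) (bcoef Alim k).
Proof.
  induction k as [k IH] using lt_wf_ind; destruct k as [|k].
  - apply (Mult_ext (fun _ _ => 0)); [|apply Mult_seq, Un_cv_const].
    intros; unfold cdiff; rewrite sum_over_0; [reflexivity|intros; cbn; ring].
  - rewrite (newton (Ahat (eta Alim)) (bcoef Alim) k (Ahat_0 _) eq_refl (Ahat_eta_euler Alim)).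
    apply (Mult_ext (fun N lam => - INR (S k) * Ahat (hhat theta N lam) (S k) + -1 *
      sum_over (seq 1 k) (fun j => Ahat (hhat theta N lam) j * cdiff theta N lam (S k - j)))).
    + intros N n lam HN Hl; symmetry; apply newton; [apply Ahat_0| |].
      * unfold cdiff; rewrite sum_over_0; [reflexivity|intros; cbn; ring].
      * apply YN_spec in Hl; destruct Hl as [Hl HlN]; apply partitions_spec in Hl.
        apply Ahat_euler; tauto.
    + apply Mult_plus; [apply (Mult_mult (fun _ _ => - INR (S k))); [apply Mult_seq, Un_cv_const|apply Mult_Ahat]|].
      apply (Mult_mult (fun _ _ => -1)); [apply Mult_seq, Un_cv_const|].
      apply (Mult_sum _ (fun j N lam => Ahat (hhat theta N lam) j * cdiff theta N lam (S k - j))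
        (fun j => Ahat (eta Alim) j * bcoef Alim (S k - j))); intros j Hj; apply in_seq in Hj.
      apply (Mult_mult (fun N lam => Ahat (hhat theta N lam) j)); [apply Mult_Ahat|apply IH; lia].
Qed.

Lemma lln_formula_eq k : lln_formula theta c k = / INR (S k) * bcoef Alim (S k).
Proof. unfold Alim; rewrite <- lln_formula_bcoef; field; apply not_0_INR; lia. Qed.

Lemma Un_cv_inv_pow m : (1 <= m)%nat -> Un_cv (fun N => / INR N ^ m) 0.
Proof.
  intros Hm; apply (Un_cv_ext (fun N => 1 / INR N ^ m)); [intros; unfold Rdiv; ring|].
  apply (Un_cv_lower _ 1 0); [lia|].
  apply (Un_cv_ext (fun _ => 1)); [intros; cbn; field|apply Un_cv_const].
Qed.

Lemma Mult_moment k : Mult (fun N lam => moment theta N lam k) (lln_formula theta c k).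
Proof.
  induction k as [k IH] using lt_wf_ind.
  rewrite lln_formula_eq.
  (* The added zero sum is the limit of the lower moments in [cdiff_moment], each of which carries a
     factor tending to 0. *)
  replace (bcoef Alim (S k)) with (bcoef Alim (S k) + sum_over (seq 0 k) (fun i => 0 * lln_formula theta c i))
    by (rewrite sum_over_0 by (intros; ring); ring).
  apply (Mult_ext (fun N lam => / INR (S k) * (cdiff theta N lam (S k) +
    sum_over (seq 0 k) (fun i => C (S k) i * (-1) ^ (S k - i) * / INR N ^ (k - i) * moment theta N lam i)))).
  - intros N n lam HN _; rewrite <- cdiff_moment by auto; field; apply not_0_INR; lia.
  - apply (Mult_mult (fun _ _ => / INR (S k))); [apply Mult_seq, Un_cv_const|].
    apply Mult_plus; [apply Mult_cdiff|].
    apply (Mult_sum _ (fun i N lam => C (S k) i * (-1) ^ (S k - i) * / INR N ^ (k - i) * moment theta N lam i)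
      (fun i => 0 * lln_formula theta c i)); intros i Hi; apply in_seq in Hi.
    apply (Mult_mult (fun N _ => C (S k) i * (-1) ^ (S k - i) * / INR N ^ (k - i))); [|apply IH; lia].
    apply Mult_seq; rewrite <- (Rmult_0_r (C (S k) i * (-1) ^ (S k - i))).
    apply Un_cv_scal, Un_cv_inv_pow; lia.
Qed.

Lemma LimE_moments ks :
  LimE (fun N lam => prodR (map (moment theta N lam) ks)) (prodR (map (lln_formula theta c) ks)).
Proof.
  assert (HMu : Mult (fun N lam => prodR (map (moment theta N lam) ks)) (prodR (map (lln_formula theta c) ks))).
  { induction ks as [|k ks IH]; [exact (Mult_seq (fun _ => 1) 1 (Un_cv_const 1))|].
    apply (Mult_mult (fun N lam => moment theta N lam k)); [apply Mult_moment|exact IH]. }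
  specialize (HMu _ _ Good_one [] (Forall_nil _)).
  rewrite Rmult_1_l in HMu; change (prodR (map (eta Alim) [])) with 1 in HMu; rewrite Rmult_1_r in HMu.
  eapply LimE_ext; [|exact HMu]; intros; unfold hprod; change (prodR (map (hhat theta N lam) [])) with 1; ring.
Qed.

(** A row has at most [n] boxes and [i < N], so each [y_i] is at most [n / theta + 1] in absolute
    value. *)
Lemma moment_bound N n lam k : (1 <= N)%nat -> In lam (YN N n) ->
  Rabs (moment theta N lam k) <= (/ theta + 1) ^ k * (1 + INR n) ^ k.
Proof.
  intros HN Hl; apply YN_spec in Hl; destruct Hl as [Hl _].
  assert (HN' : 0 < INR N) by (apply lt_0_INR; lia).
  assert (Hit : 0 < / theta) by (apply Rinv_0_lt_compat; auto).
  pose proof (pos_INR n) as Hn.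
  assert (E : moment theta N lam k = / INR N * sum_over (seq 0 N) (fun i => ycoord theta N lam i ^ k)).
  { rewrite <- moment_sum by auto; field; lra. }
  rewrite E, Rabs_mult, (Rabs_pos_eq (/ INR N)) by (left; apply Rinv_0_lt_compat; auto).
  assert (Hb : sum_over (seq 0 N) (fun i => Rabs (ycoord theta N lam i ^ k)) <=
    INR N * ((/ theta + 1) ^ k * (1 + INR n) ^ k)).
  { rewrite <- (length_seq N 0) at 2; rewrite <- sum_over_const; apply sum_over_le; intros i Hi; apply in_seq in Hi.
    rewrite <- RPow_abs, <- Rpow_mult_distr; apply pow_incr; split; [apply Rabs_pos|].
    unfold ycoord; eapply Rle_trans; [apply Rabs_triang|]; rewrite Rabs_Ropp.
    assert (Hnth : (nth i lam 0 <= n)%nat).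
    { destruct (Nat.lt_ge_cases i (length lam)) as [Hlt|Hge]; [|rewrite nth_overflow by auto; lia].
      apply (partitions_bounds n lam Hl), nth_In, Hlt. }
    apply le_INR in Hnth; pose proof (pos_INR (nth i lam 0%nat)).
    assert (H1N : 1 <= INR N) by (apply le_INR in HN; exact HN).
    assert (HiN : INR i <= INR N) by (apply le_INR; lia); pose proof (pos_INR i).
    assert (/ INR N <= 1) by (rewrite <- Rinv_1; apply Rinv_le_contravar; lra).
    assert (0 < / INR N) by (apply Rinv_0_lt_compat; auto).
    rewrite !Rabs_pos_eq.
    - assert (INR (nth i lam 0%nat) / (theta * INR N) <= / theta * INR n).
      { unfold Rdiv; rewrite Rinv_mult.
        assert (INR (nth i lam 0%nat) * / INR N <= INR n) by nra.
        replace (INR (nth i lam 0%nat) * (/ theta * / INR N)) with (/ theta * (INR (nth i lam 0%nat) * / INR N)) by ring.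
        apply Rmult_le_compat_l; lra. }
      assert (INR i / INR N <= 1) by (apply Rmult_le_reg_r with (INR N); auto; unfold Rdiv; rewrite Rmult_assoc, Rinv_l; lra).
      nra.
    - apply Rle_mult_inv_pos; auto.
    - apply Rle_mult_inv_pos; auto; apply Rmult_lt_0_compat; auto. }
  apply Rmult_le_reg_l with (INR N); auto.
  rewrite <- Rmult_assoc, Rinv_r, Rmult_1_l by lra.
  eapply Rle_trans; [apply sum_over_Rabs|exact Hb].
Qed.

(** The mass of [M N] in degree [n] is the degree-[n] part of [F_N] at [1^N], at most [wsum N n].
    Polynomially bounded functions are therefore absolutely integrable. *)
Lemma expectation_bound N f C m : (1 <= N)%nat -> 0 <= C ->
  (forall n lam, In lam (YN N n) -> Rabs (f lam) <= C * (1 + INR n) ^ m) ->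
  exists B, forall K, sum_f_R0 (fun n => sum_over (YN N n) (fun lam => M N lam * Rabs (f lam))) K <= B.
Proof.
  intros HN HC Hf.
  destruct (wsum_summable N m HN) as (S & HS).
  destruct (HM N HN) as (HM0 & _ & _).
  exists (C * S); intros K.
  assert (Hc : forall n, 0 <= (1 + INR n) ^ m * wsum N n).
  { intros n; apply Rmult_le_pos; [apply pow_le; pose proof (pos_INR n); lra|apply wsum_nonneg]. }
  eapply Rle_trans; [|apply Rmult_le_compat_l; [exact HC|apply (ser_partial_le _ S Hc HS K)]].
  rewrite !sum_f_R0_seq, <- sum_over_scal; apply sum_over_le; intros n _.
  assert (Hmass : sum_over (YN N n) (M N) <= wsum N n).
  { assert (E : sum_over (YN N n) (M N) = bN N n []).
    { rewrite bN_BF; unfold BF, FN.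
      rewrite (pr_ext n _ (fun l => sum_over (YN N n) (fun lam =>
        M N lam / Jval jc N lam * (fJ jc lam l * INR N ^ length l))))
        by (intros; cbn [Wt]; rewrite <- sum_over_scal_r; apply sum_over_ext; intros; ring).
      rewrite pr_sum_over; apply sum_over_ext; intros lam Hlam.
      rewrite pr_scal; destruct (Jval_neq0 N n lam Hlam) as [E Hne].
      change (pr n (fun l => fJ jc lam l * INR N ^ length l)) with (ev N n (fJ jc lam)).
      rewrite <- E; field; auto. }
    rewrite E; eapply Rle_trans; [apply Rle_abs|].
    pose proof (bN_bound N n [] HN) as Hb; cbn in Hb; lra. }
  eapply Rle_trans; [apply (sum_over_le _ _ (fun lam => M N lam * (C * (1 + INR n) ^ m)))|].
  - intros lam Hlam; apply Rmult_le_compat_l; auto.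
  - rewrite sum_over_scal_r.
    assert (0 <= C * (1 + INR n) ^ m).
    { apply Rmult_le_pos; auto; apply pow_le; pose proof (pos_INR n); lra. }
    replace (C * ((1 + INR n) ^ m * wsum N n)) with (wsum N n * (C * (1 + INR n) ^ m)) by ring.
    apply Rmult_le_compat_r; auto.
Qed.

Lemma LimExpect_moments ks :
  LimExpect M (fun N lam => prodR (map (moment theta N lam) ks)) (prodR (map (lln_formula theta c) ks)).
Proof.
  destruct (LimE_moments ks) as (e & He & Hl); exists e; split; auto.
  exists 1%nat; intros N HN; split; [|apply (He N HN)].
  assert (Hit : 0 < / theta) by (apply Rinv_0_lt_compat; auto).
  apply (expectation_bound N _ ((/ theta + 1) ^ list_sum ks) (list_sum ks)); auto; [apply pow_le; lra|].
  clear e He Hl; intros n lam Hlam; induction ks as [|k ks IH].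
  - unfold prodR; cbn; rewrite Rabs_R1; lra.
  - cbn [map]; change (prodR (?a :: ?b)) with (a * prodR b); change (list_sum (?a :: ?b)) with (a + list_sum b)%nat.
    rewrite Rabs_mult, !pow_add.
    pose proof (moment_bound N n lam k HN Hlam).
    replace ((/ theta + 1) ^ k * (/ theta + 1) ^ list_sum ks * ((1 + INR n) ^ k * (1 + INR n) ^ list_sum ks)) with
      (((/ theta + 1) ^ k * (1 + INR n) ^ k) * ((/ theta + 1) ^ list_sum ks * (1 + INR n) ^ list_sum ks)) by ring.
    apply Rmult_le_compat; auto using Rabs_pos.
Qed.
End Main.

Theorem theorem2p2 (theta : R) (Htheta : 0 < theta)
  (jc : list nat -> list nat -> R) (Hjack : IsJack theta jc)
  (M : nat -> list nat -> R) (HM : forall N, (1 <= N)%nat -> IsProbYN M N)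
  (HA : AssumpA jc M) (c : nat -> R) (HL : AssumpL jc M c) :
  (exists p : nat -> R,
     forall ks : list nat, ks <> [] -> Forall (fun k => 1 <= k)%nat ks ->
       LimExpect M (fun N lam => prodR (map (moment theta N lam) ks))
                   (prodR (map p ks))) /\
  (forall k, (1 <= k)%nat ->
     LimExpect M (fun N lam => moment theta N lam k) (lln_formula theta c k)).
Proof.
  split.
  - exists (lln_formula theta c); intros ks _ _; apply (LimExpect_moments theta jc M Htheta Hjack HM HA c HL).
  - intros k _; pose proof (LimExpect_moments theta jc M Htheta Hjack HM HA c HL [k]) as H.
    replace (fun N lam => moment theta N lam k) with (fun N lam => prodR (map (moment theta N lam) [k]))
      by (extensionality N; extensionality lam; apply Rmult_1_r).
    rewrite <- (Rmult_1_r (lln_formula theta c k)); exact H.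
Qed.
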